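(* Let $q$ be a power of a prime, $G=\mathrm{GL}_{4,\mathbb{F}_q}$ with $\mu(x)=\mathrm{diag}(x,x,1,1)$ and $T,B$ as in the context, and $(S,\zeta)$ satisfying conditions (a), (b), (c) of the context. Let $\lambda=(a_1,a_2,a_3,a_4)\in\mathbb{Z}^4$, $f\in H^0(S,\mathcal{V}_I(\lambda))$, and $\epsilon(q)=\frac{q^2+2q+1}{q^3+2q^2+1}$. (1) If $(a_1-a_4)+\epsilon(q)(a_2-a_4)>0$, then $f$ is divisible by $\mathrm{Ha}_{\alpha_1}$. (2) If $a_1-a_3>0$, then $f$ is divisible by $\mathrm{Ha}_{\alpha_3}$.
   Context: Notation: $k=\overline{\mathbb{F}}_q$, $\sigma$ the $q$-power Frobenius. For a connected reductive group $G$ over $\mathbb{F}_q$ and a cocharacter $\mu\colon\mathbb{G}_{m,k}\to G_k$: let $P=P_-(\mu)$ (resp. $P_+(\mu)$) be the parabolic subgroup of $G_k$ consisting of $g$ such that $t\mapsto\mu(t)^{-1}g\mu(t)$ (resp. $t\mapsto\mu(t)g\mu(t)^{-1}$) extends to a morphism $\mathbb{A}^1_k\to G_k$; $L$ the centralizer of $\mu$; $Q=(P_+(\mu))^{(q)}$, $M=L^{(q)}$, $\varphi\colon L\to M$ the $q$-Frobenius. The zip group is $E=\{(x,y)\in P\times Q:\varphi(\bar x)=\bar y\}$ ($\bar x$, $\bar y$ the Levi components), acting on $G_k$ by $(x,y)\cdot g=xgy^{-1}$; $G\text{-}\mathtt{Zip}^\mu:=[E\backslash G_k]$. Fix a Borel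 pair $(B,T)$ over $\mathbb{F}_q$ with $B\subset P$; positive roots are those with root groups in the opposite Borel $B^+$; $\Delta$ the simple roots, $I$ the simple roots of $L$, $W$ the Weyl group, $s_\alpha$ reflections, $w_0$ the longest element, $w_{0,I}$ the longest element of $W_I$, $\le$ the Bruhat order, $z=\sigma(w_{0,I})w_0$. For $\lambda\in X^*(T)$, $V_I(\lambda)=\mathrm{Ind}_B^P(\lambda)$ and $\mathcal{V}_I(\lambda)$ its vector bundle on $G\text{-}\mathtt{Zip}^\mu$. The zip flag stack $G\text{-}\mathtt{ZipFlag}^\mu=[E'\backslash G_k]$, $E'=E\cap(B\times G_k)$, with projection $\pi$, carries the line bundle $\mathcal{V}_{\mathrm{flag}}(\lambda)$ attached to the character $(x,y)\mapsto\lambda(x)$ of $E'$, with $\pi_*\mathcal{V}_{\mathrm{flag}}(\lambda)=\mathcal{V}_I(\lambda)$. Flag strata: $\mathcal{F}_w=[E'\backslash BwBz^{-1}]$, with closure $\bigcup_{w'\le w}\mathcal{F}_{w'}$. For $\alpha\in\Delta$, a partial Hasse invariant $\mathrm{Ha}_\alpha$ is a global section over $G\text{-}\mathtt{ZipFlag}^\mu$ of some $\mathcal{V}_{\mathrm{flag}}(\lambda_\alpha)$ whose divisor is exactly $\overline{\mathcal{F}}_{w_0s_\alpha}$ with multiplicity one. Condition on $(S,\zeta)$, $\zeta\colon S\to G\text{-}\mathtt{Zip}^\mu$ a morphism from a $k$-scheme: (a) $\zeta$ smooth; (b) surjective on each connected component; (c) for each $w$ of length 1, $\overline{\mathrm{Flag}(S)}_w$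 is pseudo-complete, where $\mathrm{Flag}(S)=S\times_{G\text{-}\mathtt{Zip}^\mu}G\text{-}\mathtt{ZipFlag}^\mu$ with projection $\zeta_{\mathrm{flag}}$ and $\mathrm{Flag}(S)_w=\zeta_{\mathrm{flag}}^{-1}(\mathcal{F}_w)$. Bundles on $S$, $\mathrm{Flag}(S)$ are pullbacks; $H^0(S,\mathcal{V}_I(\lambda))=H^0(\mathrm{Flag}(S),\mathcal{V}_{\mathrm{flag}}(\lambda))$, $f\mapsto f_{\mathrm{flag}}$, and $f$ is divisible by $\mathrm{Ha}_\alpha$ if $f_{\mathrm{flag}}$ is divisible by $\zeta_{\mathrm{flag}}^*\mathrm{Ha}_\alpha$. Specifics: $T$ diagonal, $B$ lower-triangular in $\mathrm{GL}_4$, $X^*(T)=\mathbb{Z}^4$ via $\prod x_i^{a_i}$, basis $e_i$, simple roots $\alpha_i=e_i-e_{i+1}$. Up to multiples of $(1-q,1-q,1-q,1-q)$, $\mathrm{Ha}_{\alpha_1}$ has weight $(1-q,1-q,1,-q)$ and $\mathrm{Ha}_{\alpha_3}$ has weight $(1,-q,0,0)$. *)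

(* Defs.v *)
From HB Require Import structures.
From mathcomp Require Import all_boot all_order all_fingroup all_algebra.
From mathcomp Require Import mpoly.
Set Implicit Arguments.
Unset Strict Implicit.
Unset Printing Implicit Defensive.
Import GRing.Theory.
Local Open Scope ring_scope.

(* Schemes over the field k are represented by their functors of points
   (Demazure-Gabriel).  Test rings range over [comUnitAlgType k]: classically,
   every nonzero commutative k-algebra carries such a structure and every
   k-algebra morphism respects it.  Leaving out the zero ring changes nothing,
   because a Zariski sheaf takes a one-point value on it. *)

Section Schemes.
Context (k : fieldType).
Implicit Types A B C D K : comUnitAlgType k.

Definition is_field K := forall x : K, x != 0 -> x \is a GRing.unit.

Record kfunctor := KFunctor {
  pt :> comUnitAlgType k -> Type;
  fmap : forall A B, {lrmorphism A -> B} -> pt A -> pt B;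
  fmap_id : forall A (f : {lrmorphism A -> A}) x, f =1 id -> fmap f x = x;
  fmap_comp : forall A B C (f : {lrmorphism A -> B}) (g : {lrmorphism B -> C})
    (h : {lrmorphism A -> C}) x, h =1 g \o f -> fmap h x = fmap g (fmap f x) }.

Record kmap (X Y : kfunctor) := KMap {
  app :> forall A, X A -> Y A;
  appE : forall A B (f : {lrmorphism A -> B}) x,
    app (fmap f x) = fmap f (app x) }.

Definition kid (X : kfunctor) : kmap X X :=
  @KMap X X (fun A x => x) (fun A B f x => erefl).

Definition affine_line : kfunctor.
Proof.
refine (@KFunctor (fun A => A : Type) (fun A B f x => f x) _ _).
- by move=> A f x ->.
- by move=> A B C f g h x ->.
Defined.

Definition subfunctor (X : kfunctor) := forall A, X A -> Prop.

(* I need not be an ideal; it stands for the ideal it generates.  The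
   condition on the right says that the image of I generates the unit ideal. *)
Definition open_sub (X : kfunctor) (U : subfunctor X) :=
  forall A (x : X A), exists I : A -> Prop,
  forall B (f : {lrmorphism A -> B}), U B (fmap f x) <->
    exists (n : nat) (b : 'I_n -> B) (a : 'I_n -> A),
      (forall i, I (a i)) /\ \sum_i b i * f (a i) = 1.

Definition closed_sub (X : kfunctor) (Z : subfunctor X) :=
  forall A (x : X A), exists I : A -> Prop,
  forall B (f : {lrmorphism A -> B}),
    Z B (fmap f x) <-> (forall a, I a -> f a = 0).

(* The open subfunctor U is Spec R, with universal point u. *)
Definition affine_open (X : kfunctor) (U : subfunctor X)
    (R : comUnitAlgType k) (u : X R) :=
  [/\ open_sub U,
      forall A (f g : {lrmorphism R -> A}), fmap f u = fmap g u -> f =1 g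
    & forall A (x : X A), U A x <-> exists f : {lrmorphism R -> A}, fmap f u = x].

Definition is_localization A B (a : A) (f : {lrmorphism A -> B}) :=
  [/\ f a \is a GRing.unit,
      forall b, exists x n, b * f a ^+ n = f x
    & forall x, f x = 0 -> exists n, x * a ^+ n = 0].

Definition zariski_sheaf (X : kfunctor) :=
  forall A (n : nat) (a c : 'I_n -> A), \sum_i c i * a i = 1 ->
  forall (B : 'I_n -> comUnitAlgType k) (r : forall i, {lrmorphism A -> B i}),
  (forall i, is_localization (a i) (r i)) ->
  forall x : forall i, X (B i),
  (forall i j C (u : {lrmorphism B i -> C}) (v : {lrmorphism B j -> C}),
     u \o r i =1 v \o r j -> fmap u (x i) = fmap v (x j)) ->
  exists! y : X A, forall i, fmap (r i) y = x i.

Definition is_scheme (X : kfunctor) :=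
  zariski_sheaf X /\
  forall K (x : X K), is_field K ->
    exists (U : subfunctor X) R (u : X R), affine_open U u /\ U K x.

Definition fin_presented A B (f : {lrmorphism A -> B}) :=
  exists (n m : nat) (v : 'I_n -> B) (r : 'I_m -> {mpoly A[n]}),
    (forall b, exists P : {mpoly A[n]}, mmap f v P = b) /\
    (forall P : {mpoly A[n]}, mmap f v P = 0 <->
       exists c : 'I_m -> {mpoly A[n]}, P = \sum_i c i * r i).

Definition square_zero_quotient C D (s : {lrmorphism C -> D}) :=
  (forall d, exists c, s c = d) /\
  (forall c c', s c = 0 -> s c' = 0 -> c * c' = 0).

Definition etale_cover A B (f : {lrmorphism A -> B}) :=
  [/\ fin_presented f,
      forall C D (s : {lrmorphism C -> D}) (a : {lrmorphism A -> C})
        (b : {lrmorphism B -> D}),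
        square_zero_quotient s -> s \o a =1 b \o f ->
        exists l : {lrmorphism B -> C},
          [/\ l \o f =1 a, s \o l =1 b
            & forall l' : {lrmorphism B -> C},
                l' \o f =1 a -> s \o l' =1 b -> l' =1 l]
    & forall K (a : {lrmorphism A -> K}), is_field K ->
        exists K' (i : {lrmorphism K -> K'}) (b : {lrmorphism B -> K'}),
          is_field K' /\ b \o f =1 i \o a].

Definition locally_fin_presented (X Y : kfunctor) (g : kmap X Y) :=
  forall K (x : X K), is_field K ->
  exists (V : subfunctor Y) A (v : Y A) (U : subfunctor X) B (u : X B),
    [/\ affine_open V v, affine_open U u, U K x
      & exists f : {lrmorphism A -> B}, fin_presented f /\ g B u = fmap f v].

Definition formally_smooth (X Y : kfunctor) (g : kmap X Y) :=
  forall C D (s : {lrmorphism C -> D}) (x : X D) (y : Y C),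
  square_zero_quotient s -> g D x = fmap s y ->
  exists x' : X C, g C x' = y /\ fmap s x' = x.

Definition smooth (X Y : kfunctor) (g : kmap X Y) :=
  locally_fin_presented g /\ formally_smooth g.

(* A subset of the underlying space |X|, whose points are the classes of
   field-valued points modulo field extension; C is only meaningful on
   field-valued points. *)
Definition saturated (X : kfunctor) (C : subfunctor X) :=
  forall K K' (f : {lrmorphism K -> K'}) (x : X K),
    is_field K -> is_field K' -> C K x <-> C K' (fmap f x).

Definition meets (X : kfunctor) (C U : subfunctor X) :=
  exists K (x : X K), [/\ is_field K, C K x & U K x].

Definition connected_set (X : kfunctor) (C : subfunctor X) :=
  [/\ saturated C, meets C C
    & forall U V : subfunctor X, open_sub U -> open_sub V ->
        (forall K (x : X K), is_field K -> C K x -> U K x \/ V K x) ->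
        meets C U -> meets C V -> meets C (fun A x => U A x /\ V A x)].

Definition connected_component (X : kfunctor) (C : subfunctor X) :=
  connected_set C /\
  forall C' : subfunctor X, connected_set C' ->
    (forall K (x : X K), is_field K -> C K x -> C' K x) ->
    forall K (x : X K), is_field K -> C' K x -> C K x.

Definition gl (A : comUnitAlgType k) := {g : 'M[A]_4 | g \in unitmx}.

Definition gl_mk A (g : 'M[A]_4) (ug : g \in unitmx) : gl A :=
  exist (fun h : 'M[A]_4 => is_true (h \in unitmx)) g ug.

Definition gl1 A : gl A := gl_mk (unitmx1 A 4).

Lemma glM_subproof A (g h : gl A) : val g *m val h \in unitmx.
Proof. by rewrite unitmx_mul (valP g) (valP h). Qed.
Definition glM A (g h : gl A) : gl A := gl_mk (glM_subproof g h).

Lemma glV_subproof A (g : gl A) : invmx (val g) \in unitmx.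
Proof. by rewrite unitmx_inv (valP g). Qed.
Definition glV A (g : gl A) : gl A := gl_mk (glV_subproof g).

(* perm_mx is multiplicative for the product of 'S_4, so 'S_4 is identified
   with the Weyl group of permutation matrices as a group. *)
Definition gl_perm A (w : 'S_4) : gl A := gl_mk (unitmx_perm A w).

Lemma glmap_subproof A B (f : {lrmorphism A -> B}) (g : gl A) :
  map_mx f (val g) \in unitmx.
Proof.
rewrite unitmxE det_map_mx; apply: rmorph_unit.
by rewrite -unitmxE (valP g).
Qed.
Definition glmap A B (f : {lrmorphism A -> B}) (g : gl A) : gl B :=
  gl_mk (glmap_subproof f g).

Definition GL4 : kfunctor.
Proof.
refine (@KFunctor gl glmap _ _).
- by move=> A f g fE; apply: val_inj; apply/matrixP => i j; rewrite /= mxE fE.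
- move=> A B C f g h x hE.
  by apply: val_inj; apply/matrixP => i j; rewrite /= !mxE hE.
Defined.

End Schemes.

Arguments gl_perm {k} A w.

Section ZipDatum.
Context (k : fieldType) (q : nat).
Implicit Types A B : comUnitAlgType k.

Definition mu (R : nzRingType) (t : R) : 'M[R]_4 :=
  diag_mx (\row_(i < 4) if (i < 2)%N then t else 1).

Definition inv_mx (R : nzRingType) (h : 'M[R]_4) :=
  exists h', h *m h' = 1%:M /\ h' *m h = 1%:M.

(* h in GL_4(A[t]) is the extension to the affine line of
   t |-> mu(t)^-1 g mu(t), resp. of t |-> mu(t) g mu(t)^-1. *)
Definition extends_minus A (g : gl A) (h : 'M[{poly A}]_4) :=
  inv_mx h /\ mu 'X *m h = map_mx polyC (val g) *m mu 'X.
Definition extends_plus A (g : gl A) (h : 'M[{poly A}]_4) :=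
  inv_mx h /\ h *m mu 'X = mu 'X *m map_mx polyC (val g).

Definition at0 A (h : 'M[{poly A}]_4) : 'M[A]_4 :=
  map_mx (fun P : {poly A} => P.[0]) h.

Definition frob A (g : 'M[A]_4) : 'M[A]_4 := map_mx (fun a => a ^+ q) g.

Definition in_P A (g : gl A) := exists h, extends_minus g h.

Definition in_B A (b : gl A) : Prop := is_trig_mx (val b).

(* The Levi component of g in P_-(mu) or P_+(mu) is the value at t = 0 of the
   extension.  As mu is defined over F_q, Q = P_+(mu)^(q) = P_+(mu). *)
Definition in_E A (x y : gl A) :=
  exists hx hy, [/\ extends_minus x hx, extends_plus y hy
                  & frob (at0 hx) = at0 hy].

Definition in_E' A (x y : gl A) := in_E x y /\ in_B x.

Definition weight := 'I_4 -> int.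

Definition character (lam : weight) A (b : gl A) : A :=
  \prod_(i < 4) val b i i ^ lam i.

Definition refl (i : 'I_3) : 'S_4 := tperm (inord i) (inord i.+1).
Definition w0 : 'S_4 := perm (@rev_ord_inj 4).
Definition w0I : 'S_4 := (refl (inord 0) * refl (inord 2))%g.
(* The Frobenius acts trivially on the Weyl group of the split group GL_4. *)
Definition zeltw : 'S_4 := (w0I * w0)%g.

(* A functor X with an action of the zip group E (values of [zact] outside E
   are irrelevant) and an E-equivariant map to GL_4.  It presents
   [E\X] over G-Zip^mu and [E'\X] over G-ZipFlag^mu. *)
Record zip_space := ZipSpace {
  zcar :> kfunctor k;
  zact : forall A, gl A -> gl A -> zcar A -> zcar A;
  zmap : kmap zcar (GL4 k);
  zact1 : forall A (s : zcar A), zact (gl1 A) (gl1 A) s = s;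
  zactM : forall A (x y x' y' : gl A) (s : zcar A), in_E x y -> in_E x' y' ->
    zact (glM x x') (glM y y') s = zact x y (zact x' y' s);
  zact_nat : forall A B (f : {lrmorphism A -> B}) (x y : gl A) (s : zcar A),
    in_E x y -> fmap f (zact x y s) = zact (glmap f x) (glmap f y) (fmap f s);
  zmap_equiv : forall A (x y : gl A) (s : zcar A), in_E x y ->
    zmap A (zact x y s) = glM (glM x (zmap A s)) (glV y) }.

Definition zip_group_space : zip_space.
Proof.
refine (@ZipSpace (GL4 k) (fun A x y g => glM (glM x g) (glV y)) (kid (GL4 k))
  _ _ _ _).
- by move=> A s; apply: val_inj; rewrite /= invmx1 mul1mx mulmx1.
- move=> A x y x' y' s _ _; apply: val_inj => /=.
  suff -> : invmx (val y *m val y') = invmx (val y') *m invmx (val y).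
    by rewrite !mulmxA.
  have U : val y *m val y' \in unitmx by rewrite unitmx_mul (valP y) (valP y').
  apply: (can_inj (mulKmx U)); rewrite mulmxV // mulmxA.
  by rewrite mulmxK ?(valP y') // mulmxV ?(valP y).
- move=> A B f x y s _; apply: val_inj => /=; rewrite !map_mxM /=.
  congr (_ *m _); set yf := map_mx f (val y).
  have U : yf \in unitmx := valP (glmap f y).
  apply: (can_inj (mulKmx U)); rewrite mulmxV // -map_mxM mulmxV ?(valP y) //.
  by rewrite map_mx1.
- by [].
Defined.

(* Closed substacks, open substacks, functions and line bundle sections on the
   quotient [E'\X] are the E'-stable, E'-invariant or E'-equivariant ones
   on X. *)
Definition flag_stable (X : zip_space) (Z : subfunctor X) :=
  forall A (x y : gl A) (s : X A), in_E' x y -> Z A s -> Z A (zact x y s).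

Definition flag_stratum (X : zip_space) (w : 'S_4) : subfunctor X :=
  fun A s => exists b b' : gl A, [/\ in_B b, in_B b'
    & zmap X A s = glM (glM (glM b (gl_perm A w)) b') (glV (gl_perm A zeltw))].

(* Scheme-theoretic closure; the strata being reduced, it is the topological
   closure with its reduced structure. *)
Definition flag_closure (X : zip_space) (U : subfunctor X) : subfunctor X :=
  fun A s => forall Z : subfunctor X, closed_sub Z -> flag_stable Z ->
    (forall B (t : X B), U B t -> Z B t) -> Z A s.

Definition flag_section (X : zip_space) (lam : weight)
    (f : kmap X (affine_line k)) :=
  forall A (x y : gl A) (s : X A), in_E' x y ->
    f A (zact x y s) = character lam x * (f A s : A).

(* Every regular function on the closed substack Z of [E'\X] is Zariski-locally
   a constant of k. *)
Definition pseudo_complete (X : zip_space) (Z : subfunctor X) :=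
  forall h : (forall A (s : X A), Z A s -> A),
  (forall A B (f : {lrmorphism A -> B}) (s : X A) (zs : Z A s)
     (zfs : Z B (fmap f s)), h B (fmap f s) zfs = f (h A s zs)) ->
  (forall A (x y : gl A) (s : X A) (zs : Z A s) (zs' : Z A (zact x y s)),
     in_E' x y -> h A (zact x y s) zs' = h A s zs) ->
  forall (K : comUnitAlgType k) (s : X K), is_field K -> Z K s ->
  exists (U : subfunctor X) (c : k),
    [/\ open_sub U, flag_stable U, U K s
      & forall A (t : X A) (zt : Z A t), U A t -> h A t zt = c%:A].

(* The divisor of h on G-ZipFlag^mu is the reduced closure of the stratum of
   w0 s_alpha, i.e. the zero scheme of h is that closed substack. *)
Definition partial_Hasse (i : 'I_3) (lam : weight)
    (h : kmap (GL4 k) (affine_line k)) :=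
  flag_section (X := zip_group_space) lam h /\
  forall A (g : gl A), h A g = 0 :> A <->
    flag_closure (@flag_stratum zip_group_space (w0 * refl i)%g) g.

(* A morphism zeta from S to the quotient stack G-Zip^mu = [E\GL_4]: an étale
   E-torsor over S with an E-equivariant map to GL_4.  The torsor is
   automatically a scheme since E is affine.  Flag(S) is [E'\gtor]. *)
Record to_gzip (S : kfunctor k) := ToGZip {
  gtor :> zip_space;
  gtor_scheme : is_scheme gtor;
  gproj : kmap gtor S;
  gproj_inv : forall A (x y : gl A) (s : gtor A), in_E x y ->
    gproj A (zact x y s) = gproj A s;
  gfree : forall A (x y : gl A) (s : gtor A), in_E x y ->
    zact x y s = s -> x = gl1 A /\ y = gl1 A;
  gtrans : forall A (s s' : gtor A), gproj A s = gproj A s' ->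
    exists x y : gl A, in_E x y /\ zact x y s = s';
  glocal : forall A (a : S A), exists B (f : {lrmorphism A -> B}) (s : gtor B),
    etale_cover f /\ gproj B s = fmap f a }.

(* Smoothness over the stack is tested on the smooth atlas
   GL_4 -> [E\GL_4], where zeta becomes gtor -> GL_4. *)
Definition smooth_zeta S (zeta : to_gzip S) := smooth (zmap zeta).

Definition surjective_on_components S (zeta : to_gzip S) :=
  forall C : subfunctor S, connected_component C ->
  forall (K : comUnitAlgType k) (g : gl K), is_field K ->
  exists (K' : comUnitAlgType k) (f : {lrmorphism K -> K'}) (s : zeta K'),
    [/\ is_field K', C K' (gproj zeta K' s) & zmap zeta K' s = glmap f g].

(* The elements of length 1 are the simple reflections. *)
Definition pseudo_complete_curves S (zeta : to_gzip S) :=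
  forall i : 'I_3, pseudo_complete (flag_closure (@flag_stratum zeta (refl i))).

(* Sections over S of the bundle attached to Ind_B^P(lam): E-equivariant maps
   from gtor to Ind_B^P(lam) = {F : P -> A^1, F(p b) = lam(b)^-1 F(p)}, with
   (x F)(p) = F(x^-1 p).  Values of f A s outside P are irrelevant. *)
Record VI_section S (zeta : to_gzip S) (lam : weight) := VISection {
  VIfun :> forall A, zeta A -> gl A -> A;
  VI_nat : forall A B (f : {lrmorphism A -> B}) (s : zeta A) (p : gl A),
    in_P p -> VIfun (fmap f s) (glmap f p) = f (VIfun s p);
  VI_ind : forall A (s : zeta A) (p b : gl A), in_P p -> in_B b ->
    VIfun s (glM p b) = character lam (glV b) * VIfun s p;
  VI_equiv : forall A (x y : gl A) (s : zeta A) (p : gl A),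
    in_E x y -> in_P p -> VIfun (zact x y s) p = VIfun s (glM (glV x) p) }.

(* f_flag is s |-> f(s)(1), a section of V_flag(lam) on Flag(S). *)
Definition divisible_by S (zeta : to_gzip S) (lam : weight)
    (f : VI_section zeta lam) (lamH : weight)
    (h : kmap (GL4 k) (affine_line k)) :=
  exists g : kmap zeta (affine_line k),
    flag_section (fun i => lam i - lamH i) g /\
    forall A (s : zeta A), f A s (gl1 A) = (g A s : A) * h A (zmap zeta A s).

End ZipDatum.

(* k is an algebraic closure of the field with q elements. *)
Definition is_Fqbar (q : nat) (k : closedFieldType) :=
  (exists p m : nat, [/\ p \in [pchar k], (0 < m)%N & q = (p ^ m)%N]) /\
  (forall x : k, exists n : nat, (0 < n)%N /\ x ^+ (q ^ n) = x).

Definition mk_weight (a1 a2 a3 a4 : int) : weight :=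
  fun i => nth 0 [:: a1; a2; a3; a4] i.

Definition epsilon (q : nat) : rat :=
  (q%:R ^+ 2 + 2 * q%:R + 1) / (q%:R ^+ 3 + 2 * q%:R ^+ 2 + 1).

(* Main.v *)
Require Import Defs.
From HB Require Import structures.
From mathcomp Require Import all_boot all_order all_fingroup all_algebra.
From mathcomp Require Import boolp classical_sets.
From mathcomp Require Import mpoly zify ring lra generic_quotient.
Set Implicit Arguments.
Unset Strict Implicit.
Unset Printing Implicit Defensive.
Import GRing.Theory.
Local Open Scope ring_scope.

(** On k-points all objects become germs of regular functions on the smooth variety X = gtor; let x_ij (y_ij) be the
entries of N = zmap(s) z (of N^-1), which satisfy x_ij(b s) = b_i x_ij b_(z j)^(-q) on the locus where the entries
further to the north-east vanish.  The divisor of Ha_(alpha_3) is x_03 = 0.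

(i) Restrict the section F to x_03 = 0 near the points where N is lower triangular, and descend through a tree of
smooth closed strata cut out by entries and a 2x2 minor, dividing at every step by the maximal powers of the
equations of the next strata.  On the one-dimensional strata a power of the quotient times a monomial in the entries
has weight 0, so pseudo-completeness bounds the weight.  A positive combination of these bounds contradicts the
hypothesis on lambda, hence F vanishes on x_03 = 0 near those points.

(ii) Moving a point along the unipotent root group u of the Levi gives polynomials Phi(u) = F and Theta(u) = x_03 of
degree q + 1.  That Theta divides Phi over the fraction field of the local ring is a clopen condition; it holds near
the lower triangular points, and such points lie over every connected component of S.  Pseudo-division by Theta
brings the vanishing back to u = 0, at every point of x_03 = 0.

(iii) Part (2) follows, as F = 0 unless a_3 >= a_4; part (1) is the same statement for the duality
g |-> J g^-T J of GL_4, which exchanges alpha_1 and alpha_3. *)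

(** * Quotients and algebras *)

(** The divisor x_03 = 0 on X may have components that miss the lower triangular points, so
    vanishing cannot be carried along it. Divisibility of Phi by Theta is instead a condition on X
    itself, and X is a torsor over S under the connected group E. The closed strata of the tree are
    not all given by entries of N: entries of N^-1 are used beside them, and the minor defines a
    smooth stratum because its four entries generate the unit ideal. On the curve of s_i the bound
    is the linear form in lambda that kills the weights of det N and of the two diagonal entries
    invertible there, and is positive on the weight of the entry next to the diagonal that cuts out
    the closed stratum. The six leaves of the tree give six inequalities involving the
    multiplicities of division. In the combination used, five multiplicities cancel, the others have
    a favourable sign, and lambda enters with coefficients q^3 + 2q^2 + 1 and (q + 1)^2, whose ratio
    is epsilon. Test algebras are arbitrary; finiteness comes from charts of finite type over k and,
    for the etale cover, from finitely generated subalgebras. *)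

Record ideal (T : comNzRingType) := Ideal {
  imem :> T -> Prop;
  ideal0 : imem 0;
  idealD : forall x y, imem x -> imem y -> imem (x + y);
  idealM : forall a x, imem x -> imem (a * x) }.

Section IdealTheory.
Context (T : comNzRingType).
Implicit Types (I J : ideal T).

Lemma idealMr I a x : I x -> I (x * a).
Proof. by rewrite mulrC; apply: idealM. Qed.
Lemma idealN I x : I x -> I (- x).
Proof. by rewrite -mulN1r; apply: idealM. Qed.
Lemma idealB I x y : I x -> I y -> I (x - y).
Proof. by move=> Ix Iy; apply: idealD => //; apply: idealN. Qed.
Lemma ideal_sum I (J : Type) (r : seq J) (P : pred J) F :
  (forall i, P i -> I (F i)) -> I (\sum_(i <- r | P i) F i).
Proof. by move=> h; elim/big_ind: _ => //; [apply: ideal0 | apply: idealD]. Qed.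

End IdealTheory.

(** For congruent elements the predicates I (x - y) coincide by extensionality, so choice returns
    the same representative; the quotient is the subtype of elements equal to their representative.
    The argument [I1] keeps the quotient ring nonzero. *)
Definition irepr (T : comNzRingType) (I : ideal T) (x : T) : T :=
  xget 0 (fun y => I (x - y)).
Definition quot_of (T : comNzRingType) (I : ideal T) (I1 : ~ I 1) :=
  {x : T | irepr I x == x}.

Section Quotient.
Context (T : comNzRingType) (I : ideal T) (I1 : ~ I 1).
Local Notation qrepr := (irepr I).

Lemma qreprP x : I (x - qrepr x).
Proof.
by rewrite /irepr; case: xgetP => // /(_ x) []; rewrite subrr; apply: ideal0.
Qed.
Lemma qrepr_eq x y : I (x - y) -> qrepr x = qrepr y.
Proof.
move=> xy; rewrite /irepr; congr xget; apply/funext => z; apply/propext; split.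
- by move=> xz; rewrite -(subrK x y) -addrA; apply: idealD => //; rewrite -opprB; apply: idealN.
- by move=> yz; rewrite -(subrK y x) -addrA; apply: idealD.
Qed.
Lemma qrepr_id x : qrepr (qrepr x) = qrepr x.
Proof. by apply/esym/qrepr_eq/qreprP. Qed.

Local Notation Q := (quot_of I1).
HB.instance Definition _ := Choice.on Q.

Lemma qpi_subproof x : qrepr (qrepr x) == qrepr x. Proof. by rewrite qrepr_id. Qed.
Definition qpi (x : T) : Q := exist _ (qrepr x) (qpi_subproof x).
Lemma qpi_eq x y : qpi x = qpi y <-> I (x - y).
Proof.
split=> [/(congr1 val) /= xy|xy]; last by apply: val_inj; apply: qrepr_eq.
have := idealB (qreprP x) (qreprP y).
by rewrite xy opprB addrA subrK.
Qed.
Lemma qval (x : Q) : qpi (val x) = x.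
Proof. by apply: val_inj; apply/eqP/(valP x). Qed.

Definition qadd (x y : Q) := qpi (val x + val y).
Definition qopp (x : Q) := qpi (- val x).
Definition qmul (x y : Q) := qpi (val x * val y).

Lemma qpiD x y : qpi (x + y) = qadd (qpi x) (qpi y).
Proof.
apply/qpi_eq; rewrite /= opprD addrACA; apply: idealD; exact: qreprP.
Qed.
Lemma qpiN x : qpi (- x) = qopp (qpi x).
Proof. by apply/qpi_eq; rewrite /= -opprD; apply: idealN; apply: qreprP. Qed.
Lemma qpiM x y : qpi (x * y) = qmul (qpi x) (qpi y).
Proof.
apply/qpi_eq => /=.
have -> : x * y - qrepr x * qrepr y =
   (x - qrepr x) * y + qrepr x * (y - qrepr y).
  by rewrite mulrBl mulrBr addrA subrK.
by apply: idealD; [apply: idealMr|apply: idealM]; apply: qreprP.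
Qed.

Lemma qaddA : associative qadd.
Proof. by move=> x y z; rewrite -(qval x) -(qval y) -(qval z) -!qpiD addrA. Qed.
Lemma qaddC : commutative qadd.
Proof. by move=> x y; rewrite /qadd addrC. Qed.
Lemma qadd0 : left_id (qpi 0) qadd.
Proof. by move=> x; rewrite -(qval x) -qpiD add0r. Qed.
Lemma qaddN : left_inverse (qpi 0) qopp qadd.
Proof. by move=> x; rewrite -(qval x) -qpiN -qpiD addNr. Qed.
Lemma qmulA : associative qmul.
Proof. by move=> x y z; rewrite -(qval x) -(qval y) -(qval z) -!qpiM mulrA. Qed.
Lemma qmulC : commutative qmul.
Proof. by move=> x y; rewrite /qmul mulrC. Qed.
Lemma qmul1 : left_id (qpi 1) qmul.
Proof. by move=> x; rewrite -(qval x) -qpiM mul1r. Qed.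
Lemma qmulD : left_distributive qmul qadd.
Proof. by move=> x y z; rewrite -(qval x) -(qval y) -(qval z) -!(qpiD, qpiM) mulrDl. Qed.
Lemma q1_neq0 : qpi 1 != qpi 0.
Proof. by apply/eqP => /qpi_eq; rewrite subr0. Qed.

HB.instance Definition _ := GRing.isZmodule.Build Q qaddA qaddC qadd0 qaddN.
HB.instance Definition _ := GRing.Zmodule_isComNzRing.Build Q qmulA qmulC qmul1 qmulD q1_neq0.

Lemma qpi_additive : zmod_morphism qpi.
Proof. by move=> x y; rewrite qpiD qpiN. Qed.
Lemma qpi_mult : monoid_morphism qpi.
Proof. by split => // x y; rewrite qpiM. Qed.
HB.instance Definition _ := GRing.isZmodMorphism.Build T Q qpi qpi_additive.
HB.instance Definition _ := GRing.isMonoidMorphism.Build T Q qpi qpi_mult.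

Lemma qpi0 x : qpi x = 0 <-> I x.
Proof. by rewrite -[0]/(qpi 0); split=> [/qpi_eq|h]; last apply/qpi_eq; rewrite subr0. Qed.

End Quotient.

Section CAlg.
Context (k : fieldType).

(** Units are the elements that have an inverse and inverses are chosen, so that every nonzero
    commutative ring under k becomes a test algebra. *)
Definition calg (T : comNzRingType) (i : {rmorphism k -> T}) : Type := T.
Section Def.
Context (T : comNzRingType) (i : {rmorphism k -> T}).
Local Notation Q := (calg i).
HB.instance Definition _ := GRing.ComNzRing.on Q.
Definition cscale (a : k) (x : Q) : Q := (i a : Q) * x.
Fact cscaleA a b x : cscale a (cscale b x) = cscale (a * b) x.
Proof. by rewrite /cscale rmorphM mulrA. Qed.
Fact cscale1 : left_id 1 cscale.
Proof. by move=> x; rewrite /cscale rmorph1 mul1r. Qed.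
Fact cscaleDr : right_distributive cscale +%R.
Proof. by move=> a x y; rewrite /cscale mulrDr. Qed.
Fact cscaleDl x : {morph cscale^~ x : a b / a + b}.
Proof. by move=> a b; rewrite /cscale rmorphD mulrDl. Qed.
HB.instance Definition _ := GRing.Zmodule_isLmodule.Build k Q cscaleA cscale1 cscaleDr cscaleDl.
Fact cscaleAl (a : k) (x y : Q) : a *: (x * y) = (a *: x) * y.
Proof. exact: mulrA. Qed.
HB.instance Definition _ := GRing.Lmodule_isLalgebra.Build k Q cscaleAl.
HB.instance Definition _ := GRing.Lalgebra_isComAlgebra.Build k Q.

Definition cunit : pred Q := fun x => `[< exists y, y * x = 1 >].
Definition cinv (x : Q) : Q := xget x (fun y => y * x = 1).
Fact cmulVx : {in cunit, left_inverse 1 cinv *%R}.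
Proof.
move=> x /asboolP [y yx]; rewrite /cinv; case: xgetP => // /(_ y) [] //.
Qed.
Fact cunitPl x y : y * x = 1 -> cunit x.
Proof. by move=> h; apply/asboolP; exists y. Qed.
Fact cinv_out : {in [predC cunit], cinv =1 id}.
Proof.
move=> x /asboolP h; rewrite /cinv; case: xgetP => // y _ yx.
by case: h; exists y.
Qed.
HB.instance Definition _ := GRing.ComNzRing_hasMulInverse.Build Q cmulVx cunitPl cinv_out.
End Def.
End CAlg.

(** * Noetherian rings and the Krull intersection theorem *)

Section IdealOps.
Context (T : comNzRingType).
Implicit Types (I J : ideal T) (x y : T).

Definition isub I J := forall x, I x -> J x.

Definition iadd I J : ideal T.
Proof.
refine (@Ideal T (fun x => exists2 y, I y & J (x - y)) _ _ _).
- by exists 0; rewrite ?subr0; apply: ideal0.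
- move=> x y [u Iu Ju] [v Iv Jv]; exists (u + v); first exact: idealD.
by rewrite opprD addrACA; apply: idealD.
- by move=> a x [u Iu Ju]; exists (a * u); rewrite -?mulrBr; apply: idealM.
Defined.

Lemma iaddl I J : isub I (iadd I J).
Proof. by move=> x Ix; exists x => //; rewrite subrr; apply: ideal0. Qed.
Lemma iaddr I J : isub J (iadd I J).
Proof. by move=> x Ix; exists 0; [apply: ideal0|rewrite subr0]. Qed.
Lemma iadd_sub I J (K : ideal T) : isub I K -> isub J K -> isub (iadd I J) K.
Proof. by move=> h h' x [y /h Ky /h' Kxy]; rewrite -(subrK y x) addrC; apply: idealD. Qed.

Definition iprinc (a : T) : ideal T.
Proof.
refine (@Ideal T (fun x => exists c, x = c * a) _ _ _).
- by exists 0; rewrite mul0r.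
- by move=> x y [c ->] [d ->]; exists (c + d); rewrite mulrDl.
- by move=> b x [c ->]; exists (b * c); rewrite mulrA.
Defined.

Lemma iprinc_mem a : iprinc a a. Proof. by exists 1; rewrite mul1r. Qed.
Definition icolon I (a : T) : ideal T.
Proof.
refine (@Ideal T (fun x => I (a * x)) _ _ _).
- by rewrite mulr0; apply: ideal0.
- by move=> x y h h'; rewrite mulrDr; apply: idealD.
- by move=> b x h; rewrite mulrCA; apply: idealM.
Defined.

Definition iscale (a : T) I : ideal T.
Proof.
refine (@Ideal T (fun x => exists2 c, I c & x = a * c) _ _ _).
- by exists 0; rewrite ?mulr0 //; apply: ideal0.
- by move=> x y [c Ic ->] [d Id ->]; exists (c + d); rewrite ?mulrDr //; apply: idealD.
- by move=> b x [c Ic ->]; exists (b * c); rewrite 1?mulrCA //; apply: idealM.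
Defined.

Definition igen (S : T -> Prop) : ideal T.
Proof.
refine (@Ideal T (fun x => forall I, (forall y, S y -> I y) -> I x) _ _ _).
- by move=> I _; apply: ideal0.
- by move=> x y h h' I hI; apply: idealD; [apply: h|apply: h'].
- by move=> a x h I hI; apply/idealM/h.
Defined.

Lemma igen_mem (S : T -> Prop) x : S x -> igen S x.
Proof. by move=> Sx I; apply. Qed.

Definition ipow I n := igen (fun x => exists2 f : 'I_n -> T, (forall i, I (f i)) & x = \prod_i f i).

Definition prime_ideal I := ~ I 1 /\ forall x y, I (x * y) -> I x \/ I y.

Lemma prime_exp I x n : prime_ideal I -> I (x ^+ n) -> I x.
Proof.
case=> I1 IM; elim: n => [/I1//|n IHn]; rewrite exprS => /IM [//|]; exact: IHn.
Qed.

Lemma ipow_sub I J n : isub I J -> isub (ipow I n) (ipow J n).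
Proof.
move=> IJ x h K hK; apply: h => y [f If ->]; apply: hK.
by exists f => // i; apply: IJ.
Qed.

Definition multset (S : T -> Prop) := S 1 /\ forall x y, S x -> S y -> S (x * y).

Lemma prime_avoid (S : T -> Prop) I : multset S -> (forall x, S x -> ~ I x) ->
  exists P : ideal T, [/\ prime_ideal P, isub I P & forall x, S x -> ~ P x].
Proof.
move=> [S1 SM] SI.
(* The union of an empty chain is empty, so the empty set has to count as good. *)
pose good (A : set T) := A = set0 \/
  exists J : ideal T, [/\ A = (fun x => J x), isub I J & forall x, S x -> ~ J x].
have [A [PA maxA]] : exists A, good A /\ forall B, (A `<` B)%classic -> ~ good B.
  apply: Zorn_bigcup => F FP totF.
  have [[X [FX [x0 Xx0]]]|noX] := pselect (exists X, F X /\ exists x, X x); last first.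
    left; apply/seteqP; split=> x //= [X FX Xx]; case: noX; exists X; split=> //; by exists x.
  right.
  have gX Y : F Y -> (exists y, Y y) -> exists J : ideal T,
      [/\ Y = (fun x => J x), isub I J & forall x, S x -> ~ J x].
    by move=> /FP [-> [y []]|].
  have [JX [EX IX SX]] := gX X FX (ex_intro _ x0 Xx0).
  unshelve eexists (@Ideal T (fun x => (\bigcup_(X in F) X)%classic x) _ _ _).
  - by exists X => //; rewrite EX; apply: ideal0.
  - move=> x y [Y FY Yx] [Z FZ Zy].
    have [YZ|ZY] := totF _ _ FY FZ.
      have [J [EJ _ _]] := gX Z FZ (ex_intro _ _ Zy).
      by exists Z => //; move: Zy (YZ x Yx); rewrite EJ /= => ? ?; apply: idealD.
    have [J [EJ _ _]] := gX Y FY (ex_intro _ _ Yx).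
    by exists Y => //; move: Yx (ZY y Zy); rewrite EJ /= => ? ?; apply: idealD.
  - move=> a x [Y FY Yx]; have [J [EJ _ _]] := gX Y FY (ex_intro _ _ Yx).
    by exists Y => //; move: Yx; rewrite EJ /=; apply: idealM.
  split=> //.
  + by move=> x Ix; exists X => //; rewrite EX; apply: IX.
  + move=> x Sx [Y FY Yx]; have [J [EJ _ SJ]] := gX Y FY (ex_intro _ _ Yx).
    by move: Yx; rewrite EJ; apply: SJ.
have [A0|[J [EA IJ SJ]]] := PA.
  have /maxA[] : (A `<` (fun x => I x))%classic.
    by rewrite A0; split=> // h; apply: (h 0 (ideal0 I)).
  by right; exists I; split=> // x.
exists J; split=> //; split=> [|x y Jxy]; first by apply: SJ.
apply: contrapT => /not_orP [nx ny].
have bad z : ~ J z -> exists c j, J j /\ S (c * z + j).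
  move=> nz; apply: contrapT => h.
  have /maxA[] : (A `<` (fun x => iadd J (iprinc z) x))%classic.
    rewrite EA; split; first by move=> w Jw; apply: iaddl.
    by move=> h2; apply/nz/(h2 z)/iaddr/iprinc_mem.
  right; exists (iadd J (iprinc z)); split=> //.
    by move=> w Iw; apply/iaddl/IJ.
  move=> w Sw [j Jj [c Ec]]; apply: h; exists c, j; split=> //.
  by rewrite -Ec subrK.
have [c [j [Jj Sc]]] := bad x nx; have [d [l [Jl Sd]]] := bad y ny.
apply: (SJ _ (SM _ _ Sc Sd)).
have -> : (c * x + j) * (d * y + l) = c * d * (x * y) + (c * x * l + (d * y + l) * j).
  by rewrite mulrDl !mulrDr mulrDl -!addrA (mulrACA c) (mulrC j) [l * j]mulrC.
apply: idealD; first exact: idealM.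
by apply: idealD; apply: idealM.
Qed.

Definition noeth := forall F : ideal T -> Prop, (exists I, F I) ->
  exists I, F I /\ forall J, F J -> isub I J -> isub J I.

(** A maximal counterexample J' is not prime, so u v lies in J' with u and v outside. The larger
    ideals J' + (u) and J' + (v) contain powers of I, and the product of these powers lies in J'. *)
Lemma noeth_ipow I J : noeth -> (forall x, I x -> exists n, J (x ^+ n)) ->
  exists n, isub (ipow I n) J.
Proof.
move=> nT; apply: contraPP => noJ IJ.
have [J' [[nJ' IJ'] maxJ']] := nT
  (fun J => (~ exists n, isub (ipow I n) J) /\ (forall x, I x -> exists n, J (x ^+ n)))
  (ex_intro _ J (conj noJ IJ)).
have nJ'1 : ~ J' 1.
  by move=> J1; apply: nJ'; exists 0 => x _; rewrite -(mulr1 x); apply: idealM.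
have [pJ|] := pselect (prime_ideal J').
  apply: nJ'; exists 1%N => x; apply => y [f If ->].
  rewrite big_ord1; have [n] := IJ' _ (If ord0); exact: prime_exp.
move=> npr; have [u [v [Juv nu nv]]] : exists u v, [/\ J' (u * v), ~ J' u & ~ J' v].
  apply: contrapT => h; apply: npr; split=> // x y Jxy; apply: contrapT => /not_orP [? ?].
  by apply: h; exists x, y.
have big z : ~ J' z -> exists n, isub (ipow I n) (iadd J' (iprinc z)).
  move=> nz; apply: contrapT => h; apply: nz.
  have /maxJ' hz : (~ exists n, isub (ipow I n) (iadd J' (iprinc z))) /\
      (forall x, I x -> exists n, (iadd J' (iprinc z)) (x ^+ n)).
    by split=> // x /IJ' [n Jn]; exists n; apply: iaddl.
  by apply: hz; [apply: iaddl|apply/iaddr/iprinc_mem].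
have [n1 h1] := big u nu; have [n2 h2] := big v nv.
apply: nJ'; exists (n1 + n2)%N => x; apply => y [f If ->].
rewrite big_split_ord /=.
have [a Ja [c Ec]] : iadd J' (iprinc u) (\prod_(i < n1) f (lshift n2 i)).
  by apply/h1/igen_mem; exists (fun i => f (lshift n2 i)).
have [b Jb [d Ed]] : iadd J' (iprinc v) (\prod_(i < n2) f (rshift n1 i)).
  by apply/h2/igen_mem; exists (fun i => f (rshift n1 i)).
rewrite -(subrK a (\prod_(i < n1) _)) -(subrK b (\prod_(i < n2) _)) Ec Ed.
rewrite mulrDr; apply: idealD; last exact: idealM.
by rewrite mulrDl; apply: idealD; [rewrite mulrACA; apply: idealM|apply: idealMr].
Qed.

(** Krull's intersection theorem modulo Q, by Noetherian maximality instead of the Artin-Rees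
    lemma. *)
Lemma krull Q J x : noeth -> (forall n, iadd Q (ipow J n) x) ->
  exists2 i, J i & Q (x - i * x).
Proof.
move=> nT xJ; pose xQ := iadd Q (iscale x J).
suff [y Qy [i Ji Ei]] : xQ x by exists i => //; rewrite mulrC -Ei subKr.
(* B is maximal among the ideals containing Q + xJ whose multiples of x all lie in Q + xJ. It is
   enough that B contains a power of J, because x is in Q + J^n. *)
have [B [[xQB BxQ] maxB]] := nT (fun B => isub xQ B /\ forall s, B (s * x) -> xQ (s * x))
  (ex_intro _ xQ (conj (fun _ => id) (fun _ => id))).
suff [n JB] : exists n, isub (ipow J n) B.
  rewrite -(mul1r x); apply: BxQ; rewrite mul1r.
  have [y Qy] := xJ n; move/JB => Bxy.
  by rewrite -(subrK y x); apply: idealD => //; apply/xQB/iaddl.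
apply: noeth_ipow => // a Ja.
(* Maximality of (B : a^m) makes it equal to (B : a^(m+1)); this lets a^m be added to B without
   losing its defining property, so a^m is already in B. *)
have [C [[m EC] maxC]] := nT
    (fun C => exists m, forall y, C y <-> B (a ^+ m * y))
    (ex_intro _ (icolon B (a ^+ 0)) (ex_intro _ 0%N (fun y => iff_refl _))).
exists m; have stab y : B (a ^+ m.+1 * y) -> B (a ^+ m * y).
  move=> By; apply/EC/(maxC (icolon B (a ^+ m.+1))); last exact: By.
    by exists m.+1.
  by move=> z /EC Bz; rewrite /= exprS -mulrA; apply: idealM.
apply: (maxB (iadd B (iprinc (a ^+ m)))); last exact/iaddr/iprinc_mem.
  split=> [y xQy|s [b Bb [t Et]]]; first exact/iaddl/xQB.
  apply: BxQ; rewrite -(subrK b (s * x)) addrC; apply: idealD => //.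
  rewrite Et mulrC; apply: stab; rewrite exprS -mulrA (mulrC _ t) -Et.
  rewrite mulrBr; apply: idealB; last exact: idealM.
  by apply/xQB/iaddr; exists (a * s); [exact: idealMr|rewrite (mulrC x) mulrA].
exact: iaddl.
Qed.
End IdealOps.
Arguments ipow : simpl never.

Lemma noeth_surj (T U : comNzRingType) (f : {rmorphism T -> U}) :
  (forall u, exists t, f t = u) -> noeth T -> noeth U.
Proof.
move=> fs nT F [I0 FI0].
pose pull (I : ideal U) : ideal T := @Ideal T (fun x => I (f x))
  (eq_ind_r I (ideal0 I) (rmorph0 f))
  (fun x y Ix Iy => eq_ind_r I (idealD Ix Iy) (rmorphD f x y))
  (fun a x Ix => eq_ind_r I (idealM (f a) Ix) (rmorphM f a x)).
have [I [[J [FJ JI]] maxI]] := nT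
  (fun I => exists J, F J /\ forall x, I x <-> pull J x)
  (ex_intro _ (pull I0) (ex_intro _ I0 (conj FI0 (fun=> iff_refl _)))).
exists J; split=> // K FK JK x; case: (fs x) => t <- Kx.
suff /JI : I t by [].
apply: (maxI (pull K)) => //; first by exists K.
by move=> y /JI /JK.
Qed.

Section Hilbert.
Context (T : comNzRingType).

Definition lead_ideal (I : ideal {poly T}) (d : nat) : ideal T.
Proof.
refine (@Ideal T (fun c => exists p : {poly T}, [/\ I p, (size p <= d.+1)%N & p`_d = c]) _ _ _).
- by exists 0; rewrite size_poly0 coef0; split=> //; apply: ideal0.
- move=> x y [p [Ip sp <-]] [r [Ir sr <-]]; exists (p + r); rewrite coefD; split=> //.
    exact: idealD.
  by apply: leq_trans (size_polyD _ _) _; rewrite geq_max sp.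
- move=> a x [p [Ip sp <-]]; exists (a%:P * p); rewrite coefCM; split=> //.
    exact: idealM.
  by rewrite mul_polyC; apply: leq_trans (size_scale_leq _ _) _.
Defined.

Lemma lead_idealS (I : ideal {poly T}) d : isub (lead_ideal I d) (lead_ideal I d.+1).
Proof.
move=> c [p [Ip sp <-]]; exists (p * 'X); rewrite coefMX; split=> //.
  exact: idealMr.
by apply: leq_trans (size_polyMleq _ _) _; rewrite size_polyX addn2.
Qed.

Lemma lead_ideal_eq (I J : ideal {poly T}) : isub I J ->
  (forall d, isub (lead_ideal J d) (lead_ideal I d)) -> isub J I.
Proof.
move=> IJ h x Jx; have [n sn] := ubnP (size x); elim: n x Jx sn => // n IHn p Jp sp.
case: n IHn sp => [|n] IHn.
  by rewrite ltnS leqn0 size_poly_eq0 => /eqP ->; apply: ideal0.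
rewrite ltnS => sp.
have [r [Ir sr Er]] : lead_ideal I n p`_n by apply: h; exists p.
rewrite -(subrK r p); apply: idealD => //.
apply: IHn; first by apply: idealB => //; apply: IJ.
rewrite ltnS; apply/leq_sizeP => j; rewrite leq_eqVlt => /orP [/eqP<-|nj].
  by rewrite coefB Er subrr.
by rewrite coefB !nth_default ?subrr //; [apply: leq_trans sr nj|apply: leq_trans sp nj].
Qed.

(** Hilbert's basis theorem. An ideal and a degree d with maximal leading ideal settle all degrees
    from d on; the finitely many lower degrees are then maximised one at a time, going down from
    d. *)
Lemma noeth_poly : noeth T -> noeth {poly T}.
Proof.
move=> nT F [I0 FI0].
have [L [[I1 [d [FI1 LE]]] maxL]] := nT
  (fun L => exists I d, F I /\ forall x, L x <-> lead_ideal I d x)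
  (ex_intro _ (lead_ideal I0 0) (ex_intro _ I0 (ex_intro _ 0%N (conj FI0 (fun=> iff_refl _))))).
have leadD I m n : isub (lead_ideal I n) (lead_ideal I (m + n)).
  by elim: m => // m IHm x /IHm; apply: lead_idealS.
have mono I J n : isub I J -> isub (lead_ideal I n) (lead_ideal J n).
  by move=> IJ c [p [Ip ? ?]]; exists p; split=> //; apply: IJ.
have high J n : F J -> isub I1 J -> isub (lead_ideal J (n + d)) (lead_ideal I1 (n + d)).
  move=> FJ IJ x Jx; apply/leadD/LE/(maxL (lead_ideal J (n + d))) => //.
    by exists J, (n + d)%N.
  by move=> y /LE Iy; apply/(mono _ _ _ IJ)/leadD.
have [I [FI II h]] : exists I, [/\ F I, isub I1 I & forall J n, F J -> isub I J ->
    (d - d <= n)%N -> isub (lead_ideal J n) (lead_ideal I n)].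
  elim: {2}d => [|m [I [FI II h]]].
    exists I1; split=> // J n FJ IJ; rewrite subn0 => /subnK <-; exact: high.
  have [L' [[I' [FI' II' LE']] maxL']] := nT
    (fun L => exists I', [/\ F I', isub I I' & forall x, L x <-> lead_ideal I' (d - m.+1) x])
    (ex_intro _ (lead_ideal I (d - m.+1)) (ex_intro _ I (And3 FI (fun _ => id) (fun=> iff_refl _)))).
  exists I'; split=> // [x /II /II'//|J n FJ IJ].
  rewrite leq_eqVlt => /orP [/eqP <-|nm].
    move=> x Jx; apply/LE'/(maxL' (lead_ideal J (d - m.+1))) => //.
      by exists J; split=> // y /II' /IJ.
    by move=> y /LE'; apply: mono.
  move=> x Jx; apply: (mono _ _ _ II'); apply: h Jx => //; first by move=> y /II' /IJ.
  by move: nm; lia.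
exists I; split=> // J FJ IJ; apply: lead_ideal_eq => // n; apply: h => //.
by rewrite subnn.
Qed.
End Hilbert.

Lemma noeth_field (k : fieldType) : noeth k.
Proof.
move=> F [I FI]; have [I1|I1] := pselect (I 1).
  by exists I; split=> // J _ _ x _; rewrite -(mulr1 x); apply: idealM.
have [[J [FJ J1]]|h] := pselect (exists J, F J /\ J 1).
  by exists J; split=> // K _ _ x _; rewrite -(mulr1 x); apply: idealM.
exists I; split=> // J FJ IJ x Jx; have [->|x0] := eqVneq x 0; first exact: ideal0.
by case: h; exists J; split=> //; rewrite -(mulVf x0); apply: idealM.
Qed.

Section MpolyStep.
Context (k : comNzRingType) (n : nat).
(** Adjoining the last variable: a surjection that carries the Noetherian and the Jacobson property
    from n to n + 1 variables. *)
Definition mpoly_step (p : {poly {mpoly k[n]}}) : {mpoly k[n.+1]} :=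
  (map_poly (@mwiden n k) p).['X_ord_max].
Lemma mpoly_step_zmod : zmod_morphism mpoly_step.
Proof. by move=> p r; rewrite /mpoly_step rmorphB hornerD hornerN. Qed.
Lemma mpoly_step_monoid : monoid_morphism mpoly_step.
Proof. by split=> [|p r]; rewrite /mpoly_step ?rmorph1 ?hornerC // rmorphM hornerM. Qed.
HB.instance Definition _ := GRing.isZmodMorphism.Build _ _ mpoly_step mpoly_step_zmod.
HB.instance Definition _ := GRing.isMonoidMorphism.Build _ _ mpoly_step mpoly_step_monoid.
Lemma mpoly_step_surj u : exists p, mpoly_step p = u.
Proof.
elim/mpolyind: u => [|c m p _ _ [r Er]]; first by exists 0; rewrite rmorph0.
suff [r' Er'] : exists r', mpoly_step r' = c *: 'X_[m] by exists (r' + r); rewrite rmorphD /= Er Er'.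
exists ((c%:MP)%:P * \prod_(i < n.+1) (if unlift ord_max i is Some j then ('X_j)%:P else 'X) ^+ m i).
rewrite rmorphM rmorph_prod /= {1}/mpoly_step map_polyC hornerC /= mwidenC mul_mpolyC.
congr (_ *: _); rewrite (mpolyXE _ 1%g); apply: eq_bigr => i _; rewrite perm1 rmorphXn; congr (_ ^+ _).
case: unliftP => [j ->|->].
  rewrite /= /mpoly_step map_polyC hornerC /= mwidenX mnmwiden1.
  by congr ('X_ _); apply: val_inj; rewrite /= /bump leqNgt ltn_ord.
rewrite -[LHS]/((map_poly (@mwiden n k) 'X).['X_ord_max]).
by rewrite (map_polyX (@mwiden n k)) hornerX.
Qed.
End MpolyStep.

Lemma noeth_mpoly (k : fieldType) n : noeth {mpoly k[n]}.
Proof.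
elim: n => [|n IHn]; last first.
  by apply: (noeth_surj (@mpoly_step_surj k n)); apply: noeth_poly.
apply: (@noeth_surj k _ (@mpolyC 0 k)); last exact: noeth_field.
move=> u; exists (u@_0); apply/mpolyP => m; rewrite mcoeffC.
by have -> : m = 0%MM by [apply/mnmP => -[]]; rewrite eqxx mulr1.
Qed.

(** * Residue fields *)

Lemma pack_rmorphism (U V : comNzRingType) (g : U -> V) :
  g 1 = 1 -> (forall x y, g (x - y) = g x - g y) -> (forall x y, g (x * y) = g x * g y) ->
  exists h : {rmorphism U -> V}, h =1 g.
Proof.
move=> g1 gB gM.
pose i1 := GRing.isZmodMorphism.Build _ _ g gB.
pose i2 := GRing.isMonoidMorphism.Build _ _ g (conj g1 gM).
pose h : {rmorphism U -> V} := HB.pack g i1 i2.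
by exists h.
Qed.

Lemma rmorphism_factor (T U V : comNzRingType) (f : {rmorphism T -> U}) (g : {rmorphism T -> V}) :
  (forall u, exists t, f t = u) -> (forall t, f t = 0 -> g t = 0) ->
  exists h : {rmorphism U -> V}, forall t, h (f t) = g t.
Proof.
move=> fs fg; pose s u := xget 0 (fun t => f t = u).
have sK u : f (s u) = u.
  by rewrite /s; case: xgetP => // h; have [t /h] := fs u.
have gE t t' : f t = f t' -> g t = g t'.
  by move=> E; apply/subr0_eq; rewrite -rmorphB; apply: fg; rewrite rmorphB E subrr.
have [|||h hE] := @pack_rmorphism U V (g \o s).
- by rewrite /= -[RHS](rmorph1 g); apply: gE; rewrite sK rmorph1.
- by move=> x y; rewrite /= -rmorphB; apply: gE; rewrite rmorphB !sK.
- by move=> x y; rewrite /= -rmorphM; apply: gE; rewrite rmorphM !sK.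
by exists h => t; rewrite hE /=; apply: gE; rewrite sK.
Qed.

Section ClassicalUnits.
Context (T : comNzRingType).
Definition clu : Type := T.
HB.instance Definition _ := GRing.ComNzRing.on clu.
Definition clu_unit : pred clu := fun x => `[< exists y, y * x = 1 >].
Definition clu_inv (x : clu) : clu := xget x (fun y => y * x = 1).
Fact clu_mulVx : {in clu_unit, left_inverse 1 clu_inv *%R}.
Proof. by move=> x /asboolP [y yx]; rewrite /clu_inv; case: xgetP => // /(_ y) []. Qed.
Fact clu_unitPl x y : y * x = 1 -> clu_unit x.
Proof. by move=> h; apply/asboolP; exists y. Qed.
Fact clu_inv_out : {in [predC clu_unit], clu_inv =1 id}.
Proof.
move=> x /asboolP h; rewrite /clu_inv; case: xgetP => // y _ yx.
by case: h; exists y.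
Qed.
HB.instance Definition _ := GRing.ComNzRing_hasMulInverse.Build clu clu_mulVx clu_unitPl clu_inv_out.
End ClassicalUnits.

Definition prime1 (T : comNzRingType) (P : ideal T) (pP : prime_ideal P) : ~ P 1 := proj1 pP.
Definition dquot (T : comNzRingType) (P : ideal T) (pP : prime_ideal P) : Type :=
  clu (quot_of (prime1 pP)).
Section DomainQuotient.
Context (T : comNzRingType) (P : ideal T) (pP : prime_ideal P).
Local Notation D := (dquot pP).
HB.instance Definition _ := GRing.ComUnitRing.on D.
Definition dpi : {rmorphism T -> D} := qpi (prime1 pP).
Lemma dpi0 x : dpi x = 0 <-> P x. Proof. exact: qpi0. Qed.
Lemma dpi_surj u : exists t, dpi t = u.
Proof. by exists (val (u : quot_of (prime1 pP))); apply: qval. Qed.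
Fact dquot_integral : GRing.integral_domain_axiom D.
Proof.
move=> x y; have [s <-] := dpi_surj x; have [t <-] := dpi_surj y.
by rewrite -rmorphM => /dpi0 /(proj2 pP) [] /dpi0 ->; rewrite eqxx ?orbT.
Qed.
HB.instance Definition _ := GRing.ComUnitRing_isIntegral.Build D dquot_integral.
End DomainQuotient.

Definition iker (T U : comNzRingType) (f : {rmorphism T -> U}) : ideal T :=
  @Ideal T (fun x => f x = 0) (rmorph0 f)
  (fun x y fx fy => etrans (rmorphD f x y) (etrans (f_equal2 _ fx fy) (addr0 0)))
  (fun a x fx => etrans (rmorphM f a x) (etrans (f_equal2 _ erefl fx) (mulr0 _))).
Definition ipre (T U : comNzRingType) (f : {rmorphism T -> U}) (I : ideal U) : ideal T :=
  @Ideal T (fun x => I (f x)) (eq_ind_r I (ideal0 I) (rmorph0 f))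
  (fun x y Ix Iy => eq_ind_r I (idealD Ix Iy) (rmorphD f x y))
  (fun a x Ix => eq_ind_r I (idealM (f a) Ix) (rmorphM f a x)).
Lemma prime_pre (T U : comNzRingType) (f : {rmorphism T -> U}) (I : ideal U) :
  prime_ideal I -> prime_ideal (ipre f I).
Proof. by case=> I1 IM; split=> [|x y] /=; rewrite ?rmorph1 // rmorphM; apply: IM. Qed.

Definition iimg (T U : comNzRingType) (f : {rmorphism T -> U})
  (fs : forall u, exists t, f t = u) (I : ideal T) : ideal U.
Proof.
refine (@Ideal U (fun u => exists2 t, I t & f t = u) _ _ _).
- by exists 0; [apply: ideal0|rewrite rmorph0].
- by move=> x y [t It <-] [s Is <-]; exists (t + s); [apply: idealD|rewrite rmorphD].
- by move=> a x [t It <-]; have [b <-] := fs a; exists (b * t); [apply: idealM|rewrite rmorphM].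
Defined.

Lemma iimg_mem (T U : comNzRingType) (f : {rmorphism T -> U}) fs (I : ideal T) x :
  (forall t, f t = 0 -> I t) -> iimg (f := f) fs I (f x) <-> I x.
Proof.
move=> kI; split=> [[t It E]|Ix]; last by exists x.
by rewrite -(subrK t x); apply: idealD => //; apply: kI; rewrite rmorphB E subrr.
Qed.

Lemma prime_img (T U : comNzRingType) (f : {rmorphism T -> U}) fs (I : ideal T) :
  (forall t, f t = 0 -> I t) -> prime_ideal I -> prime_ideal (iimg (f := f) fs I).
Proof.
move=> kI [I1 IM]; split=> [|x y]; first by rewrite -(rmorph1 f) iimg_mem.
have [t <-] := fs x; have [s <-] := fs y.
by rewrite -rmorphM !iimg_mem //; apply: IM.
Qed.

(** * The Nullstellensatz *)

Section Jacobson.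
Context (k : closedFieldType).

(** Every prime is the intersection of the kernels of the k-points above it; in this form the
    property passes from T to T[X]. *)
Definition jacobson (T : comNzRingType) (i : k -> T) :=
  forall (P : ideal T) b, prime_ideal P -> ~ P b ->
  exists f : {rmorphism T -> k}, [/\ forall c, f (i c) = c, forall x, P x -> f x = 0 & f b != 0].

Lemma jacobson_surj (T U : comNzRingType) (i : k -> T) (f : {rmorphism T -> U}) :
  (forall u, exists t, f t = u) -> jacobson i -> jacobson (f \o i).
Proof.
move=> fs jT P b pP Pb; have [t Et] := fs b.
have [|g [gi gP gt]] := jT _ t (prime_pre f pP); first by rewrite /= Et.
have [|h hE] := rmorphism_factor (g := g) fs.
  by move=> s fs0; apply: gP; rewrite /= fs0; apply: ideal0.
exists h; split=> [c|x|]; first by rewrite /= hE.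
  by have [s <-] := fs x; rewrite hE => Px; apply: gP.
by rewrite -Et hE.
Qed.

Lemma horner_mapP (T : comNzRingType) (g : {rmorphism T -> k}) (a : k) :
  exists h : {rmorphism {poly T} -> k}, forall p, h p = (map_poly g p).[a].
Proof.
apply: (@pack_rmorphism {poly T} k (fun p => (map_poly g p).[a])).
- by rewrite rmorph1 hornerC.
- by move=> x y; rewrite rmorphB hornerD hornerN.
- by move=> x y; rewrite rmorphM hornerM.
Qed.

Lemma min_size (D : comNzRingType) (F : {poly D} -> Prop) : (exists p, F p) ->
  exists p, F p /\ forall r, F r -> (size p <= size r)%N.
Proof.
move=> [p Fp]; have h : exists n, `[< exists p, F p /\ size p = n >].
  by exists (size p); apply/asboolP; exists p.
case: (ex_minnP h) => m /asboolP [r [Fr Er]] mm.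
by exists r; split=> // s Fs; rewrite Er; apply: mm; apply/asboolP; exists s.
Qed.

(** If P has a nonzero element f of minimal degree, pseudo-division produces a nonzero constant c in
    P + (b); a k-point of D at which c and the leading coefficient of f survive is extended by a
    root of f. If P is zero, it is extended by a value that is not a root of b. *)
Lemma jacobson_poly_dom (D : idomainType) (i : k -> D) (P : ideal {poly D}) b :
  jacobson i -> prime_ideal P -> (forall c, P c%:P -> c = 0) -> ~ P b ->
  exists f : {rmorphism {poly D} -> k},
    [/\ forall c, f (i c)%:P = c, forall x, P x -> f x = 0 & f b != 0].
Proof.
move=> jD [P1 PM] P0 Pb.
pose Z : ideal D := @Ideal D (fun x => x = 0) erefl
  (fun x y (h : x = 0) (h' : y = 0) => etrans (f_equal2 +%R h h') (addr0 0))
  (fun a x (h : x = 0) => etrans (f_equal ( *%R a) h) (mulr0 a)).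
have pZ : prime_ideal Z.
  split; first by apply/eqP/oner_neq0.
  by move=> x y /= /eqP; rewrite mulf_eq0 => /orP[] /eqP; [left|right].
have [[f0 [Pf0 f00]]|P00] := pselect (exists f, P f /\ f <> 0); last first.
  have b0 : b != 0 by apply: contra_notN Pb => /eqP ->; apply: ideal0.
  have [|g [gi _ gb]] := jD Z (lead_coef b) pZ.
    by apply/eqP; rewrite lead_coef_eq0.
  have /closed_nonrootP [a ra] : map_poly g b != 0.
    by rewrite -lead_coef_eq0 lead_coef_map_eq.
  have [h hE] := horner_mapP g a.
  exists h; split=> [c|x Px|]; rewrite hE //.
    by rewrite map_polyC hornerC /= gi.
  suff -> : x = 0 by rewrite rmorph0 horner0.
  by apply: contrapT => x0; apply: P00; exists x.
have [f [[Pf nf] fmin]] := min_size (ex_intro (fun f => P f /\ f <> 0) f0 (conj Pf0 f00)).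
have {}nf : f != 0 by apply/eqP.
have small r : P r -> (size r < size f)%N -> r = 0.
  move=> Pr; case: (eqVneq r 0) => // /eqP r0; rewrite ltnNge fmin //.
have lcP p n x : p != 0 -> P ((lead_coef p ^+ n) *: x) -> P x.
  move=> p0; rewrite -mul_polyC => /PM [/P0/eqP|//].
  by rewrite expf_eq0 lead_coef_eq0 (negPf p0) andbF.
pose Pb' := iadd P (iprinc b).
(* Of minimal size in P + (b) outside P. It divides f up to a power of its leading coefficient, with
   a cofactor in P, and minimality of f forces it to be constant. *)
have [w [[Pbw Pw] wmin]] := min_size (F := fun w => Pb' w /\ ~ P w)
  (ex_intro _ b (conj (@iaddr _ P (iprinc b) b (iprinc_mem b)) Pb)).
have nw : w != 0 by apply: contra_notN Pw => /eqP ->; apply: ideal0.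
have divE (p r : {poly D}) : p != 0 -> exists n u v,
    lead_coef p ^+ n *: r = u * p + v /\ (size v < size p)%N.
  move=> p0; exists (Pdiv.Idomain.scalp r p), (Pdiv.Idomain.divp r p), (Pdiv.Idomain.modp r p); split.
    by rewrite Pdiv.Idomain.divp_eq.
  by rewrite Pdiv.Idomain.ltn_modp.
have swf : (size w < size f)%N.
  have [n [u [v [E sv]]]] := divE f w nf.
  apply: leq_ltn_trans sv; apply: wmin; split.
    have -> : v = lead_coef f ^+ n *: w - u * f by rewrite E addrC addKr.
    apply: idealB; first by rewrite -mul_polyC; apply: idealM.
    exact/iaddl/idealM.
  move=> Pv; apply/Pw/(lcP f n) => //; rewrite E; apply: idealD => //; exact: idealM.
have [n [u [v [E sv]]]] := divE w f nw.
have v0 : v = 0.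
  apply: small; last exact: ltn_trans sv swf.
  apply: contrapT => Pv; move: sv; rewrite ltnNge wmin //; split=> //.
  have -> : v = lead_coef w ^+ n *: f - u * w by rewrite E addrC addKr.
  apply: idealB; last exact: idealM.
  by apply: iaddl; rewrite -mul_polyC; apply: idealM.
have {E} E : lead_coef w ^+ n *: f = u * w by rewrite E v0 addr0.
have Pu : P u.
  have /PM [//|/Pw//] : P (u * w) by rewrite -E -mul_polyC; apply: idealM.
have lw : lead_coef w ^+ n != 0 by rewrite expf_neq0 // lead_coef_eq0.
have nu : u != 0.
  apply/eqP => u0; move/eqP: E; rewrite u0 mul0r scale_poly_eq0.
  by rewrite (negPf lw) (negPf nf).
have sw1 : (size w <= 1)%N.
  have : (size (u * w)%R <= size u)%N.
    by rewrite -E size_scale //; apply: fmin; split=> //; apply/eqP.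
  rewrite size_mul //; move: nw nu; rewrite -!size_poly_gt0.
  by case: (size w) => // m; case: (size u) => // l _ _; rewrite addSn /= addnS ltnS -{2}[l]addn0 leq_add2l.
have Ew := size1_polyC sw1; set c := w`_0 in Ew.
have c0 : c != 0 by move: nw; rewrite Ew polyC_eq0.
have [|g [gi _ gb]] := jD Z (lead_coef f * c) pZ.
  by apply/eqP; rewrite mulf_neq0 // lead_coef_eq0.
have [gf gc] : g (lead_coef f) != 0 /\ g c != 0.
  by move: gb; rewrite rmorphM mulf_eq0 => /norP.
have sgf : size (map_poly g f) = size f by rewrite size_map_poly_id0.
have /closed_rootP [a ra] : size (map_poly g f) != 1%N.
  rewrite sgf; apply/eqP => sf.
  have := size1_polyC (eq_leq sf) => Ef; move: nf Pf; rewrite Ef => nf /P0 f00'.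
  by rewrite f00' eqxx in nf.
have [h hE] := horner_mapP g a.
have hP x : P x -> h x = 0.
  move=> Px; have [m [r [s [Es ss]]]] := divE f x nf.
  have s0 : s = 0.
    apply: small ss; have -> : s = lead_coef f ^+ m *: x - r * f by rewrite Es addrC addKr.
    by apply: idealB; [rewrite -mul_polyC|]; apply: idealM.
  have hl : h (lead_coef f ^+ m)%:P != 0.
    by rewrite hE map_polyC hornerC /= rmorphXn expf_neq0.
  have hf : h f = 0 by rewrite hE; apply/eqP.
  have := congr1 h Es; rewrite s0 addr0 -mul_polyC [LHS]rmorphM [RHS]rmorphM hf mulr0.
  by move/eqP; rewrite mulf_eq0 (negPf hl) => /eqP.
exists h; split=> [d||] //; first by rewrite hE map_polyC hornerC /= gi.
apply: contra_neq gc => hb.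
have [p Pp [d Ed]] := Pbw.
have := congr1 h Ed; rewrite rmorphB rmorphM hb mulr0 (hP p Pp) subr0 Ew hE.
by rewrite map_polyC hornerC.
Qed.

(** Dividing T by the contraction of P reduces to a domain in which the contraction is zero. *)
Lemma jacobson_poly (T : comNzRingType) (i : k -> T) :
  jacobson i -> jacobson (fun c => (i c)%:P).
Proof.
move=> jT P b pP Pb; pose P0 := ipre (@polyC T) P.
have pP0 : prime_ideal P0 := prime_pre _ pP.
pose pi := map_poly (dpi pP0).
have pis u : exists t, pi t = u.
  exists (\poly_(j < size u) (val u`_j : T)); apply/polyP => j.
  rewrite coef_map coef_poly; case: ltnP => [_|]; first exact: qval.
  by move=> h; rewrite [RHS]nth_default //; apply/dpi0; apply: ideal0.
have kP t : pi t = 0 -> P t.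
  move=> t0; rewrite -[t]coefK poly_def; apply: ideal_sum => j _.
  rewrite -mul_polyC; apply: idealMr; suff : P0 t`_j by [].
  by apply/dpi0; move/polyP: t0 => /(_ j); rewrite coef_map coef0.
have [g [gi gP gb]] : exists g : {rmorphism {poly dquot pP0} -> k},
    [/\ forall c, g ((dpi pP0 \o i) c)%:P = c, forall x, iimg pis P x -> g x = 0 & g (pi b) != 0].
  apply: jacobson_poly_dom.
  - exact: (@jacobson_surj T (dquot pP0) i (dpi pP0) (@dpi_surj T P0 pP0) jT).
  - exact: (@prime_img _ _ pi pis P kP pP).
  - move=> c; have [t <-] := dpi_surj c; rewrite -map_polyC -/pi iimg_mem //.
    by move=> Pt; apply/dpi0.
  - by rewrite iimg_mem.
exists (g \o pi); split=> [c|x Px|] //=.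
  by rewrite -[RHS]gi /pi map_polyC.
by apply: gP; exists x.
Qed.

Lemma jacobson_mpoly n : jacobson (fun c : k => c%:MP_[n]).
Proof.
elim: n => [|n IHn]; last first.
  have := jacobson_surj (@mpoly_step_surj k n) (jacobson_poly IHn).
  congr jacobson; apply/funext => c /=.
  by rewrite /mpoly_step map_polyC hornerC /= mwidenC.
have jk : jacobson (@id k).
  move=> P b [P1 PM] Pb; exists idfun; split=> //= [x Px|].
    apply: contrapT => /eqP x0; apply: P1; rewrite -(mulVf x0); exact: idealM.
  by apply: contra_notN Pb => /eqP ->; apply: ideal0.
have := @jacobson_surj k _ (@id k) (@mpolyC 0 k); apply=> // u.
exists (u@_0); apply/mpolyP => m; rewrite mcoeffC.
by have -> : m = 0%MM by [apply/mnmP => -[]]; rewrite eqxx mulr1.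
Qed.
End Jacobson.

Lemma fraction_surj (D : idomainType) (z : {fraction D}) :
  exists x y : D, y != 0 /\ z * tofrac y = tofrac x.
Proof.
elim/quotW: z => r; exists (frac r).1, (frac r).2; split; first exact: denom_ratioP.
rewrite !piE; apply/eqmodP => /=.
rewrite FracField.equivfE /FracField.mulf !numden_Ratio ?mulf_neq0 ?oner_neq0 ?denom_ratioP //.
by rewrite !mulr1 mulrC.
Qed.

Section Algebras.
Context (k : fieldType).
Implicit Types A B C : comUnitAlgType k.

Lemma lr_of A B (f : {rmorphism A -> B}) :
  (forall c : k, f c%:A = c%:A) -> exists g : {lrmorphism A -> B}, g =1 f.
Proof.
move=> fk; have fZ : scalable f.
  by move=> c x; rewrite -[c *: x]mulr_algl rmorphM fk mulr_algl.
pose i1 := GRing.isZmodMorphism.Build _ _ (f : A -> B) (@rmorphB _ _ f).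
pose i2 := GRing.isMonoidMorphism.Build _ _ (f : A -> B) (conj (rmorph1 f) (rmorphM f)).
pose i3 := GRing.isScalable.Build _ _ _ _ (f : A -> B) fZ.
pose h : {lrmorphism A -> B} := HB.pack (f : A -> B) i1 i2 i3.
by exists h.
Qed.

Lemma lr_factor (T : comNzRingType) A B (i : k -> T) (f : {rmorphism T -> A})
    (g : {rmorphism T -> B}) :
  (forall u, exists t, f t = u) -> (forall t, f t = 0 -> g t = 0) ->
  (forall c, f (i c) = c%:A) -> (forall c, g (i c) = c%:A) ->
  exists h : {lrmorphism A -> B}, forall t, h (f t) = g t.
Proof.
move=> fs fg fi gi; have [h hE] := rmorphism_factor fs fg.
have [|h' h'E] := @lr_of A B h; first by move=> c; rewrite -fi hE gi.
by exists h' => t; rewrite h'E hE.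
Qed.

Lemma lr_id A : exists f : {lrmorphism A -> A}, f =1 id.
Proof. by exists idfun. Qed.

Lemma lr_comp A B C (f : {lrmorphism A -> B}) (g : {lrmorphism B -> C}) :
  exists h : {lrmorphism A -> C}, h =1 g \o f.
Proof. by exists (g \o f). Qed.

Lemma in_algP A : exists f : {lrmorphism k^o -> A}, forall c, f c = c%:A.
Proof.
have [|f fE] := @lr_of k^o A (GRing.in_alg A : {rmorphism k -> A}); last by exists f.
by move=> c; rewrite (_ : c%:A = c :> k^o) //; exact: mulr1.
Qed.

Lemma quotient_alg (T : comNzRingType) (i : {rmorphism k -> T}) (I : ideal T) : ~ I 1 ->
  exists B (f : {rmorphism T -> B}), [/\ forall u, exists t, f t = u,
    forall t, f t = 0 <-> I t & forall c, f (i c) = c%:A].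
Proof.
move=> I1; exists (calg (qpi I1 \o i)), (qpi I1); split.
- by move=> u; exists (val (u : quot_of I1)); apply: qval.
- exact: qpi0.
- by move=> c; rewrite -[RHS]/(((qpi I1 \o i) c : calg _) * 1) mulr1.
Qed.

Lemma localization A (a : A) : (forall n, a ^+ n != 0) ->
  exists B (f : {lrmorphism A -> B}), is_localization a f /\
    forall C (g : {lrmorphism A -> C}), g a \is a GRing.unit ->
      exists h : {lrmorphism B -> C}, h \o f =1 g.
Proof.
move=> an; pose r : {poly A} := a%:P * 'X - 1.
pose I := iprinc r.
have kerI (x : A) : I x%:P -> exists n, x * a ^+ n = 0.
  case=> p; rewrite /r mulrBr mulr1 mulrA (mulrC p) => Ep.
  have Ec j : (x%:P)`_j = ((a%:P * p) * 'X - p)`_j by rewrite -Ep.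
  have cp j : p`_j = - (x * a ^+ j).
    elim: j => [|j IHj]; first by have := Ec 0%N; rewrite coefC coefB coefMX /= sub0r mulr1 => ->; rewrite opprK.
    have := Ec j.+1; rewrite coefC coefB coefMX coefCM /= IHj => /esym/eqP.
    by rewrite subr_eq0 => /eqP <-; rewrite exprS mulrN mulrCA.
  by exists (size p); apply/eqP; rewrite -oppr_eq0 -cp nth_default.
have I1 : ~ I 1 by move=> /kerI [n]; rewrite mul1r; apply/eqP.
pose i : {rmorphism k -> {poly A}} := @polyC A \o (GRing.in_alg A : {rmorphism k -> A}).
have [B [f [fs f0 fi]]] := quotient_alg i I1.
have [|g gE] := @lr_of A B (f \o @polyC A); first by move=> c; rewrite -fi.
have fP c : f c%:P = g c by rewrite gE.
have fX : f 'X * g a = 1.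
  rewrite gE /= -rmorphM mulrC; apply/subr0_eq; rewrite -(rmorph1 f) -rmorphB.
  by apply/f0/iprinc_mem.
have ga : g a \is a GRing.unit by apply/unitrPr; exists (f 'X); rewrite mulrC.
exists B, g; split; first split=> //.
- move=> b; have [p <-] := fs b; elim/poly_ind: p => [|p c [x [n Ex]]].
    by exists 0, 0%N; rewrite !rmorph0 mul0r.
  exists (x + c * a ^+ n.+1), n.+1.
  rewrite !rmorphD !rmorphM /= fP exprS mulrDl; congr (_ + _); last first.
    by rewrite rmorphXn exprS.
  by rewrite -mulrA (mulrA (f 'X)) fX mul1r Ex.
- by move=> x; rewrite gE /= => /f0 /kerI.
move=> C h ha.
have [h' h'E] : exists h' : {rmorphism {poly A} -> C}, forall p, h' p = (map_poly h p).[(h a)^-1].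
  apply: (@pack_rmorphism {poly A} C (fun p => (map_poly h p).[(h a)^-1])).
  - by rewrite rmorph1 hornerC.
  - by move=> x y; rewrite rmorphB hornerD hornerN.
  - by move=> x y; rewrite rmorphM hornerM.
have [|||l lE] := @lr_factor _ B C i f h' fs.
- move=> t /f0 [c ->]; rewrite rmorphM [h' r]h'E /r rmorphB rmorphM /= map_polyC map_polyX rmorph1.
  by rewrite hornerD hornerN hornerM !hornerC hornerX /= mulrV // subrr mulr0.
- exact: fi.
- by move=> c; rewrite h'E map_polyC hornerC /= linearZ rmorph1.
exists l => x /=; rewrite gE /= lE h'E map_polyC hornerC //.
Qed.

(** The last clause, that all elements are fractions from A, allows this field to be embedded in
    every field to which A maps with the same kernel. *)
Lemma residue_frac A (P : ideal A) : prime_ideal P ->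
  exists (K : comUnitAlgType k) (f : {lrmorphism A -> K}), [/\ is_field K, forall x, f x = 0 <-> P x
    & forall z, exists x y, f y != 0 /\ z * f y = f x].
Proof.
move=> pP; pose D := dquot pP.
pose i : {rmorphism k -> {fraction D}} :=
  @tofrac D \o (dpi pP \o (GRing.in_alg A : {rmorphism k -> A})).
pose K : comUnitAlgType k := calg i.
pose f : {rmorphism A -> K} := (@tofrac D \o dpi pP : {rmorphism A -> {fraction D}}).
have [|g gE] := @lr_of A K f.
  by move=> c; rewrite -[RHS]/(((i c : K) * 1)) mulr1.
exists K, g; split.
- move=> x x0; apply/unitrPr; exists ((x : {fraction D})^-1 : K).
  exact: (@divff {fraction D}).
- move=> x; rewrite gE /=; split=> [/eqP|/dpi0 h].
    by rewrite -[_ == _]/(tofrac (dpi pP x) == 0) tofrac_eq0 => /eqP /dpi0.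
  by rewrite -[LHS]/(tofrac (dpi pP x)) h rmorph0.
move=> z; have [u [v [v0 E]]] := fraction_surj (z : {fraction D}).
have [x Ex] := dpi_surj u; have [y Ey] := dpi_surj v.
exists x, y; rewrite !gE /=; split.
  by rewrite -[_ == _]/(tofrac (dpi pP y) == 0) tofrac_eq0 Ey.
by rewrite -[RHS]/(tofrac (dpi pP x)) Ex -E -Ey.
Qed.

Lemma residue_field A (P : ideal A) : prime_ideal P ->
  exists (K : comUnitAlgType k) (f : {lrmorphism A -> K}), is_field K /\ forall x, f x = 0 <-> P x.
Proof. by move=> /residue_frac [K [f [Kf f0 _]]]; exists K, f. Qed.

Lemma residue_embed A (K : comUnitAlgType k) (f : {lrmorphism A -> K}) (L : comUnitAlgType k) (g : {lrmorphism A ->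
  L}) :
  is_field K -> is_field L -> (forall z : K, exists x y, f y != 0 /\ z * f y = f x) ->
  (forall x, f x = 0 <-> g x = 0) -> exists h : {lrmorphism K -> L}, h \o f =1 g.
Proof.
move=> Kf Lf fr fg; have [x hx] := choice fr; have [y hy] := choice hx.
have gn z : f z != 0 -> g z != 0 by apply: contra_neq => /fg.
have ug z : f z != 0 -> g z \is a GRing.unit by move=> /gn /Lf.
have fM a b : f (a * b) = f a * f b by exact: rmorphM.
have fB a b : f (a - b) = f a - f b by exact: rmorphB.
have gM a b : g (a * b) = g a * g b by exact: rmorphM.
have gB a b : g (a - b) = g a - g b by exact: rmorphB.
have f1 : f 1 = 1 by exact: rmorph1.
have g1 : g 1 = 1 by exact: rmorph1.
pose h z := g (x z) / g (y z).
have key z a b : f b != 0 -> z * f b = f a -> h z = g a / g b.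
  move=> fb E; have [fy Ez] := hy z.
  apply: (mulIr (ug _ fy)); apply: (mulIr (ug _ fb)); rewrite divrK ?ug // mulrAC divrK ?ug //.
  rewrite -!gM; apply/eqP; rewrite -subr_eq0 -gB; apply/eqP/fg.
  by rewrite fB !fM -Ez -E mulrAC subrr.
have nz z w : f z != 0 -> f w != 0 -> f (z * w) != 0.
  move=> /Kf u /Kf v; rewrite fM; apply/eqP => E.
  have : f z * f w \is a GRing.unit by rewrite unitrM u v.
  by rewrite E unitr0.
have [|||h' h'E] := @pack_rmorphism K L h.
- rewrite (key 1 1 1) ?f1 ?g1 ?divr1 ?mulr1 ?oner_neq0 //.
- move=> z w; have [fz Ez] := hy z; have [fw Ew] := hy w.
  rewrite (key (z - w) (x z * y w - x w * y z) (y z * y w)); last 2 first.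
  + exact: nz.
  + by rewrite fB !fM -Ez -Ew; ring.
  apply: (mulIr (ug _ (nz _ _ fz fw))); rewrite divrK ?ug ?nz // mulrBl gM.
  rewrite mulrA divrK ?ug // [g (y z) * g (y w)]mulrC mulrA divrK ?ug //.
  by rewrite gB !gM.
- move=> z w; have [fz Ez] := hy z; have [fw Ew] := hy w.
  rewrite (key (z * w) (x z * x w) (y z * y w)); last 2 first.
  + exact: nz.
  + by rewrite !fM -Ez -Ew; ring.
  by rewrite !gM invrM ?ug // [_^-1 * _^-1]mulrC mulrACA.
have h'f z : h' (f z) = g z.
  by rewrite h'E (key (f z) z 1) ?f1 ?g1 ?divr1 ?mulr1 ?oner_neq0.
have [|hl hlE] := @lr_of K L h'.
  move=> c; have fA : f c%:A = c%:A by rewrite -[RHS](congr1 (fun z => c *: z) f1); apply: linearZ.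
  have gA : g c%:A = c%:A by rewrite -[RHS](congr1 (fun z => c *: z) g1); apply: linearZ.
  by rewrite -fA h'f gA.
by exists hl => z; rewrite /= hlE h'f.
Qed.
End Algebras.

(** * Formal smoothness and order at a point *)

Lemma mpoly_rmorph_eq (A B : comNzRingType) n (f g : {rmorphism {mpoly A[n]} -> B}) :
  (forall c, f c%:MP = g c%:MP) -> (forall i, f 'X_i = g 'X_i) -> f =1 g.
Proof.
move=> fg fgX p; elim/mpolyind: p => [|c m p _ _ IH]; first by rewrite !rmorph0.
rewrite !rmorphD -IH; congr (_ + _).
rewrite -mul_mpolyC !rmorphM fg; congr (_ * _).
rewrite (mpolyXE _ 1%g) !rmorph_prod; apply: eq_bigr => i _.
by rewrite perm1 !rmorphXn fgX.
Qed.

Lemma mmapP (A B : comNzRingType) n (h : {rmorphism A -> B}) (v : 'I_n -> B) :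
  exists f : {rmorphism {mpoly A[n]} -> B},
    [/\ forall p, f p = mmap h v p, forall c, f c%:MP = h c & forall i, f 'X_i = v i].
Proof.
exists (mmap h v); split=> // [c|i]; first exact: mmapC.
by rewrite /= mmapX /mmap1 (bigD1 i) //= mnm1E eqxx expr1 big1 ?mulr1 // => j ji;
   rewrite mnm1E eq_sym (negPf ji) expr0.
Qed.

Section IPow.
Context (T : comNzRingType).
Implicit Types (I J : ideal T).

Lemma ipow_prod I n (f : 'I_n -> T) : (forall i, I (f i)) -> ipow I n (\prod_i f i).
Proof. by move=> If; apply: igen_mem; exists f. Qed.
Lemma ipow_mul I m n x y : ipow I m x -> ipow I n y -> ipow I (m + n) (x * y).
Proof.
move=> Ix Iy; suff : icolon (ipow I (m + n)) y x by rewrite /= mulrC.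
apply: Ix => _ [f If ->] /=; rewrite mulrC.
suff : icolon (ipow I (m + n)) (\prod_i f i) y by [].
apply: Iy => _ [g Ig ->] /=.
pose h i := match split i with inl j => f j | inr j => g j end.
have -> : (\prod_i f i) * (\prod_i g i) = \prod_i h i.
  rewrite big_split_ord /=; congr (_ * _); apply: eq_bigr => i _; rewrite /h.
    by rewrite (unsplitK (inl i)).
  by rewrite (unsplitK (inr i)).
by apply: ipow_prod => i; rewrite /h; case: split.
Qed.
Lemma ipow1 I x : I x -> ipow I 1 x.
Proof. by move=> Ix; have := @ipow_prod I 1 (fun=> x) (fun=> Ix); rewrite big_ord1. Qed.
Lemma ipow1E I x : ipow I 1 x <-> I x.
Proof.
split=> [|/ipow1//]; apply=> y [f If ->]; rewrite big_ord1; exact: If.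
Qed.
Lemma ipow0 I x : ipow I 0 x.
Proof.
rewrite -(mulr1 x); apply: idealM.
by have := @ipow_prod I 0 (fun=> 1) (fun i => False_ind _ (Bool.diff_false_true (ltn_ord i))); rewrite big_ord0.
Qed.
Lemma ipow_leq I m n x : (m <= n)%N -> ipow I n x -> ipow I m x.
Proof.
move=> mn h; apply: (h (ipow I m)) => y [f If ->]; move: f If; rewrite -(subnKC mn) => f If.
rewrite big_split_ord; apply: idealMr; apply: ipow_prod => i; exact: If.
Qed.
Lemma ipow_exp I n x : I x -> ipow I n (x ^+ n).
Proof.
by move=> Ix; rewrite -[n in x ^+ n]card_ord -prodr_const; apply: ipow_prod.
Qed.
End IPow.

Lemma ipow_morph (T U : comNzRingType) (f : {rmorphism T -> U}) (I : ideal T) (J : ideal U) n m :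
  (forall x, I x -> ipow J m (f x)) -> forall x, ipow I n x -> ipow J (n * m) (f x).
Proof.
move=> fI x hx; apply: (hx (ipre f (ipow J (n * m)))) => y [g Ig ->].
change (ipow J (n * m) (f (\prod_i g i))); rewrite rmorph_prod {hx}; elim: n g Ig => [|n IHn] g Ig; first by
  rewrite big_ord0 mul0n; apply: ipow0.
rewrite big_ord_recl mulSn; apply: ipow_mul; first exact: fI.
exact: IHn.
Qed.

Section Local.
Context (k : closedFieldType) (n : nat).
Local Notation P := {mpoly k[n]}.
Implicit Types (q : 'I_n -> k) (J : ideal P) (e r h : P).

Definition maxid q : ideal P := iker (meval q).
Lemma maxid_mem q r : maxid q r <-> r.@[q] = 0. Proof. by []. Qed.

Lemma point_of (f : {rmorphism P -> k}) : (forall c, f c%:MP = c) ->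
  forall p, f p = p.@[fun i => f 'X_i].
Proof.
move=> fc p; apply: (@mpoly_rmorph_eq _ _ _ f (meval (fun i => f 'X_i))) => [c|i].
  by rewrite fc /= mevalC.
by rewrite /= mevalXU.
Qed.

(** The substitution X_i -> q_i + t X_i, with t the new variable: the order in t of the image is the
    order of vanishing at q. *)
Lemma blowup_sig q : {f : {rmorphism P -> {poly P}} | (forall c, f c%:MP = c%:MP%:P) /\
  forall i, f 'X_i = (q i)%:MP%:P + 'X * ('X_i)%:P}.
Proof.
apply: cid; have [f [_ fC fX]] := mmapP (@polyC P \o @mpolyC n k)
  (fun i => (q i)%:MP%:P + 'X * ('X_i)%:P : {poly P}).
by exists f.
Qed.
Definition blowup q : {rmorphism P -> {poly P}} := sval (blowup_sig q).
Lemma blowupC q c : blowup q c%:MP = c%:MP%:P. Proof. by case: (svalP (blowup_sig q)). Qed.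
Lemma blowupX q i : blowup q 'X_i = (q i)%:MP%:P + 'X * ('X_i)%:P.
Proof. by case: (svalP (blowup_sig q)). Qed.

Lemma blowup0 q p : (blowup q p)`_0 = (p.@[q])%:MP.
Proof.
have [f fE] : exists f : {rmorphism P -> P}, forall p, f p = (blowup q p)`_0.
  apply: (@pack_rmorphism P P (fun p => (blowup q p)`_0)).
  - by rewrite rmorph1 coef1.
  - by move=> x y; rewrite rmorphB coefB.
  - by move=> x y; rewrite rmorphM coef0M.
rewrite -fE.
apply: (@mpoly_rmorph_eq _ _ _ f (@mpolyC n k \o meval q)) => [c|i] /=.
  by rewrite fE blowupC coefC mevalC.
by rewrite fE blowupX coefD coefC coefXM addr0 mevalXU.
Qed.

Lemma blowup_low q N r : ipow (maxid q) N r -> forall i, (i < N)%N -> (blowup q r)`_i = 0.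
Proof.
suff h : isub (ipow (maxid q) N) (ipre (blowup q) (iprinc ('X^N))).
  by move=> /h [c ->] i iN; rewrite coefMXn iN.
move=> x; apply=> _ [f If ->] /=.
rewrite rmorph_prod; elim: N f If => [|N IHN] f If.
  by rewrite big_ord0 expr0; exists 1; rewrite mulr1.
rewrite big_ord_recl exprS; have [c ->] := IHN (fun i => f (lift ord0 i)) (fun i => If _).
have [d ->] : exists d, blowup q (f ord0) = d * 'X.
  have := factor_theorem (blowup q (f ord0)) 0; rewrite subr0 => h; apply/h.
  by rewrite /root horner_coef0 blowup0 If.
by exists (d * c); rewrite mulrACA.
Qed.

(** Substituting X_i - q_i for X_i and 1 for t recovers r, and the coefficient of t^j lands in the
    j-th power of the maximal ideal of q. *)
Lemma blowup_high q N r : (forall i, (i < N)%N -> (blowup q r)`_i = 0) -> ipow (maxid q) N r.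
Proof.
move=> hr.
have [s [_ sC sX]] := mmapP (@mpolyC n k) (fun i => 'X_i - (q i)%:MP : P).
pose good (g : {poly P}) := forall j, ipow (maxid q) j (s g`_j).
have goodM f g : good f -> good g -> good (f * g).
  move=> gf gg j; rewrite coefM rmorph_sum; apply: ideal_sum => i _.
  have {1}-> : j = (i + (j - i))%N by rewrite subnKC // -ltnS.
  by rewrite rmorphM; apply: ipow_mul.
have goodD f g : good f -> good g -> good (f + g).
  by move=> gf gg j; rewrite coefD rmorphD; apply: idealD.
have goodC (c : k) : good c%:MP%:P.
  move=> j; rewrite coefC; case: eqP => [->|_]; first exact: ipow0.
  by rewrite rmorph0; apply: ideal0.
have goodX i : good (blowup q 'X_i).
  rewrite blowupX; apply: goodD => // j.
  have -> : ('X * ('X_i)%:P : {poly P})`_j = if j == 1%N then 'X_i else 0.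
    by rewrite coefXM coefC; case: j => [|[]].
  case: eqP => [->|_]; last by rewrite rmorph0; apply: ideal0.
  by rewrite sX; apply: ipow1; rewrite maxid_mem mevalB mevalXU mevalC subrr.
have gr : good (blowup q r).
  elim/mpolyind: (r) => [|c m p _ _ IH]; first by rewrite rmorph0 => j; rewrite coef0 rmorph0; apply: ideal0.
  rewrite rmorphD; apply: (goodD) => //; rewrite -mul_mpolyC rmorphM blowupC; apply: (goodM) => //.
  rewrite (mpolyXE _ 1%g) rmorph_prod; elim/big_ind: _ => [|f g gf gg|i _]; [by have := goodC 1; rewrite
    rmorph1|exact: goodM|].
  rewrite perm1 rmorphXn; elim: (m i) => [|l IHl]; first by have := goodC 1; rewrite rmorph1.
  by rewrite exprS; apply: (goodM).
have -> : r = \sum_(j < size (blowup q r)) s (blowup q r)`_j.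
  have [f fE] : exists f : {rmorphism {poly P} -> P}, forall p, f p = (map_poly s p).[1].
    apply: (@pack_rmorphism {poly P} P (fun p => (map_poly s p).[1])).
    - by rewrite rmorph1 hornerC.
    - by move=> x y; rewrite rmorphB hornerD hornerN.
    - by move=> x y; rewrite rmorphM hornerM.
  transitivity (f (blowup q r)); last first.
    by rewrite fE (@horner_coef_wide _ (size (blowup q r))) ?size_poly //;
       apply: eq_bigr => i _; rewrite coef_map expr1n mulr1.
  rewrite -[LHS]/((idfun : {rmorphism P -> P}) r) -[RHS]/((f \o blowup q) r).
  apply: mpoly_rmorph_eq => [c|i] /=; rewrite fE ?blowupC ?blowupX.
    by rewrite map_polyC hornerC /= sC.
  rewrite rmorphD rmorphM /= !map_polyC map_polyX !hornerE /= sC sX.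
  by rewrite addrC subrK.
apply: ideal_sum => j _; case: (ltnP j N) => jN; last exact: ipow_leq jN (gr j).
by rewrite hr // rmorph0; apply: ideal0.
Qed.

(** Over a domain the lowest nonzero terms multiply to a nonzero term, so orders add. *)
Lemma low_coefM (f g : {poly P}) a b :
  (forall i, (i < a + b)%N -> (f * g)`_i = 0) ->
  (forall i, (i < a)%N -> f`_i = 0) \/ (forall i, (i < b)%N -> g`_i = 0).
Proof.
move=> fg0; apply: contrapT => /not_orP [nf ng].
have wit (p : {poly P}) c : ~ (forall i, (i < c)%N -> p`_i = 0) ->
    exists i, [/\ (i < c)%N, p`_i != 0 & forall j, (j < i)%N -> p`_j = 0].
  move=> np; have ex : exists i, p`_i != 0.
    by apply: contrapT => h; apply: np => i _; apply/eqP; apply: contrapT => /negP pi; apply: h; exists i.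
  case: (ex_minnP ex) => i pi mi; exists i; split=> //.
    rewrite ltnNge; apply/negP => ci; apply: np => j jc; apply/eqP.
    by apply: contraTT (leq_trans jc ci) => /mi; rewrite -leqNgt.
  by move=> j ji; apply/eqP; apply: contraTT ji => /mi; rewrite -leqNgt.
have [i [ia fi mi]] := wit _ _ nf; have [j [jb gj mj]] := wit _ _ ng.
have : (f * g)`_(i + j) = f`_i * g`_j.
  rewrite coefM (bigD1 (inord i)) //= inordK ?ltnS ?leq_addr // addKn big1 ?addr0 // => l.
  rewrite -(inj_eq val_inj) /= inordK ?ltnS ?leq_addr // => li.
  case: (ltngtP l i) li => // li _; first by rewrite mi // mul0r.
  by rewrite mj ?mulr0 // ltn_subLR ?ltn_add2r // -ltnS.
rewrite fg0; last by rewrite -addSn; apply: leq_add => //; apply: ltnW.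
by move/esym/eqP; rewrite mulf_eq0 (negPf fi) (negPf gj).
Qed.

(** t lifts to polynomials a section of P/J^2 -> P/J; this is the form in which formal smoothness of
    P/J over k is used. *)
Definition smooth_ideal J := exists t : {rmorphism P -> P},
  [/\ forall c, t c%:MP = c%:MP, forall p, J (t p - p) & forall p, J p -> ipow J 2 (t p)].

(** Each further application of t doubles the exponent of J. *)
Lemma smooth_iter J N : smooth_ideal J -> exists t : {rmorphism P -> P},
  [/\ forall p, J (t p - p) & forall p, J p -> ipow J (2 ^ N) (t p)].
Proof.
case=> t [_ tJ t2]; elim: N => [|N [s [sJ sN]]].
  by exists idfun; split=> p; [rewrite subrr; apply: ideal0|apply: ipow1].
have t1 p : J p -> ipow J 1 (s p).
  by move=> Jp; apply: ipow1; rewrite -(subrK p (s p)); apply: idealD.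
exists (s \o t); split=> p /=.
  rewrite -(subrK (s p) (s (t p))) -rmorphB -addrA; apply: idealD => //.
  by apply/ipow1E/t1.
by move/t2 => h; rewrite expnS; apply: (ipow_morph sN h).
Qed.

(** r is zero in the local ring of P/J at q. *)
Definition gz J q r := exists2 e, e.@[q] != 0 & J (e * r).

Lemma gzP J q r : (forall N, iadd J (ipow (maxid q) N) r) -> gz J q r.
Proof.
move=> h; have [i qi Ji] := krull (@noeth_mpoly k n) h.
exists (1 - i); last by rewrite mulrBl mul1r.
by rewrite mevalB meval1 (qi : i.@[q] = 0) subr0 oner_neq0.
Qed.

(** A smooth point has an integral local ring. An iterate of t sends e r1 r2 into a high power of J,
    hence to something of high order at q. Orders add and t e is nonzero at q, so t r1 or t r2 has
    high order; since t r = r modulo J, one of the r_i lies in J + m^N for the N that was meant to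
    exclude it. *)
Lemma gz_dom J q r1 r2 : smooth_ideal J -> isub J (maxid q) -> gz J q (r1 * r2) ->
  gz J q r1 \/ gz J q r2.
Proof.
move=> sJ Jq [e qe Je]; apply: contrapT => /not_orP [n1 n2].
have wit r : ~ gz J q r -> exists N, ~ iadd J (ipow (maxid q) N) r.
  by move=> nr; apply: contrapT => h; apply/nr/gzP => N; apply: contrapT => ?; apply: h; exists N.
have [N1 h1] := wit _ n1; have [N2 h2] := wit _ n2.
have [t [tJ tN]] := smooth_iter (1 + (N1 + N2)) sJ.
have key r N : ~ iadd J (ipow (maxid q) N) r ->
    ~ forall i, (i < N)%N -> (blowup q (t r))`_i = 0.
  move=> nr /blowup_high h; apply: nr; exists (r - t r); last by rewrite opprB addrC subrK.
  by rewrite -opprB; apply: idealN.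
have low : forall i, (i < 1 + (N1 + N2))%N ->
    (blowup q (t e) * (blowup q (t r1) * blowup q (t r2)))`_i = 0.
  rewrite -!rmorphM; apply: blowup_low; apply: (@ipow_leq _ _ _ (2 ^ (1 + (N1 + N2)))).
    by apply: ltnW; apply: ltn_expl.
  by apply: (ipow_sub Jq); apply: tN.
case/low_coefM: low => [/(_ 0%N isT)|/low_coefM [h|h]]; [|exact: (key _ _ h1 h)|exact: (key _ _ h2 h)].
rewrite blowup0 => /eqP; rewrite mpolyC_eq0 => /eqP te0; case/negP: qe.
by have := Jq _ (tJ e); rewrite maxid_mem mevalB te0 sub0r => /eqP; rewrite oppr_eq0.
Qed.

(** By the Nullstellensatz a power of e r lies in J, and the local ring, being a domain, is
    reduced. *)
Lemma gz_nullst J q r : smooth_ideal J -> isub J (maxid q) ->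
  (exists2 e, e.@[q] != 0 & forall x, isub J (maxid x) -> e.@[x] != 0 -> r.@[x] = 0) ->
  gz J q r.
Proof.
move=> sJ Jq [e qe h].
have [m Jm] : exists m, J ((e * r) ^+ m).
  apply: contrapT => nm.
  have [| |Q [pQ JQ SQ]] := @prime_avoid P (fun x => exists m, x = (e * r) ^+ m) J.
  - by split; [exists 0%N|move=> _ _ [a ->] [b ->]; exists (a + b)%N; rewrite exprD].
  - by move=> _ [m ->] Jm; apply: nm; exists m.
  have [|f [fC fQ fe]] := jacobson_mpoly pQ (b := e * r).
    by apply: SQ; exists 1%N.
  move: fe; rewrite rmorphM !(point_of fC) mulf_eq0 => /norP [ne nr].
  case/negP: nr; apply/eqP/h => // x /JQ /fQ; by rewrite (point_of fC).
have {}Jm : gz J q ((e * r) ^+ m) by exists 1; rewrite ?meval1 ?oner_neq0 // mul1r.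
elim: m Jm => [[c qc]|m IHm].
  by rewrite mulr1 => /Jq; rewrite maxid_mem => /eqP; rewrite (negPf qc).
rewrite exprS => /(gz_dom sJ Jq) [|/IHm//] [c qc Jc].
by exists (c * e); rewrite ?mevalM ?mulf_neq0 // -mulrA.
Qed.

(** A function e that is nonzero at q is invertible modulo m^N, by the geometric series; so r lies
    in J + m^N for all N and Krull's theorem applies. *)
Lemma gz_krull J q h r : smooth_ideal J -> isub J (maxid q) -> h.@[q] = 0 ->
  (forall m, exists e s, e.@[q] != 0 /\ J (e * r - h ^+ m * s)) -> gz J q r.
Proof.
move=> sJ Jq hq H; apply: gzP => N; have [e [s [qe Je]]] := H N.
have Mr : iadd J (ipow (maxid q) N) (e * r).
  exists (e * r - h ^+ N * s) => //; rewrite subKr; apply: idealMr.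
  exact: ipow_exp.
have [u Eu] : exists u, ipow (maxid q) N (1 - u * e).
  pose c := (e.@[q])^-1; pose m := 1 - c *: e.
  have Mm : maxid q m.
    by rewrite maxid_mem mevalB meval1 mevalZ mulVf // subrr.
  exists ((\sum_(i < N) m ^+ i) * c%:MP).
  rewrite -mulrA mul_mpolyC (_ : c *: e = 1 - m); last by rewrite subKr.
  suff -> : (\sum_(i < N) m ^+ i) * (1 - m) = 1 - m ^+ N by rewrite subKr; apply: ipow_exp.
  by rewrite mulrC -[1 - m]opprB mulNr -subrX1 opprB.
rewrite -(subrK (u * e * r) r) -{1}(mul1r r) -mulrBl; apply: idealD.
  by apply: iaddr; apply: idealMr.
by rewrite -mulrA; apply: idealM.
Qed.
End Local.

(** * Charts, k-points and regular germs *)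

Section LR.
Context (k : fieldType) (A B : comUnitAlgType k) (f : {lrmorphism A -> B}).
Lemma lrM a b : f (a * b) = f a * f b. Proof. exact: rmorphM. Qed.
Lemma lrD a b : f (a + b) = f a + f b. Proof. exact: rmorphD. Qed.
Lemma lrB a b : f (a - b) = f a - f b. Proof. exact: rmorphB. Qed.
Lemma lrX a n : f (a ^+ n) = f a ^+ n. Proof. exact: rmorphXn. Qed.
Lemma lr1 : f 1 = 1. Proof. exact: rmorph1. Qed.
Lemma lr0 : f 0 = 0. Proof. exact: rmorph0. Qed.
Lemma lr_sum n (F : 'I_n -> A) : f (\sum_i F i) = \sum_i f (F i).
Proof. exact: raddf_sum. Qed.
Lemma lrA (c : k) : f c%:A = c%:A.
Proof. by rewrite -[RHS](congr1 (fun z => c *: z) lr1); apply: linearZ. Qed.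
End LR.

Section Charts.
Context (k : closedFieldType) (X : kfunctor k).
Implicit Types (A B C D R : comUnitAlgType k).

Definition fn := kmap X (affine_line k).
Definition ev (E : fn) A (s : X A) : A := E A s.
Lemma evE (E : fn) A B (f : {lrmorphism A -> B}) s : ev E (fmap f s) = f (ev E s).
Proof. exact: (appE E f s). Qed.

(** The field [c_gen] makes charts of finite type over k, which is what gives access to the
    Nullstellensatz and to Noetherian arguments. *)
Record chart := Chart {
  cU : subfunctor X; cR : comUnitAlgType k; cu : X cR; cn : nat; cv : 'I_cn -> cR;
  c_open : affine_open cU cu;
  c_gen : forall r, exists p : {mpoly k[cn]}, mmap (GRing.in_alg cR) cv p = r }.

Arguments cU : clear implicits.
Arguments cu : clear implicits.
Definition pts := X k^o.
Definition kpoint (c : chart) := {lrmorphism cR c -> k^o}.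
Definition at_ (c : chart) (y : kpoint c) : pts := fmap y (cu c).

Definition near (q : pts) (Q : pts -> Prop) :=
  exists c (x : kpoint c) e, [/\ at_ x = q, x e != 0
    & forall y : kpoint c, y e != 0 -> Q (at_ y)].

Lemma at_inj (c : chart) (x y : kpoint c) : at_ x = at_ y -> x =1 y.
Proof. by case: (c_open c) => _ h _ /h. Qed.

Lemma chart_point (c : chart) A (s : X A) : cU c A s <-> exists f : {lrmorphism cR c -> A}, fmap f (cu c) = s.
Proof. by case: (c_open c) => _ _. Qed.

Lemma lr_eq A B (f : {lrmorphism A -> B}) (s : X A) (g : {lrmorphism A -> B}) :
  f =1 g -> fmap f s = fmap g s.
Proof.
move=> fg; have [i iE] := lr_id B.
rewrite (@fmap_comp _ X _ _ _ g i f s) => [|x /=]; last by rewrite iE fg.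
exact: fmap_id.
Qed.

Lemma unit_k (a : k^o) : (a \is a GRing.unit) = (a != 0). Proof. exact: unitfE. Qed.

Lemma is_field_k : is_field (k^o : comUnitAlgType k).
Proof. by move=> a; rewrite unit_k. Qed.

(** Openness of the chart yields elements of A generating the unit ideal of the field B; one of them
    is nonzero there, and inverting it moves the point into the chart. *)
Lemma local_chart (c : chart) A (s : X A) B (f : {lrmorphism A -> B}) :
  is_field B -> cU c B (fmap f s) ->
  exists a, [/\ f a != 0, forall m, a ^+ m != 0 & forall C (g : {lrmorphism A -> C}),
    g a \is a GRing.unit -> exists h : {lrmorphism cR c -> C}, fmap h (cu c) = fmap g s].
Proof.
move=> Bf Us; case: (c_open c) => /(_ A s) [I HI] _ _.
have /HI [n [b [a [Ia Sba]]]] := Us.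
have [i fai] : exists i, f (a i) != 0.
  apply: contrapT => h; have : (1 : B) = 0.
    rewrite -Sba big1 // => i _; case: (eqVneq (f (a i)) 0) => [->|ne]; rewrite ?mulr0 //.
    by case: h; exists i.
  by apply/eqP/oner_neq0.
exists (a i); split=> // [m|C g ga].
  apply/eqP => h; have := unitrX m (Bf _ fai).
  by rewrite -rmorphXn h rmorph0 unitr0.
apply/chart_point/HI; exists 1%N, (fun=> (g (a i))^-1), (fun=> a i).
by split=> //; rewrite big_ord1 mulVr.
Qed.

(** On a localization of the first chart at some a, the functions of the second become fractions
    whose denominators are powers of a. Two functions are treated together so that the numerator and
    denominator of a fraction are transported by the same point. *)
Lemma transfer (c c' : chart) (x : kpoint c) (x' : kpoint c') (r1 r2 : cR c') : at_ x = at_ x' ->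
  exists a s1 s2, x a != 0 /\ forall y : kpoint c, y a != 0 ->
    exists y' : kpoint c', [/\ at_ y' = at_ y, y' r1 * y a = y s1 & y' r2 * y a = y s2].
Proof.
move=> Exx'; have Ux : cU c' _ (fmap x (cu c)) by apply/chart_point; exists x'.
have [a [xa am ha]] := local_chart is_field_k Ux.
have [B [f [[fa fB _] fU]]] := localization am.
have [g Eg] := ha _ f fa.
have [s1 [n1 E1]] := fB (g r1); have [s2 [n2 E2]] := fB (g r2).
exists (a ^+ (n1 + n2).+1), (s1 * a ^+ n2.+1), (s2 * a ^+ n1.+1); split.
  by rewrite lrX expf_neq0.
move=> y ya; have ya0 : y a != 0.
  by apply: contraNneq ya => h; rewrite lrX h expr0n.
have [y1 y1E] := fU _ y (eq_ind_r is_true ya0 (unit_k _)).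
have [y' y'E] := lr_comp g y1; exists y'; split.
- rewrite /at_ (fmap_comp _ y'E) Eg -(@fmap_comp _ X _ _ _ f y1 y) //.
- rewrite y'E lrM !lrX -!y1E /= -E1 -addnS exprD lrM mulrA.
  by rewrite lrX.
- rewrite y'E lrM !lrX -!y1E /= -E2 addnC -addnS exprD lrM mulrA.
  by rewrite lrX.
Qed.

Lemma near_in (c : chart) (x : kpoint c) Q : near (at_ x) Q ->
  exists2 e, x e != 0 & forall y : kpoint c, y e != 0 -> Q (at_ y).
Proof.
case=> c' [x' [e' [E xe hQ]]].
have [a [s [s' [xa ha]]]] := transfer e' e' (esym E).
exists (a * s).
  have [y' [Ey Es _]] := ha _ xa.
  rewrite lrM mulf_neq0 // -Es mulf_neq0 //.
  by rewrite (at_inj (etrans Ey (esym E))).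
move=> y; rewrite lrM mulf_eq0 => /norP [/ha [y' [<- Es _]]].
by rewrite -Es mulf_eq0 => /norP [/hQ].
Qed.

Lemma nearI (c : chart) (x : kpoint c) e (Q : pts -> Prop) : x e != 0 ->
  (forall y : kpoint c, y e != 0 -> Q (at_ y)) -> near (at_ x) Q.
Proof. by move=> xe h; exists c, x, e. Qed.

Lemma near_chart q Q : near q Q -> exists c (x : kpoint c), at_ x = q.
Proof. by case=> c [x [e [h _ _]]]; exists c, x. Qed.

Lemma near_and q Q Q' : near q Q -> near q Q' -> near q (fun s => Q s /\ Q' s).
Proof.
move=> h; have [c [x Eq]] := near_chart h; rewrite -Eq in h * => h'.
have [e xe he] := near_in h; have [e' xe' he'] := near_in h'.
apply: (@nearI c x (e * e')); first by rewrite lrM mulf_neq0.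
by move=> y; rewrite lrM mulf_eq0 => /norP [/he ? /he' ?].
Qed.

Lemma near_sub q Q Q' : (forall s, Q s -> Q' s) -> near q Q -> near q Q'.
Proof. by move=> QQ [c [x [e [h xe he]]]]; exists c, x, e; split=> // y /he /QQ. Qed.

Lemma near_at q Q : near q Q -> Q q.
Proof. by case=> c [x [e [<- xe he]]]; apply: he. Qed.

Lemma near_near q Q : near q Q -> near q (near^~ Q).
Proof.
case=> c [x [e [<- xe he]]]; apply: (nearI xe) => y ye; exact: nearI ye he.
Qed.

Lemma lr_k (c : chart) (y : kpoint c) (a : k) : y a%:A = a.
Proof. by rewrite lrA; apply: mulr1. Qed.

Definition zeros (Z : fn -> Prop) A (s : X A) := forall E, Z E -> ev E s = 0.
(** On the zeros of Z near q, phi is the fraction r / e; values of phi off these zeros are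
    irrelevant. *)
Definition reg (Z : fn -> Prop) (q : pts) (phi : pts -> k) :=
  exists c (x : kpoint c) e r, [/\ at_ x = q, x e != 0
    & forall y : kpoint c, y e != 0 -> zeros Z (at_ y) -> phi (at_ y) * y e = y r].

Lemma reg_in Z (c : chart) (x : kpoint c) phi : reg Z (at_ x) phi ->
  exists e r, x e != 0 /\
    forall y : kpoint c, y e != 0 -> zeros Z (at_ y) -> phi (at_ y) * y e = y r.
Proof.
case=> c' [x' [e' [r' [E xe hQ]]]].
have [a [s1 [s2 [xa ha]]]] := transfer e' r' (esym E).
exists (a * s1), (a * s2); split.
  have [y' [Ey Es _]] := ha _ xa.
  rewrite lrM mulf_neq0 // -Es mulf_neq0 //.
  by rewrite (at_inj (etrans Ey (esym E))).
move=> y; rewrite lrM mulf_eq0 => /norP [ya]; have [y' [Ey E1 E2]] := ha _ ya.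
rewrite -{1}E1 mulf_eq0 => /norP [ye _] Zy; rewrite !lrM -E1 -E2 -Ey.
by rewrite -(hQ y' ye) ?Ey // mulrCA !mulrA.
Qed.

Lemma reg_ev Z q (E : fn) : near q (fun=> True) -> reg Z q (@ev E k^o).
Proof.
case=> c [x [e [<- xe _]]]; exists c, x, 1, (ev E (cu c)).
by rewrite (lr1 x) oner_neq0; split=> // y _ _; rewrite (lr1 y) mulr1 /at_ evE.
Qed.

Lemma reg_near Z q phi : reg Z q phi -> near q (fun=> True).
Proof. by case=> c [x [e [r [h xe _]]]]; exists c, x, e. Qed.

Lemma reg_cst Z q (a : k) : near q (fun=> True) -> reg Z q (fun=> a).
Proof.
case=> c [x [e [<- xe _]]]; exists c, x, 1, (a%:A).
by rewrite (lr1 x) oner_neq0; split=> // y _ _; rewrite (lr1 y) mulr1 lr_k.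
Qed.

Lemma reg_mul Z q phi psi : reg Z q phi -> reg Z q psi -> reg Z q (fun s => phi s * psi s).
Proof.
move=> h; have [c [x Eq]] := near_chart (reg_near h); rewrite -Eq in h * => h'.
have [e [r [xe he]]] := reg_in h; have [e' [r' [xe' he']]] := reg_in h'.
exists c, x, (e * e'), (r * r'); rewrite lrM mulf_neq0 //; split=> // y.
rewrite lrM mulf_eq0 => /norP [ye ye'] Zy.
by rewrite lrM mulrACA he // he'.
Qed.

Lemma reg_exp Z q phi n : reg Z q phi -> reg Z q (fun s => phi s ^+ n).
Proof.
move=> h; elim: n => [|n IHn]; first exact: reg_cst (reg_near h).
have := reg_mul h IHn; congr reg; apply/funext => s; by rewrite exprS.
Qed.

Lemma reg_eq Z q phi psi : near q (fun s => zeros Z s -> phi s = psi s) ->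
  reg Z q phi -> reg Z q psi.
Proof.
move=> h; have [c [x Eq]] := near_chart h; rewrite -Eq in h * => /reg_in [e [r [xe he]]].
have [e' xe' he'] := near_in h.
exists c, x, (e * e'), (r * e'); rewrite lrM mulf_neq0 //; split=> // y.
rewrite lrM mulf_eq0 => /norP [ye ye'] Zy.
by rewrite lrM mulrA -he' // he.
Qed.

Lemma reg_sub (Z Z' : fn -> Prop) q phi : (forall s : pts, zeros Z' s -> zeros Z s) ->
  reg Z q phi -> reg Z' q phi.
Proof.
move=> ZZ [c [x [e [r [h xe he]]]]]; exists c, x, e, r; split=> // y ye /ZZ; exact: he.
Qed.

Lemma reg_inv Z q phi : reg Z q phi -> (zeros Z q -> phi q != 0) -> zeros Z q -> reg Z q (fun s => (phi s)^-1).
Proof.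
move=> h; have [c [x Eq]] := near_chart (reg_near h); rewrite -Eq in h * => pq Zq.
have [e [r [xe he]]] := reg_in h.
have xr : x r != 0 by rewrite -he // mulf_neq0 // pq.
exists c, x, (r * e), (e * e); rewrite lrM mulf_neq0 //; split=> // y.
rewrite lrM mulf_eq0 => /norP [yr ye] Zy; rewrite -he // lrM mulrA mulKf //.
by apply: contraNneq yr => p0; rewrite -he // p0 mul0r.
Qed.

Lemma reg_neq0 Z q phi : reg Z q phi -> zeros Z q -> phi q != 0 ->
  near q (fun s => zeros Z s -> phi s != 0).
Proof.
move=> h; have [c [x Eq]] := near_chart (reg_near h); rewrite -Eq in h * => Zq pq.
have [e [r [xe he]]] := reg_in h.
apply: (@nearI c x (r * e)); first by rewrite lrM mulf_neq0 // -he // mulf_neq0.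
move=> y; rewrite lrM mulf_eq0 => /norP [yr ye] Zy.
by apply: contraNneq yr => p0; rewrite -he // p0 mul0r.
Qed.

(** A k-point of X has at most one lift to the chart, so the fraction is well defined where e is
    nonzero; elsewhere the value is arbitrary. *)
Lemma reg_make (c : chart) (e r : cR c) : exists phi : pts -> k,
  forall y : kpoint c, y e != 0 -> phi (at_ y) * y e = y r.
Proof.
exists (fun s => xget 0 (fun a : k => forall y : kpoint c, at_ y = s -> y e != 0 -> a * y e = y r)).
move=> y ye; case: xgetP => [a _ ->//|h]; case: (h (y r / y e)) => z /at_inj zy _.
by rewrite !zy divfK.
Qed.
End Charts.
Arguments cU {k X} c A _.
Arguments cu {k X} c.

Lemma igen_sub (T : comNzRingType) (S : T -> Prop) (I : ideal T) :
  (forall y, S y -> I y) -> isub (igen S) I.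
Proof. by move=> SI x; apply. Qed.

Section SmoothSets.
Context (k : closedFieldType) (X : kfunctor k).
Implicit Types (A B C D R : comUnitAlgType k) (c : chart X) (Z : fn X -> Prop) (h : fn X).

Lemma gam_sig c : {f : {rmorphism {mpoly k[cn c]} -> cR c} |
  (forall a, f a%:MP = a%:A) /\ forall r, exists p, f p = r}.
Proof.
apply: cid; have [f [fE fC _]] := mmapP (GRing.in_alg (cR c)) (@cv _ _ c).
by exists f; split=> // r; have [p <-] := c_gen r; exists p.
Qed.
Definition gam c := sval (gam_sig c).
Lemma gamC c a : gam c a%:MP = a%:A. Proof. by case: (svalP (gam_sig c)). Qed.
Lemma gam_surj c r : exists p, gam c p = r. Proof. by case: (svalP (gam_sig c)). Qed.
Opaque gam.

Definition coords c (y : kpoint c) : 'I_(cn c) -> k := fun i => y (gam c 'X_i).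
Lemma coordsE c (y : kpoint c) p : y (gam c p) = p.@[coords y].
Proof.
have [f fE] : exists f : {rmorphism {mpoly k[cn c]} -> k}, f =1 y \o gam c.
  apply: (@pack_rmorphism {mpoly k[cn c]} k (y \o gam c)) => [|a b|a b] /=.
  - by rewrite rmorph1 lr1.
  - by rewrite rmorphB lrB.
  - by rewrite rmorphM lrM.
have := point_of (f := f) _ p; rewrite fE /= => ->.
  by congr (meval _ _); apply/funext => i; rewrite fE.
by move=> a; rewrite fE /= gamC lr_k.
Qed.

Definition eqs c Z : ideal (cR c) := igen (fun r => exists2 E, Z E & r = ev E (cu c)).
Definition pideal c Z := ipre (gam c) (eqs c Z).

Lemma pidealE c Z p : pideal c Z p <-> eqs c Z (gam c p). Proof. by []. Qed.

Lemma eqs_map c Z A (f : {lrmorphism cR c -> A}) r : zeros Z (fmap f (cu c)) -> eqs c Z r -> f r = 0.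
Proof.
move=> Zf; apply: (@igen_sub _ _ (iker (f : {rmorphism cR c -> A}))) => _ [E ZE ->] /=.
by rewrite -evE Zf.
Qed.

Lemma zeros_map Z A B (f : {lrmorphism A -> B}) (s : X A) : zeros Z s -> zeros Z (fmap f s).
Proof. by move=> Zs E ZE; rewrite evE Zs // lr0. Qed.

Lemma pideal_pt c Z (y : kpoint c) : zeros Z (at_ y) <-> isub (pideal c Z) (maxid (coords y)).
Proof.
split=> [Zy p Jp|JZ E ZE].
  by rewrite maxid_mem -coordsE; apply: (eqs_map Zy).
have [p Ep] := gam_surj (ev E (cu c)).
rewrite /at_ evE -Ep coordsE; apply/JZ/pidealE; rewrite Ep; apply: igen_mem.
by exists E.
Qed.

Lemma point_at c Z q : isub (pideal c Z) (maxid q) -> exists2 y : kpoint c,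
  zeros Z (at_ y) & forall p, y (gam c p) = p.@[q].
Proof.
move=> JZ.
have [|||y yE] := @lr_factor k _ (cR c) k^o (@mpolyC (cn c) k) (gam c) (meval q) (@gam_surj c).
- by move=> t t0; apply/JZ/pidealE; rewrite t0; apply: ideal0.
- exact: gamC.
- by move=> a /=; rewrite mevalC; apply/esym/mulr1.
exists y => [|p]; last exact: yE.
move=> E ZE; have [p Ep] := gam_surj (ev E (cu c)).
rewrite /at_ evE -Ep yE; apply/JZ/pidealE; rewrite Ep; apply: igen_mem.
by exists E.
Qed.

Definition smooth_set Z := forall C D (s : {lrmorphism C -> D}) (x : X D),
  square_zero_quotient s -> zeros Z x -> exists2 x' : X C, zeros Z x' & fmap s x' = x.

(** Membership in an open set is a relation sum b_i a_i = 1; lifting the b_i gives a sum that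
    reduces to 1, hence a unit. *)
Lemma chart_lift c C D (s : {lrmorphism C -> D}) (x : X C) :
  (forall a, s a \is a GRing.unit -> a \is a GRing.unit) -> (forall d, exists a, s a = d) ->
  cU c D (fmap s x) -> cU c C x.
Proof.
move=> su ss; have [op _ _] := c_open c; have [I HI] := op C x.
case/HI => n [b [a [Ia Sba]]].
have [b' Eb'] := choice (fun i => ss (b i)).
have u1 : \sum_i b' i * a i \is a GRing.unit.
  apply: su; rewrite lr_sum (_ : \sum_i _ = 1) ?unitr1 // -Sba.
  by apply: eq_bigr => i _; rewrite lrM Eb'.
have [f fE] := lr_id C; rewrite -(fmap_id x fE); apply/HI.
exists n, (fun i => (\sum_i b' i * a i)^-1 * b' i), a; split=> //.
rewrite -[RHS](mulVr u1) mulr_sumr; apply: eq_bigr => i _; rewrite fE mulrA //.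
Qed.

Lemma square_zero_unit C D (s : {lrmorphism C -> D}) : square_zero_quotient s ->
  forall a, s a \is a GRing.unit -> a \is a GRing.unit.
Proof.
case=> ss s0 a /unitrPr [d Ed]; have [b Eb] := ss d; rewrite -Eb in Ed.
have z : s (a * b - 1) = 0 by rewrite lrB lrM Ed lr1 subrr.
have E := s0 _ _ z z; set d' := a * b - 1 in E.
have ab : a * b = d' + 1 by rewrite subrK.
apply/unitrPr; exists (b * (1 - d')).
by rewrite mulrA ab mulrBr mulr1 mulrDl mul1r E add0r addrAC subrr add0r.
Qed.

(** Infinitesimal lifting is applied to the tautological point with values in P/J along P/J^2 ->
    P/J. *)
Lemma smooth_chart c Z (x : kpoint c) : smooth_set Z -> zeros Z (at_ x) ->
  smooth_ideal (pideal c Z).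
Proof.
move=> sZ Zx; set J := pideal c Z; have Jx := (pideal_pt Z x).1 Zx.
have J1 : ~ J 1 by move/Jx; rewrite maxid_mem meval1; apply/eqP/oner_neq0.
have J21 : ~ ipow J 2 1 by move/(ipow_leq (isT : (1 <= 2)%N))/ipow1E.
have [D [p [ps p0 pC]]] := quotient_alg (@mpolyC (cn c) k) J1.
have [C [r [rs r0 rC]]] := quotient_alg (@mpolyC (cn c) k) J21.
have [|s sE] := lr_factor (g := p) rs _ rC pC.
  by move=> t /r0 Jt; apply/p0/ipow1E; apply: ipow_leq Jt.
have [|d dE] := lr_factor (g := p) (@gam_surj c) _ (@gamC c) pC.
  by move=> t t0; apply/p0/pidealE; rewrite t0; apply: ideal0.
have sqs : square_zero_quotient s.
  split=> [u|a b]; first by have [t <-] := ps u; exists (r t); rewrite sE.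
  have [t <-] := rs a; have [t' <-] := rs b; rewrite !sE => /p0 Jt /p0 Jt'.
  by rewrite -rmorphM; apply/r0; apply: (ipow_mul (m := 1) (n := 1)); apply: ipow1.
have Zd : zeros Z (fmap d (cu c)).
  move=> E ZE; rewrite evE; have [t Et] := gam_surj (ev E (cu c)).
  by rewrite -Et dE; apply/p0/pidealE; rewrite Et; apply: igen_mem; exists E.
have [x' Zx' Ex'] := sZ _ _ s _ sqs Zd.
have Ux' : cU c C x'.
  apply: (chart_lift (s := s)); first exact: square_zero_unit.
    by case: sqs.
  by rewrite Ex'; apply/chart_point; exists d.
have [g Eg] := (chart_point c x').1 Ux'.
have sg : s \o g =1 d.
  have [_ inj _] := c_open c; apply: inj; rewrite -Ex' -Eg; exact: fmap_comp.
have [v Ev] := choice (fun i => rs (g (gam c 'X_i))).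
have [t [_ tC tX]] := mmapP (@mpolyC (cn c) k) v.
have rt q : r (t q) = g (gam c q).
  have [g' g'E] : exists g' : {rmorphism cR c -> C}, g' =1 g by exists (g : {rmorphism cR c -> C}).
  rewrite -g'E -[LHS]/((r \o t) q) -[RHS]/((g' \o gam c) q).
  apply: mpoly_rmorph_eq => [a|i] /=; rewrite ?tX ?tC ?Ev g'E //.
  by rewrite gamC lrA rC.
exists t; split=> [//|q|q Jq].
  by apply/p0; rewrite rmorphB -sE rt -[s _]/((s \o g) _) sg dE subrr.
by apply/r0; rewrite rt; apply: (eqs_map (Z := Z)) => //; rewrite Eg.
Qed.

Definition zg Z q (phi : pts X -> k) := near q (fun s => zeros Z s -> phi s = 0).

Lemma chart_nullst c Z (x : kpoint c) r : smooth_set Z -> zeros Z (at_ x) ->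
  (exists2 e, x e != 0 & forall y : kpoint c, y e != 0 -> zeros Z (at_ y) -> y r = 0) ->
  exists2 e, x e != 0 & eqs c Z (e * r).
Proof.
move=> sZ Zx [e xe he]; have [p Ep] := gam_surj r; have [u Eu] := gam_surj e.
have [|w qw Jw] := @gz_nullst k _ (pideal c Z) (coords x) p (smooth_chart sZ Zx) ((pideal_pt Z x).1 Zx).
  exists u; first by rewrite -coordsE Eu.
  move=> q /point_at [y Zy yE] qu; rewrite -yE Ep; apply: he => //.
  by rewrite -Eu yE.
exists (gam c w); first by rewrite coordsE.
by move/pidealE: Jw; rewrite rmorphM Ep.
Qed.

Lemma chart_dom c Z (x : kpoint c) r1 r2 : smooth_set Z -> zeros Z (at_ x) ->
  (exists2 e, x e != 0 & eqs c Z (e * (r1 * r2))) ->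
  (exists2 e, x e != 0 & eqs c Z (e * r1)) \/ (exists2 e, x e != 0 & eqs c Z (e * r2)).
Proof.
move=> sZ Zx [e xe he]; have [p1 E1] := gam_surj r1; have [p2 E2] := gam_surj r2.
have [u Eu] := gam_surj e.
have [|[w qw Jw]|[w qw Jw]] := @gz_dom k _ (pideal c Z) (coords x) p1 p2 (smooth_chart sZ Zx) ((pideal_pt Z x).1 Zx).
- by exists u; [rewrite -coordsE Eu|apply/pidealE; rewrite !rmorphM Eu E1 E2].
- by left; exists (gam c w); [rewrite coordsE|move/pidealE: Jw; rewrite rmorphM E1].
- by right; exists (gam c w); [rewrite coordsE|move/pidealE: Jw; rewrite rmorphM E2].
Qed.

Lemma zg_in c Z (x : kpoint c) phi e r : x e != 0 ->
  (forall y : kpoint c, y e != 0 -> zeros Z (at_ y) -> phi (at_ y) * y e = y r) ->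
  zg Z (at_ x) phi <-> exists2 u, x u != 0 & forall y : kpoint c, y u != 0 -> zeros Z (at_ y) -> y r = 0.
Proof.
move=> xe he; split=> [/near_in [u xu hu]|[u xu hu]].
  exists (e * u) => [|y]; [by rewrite lrM mulf_neq0|rewrite lrM mulf_eq0 => /norP [ye yu] Zy].
  by rewrite -he // hu // mul0r.
apply: (@nearI _ _ c x (e * u)) => [|y]; [by rewrite lrM mulf_neq0|rewrite lrM mulf_eq0 => /norP [ye yu] Zy].
by apply: (mulIf ye); rewrite he // mul0r; apply: hu.
Qed.

Lemma eqs_germ c Z (x : kpoint c) r : (exists2 e, x e != 0 & eqs c Z (e * r)) ->
  exists2 e, x e != 0 & forall y : kpoint c, y e != 0 -> zeros Z (at_ y) -> y r = 0.
Proof.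
case=> e xe he; exists e => // y ye Zy; apply: (mulfI ye).
by rewrite -lrM mulr0; apply: (eqs_map Zy).
Qed.

Lemma zg_dom Z q phi psi : smooth_set Z -> zeros Z q -> reg Z q phi -> reg Z q psi ->
  zg Z q (fun s => phi s * psi s) -> zg Z q phi \/ zg Z q psi.
Proof.
move=> sZ Zq h; have [c [x Eq]] := near_chart (reg_near h); rewrite -Eq in h Zq * => h' H.
have [e [r [xe he]]] := reg_in h; have [e' [r' [xe' he']]] := reg_in h'.
have xee : x (e * e') != 0 by rewrite lrM mulf_neq0.
have := (zg_in (r := r * r') xee _).1 H; case=> [y|u xu hu].
  rewrite lrM mulf_eq0 => /norP [ye ye'] Zy; by rewrite lrM mulrACA he // he'.
have := chart_dom (r1 := r) (r2 := r') sZ Zq; case.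
- by apply: chart_nullst => //; exists u.
- by move/eqs_germ => h1; left; apply/(zg_in xe he).
- by move/eqs_germ => h1; right; apply/(zg_in xe' he').
Qed.

Definition addeq Z h : fn X -> Prop := fun E => Z E \/ E = h.

Lemma zeros_add Z h A (s : X A) : zeros (addeq Z h) s <-> zeros Z s /\ ev h s = 0.
Proof.
split=> [H|[Zs hs] E [/Zs//|->//]].
by split=> [E ZE|]; apply: H; [left|right].
Qed.

(** Since Z with h = 0 is smooth, a function vanishing at its k-points near q lies, up to a factor
    invertible at q, in the ideal generated by the equations of Z and h; the coefficient of h is the
    quotient. *)
Lemma zg_div Z h q phi : smooth_set (addeq Z h) -> zeros (addeq Z h) q ->
  reg Z q phi -> zg (addeq Z h) q phi ->
  exists2 psi, reg Z q psi & near q (fun s => zeros Z s -> phi s = ev h s * psi s).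
Proof.
move=> sZ Zq rp; have [c [x Eq]] := near_chart (reg_near rp); rewrite -Eq in rp Zq * => H.
have [e [r [xe he]]] := reg_in rp.
have he2 (y : kpoint c) : y e != 0 -> zeros (addeq Z h) (at_ y) -> phi (at_ y) * y e = y r.
  by move=> ye /zeros_add [Zy _]; apply: he.
have [u xu Ju] := chart_nullst sZ Zq ((zg_in xe he2).1 H).
have [i Zi [a Ea]] : iadd (eqs c Z) (iprinc (ev h (cu c))) (u * r).
  apply: igen_sub Ju => _ [E [ZE|->] ->]; last exact/iaddr/iprinc_mem.
  by apply/iaddl/igen_mem; exists E.
have [psi hpsi] := reg_make (u * e) a.
exists psi.
  exists c, x, (u * e), a; rewrite lrM mulf_neq0 //; split=> // y yue _; exact: hpsi.
apply: (@nearI _ _ c x (u * e)) => [|y yue Zy]; first by rewrite lrM mulf_neq0.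
apply: (mulIf yue); rewrite -mulrA hpsi // lrM mulrCA.
have [yu ye] : y u != 0 /\ y e != 0 by move: yue; rewrite lrM mulf_eq0 => /norP.
rewrite he // -lrM -(subrK i (u * r)) Ea lrD (eqs_map Zy Zi) addr0 lrM /at_ evE mulrC //.
Qed.

Lemma zg_krull Z h q phi : smooth_set Z -> zeros Z q -> ev h q = 0 -> reg Z q phi ->
  (forall m, exists2 psi, reg Z q psi & near q (fun s => zeros Z s -> phi s = ev h s ^+ m * psi s)) ->
  zg Z q phi.
Proof.
move=> sZ Zq hq rp; have [c [x Eq]] := near_chart (reg_near rp); rewrite -Eq in rp Zq hq * => H.
have [e [r [xe he]]] := reg_in rp; apply/(zg_in xe he)/eqs_germ.
have [p Ep] := gam_surj r; have [ph Eph] := gam_surj (ev h (cu c)).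
have [||w qw Jw] := @gz_krull k _ (pideal c Z) (coords x) ph p (smooth_chart sZ Zq) ((pideal_pt Z x).1 Zq).
- by rewrite -coordsE Eph -evE.
- move=> m; have [psi /reg_in [e' [r' [xe' he']]] /near_in [u xu hu]] := H m.
  have [w xw Jw] : exists2 w, x w != 0 & eqs c Z (w * (e' * r - ev h (cu c) ^+ m * (e * r'))).
    apply: chart_nullst => //; exists (e * e' * u); first by rewrite !lrM !mulf_neq0.
    move=> y; rewrite !lrM !mulf_eq0 => /norP [/norP [ye ye'] yu] Zy.
    rewrite lrB !lrM lrX -he // -he' // hu //.
    rewrite -!evE; set a1 := y e; set a2 := y e'; set a3 := psi _; set a4 := ev h _.
    by move: a1 a2 a3 a4; rewrite /= => a1 a2 a3 a4; ring.
  have [pw Epw] := gam_surj (w * e'); have [ps Eps] := gam_surj (w * (e * r')).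
  exists pw, ps; split; first by rewrite -coordsE Epw lrM mulf_neq0.
  apply/pidealE; rewrite rmorphB !rmorphM rmorphXn Epw Eps Eph Ep.
  by rewrite -mulrA [_ ^+ m * _]mulrCA -mulrBr.
- exists (gam c w); first by rewrite coordsE.
  by move/pidealE: Jw; rewrite rmorphM Ep.
Qed.

(** Passes from k-points to points with values in a local algebra over q, so that a tangent vector
    can detect that a germ is nonzero. *)
Lemma zg_point Z q h C (p : {lrmorphism C -> k^o}) (s : X C) :
  smooth_set Z -> zg Z q (@ev _ _ h k^o) -> zeros Z s -> fmap p s = q ->
  (forall a, p a != 0 -> a \is a GRing.unit) -> ev h s = 0.
Proof.
move=> sZ H Zs Eq pu; have [c [x Ex]] := near_chart H; rewrite -Ex in H Eq.
have Zx : zeros Z (at_ x) by rewrite -Eq; apply: zeros_map.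
have [e xe he] : exists2 e, x e != 0 & eqs c Z (e * ev h (cu c)).
  apply: chart_nullst => //; have [u xu hu] := near_in H.
  by exists u => // y yu Zy; rewrite -evE; apply: hu.
have Us : cU c C s.
  apply: (chart_lift (s := p)); first by move=> a; rewrite unit_k; apply: pu.
    by move=> d; exists (d%:A); rewrite lrA; apply: mulr1.
  by rewrite Eq; apply/chart_point; exists x.
have [f Ef] := (chart_point c s).1 Us.
have fe : f e \is a GRing.unit.
  apply: pu; rewrite -[p (f e)]/((p \o f) e).
  suff <- : x e = (p \o f) e by [].
  have [_ inj _] := c_open c; apply: (inj _ x (p \o f)).
  by rewrite -[LHS]/(at_ x) -Eq -Ef; apply/esym/fmap_comp.
apply: (mulrI fe); rewrite mulr0 -Ef evE -lrM; apply: (eqs_map _ he).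
by rewrite Ef.
Qed.
End SmoothSets.

(** * Global functions from regular germs *)

Lemma prime_unit (T : comNzRingType) (I : ideal T) :
  (forall P : ideal T, prime_ideal P -> isub I P -> False) -> I 1.
Proof.
move=> h; apply: contrapT => I1.
have [| |P [pP IP _]] := @prime_avoid T (fun x => x = 1) I; last exact: h pP IP.
  by split=> // x y -> ->; rewrite mulr1.
by move=> x ->.
Qed.

Definition ann (T : comNzRingType) (x : T) : ideal T.
Proof.
refine (@Ideal T (fun b => b * x = 0) (mul0r x) _ _) => [a b ha hb|a b hb].
- by rewrite mulrDl ha hb addr0.
- by rewrite -mulrA hb mulr0.
Defined.

Definition fin_ideal (T : comNzRingType) (S : T -> Prop) : ideal T.
Proof.
refine (@Ideal T (fun x => exists n (c b : 'I_n -> T),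
  (forall i, S (b i)) /\ x = \sum_i c i * b i) _ _ _).
- by exists 0%N, (fun=> 0), (fun=> 0); rewrite big_ord0; split=> // -[].
- move=> y z [n [c [b [Sb ->]]]] [m [d [e [Se ->]]]].
  exists (n + m)%N, (fun i => match split i with inl j => c j | inr j => d j end),
    (fun i => match split i with inl j => b j | inr j => e j end).
  split=> [i|]; first by case: split.
  rewrite big_split_ord /=; congr (_ + _); apply: eq_bigr => i _.
    by rewrite (unsplitK (inl i)).
  by rewrite (unsplitK (inr i)).
- move=> a y [n [c [b [Sb ->]]]]; exists n, (fun i => a * c i), b; split=> //.
  by rewrite mulr_sumr; apply: eq_bigr => i _; rewrite mulrA.
Defined.

Lemma igen_fin (T : comNzRingType) (S : T -> Prop) x : igen S x ->
  exists n (c b : 'I_n -> T), (forall i, S (b i)) /\ x = \sum_i c i * b i.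
Proof.
move=> h; apply: (h (fin_ideal S)) => y Sy.
by exists 1%N, (fun=> 1), (fun=> y); rewrite big_ord1 mul1r.
Qed.

Lemma unitrM_imp (A : comUnitRingType) (a b : A) :
  a \is a GRing.unit -> b \is a GRing.unit -> a * b \is a GRing.unit.
Proof. by rewrite unitrM => -> ->. Qed.

Section LRUnit.
Context (k : fieldType) (A B : comUnitAlgType k) (f : {lrmorphism A -> B}).
Lemma lr_unit a : a \is a GRing.unit -> f a \is a GRing.unit. Proof. exact: rmorph_unit. Qed.
Lemma lrV a : a \is a GRing.unit -> f a^-1 = (f a)^-1. Proof. exact: rmorphV. Qed.
End LRUnit.

Section Functions.
Context (k : closedFieldType) (X : kfunctor k).
Implicit Types (A B C D R K : comUnitAlgType k) (c : chart X) (Z : fn X -> Prop).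

Section Glue.
Context (Zs : forall A, X A -> Prop) (Val : forall A, X A -> A -> Prop).
Context (Zs_map : forall A B (g : {lrmorphism A -> B}) (s : X A), Zs s -> Zs (fmap g s)).
Context (Val_fun : forall A (s : X A) v w, Zs s -> Val s v -> Val s w -> v = w).
Context (Val_map : forall A B (g : {lrmorphism A -> B}) (s : X A) v,
  Val s v -> Val (fmap g s) (g v)).
Context (Val_loc : forall A (s : X A) K (f : {lrmorphism A -> K}), is_field K -> Zs s ->
  exists a, f a != 0 /\ forall B (g : {lrmorphism A -> B}), is_localization a g ->
    exists v, Val (fmap g s) v).

Let char A (s : X A) (a : A) := forall B (g : {lrmorphism A -> B}) v,
  Val (fmap g s) v -> g a = v.
Let good A (s : X A) (b al : A) := forall B (g : {lrmorphism A -> B}),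
  g b \is a GRing.unit -> Val (fmap g s) (g al / g b).

Lemma good_cover A (s : X A) : Zs s -> igen (fun b => exists al, good s b al) 1.
Proof.
move=> Zss; apply: prime_unit => P pP SP.
have [K [f [Kf f0]]] := residue_field pP.
have [a [fa ha]] := Val_loc f Kf Zss.
have am m : a ^+ m != 0.
  apply/eqP => am; have := unitrX m (Kf _ fa).
  by rewrite -lrX am lr0 unitr0.
have [B [g [lg gU]]] := localization am.
have [ga gB _] := lg; have [v Vv] := ha B g lg.
have [al [n En]] := gB v.
(* The exponent n + 1 instead of n: inverting this power inverts a even when n = 0. *)
have : P (a ^+ n.+1).
  apply/SP/igen_mem; exists (al * a) => B' g' ub.
  have ua : g' a \is a GRing.unit by move: ub; rewrite lrX unitrX_pos.
  have [h hE] := gU _ g' ua.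
  have -> : fmap g' s = fmap h (fmap g s) by apply: fmap_comp => z; rewrite /= -hE.
  have h' z : g' z = h (g z) by rewrite -hE.
  have -> : g' (al * a) / g' (a ^+ n.+1) = h v; last exact: Val_map.
  apply: (canLR (mulrK ub)); rewrite !h' -lrM; congr (h _).
  by rewrite lrM -En -mulrA lrX exprSr.
by move/(prime_exp pP)/f0/eqP; apply/negP.
Qed.

Lemma nilp_ann A (b x : A) : (forall B (g : {lrmorphism A -> B}), is_localization b g -> g x = 0) ->
  exists n, b ^+ n * x = 0.
Proof.
move=> h; have [bn|bn] := pselect (forall n, b ^+ n != 0).
  have [B [g [lg _]]] := localization bn; have [_ _ g0] := lg.
  by have [n xn] := g0 _ (h _ _ lg); exists n; rewrite mulrC.
by apply: contrapT => hn; apply: bn => n; apply/eqP => bn; apply: hn; exists n; rewrite bn mul0r.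
Qed.

(** The sheaf property of A itself. The value is al_i / b_i where b_i is invertible; raising to a
    common power M makes these fractions compatible in A, and a partition of unity in the b_i^(M+1)
    glues them. *)
Lemma glue_char A (s : X A) : Zs s -> exists a, char s a.
Proof.
move=> Zss; have [n [c [b [gb E1]]]] := igen_fin (good_cover Zss).
have [al hal] := choice gb.
have comp ij : exists N, (b ij.1 * b ij.2) ^+ N * (b ij.2 * al ij.1 - b ij.1 * al ij.2) = 0.
  apply: nilp_ann => B g [ub _ _]; case: ij ub => i j /=.
  rewrite lrM unitrM => /andP [ui uj].
  have := Val_fun (Zs_map g Zss) (hal i _ g ui) (hal j _ g uj) => E.
  rewrite lrB !lrM -[g (al i)](divrK ui) E.
  by rewrite -[g (al j)](divrK uj) !mulrA mulrK //; ring.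
have [N hN] := choice comp; pose M := \max_(ij : 'I_n * 'I_n) N ij.
have {}comp i j : b j ^+ M.+1 * (al i * b i ^+ M) = b i ^+ M.+1 * (al j * b j ^+ M).
  have NM : (N (i, j) <= M)%N by apply: leq_bigmax.
  have := hN (i, j); rewrite /= => h0.
  apply/eqP; rewrite -subr_eq0; apply/eqP.
  transitivity ((b i * b j) ^+ (M - N (i, j)) * ((b i * b j) ^+ N (i, j) * (b j * al i - b i * al j))).
    rewrite mulrA -exprD subnK // exprMn !exprS; ring.
  by rewrite h0 mulr0.
have cov : igen (fun x => exists i, x = b i ^+ M.+1) 1.
  apply: prime_unit => P pP SP; case: (pP) => P1 _; apply: P1.
  rewrite E1; apply: ideal_sum => i _; apply: idealM.
  by apply: (prime_exp (n := M.+1) pP); apply/SP/igen_mem; exists i.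
have [m [d [e [he Ee]]]] := igen_fin cov.
have [ix hix] := choice he.
pose a := \sum_i d i * (al (ix i) * b (ix i) ^+ M).
have ha j : b j ^+ M.+1 * a = al j * b j ^+ M.
  rewrite /a mulr_sumr -[RHS]mul1r Ee mulr_suml; apply: eq_bigr => i _.
  by rewrite hix -[RHS]mulrA -(comp _ j) mulrCA.
exists a => B g v Vv; apply/eqP; rewrite -subr_eq0; apply/eqP.
suff : ann (g a - v) 1 by rewrite /ann /= mul1r.
apply: prime_unit => P pP SP.
have Pb j : P (g (b j)).
  have [q hq] : exists q, g (b j) ^+ q * (g (b j) * v - g (al j)) = 0.
    apply: nilp_ann => C h [ub _ _].
    have [l lE] := lr_comp g h.
    have := hal j _ l; rewrite lE /= => /(_ ub) Vl.
    have Eg : fmap l s = fmap h (fmap g s) by apply: fmap_comp.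
    rewrite Eg in Vl; have := Val_fun (Zs_map h (Zs_map g Zss)) (Val_map h Vv) Vl => E.
    rewrite lrB lrM E mulrC divrK // lE subrr //.
  apply: (prime_exp (n := q + M.+1) pP); apply: SP; rewrite /ann /= mulrBr.
  rewrite exprD -!mulrA -!lrX -lrM ha lrM !lrX exprSr.
  move/eqP: hq; rewrite mulrBr subr_eq0 => /eqP hq.
  rewrite [X in X - _](_ : _ = g (b j) ^+ M * (g (b j) ^+ q * g (al j))); last by ring.
  by rewrite -hq; ring.
case: (pP) => P1 _; apply: P1; rewrite -(lr1 g) E1 lr_sum; apply: ideal_sum => i _.
by rewrite lrM; apply: idealM.
Qed.

Lemma char_uniq A (s : X A) a a' : Zs s -> char s a -> char s a' -> a = a'.
Proof.
move=> Zss ca ca'; apply/eqP; rewrite -subr_eq0; apply/eqP.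
suff : ann (a - a') 1 by rewrite /ann /= mul1r.
apply: prime_unit => P pP SP; have [K [f [Kf f0]]] := residue_field pP.
have [b [fb hb]] := Val_loc f Kf Zss.
have [n hn] : exists n, b ^+ n * (a - a') = 0.
  apply: nilp_ann => B g lg; have [v Vv] := hb B g lg.
  by rewrite lrB (ca _ _ _ Vv) (ca' _ _ _ Vv) subrr.
by move/negP: fb; apply; apply/eqP/f0/(prime_exp (n := n) pP)/SP.
Qed.

Lemma glue : exists h : forall A, X A -> A,
  (forall A B (g : {lrmorphism A -> B}) (s : X A), Zs s -> h B (fmap g s) = g (h A s)) /\
  forall A (s : X A) v, Zs s -> Val s v -> h A s = v.
Proof.
exists (fun A s => xget 0 (char s)).
have hc A (s : X A) : Zs s -> char s (xget 0 (char s)).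
  by move=> /glue_char [a ca]; case: xgetP => // /(_ a).
split=> [A B g s Zss|A s v Zss Vv].
  apply: (char_uniq (Zs_map g Zss)); first exact/hc/Zs_map.
  move=> C l v; have [l' l'E] := lr_comp g l.
  by rewrite -(@fmap_comp _ X _ _ _ g l l') // => /(hc _ _ Zss); rewrite l'E.
have [i iE] := lr_id A; have := hc _ _ Zss _ i v; rewrite iE (fmap_id s iE).
exact.
Qed.
End Glue.

Context (Z : fn X -> Prop).
Context (sZ : smooth_set Z).
Context (cov : forall K (s : X K), is_field K -> exists c, cU c K s).

(** A prime containing the colon ideal (J : p) would have a k-point above it; there the local
    Nullstellensatz gives an e, nonzero at the point, with e p in J, so that e belongs to the colon
    ideal. *)
Lemma chart_dens c r : (forall y : kpoint c, zeros Z (at_ y) -> y r = 0) -> eqs c Z r.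
Proof.
move=> h; have [p Ep] := gam_surj r.
suff h1 : pideal c Z (p * 1) by move/pidealE: h1; rewrite mulr1 Ep.
change (icolon (pideal c Z) p 1).
apply: prime_unit => P pP JP.
have [|f [fC fP _]] := jacobson_mpoly pP (b := 1); first by case: pP.
have fE := point_of fC.
have [y Zy yE] : exists2 y : kpoint c, zeros Z (at_ y) & forall p, y (gam c p) = p.@[fun i => f 'X_i].
  apply: point_at => q Jq; rewrite maxid_mem -fE; apply/fP/JP.
  exact: (@idealM _ (pideal c Z) p q Jq).
have [|e ye Je] := @chart_nullst _ _ c Z y r sZ Zy.
  by exists 1; rewrite ?lr1 ?oner_neq0 // => z _ /h.
have [u Eu] := gam_surj e; case/negP: ye; rewrite -Eu yE -fE; apply/eqP/fP/JP.
by change (pideal c Z (p * u)); apply/pidealE; rewrite mulrC rmorphM Eu Ep.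
Qed.

Definition natural_on (h : forall A, X A -> A) :=
  forall A B (g : {lrmorphism A -> B}) (s : X A), zeros Z s -> h B (fmap g s) = g (h A s).

Lemma universal_zero c : ~ eqs c Z 1 -> exists D (d : {lrmorphism cR c -> D}),
  [/\ forall u, exists r, d r = u, forall r, d r = 0 <-> eqs c Z r,
   zeros Z (fmap d (cu c)) & forall A (f : {lrmorphism cR c -> A}), zeros Z (fmap f (cu c)) ->
     exists g : {lrmorphism D -> A}, forall r, g (d r) = f r].
Proof.
move=> nz; have [D [d' [ds d0 dC]]] := quotient_alg (GRing.in_alg (cR c) : {rmorphism k -> cR c}) nz.
have [d dE] := lr_of dC.
exists D, d; split.
- by move=> u; have [r <-] := ds u; exists r; rewrite dE.
- by move=> r; rewrite dE.
- by move=> E ZE; rewrite evE dE; apply/d0/igen_mem; exists E.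
move=> A f Zf; have [|||g gE] := @lr_factor k _ D A (GRing.in_alg (cR c)) d' f ds.
- by move=> t /d0; apply: eqs_map.
- exact: dC.
- by move=> a; apply: lrA.
by exists g => r; rewrite dE gE.
Qed.

(** After localization the point s factors through the universal zero of Z in a chart, where
    vanishing at k-points is enough. *)
Lemma dens h : natural_on h -> (forall s : pts X, zeros Z s -> h k^o s = 0) ->
  forall A (s : X A), zeros Z s -> h A s = 0.
Proof.
move=> hn h0 A s Zs; suff : ann (h A s) 1 by rewrite /ann /= mul1r.
apply: prime_unit => P pP SP; have [K [f [Kf f0]]] := residue_field pP.
have [c cs] := cov (fmap f s) Kf.
have [a [fa am ha]] := local_chart Kf cs.
have [n hn'] : exists n, a ^+ n * h A s = 0.
  apply: nilp_ann => B g lg; have [ua _ _] := lg; have [w Ew] := ha _ g ua.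
  have Zw : zeros Z (fmap w (cu c)) by rewrite Ew; apply: zeros_map.
  have [/(eqs_map Zw)|nz] := pselect (eqs c Z 1).
    by rewrite lr1 => /eqP; rewrite oner_eq0.
  have [D [d [ds d0 Zd dU]]] := universal_zero nz.
  have [w' w'E] := dU _ _ Zw.
  have -> : g (h A s) = w' (h D (fmap d (cu c))).
    rewrite -!hn //; congr (h B _); rewrite -Ew; by apply: fmap_comp => z; rewrite /= w'E.
  have [r Er] := ds (h D (fmap d (cu c))).
  suff d0r : d r = 0 by rewrite -Er d0r lr0.
  apply/d0/chart_dens => y Zy; have [y' y'E] := dU _ _ Zy.
  rewrite -y'E Er -hn // -[RHS](h0 _ Zy); congr (h k^o _); by apply/esym; apply: fmap_comp => z; rewrite /= y'E.
by move/negP: fa; apply; apply/eqP/f0/(prime_exp (n := n) pP)/SP.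
Qed.

(** The kernel of f on the polynomial ring of the chart is prime, and the Nullstellensatz gives a
    k-point of its closure off e = 0. *)
Lemma special c K (f : {lrmorphism cR c -> K}) e : is_field K -> zeros Z (fmap f (cu c)) ->
  f e != 0 -> exists y : kpoint c, [/\ zeros Z (at_ y), y e != 0 & forall r, f r = 0 -> y r = 0].
Proof.
move=> Kf Zf fe.
have [f' f'E] : exists f' : {rmorphism {mpoly k[cn c]} -> K}, f' =1 f \o gam c.
  apply: (@pack_rmorphism {mpoly k[cn c]} K (f \o gam c)) => [|a b|a b] /=.
  - by rewrite rmorph1 lr1.
  - by rewrite rmorphB lrB.
  - by rewrite rmorphM lrM.
have pP : prime_ideal (iker f').
  split=> [|a b]; rewrite /= ?rmorph1 ?rmorphM; first by move/eqP; rewrite oner_eq0.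
  move=> h; case: (eqVneq (f' a) 0) => [|na]; first by left.
  by right; apply: (mulrI (Kf _ na)); rewrite h mulr0.
have [p Ep] := gam_surj e.
have [|g [gC gP gp]] := jacobson_mpoly pP (b := p).
  by rewrite /= f'E /= Ep; apply/eqP.
have gE := point_of gC.
have gP' r : f r = 0 -> forall p', gam c p' = r -> p'.@[fun i => g 'X_i] = 0.
  by move=> fr p' Ep'; rewrite -gE; apply: gP; rewrite /= f'E /= Ep'.
have [y Zy yE] : exists2 y : kpoint c, zeros Z (at_ y) & forall p, y (gam c p) = p.@[fun i => g 'X_i].
  apply: point_at => q Jq; rewrite maxid_mem; apply: gP' (erefl _).
  by move: Jq => /pidealE; apply: (eqs_map Zf).
exists y; split=> [//||r fr].
  by rewrite -Ep yE -gE.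
have [p' Ep'] := gam_surj r; rewrite -Ep' yE. exact: (gP' r fr p' Ep').
Qed.

Section Regular.
Context (eta : pts X -> k).
Context (eta_reg : forall q, zeros Z q -> reg Z q eta).

Let Val A (s : X A) (v : A) := exists c (e r : cR c) (p : {lrmorphism cR c -> A}),
  [/\ fmap p (cu c) = s, p e \is a GRing.unit, v = p r / p e
    & forall y : kpoint c, y e != 0 -> zeros Z (at_ y) -> eta (at_ y) * y e = y r].

Lemma regular_map A B (g : {lrmorphism A -> B}) (s : X A) v : Val s v -> Val (fmap g s) (g v).
Proof.
case=> c [e [r [p [<- pe -> h]]]]; have [p' p'E] := lr_comp p g.
exists c, e, r, p'; split=> //.
- exact: fmap_comp.
- by rewrite p'E /=; apply: lr_unit.
- rewrite !p'E /= lrM; by congr (_ * _); exact: lrV.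
Qed.

(** The two fractions agree at k-points. On the localization where both charts are available, their
    cross difference, multiplied by the denominators e, s1 and a, vanishes at all k-points and
    therefore belongs to the ideal of Z. *)
Lemma regular_fun A (s : X A) v w : zeros Z s -> Val s v -> Val s w -> v = w.
Proof.
move=> Zs [c [e [r [p [Es pe -> h]]]]] [c' [e' [r' [p' [Es' pe' -> h']]]]].
suff E0 : p r * p' e' - p' r' * p e = 0.
  apply: (mulIr pe); rewrite divrK //; apply: (mulIr pe').
  by move/eqP: E0; rewrite subr_eq0 => /eqP ->; rewrite mulrAC divrK.
suff : ann (p r * p' e' - p' r' * p e) 1 by rewrite /ann /= mul1r.
apply: prime_unit => P pP SP; have [K [f [Kf f0]]] := residue_field pP.
have [fp fpE] := lr_comp p f; have [fp' fp'E] := lr_comp p' f.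
have Uf : cU c' K (fmap fp (cu c)).
  apply/chart_point; exists fp'; rewrite (fmap_comp _ fpE) (fmap_comp _ fp'E).
  by rewrite Es Es'.
have [a [fa am ha]] := local_chart Kf Uf.
have [B [g [lg gU]]] := localization am; have [ga gB _] := lg.
have [l El] := ha _ g ga.
have [s1 [n1 E1]] := gB (l e'); have [s2 [n2 E2]] := gB (l r').
pose t := (r * s1 * a ^+ n2 - s2 * e * a ^+ n1).
have Jt : eqs c Z (t * e * s1 * a).
  apply: chart_dens => y Zy; rewrite /t !lrM.
  case: (eqVneq (y e) 0) => [->|ye]; first by rewrite mulr0 !mul0r.
  case: (eqVneq (y s1) 0) => [->|ys]; first by rewrite mulr0 !mul0r.
  case: (eqVneq (y a) 0) => [->|ya]; first by rewrite mulr0.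
  rewrite (_ : y (_ - _) = 0) ?mul0r // lrB !lrM.
  have [y1 y1E] := gU _ y (eq_ind_r is_true ya (unit_k _)).
  have [y' y'E] := lr_comp l y1.
  have at' : at_ y' = at_ y.
    by rewrite /at_ (fmap_comp _ y'E) El -(@fmap_comp _ X _ _ _ g y1 y).
  have Y1 : y s1 = y' e' * y a ^+ n1 by rewrite y'E -!y1E /= -E1 lrM lrX.
  have Y2 : y s2 = y' r' * y a ^+ n2 by rewrite y'E -!y1E /= -E2 lrM lrX.
  have ye' : y' e' != 0 by apply: contraNneq ys => z; rewrite Y1 z mul0r.
  have H2 := h' y' ye'; rewrite at' in H2; rewrite Y2 -(H2 Zy) Y1 -h // !lrX.
  by set a1 := y e; set a2 := y a; set a3 := y' e'; move: a1 a2 a3 (eta _) => /= *; ring.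
have [n hn] : exists n, p a ^+ n * (p r * p' e' - p' r' * p e) = 0.
  apply: nilp_ann => B2 g2 lg2; have [ua _ _] := lg2.
  have [gp gpE] := lr_comp p g2; have [gp' gp'E] := lr_comp p' g2.
  have ua' : gp a \is a GRing.unit by rewrite gpE.
  have [m mE] := gU _ gp ua'; have [ml mlE] := lr_comp l m.
  have mlE' : ml =1 gp'.
    have [_ inj _] := c_open c'; apply: inj.
    rewrite (fmap_comp _ mlE) El -(@fmap_comp _ X _ _ _ g m gp); last by move=> z; rewrite -mE.
    by rewrite (fmap_comp _ gpE) (fmap_comp _ gp'E) Es Es'.
  have Y1 : gp s1 = gp' e' * gp a ^+ n1 by rewrite -mlE' mlE -!mE /= -E1 lrM lrX.
  have Y2 : gp s2 = gp' r' * gp a ^+ n2 by rewrite -mlE' mlE -!mE /= -E2 lrM lrX.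
  have : gp (t * e * s1 * a) = 0.
    by apply: (eqs_map _ Jt); rewrite (fmap_comp _ gpE) Es; apply: zeros_map.
  have ue : gp e \is a GRing.unit by rewrite gpE /= lr_unit.
  have ue' : gp' e' \is a GRing.unit by rewrite gp'E /= lr_unit.
  rewrite /t !(lrM, lrB, lrX) Y1 Y2 -[g2 (p r)]gpE -[g2 (p e)]gpE -[g2 (p' r')]gp'E -[g2 (p' e')]gp'E.
  move=> E3; apply: (mulIr ue); apply: (mulIr ue'); apply: (mulIr (unitrX (n2 + n1 + n1).+1 ua')).
  by rewrite !mul0r -[RHS]E3 exprS !exprD; ring.
by move/negP: fa; apply; rewrite fpE; apply/eqP/f0/(prime_exp (n := n) pP)/SP.
Qed.

Lemma regular_loc A (s : X A) K (f : {lrmorphism A -> K}) : is_field K -> zeros Z s ->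
  exists a, f a != 0 /\ forall B (g : {lrmorphism A -> B}), is_localization a g ->
    exists v, Val (fmap g s) v.
Proof.
move=> Kf Zs; have [c Us] := cov (fmap f s) Kf.
have [a [fa am ha]] := local_chart Kf Us.
have [fr Efr] := (chart_point c _).1 Us.
have [||y [Zy _ hy]] := @special c K fr 1 Kf; first by rewrite Efr; apply: zeros_map.
  by rewrite lr1 oner_neq0.
have [e [r [ye he]]] := reg_in (eta_reg Zy).
have fe : fr e != 0 by apply: contraNneq ye => /hy ->.
have [B [g [lg gU]]] := localization am; have [ga gB _] := lg.
have [l El] := ha _ g ga; have [n [m En]] := gB (l e).
have [f' f'E] := gU _ f (Kf _ fa).
have El' : f' (l e) = fr e.
  have [fl flE] := lr_comp l f'; rewrite -[f' _]flE.
  have [_ inj _] := c_open c; apply: inj.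
  rewrite (fmap_comp _ flE) El Efr -(@fmap_comp _ X _ _ _ g f' f) //.
exists (a * n); split.
  have uf z : f z != 0 -> f z \is a GRing.unit by apply: Kf.
  have un : f n \is a GRing.unit.
    rewrite -f'E /= -En lrM El' lrX; apply: unitrM_imp.
      by apply: (Kf _ fe).
    by apply: unitrX; rewrite (_ : f' (g a) = f a) ?Kf //; apply: (f'E a).
  apply/eqP => z; have := unitrM_imp (uf _ fa) un.
  by rewrite -lrM z unitr0.
move=> B2 g2 [u2 _ _]; move: (u2); rewrite lrM unitrM => /andP [ua un].
have [l2 El2] := ha _ g2 ua; have [m2 m2E] := gU _ g2 ua.
have El2' : m2 (l e) = l2 e.
  have [fl flE] := lr_comp l m2; rewrite -[m2 _]flE.
  have [_ inj _] := c_open c; apply: inj.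
  rewrite (fmap_comp _ flE) El El2 -(@fmap_comp _ X _ _ _ g m2 g2) //.
have ue : l2 e \is a GRing.unit.
  move: un; rewrite -m2E /= -En lrM El2' => un.
  by move: un; rewrite unitrM => /andP [].
by exists (l2 r / l2 e), c, e, r, l2.
Qed.

(** Extends a function constructed on k-points to all test algebras, as pseudo-completeness and
    divisibility are stated for natural families. *)
Lemma regular_fn : exists h : forall A, X A -> A,
  natural_on h /\ forall s : pts X, zeros Z s -> h k^o s = eta s.
Proof.
have [h [hn hv]] := @glue (fun A s => zeros Z s) Val
  (fun A B g s => @zeros_map _ _ Z A B g s) regular_fun regular_map regular_loc.
exists h; split=> // s Zs; have [c [x Eq]] := near_chart (reg_near (eta_reg Zs)).
have := eta_reg Zs; rewrite -Eq => /reg_in [e [r [xe he]]].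
apply: hv; rewrite ?Eq //; exists c, e, r, x; split=> //; first by rewrite unit_k.
have Zx : zeros Z (at_ x) by rewrite Eq.
by rewrite -Eq -(he x xe Zx); apply/esym/mulfK.
Qed.
End Regular.
End Functions.

(** * The zip group and polynomial algebras *)

Section PolyAlg.
Context (k : fieldType).
Implicit Types A B C : comUnitAlgType k.

(** The quotient of A[X] by the zero ideal: the same ring, with all its invertible elements
    recognised as units. *)
Lemma poly_alg A : exists B (io : {rmorphism {poly A} -> B}) (j : {lrmorphism A -> B}),
  [/\ forall b, exists p, io p = b, forall p, io p = 0 -> p = 0, forall a, j a = io a%:P
    & forall C (g : {lrmorphism A -> C}) (z : C), exists h : {lrmorphism B -> C},
        (forall a, h (j a) = g a) /\ forall p, h (io p) = (map_poly g p).[z]].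
Proof.
pose i : {rmorphism k -> {poly A}} := polyC \o (GRing.in_alg A : {rmorphism k -> A}).
pose Z := @Ideal {poly A} (fun x => x = 0) erefl
  (fun x y hx hy => eq_ind_r (fun t => t + y = 0) (eq_ind_r (fun t => 0 + t = 0) (addr0 0) hy) hx)
  (fun a x hx => eq_ind_r (fun t => a * t = 0) (mulr0 a) hx).
have [|B [io [ios io0 ioC]]] := @quotient_alg k _ i Z; first by move/eqP; rewrite /= oner_eq0.
have [|j jE] := @lr_of k A B (io \o polyC); first by move=> c; rewrite -ioC.
exists B, io, j; split=> //; first by move=> p /io0.
move=> C g z; pose g' : {rmorphism {poly A} -> C} :=
  horner_morph (fun a => mulrC z ((g : {rmorphism A -> C}) a)).
have g'E p : g' p = (map_poly g p).[z] by [].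
have [|||h hE] := @lr_factor k _ B C i io g' ios.
- by move=> t /io0 ->; rewrite rmorph0.
- exact: ioC.
- by move=> c; rewrite g'E /i /= map_polyC hornerC /= lrA.
exists h; split=> [a|p]; last by rewrite hE.
by rewrite jE /= hE g'E map_polyC hornerC.
Qed.

Lemma mpoly_alg A n : exists B (io : {rmorphism {mpoly A[n]} -> B}) (j : {lrmorphism A -> B}),
  [/\ forall b, exists p, io p = b, forall p, io p = 0 -> p = 0, forall a, j a = io a%:MP
    & forall C (g : {lrmorphism A -> C}) (z : 'I_n -> C), exists h : {lrmorphism B -> C},
        (forall a, h (j a) = g a) /\ forall p, h (io p) = mmap g z p].
Proof.
pose i : {rmorphism k -> {mpoly A[n]}} := (@mpolyC n A) \o (GRing.in_alg A : {rmorphism k -> A}).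
pose Z := @Ideal {mpoly A[n]} (fun x => x = 0) erefl
  (fun x y hx hy => eq_ind_r (fun t => t + y = 0) (eq_ind_r (fun t => 0 + t = 0) (addr0 0) hy) hx)
  (fun a x hx => eq_ind_r (fun t => a * t = 0) (mulr0 a) hx).
have [|B [io [ios io0 ioC]]] := @quotient_alg k _ i Z; first by move/eqP; rewrite /= oner_eq0.
have [|j jE] := @lr_of k A B (io \o (@mpolyC n A)); first by move=> c; rewrite -ioC.
exists B, io, j; split=> //; first by move=> p /io0.
move=> C g z; have [g' [g'E g'C _]] := mmapP (g : {rmorphism A -> C}) z.
have [|||h hE] := @lr_factor k _ B C i io g' ios.
- by move=> t /io0 ->; rewrite rmorph0.
- exact: ioC.
- by move=> c; rewrite g'C /= lrA.
exists h; split=> [a|p]; last by rewrite hE g'E.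
by rewrite jE /= hE g'C.
Qed.
End PolyAlg.

Definition lowb (R : nzRingType) (x : 'M[R]_4) := forall i j : 'I_4, (i < 2)%N -> (2 <= j)%N -> x i j = 0.
Definition uppb (R : nzRingType) (x : 'M[R]_4) := forall i j : 'I_4, (2 <= i)%N -> (j < 2)%N -> x i j = 0.
Definition sblk (i j : 'I_4) := (i < 2)%N == (j < 2)%N.

Section Blocks.
Context (R : comUnitRingType).
Implicit Types x y : 'M[R]_4.

Lemma uppb_tr x : uppb x <-> lowb x^T.
Proof. by split=> h i j hi hj; [rewrite mxE; apply: h|have := h j i hj hi; rewrite mxE]. Qed.

Lemma lowb_diag x y i j : lowb x -> lowb y -> sblk i j ->
  (x *m y) i j = \sum_(l < 4 | sblk i l) x i l * y l j.
Proof.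
move=> hx hy ij; rewrite mxE [RHS]big_mkcond; apply: eq_bigr => l _.
case: ifPn => //; move: ij; rewrite /sblk => /eqP ij; case: (ltnP i 2) => hi; case: (ltnP l 2) => hl //= _.
- by rewrite hx // mul0r.
- by rewrite (hy l j) // ?mulr0 // leqNgt -ij -leqNgt.
Qed.

Lemma lowb_inv x : x \in unitmx -> lowb x -> lowb (invmx x).
Proof.
move=> ux hx; pose x' : 'M_(2 + 2) := x; pose y' : 'M_(2 + 2) := invmx x.
have ur0 : ursubmx x' = 0.
  apply/matrixP => i j; rewrite !mxE; apply: hx; rewrite /= ?ltn_ord //.
have := (mulmxV ux : @mulmx R (2 + 2) (2 + 2) (2 + 2) x' y' = 1%:M); rewrite -(submxK x') -(submxK y') ur0
  mulmx_block !mul0mx !addr0.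
rewrite (scalar_mx_block 2 2 1) => /eq_block_mx [E1 E2 _ _].
have [_ u] := mulmx1_unit E1.
have u1 : ulsubmx x' \in unitmx by have [] := mulmx1_unit E1.
have y0 : ursubmx y' = 0 by rewrite -(mulKmx u1 (ursubmx y')) E2 mulmx0.
move=> i j i2 j2; have i2' : (i < 2)%N := i2.
have j2' : (j - 2 < 2)%N by have := ltn_ord j; lia.
have := congr1 (fun m : 'M_2 => m (Ordinal i2') (Ordinal j2')) y0; rewrite !mxE => <-.
by congr (invmx x _ _); apply: val_inj => /=; lia.
Qed.

Lemma uppb_inv x : x \in unitmx -> uppb x -> uppb (invmx x).
Proof.
by move=> ux /uppb_tr h; apply/uppb_tr; rewrite trmx_inv; apply: lowb_inv => //; rewrite unitmx_tr.
Qed.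
End Blocks.

Section EChar.
Context (k : fieldType) (q : nat).
Implicit Types A B : comUnitAlgType k.

Lemma muE (R : nzRingType) (t : R) (h : 'M[R]_4) i j :
  (mu t *m h) i j = (if (i < 2)%N then t else 1) * h i j.
Proof. by rewrite /mu mul_diag_mx !mxE. Qed.
Lemma muEr (R : nzRingType) (t : R) (h : 'M[R]_4) i j :
  (h *m mu t) i j = h i j * (if (j < 2)%N then t else 1).
Proof. by rewrite /mu mul_mx_diag !mxE. Qed.

(** The family mu(t)^-1 g mu(t) as a matrix over A[t]: the lower left block acquires a factor t. In
    [plus_of] it is the upper right block. *)
Let minus_of (A : comUnitRingType) (g : 'M[A]_4) : 'M[{poly A}]_4 :=
  \matrix_(i, j) if sblk i j then (g i j)%:P else if (i < 2)%N then 0 else (g i j)%:P * 'X.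
Let plus_of (A : comUnitRingType) (g : 'M[A]_4) : 'M[{poly A}]_4 :=
  \matrix_(i, j) if sblk i j then (g i j)%:P else if (i < 2)%N then (g i j)%:P * 'X else 0.

Lemma minus_ofE A (g : 'M[A]_4) : lowb g -> mu 'X *m minus_of g = map_mx polyC g *m mu 'X.
Proof.
move=> hg; apply/matrixP => i j; rewrite muE muEr !mxE /sblk.
case: (ltnP i 2) => hi; case: (ltnP j 2) => hj //=; rewrite ?mul1r ?mulr1 ?mulr0 //.
- by rewrite commr_polyX.
- by rewrite hg.
Qed.
Lemma plus_ofE A (g : 'M[A]_4) : uppb g -> plus_of g *m mu 'X = mu 'X *m map_mx polyC g.
Proof.
move=> hg; apply/matrixP => i j; rewrite muE muEr !mxE /sblk.
case: (ltnP i 2) => hi; case: (ltnP j 2) => hj //=; rewrite ?mul1r ?mulr1 ?mul0r //.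
- by rewrite commr_polyX.
- by rewrite commr_polyX.
- by rewrite hg.
Qed.

Lemma mu_inj A (h h' : 'M[{poly A}]_4) : mu 'X *m h = mu 'X *m h' -> h = h'.
Proof.
move=> E; apply/matrixP => i j; have := congr1 (fun m : 'M_4 => m i j) E.
rewrite !muE; case: ifP => _; rewrite ?mul1r // => /polyP H; apply/polyP => n.
by have := H n.+1; rewrite -!commr_polyX !coefMX.
Qed.
Lemma mu_injr A (h h' : 'M[{poly A}]_4) : h *m mu 'X = h' *m mu 'X -> h = h'.
Proof.
move=> E; apply/matrixP => i j; have := congr1 (fun m : 'M_4 => m i j) E.
rewrite !muEr; case: ifP => _; rewrite ?mulr1 // => /polyP H; apply/polyP => n.
by have := H n.+1; rewrite !coefMX.
Qed.

Lemma extends_minusP A (x : gl A) : lowb (val x) -> extends_minus x (minus_of (val x)).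
Proof.
move=> hx; split; last exact: minus_ofE.
have hV := lowb_inv (valP x) hx.
have cancel (a b : 'M[A]_4) : lowb a -> lowb b -> a *m b = 1%:M -> minus_of a *m minus_of b = 1%:M.
  move=> ha hb ab; apply: mu_inj.
  by rewrite mulmxA minus_ofE // -mulmxA minus_ofE // mulmxA -map_mxM ab map_mx1 mul1mx mulmx1.
exists (minus_of (invmx (val x))).
by split; apply: cancel => //; [apply: mulmxV|apply: mulVmx]; apply: (valP x).
Qed.
Lemma extends_plusP A (x : gl A) : uppb (val x) -> extends_plus x (plus_of (val x)).
Proof.
move=> hx; split; last exact: plus_ofE.
have hV := uppb_inv (valP x) hx.
have cancel (a b : 'M[A]_4) : uppb a -> uppb b -> a *m b = 1%:M -> plus_of a *m plus_of b = 1%:M.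
  move=> ha hb ab; apply: mu_injr.
  by rewrite -mulmxA plus_ofE // mulmxA plus_ofE // -mulmxA -map_mxM ab map_mx1 mul1mx mulmx1.
exists (plus_of (invmx (val x))).
by split; apply: cancel => //; [apply: mulmxV|apply: mulVmx]; apply: (valP x).
Qed.

Lemma extends_minus_low A (x : gl A) h : extends_minus x h ->
  lowb (val x) /\ forall i j, sblk i j -> at0 h i j = val x i j.
Proof.
case=> _ E; have E' i j := congr1 (fun m : 'M_4 => m i j) E.
have low : lowb (val x).
  move=> i j i2 j2; have := E' i j; rewrite muE muEr i2 ltnNge j2 /= mulr1 mxE => /polyP /(_ 0%N).
  by rewrite coefXM coefC /= => <-.
split=> // i j; rewrite /sblk => /eqP ij; have := E' i j; rewrite muE muEr ij !mxE.
case: ifP => _; last by rewrite mul1r mulr1 => ->; rewrite hornerC.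
move=> /polyP /(_ 1%N); rewrite -commr_polyX !coefMX /= coefC /= => <-.
by rewrite horner_coef0.
Qed.
Lemma extends_plus_upp A (x : gl A) h : extends_plus x h ->
  uppb (val x) /\ forall i j, sblk i j -> at0 h i j = val x i j.
Proof.
case=> _ E; have E' i j := congr1 (fun m : 'M_4 => m i j) E.
have low : uppb (val x).
  move=> i j i2 j2; have := E' i j; rewrite muE muEr j2 ltnNge i2 /= mul1r mxE => /polyP /(_ 0%N).
  by rewrite coefMX coefC /= => <-.
split=> // i j; rewrite /sblk => /eqP ij; have := E' i j; rewrite muE muEr ij !mxE.
case: ifP => _; last by rewrite mul1r mulr1 => ->; rewrite hornerC.
move=> /polyP /(_ 1%N); rewrite -commr_polyX !coefMX /= coefC /= => <-.
by rewrite horner_coef0.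
Qed.

Lemma at0_off_minus A (x : gl A) h i j : extends_minus x h -> ~~ sblk i j -> at0 h i j = 0.
Proof.
move=> hx; have [low _] := extends_minus_low hx; case: hx => _ E.
have := congr1 (fun m : 'M_4 => m i j) E; rewrite muE muEr !mxE /sblk.
case: (ltnP i 2) => i2; case: (ltnP j 2) => j2 // Eij _.
  move: Eij; rewrite mulr1 low // => /polyP /(_ 1%N).
  by rewrite -commr_polyX coefMX coefC /= horner_coef0.
by move: Eij; rewrite mul1r => ->; rewrite hornerMX mulr0.
Qed.
Lemma at0_off_plus A (x : gl A) h i j : extends_plus x h -> ~~ sblk i j -> at0 h i j = 0.
Proof.
move=> hx; have [low _] := extends_plus_upp hx; case: hx => _ E.
have := congr1 (fun m : 'M_4 => m i j) E; rewrite muE muEr !mxE /sblk.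
case: (ltnP i 2) => i2; case: (ltnP j 2) => j2 // Eij _.
  by move: Eij; rewrite mulr1 => ->; rewrite hornerM hornerX mul0r.
move: Eij; rewrite mul1r low // => /polyP /(_ 1%N).
by rewrite coefMX coefC /= horner_coef0.
Qed.

Context (q0 : (0 < q)%N).

Lemma in_EP A (x y : gl A) : in_E q x y <->
  [/\ lowb (val x), uppb (val y) & forall i j, sblk i j -> val y i j = val x i j ^+ q].
Proof.
split=> [[hx [hy [ex ey Eq]]]|[lx uy Eq]].
  have [lx dx] := extends_minus_low ex; have [uy dy] := extends_plus_upp ey.
  split=> // i j ij; rewrite -dx // -dy //.
  by have := congr1 (fun m : 'M_4 => m i j) Eq; rewrite mxE.
have ex := extends_minusP lx; have ey := extends_plusP uy.
exists (minus_of (val x)), (plus_of (val y)); split=> //.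
apply/matrixP => i j; rewrite mxE; case: (boolP (sblk i j)) => ij.
  by rewrite (extends_minus_low ex).2 // (extends_plus_upp ey).2 // Eq.
by rewrite (at0_off_minus ex) // (at0_off_plus ey) // expr0n eqn0Ngt q0.
Qed.

Lemma in_PP A (x : gl A) : in_P x <-> lowb (val x).
Proof.
split=> [[h /extends_minus_low []]//|lx].
by exists (minus_of (val x)); apply: extends_minusP.
Qed.

Lemma lowb_map A B (f : {lrmorphism A -> B}) x : lowb x -> lowb (map_mx f x).
Proof. by move=> h i j hi hj; rewrite mxE h // lr0. Qed.

Lemma in_E_map A B (f : {lrmorphism A -> B}) (x y : gl A) : in_E q x y -> in_E q (glmap f x) (glmap f y).
Proof.
move=> /in_EP [lx uy Eq]; apply/in_EP; split=> [|i j hi hj|i j ij] /=.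
- exact: lowb_map.
- by rewrite mxE uy // lr0.
- by rewrite !mxE Eq // lrX.
Qed.
End EChar.

(** * Field-valued points of open sets of k-points *)

Section FieldPoints.
Context (k : closedFieldType) (X : kfunctor k).
Implicit Types (A B C D R K L : comUnitAlgType k) (c : chart X) (O : pts X -> Prop).
Context (cov : forall K (s : X K), is_field K -> exists c, cU c K s).

Definition opn O := forall q, O q -> near q O.
(** The open subset of X with k-points O, evaluated at a field-valued point: s lies in a basic open
    set whose k-points are all in O. *)
Definition fld O K (s : X K) := exists c (f : {lrmorphism cR c -> K}) e,
  [/\ fmap f (cu c) = s, f e != 0 & forall y : kpoint c, y e != 0 -> O (at_ y)].

Lemma zeros0 A (s : X A) : zeros (fun _ : fn X => False) s. Proof. by []. Qed.

Lemma field_unit K (a : K) : is_field K -> (a \is a GRing.unit) = (a != 0).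
Proof.
move=> Kf; apply/idP/idP => [ua|/Kf //].
by apply: contraTneq ua => ->; rewrite unitr0.
Qed.
Lemma field_map K A (i : {lrmorphism K -> A}) a : is_field K -> a != 0 -> i a != 0.
Proof.
move=> Kf /Kf /(lr_unit i) u; apply: contraTneq u => ->; by rewrite unitr0.
Qed.
Lemma field_mul K (a b : K) : is_field K -> a != 0 -> b != 0 -> a * b != 0.
Proof. by move=> Kf; rewrite -!(field_unit _ Kf) unitrM => -> ->. Qed.
Lemma field_mulN K (a b : K) : is_field K -> a * b != 0 -> a != 0 /\ b != 0.
Proof. by move=> Kf; rewrite -!(field_unit _ Kf) unitrM => /andP. Qed.
Lemma field_exp K (a : K) n : is_field K -> a != 0 -> a ^+ n != 0.
Proof. by move=> Kf; rewrite -!(field_unit _ Kf); apply: unitrX. Qed.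

Lemma field_transfer A (s : X A) K (f : {lrmorphism A -> K}) c (f' : {lrmorphism cR c -> K}) e :
  is_field K -> fmap f' (cu c) = fmap f s -> f' e != 0 ->
  exists2 a, f a != 0 & forall L (g : {lrmorphism A -> L}), is_field L -> g a != 0 ->
    exists2 g' : {lrmorphism cR c -> L}, fmap g' (cu c) = fmap g s & g' e != 0.
Proof.
move=> Kf Ef fe; have Us : cU c K (fmap f s) by apply/chart_point; exists f'.
have [a [fa am ha]] := local_chart Kf Us.
have [B [g [lg gU]]] := localization am; have [ga gB _] := lg.
have [l El] := ha _ g ga; have [s1 [n En]] := gB (l e).
have key L (h : {lrmorphism A -> L}) : is_field L -> h a != 0 ->
    exists2 g' : {lrmorphism cR c -> L}, fmap g' (cu c) = fmap h s & g' e * h a ^+ n = h s1.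
  move=> Lf ha0; have [m mE] := gU _ h (Lf _ ha0); have [ml mlE] := lr_comp l m.
  exists ml; first by rewrite (fmap_comp _ mlE) El -(@fmap_comp _ X _ _ _ g m h).
  have mE' z : m (g z) = h z by apply: mE.
  by rewrite mlE /= -!mE' -lrX -lrM En.
exists (a * s1).
  have [g' Eg' E1] := key _ f Kf fa.
  have gf' : g' =1 f'.
    by have [_ inj _] := c_open c; apply: inj; rewrite Eg' Ef.
  by rewrite lrM field_mul // -E1 gf' field_mul // field_exp.
move=> L h Lf; rewrite lrM => /(field_mulN Lf) [/(key _ _ Lf) [g' Eg E1] hs].
by exists g' => //; move: hs; rewrite -E1 => /(field_mulN Lf) [].
Qed.

Lemma fld_disj O O' K (s : X K) : is_field K -> fld O s -> fld O' s -> exists2 y, O y & O' y.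
Proof.
move=> Kf [c [f [e [Ef fe he]]]] [c' [f' [e' [Ef' fe' he']]]].
have [|a fa ha] := @field_transfer _ (cu c) _ f _ f' _ Kf _ fe'; first by rewrite Ef.
have [||y [_ ye _]] := @special _ X (fun _ => False) c K f (e * a) Kf; first exact: zeros0.
  by rewrite lrM field_mul.
move: ye; rewrite lrM mulf_eq0 => /norP [ye ya].
have [y' Ey y'e] := ha _ y (@is_field_k k) ya.
by exists (at_ y); [apply: he|rewrite /at_ -Ey; apply: (he' y')].
Qed.

Lemma fld_cover O O' K (s : X K) : opn O -> opn O' -> (forall y, O y \/ O' y) -> is_field K ->
  fld O s \/ fld O' s.
Proof.
move=> oO oO' OO Kf; have [c Us] := cov s Kf; have [f Ef] := (chart_point c s).1 Us.
have [||y [_ _ hy]] := @special _ X (fun _ => False) c K f 1 Kf; first exact: zeros0.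
  by rewrite lr1 oner_neq0.
case: (OO (at_ y)) => [/oO|/oO'] /near_in [e ye he]; [left|right];
  by exists c, f, e; split=> //; apply: contraNneq ye => /hy ->.
Qed.

Lemma fld_open O A (s : X A) K (f : {lrmorphism A -> K}) : is_field K -> fld O (fmap f s) ->
  exists2 a, f a != 0 & forall L (g : {lrmorphism A -> L}), is_field L -> g a != 0 -> fld O (fmap g s).
Proof.
move=> Kf [c [f' [e [Ef fe he]]]]; have [a fa ha] := field_transfer Kf Ef fe.
by exists a => // L g Lf ga; have [g' Eg ge] := ha L g Lf ga; exists c, g', e.
Qed.

Lemma fld_map O K L (i : {lrmorphism K -> L}) (s : X K) : is_field K ->
  fld O s -> fld O (fmap i s).
Proof.
move=> Kf [c [f [e [Ef fe he]]]]; have [f' f'E] := lr_comp f i.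
exists c, f', e; split=> //; first by rewrite (fmap_comp _ f'E) Ef.
by rewrite f'E /= field_map.
Qed.

Lemma fld_k O (y : pts X) : opn O -> O y -> fld O y.
Proof. by move=> oO /oO [c [x [e [Ex xe he]]]]; exists c, x, e. Qed.

(** The spectrum of a domain is irreducible, so two disjoint open sets cannot both meet it. *)
Lemma fld_path O O' A (s : X A) K K' (f : {lrmorphism A -> K}) (f' : {lrmorphism A -> K'}) :
  (forall a b : A, a * b = 0 -> a = 0 \/ b = 0) ->
  is_field K -> is_field K' -> opn O -> opn O' -> (forall y, O y \/ O' y) ->
  (forall y, O y -> O' y -> False) ->
  fld O (fmap f s) -> fld O (fmap f' s).
Proof.
move=> Ad Kf Kf' oO oO' OO dO h0; case: (fld_cover (fmap f' s) oO oO' OO Kf') => // h1.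
have [a fa ha] := fld_open Kf h0; have [a' fa' ha'] := fld_open Kf' h1.
pose Z := @Ideal A (fun x => x = 0) erefl
  (fun x y hx hy => eq_ind_r (fun t => t + y = 0) (eq_ind_r (fun t => 0 + t = 0) (addr0 0) hy) hx)
  (fun a x hx => eq_ind_r (fun t => a * t = 0) (mulr0 a) hx).
have pZ : prime_ideal Z by split=> [|x y] /=; [move/eqP; rewrite oner_eq0|apply: Ad].
have [L [g [Lf g0]]] := residue_field pZ.
have ne x : x != 0 -> g x != 0 by apply: contra_neq => /g0.
have [||y Oy O'y] := @fld_disj O O' L (fmap g s) Lf; last by case: (dO y).
  by apply: ha => //; apply/ne; apply: contraNneq fa => ->; rewrite lr0.
by apply: ha' => //; apply/ne; apply: contraNneq fa' => ->; rewrite lr0.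
Qed.
End FieldPoints.

(** * Going down along etale covers *)

Section FGen.
Context (k : fieldType) (S : comNzRingType) (kap : {rmorphism k -> S}).

Definition fgen (z : seq S) (s : S) :=
  exists p : {mpoly k[size z]}, mmap kap (fun i => nth 0 z i) p = s.

Lemma fgen_sub z z' s : (forall x, x \in z -> fgen z' x) -> fgen z s -> fgen z' s.
Proof.
move=> zz [p <-].
have [w wE] := choice (fun i : 'I_(size z) => zz _ (mem_nth 0 (ltn_ord i))).
have [f [fE fC fX]] := mmapP kap (fun i : 'I_(size z') => nth 0 z' i).
have [g [gE gC gX]] := mmapP (@mpolyC (size z') k) w.
have [h [hE hC hX]] := mmapP kap (fun i : 'I_(size z) => nth 0 z i).
exists (g p); rewrite -fE -hE; move: p.
apply: (@mpoly_rmorph_eq _ _ _ (f \o g) h) => [c|i] /=; first by rewrite gC fC hC.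
by rewrite gX hX fE wE.
Qed.

Lemma fgen_mem z x : x \in z -> fgen z x.
Proof.
move=> xz; have [f [fE fC fX]] := mmapP kap (fun i : 'I_(size z) => nth 0 z i).
have iz : (index x z < size z)%N by rewrite index_mem.
by exists 'X_(Ordinal iz); rewrite -fE fX /= nth_index.
Qed.
Lemma fgenC z c : fgen z (kap c).
Proof. by exists c%:MP; rewrite mmapC. Qed.
Lemma fgenD z x y : fgen z x -> fgen z y -> fgen z (x + y).
Proof. by move=> [p <-] [p' <-]; exists (p + p'); rewrite mmapD. Qed.
Lemma fgenM z x y : fgen z x -> fgen z y -> fgen z (x * y).
Proof.
move=> [p <-] [p' <-]; exists (p * p').
by have [f [fE _ _]] := mmapP kap (fun i : 'I_(size z) => nth 0 z i); rewrite -!fE rmorphM.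
Qed.

Lemma fgen_family (G : S -> Prop) (l : seq S) :
  (forall s, exists2 z, {in z, forall x, G x} & fgen z s) ->
  exists2 z, {in z, forall x, G x} & {in l, forall x, fgen z x}.
Proof.
move=> h; elim: l => [|s l [z zG zl]]; first by exists [::].
have [z' zG' zs] := h s; exists (z' ++ z).
  by move=> x; rewrite mem_cat => /orP [/zG'|/zG].
move=> x; rewrite inE => /orP [/eqP ->|/zl xl].
  by apply: fgen_sub zs => y yz; apply: fgen_mem; rewrite mem_cat yz.
by apply: fgen_sub xl => y yz; apply: fgen_mem; rewrite mem_cat yz orbT.
Qed.
End FGen.

Lemma poly_mpoly_ind (A : comNzRingType) n (H : {poly {mpoly A[n]}} -> Prop) :
  (forall x : A, H x%:MP%:P) -> (forall i : 'I_n, H ('X_i)%:P) -> H 'X ->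
  (forall x y, H x -> H y -> H (x + y)) -> (forall x y, H x -> H y -> H (x * y)) -> forall s, H s.
Proof.
move=> HC HX H'X HD HM.
have H1 : H 1 by have := HC 1; rewrite mpolyC1.
have HE x l : H x -> H (x ^+ l).
  by move=> Hx; elim: l => [|l IH]; [rewrite expr0|rewrite exprS; apply: HM].
have cst (p : {mpoly A[n]}) : H p%:P.
  elim/mpolyind: p => [|x m p _ _ IH]; first by have := HC 0; rewrite mpolyC0.
  rewrite polyCD; apply: (HD) => //; rewrite -mul_mpolyC polyCM; apply: (HM) => //.
  rewrite (mpolyXE_id _ m) rmorph_prod.
  by apply: (big_ind H) => // i _; rewrite rmorphXn /=; exact: HE.
move=> s; elim/poly_ind: s => [|s x IH]; first by have := cst 0.
by apply: (HD) => //; apply: HM.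
Qed.

Section EtaleTau.
Context (k : closedFieldType).
Implicit Types A B C D K L : comUnitAlgType k.

Definition sq_lift A B (f : {lrmorphism A -> B}) :=
  forall C D (s : {lrmorphism C -> D}) (a : {lrmorphism A -> C}) (b : {lrmorphism B -> D}),
    square_zero_quotient s -> s \o a =1 b \o f ->
    exists l : {lrmorphism B -> C}, l \o f =1 a /\ s \o l =1 b.

(** Lifting the identity of B = A[x]/I through A[x]/I^2 gives an A-endomorphism tau that is the
    identity modulo I and sends I into I^2. The last property is written with explicit coefficients
    so that it can be transported to a finitely generated subring. *)
Lemma etale_tau A B (f : {lrmorphism A -> B}) : fin_presented f -> sq_lift f ->
  exists n m (r : 'I_m -> {mpoly A[n]}) (pi : {rmorphism {mpoly A[n]} -> B})
    (tau : {rmorphism {mpoly A[n]} -> {mpoly A[n]}}),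
  [/\ forall b, exists p, pi p = b, forall a, pi a%:MP = f a,
      forall p, pi p = 0 <-> exists c : 'I_m -> {mpoly A[n]}, p = \sum_i c i * r i,
      forall a, tau a%:MP = a%:MP
    & (forall p, pi (tau p) = pi p) /\
      forall i, exists e : 'I_m -> 'I_m -> {mpoly A[n]}, tau (r i) = \sum_a \sum_b e a b * (r a * r b)].
Proof.
move=> [n [m [v [r [ps pk]]]]] lf.
have [pi [piE piC piX]] := mmapP (f : {rmorphism A -> B}) v.
exists n, m, r, pi; pose I := iker pi.
have pi_s b : exists p, pi p = b by have [p <-] := ps b; exists p.
have pi_k p : pi p = 0 <-> exists c : 'I_m -> {mpoly A[n]}, p = \sum_i c i * r i by rewrite piE.
have I2 p : ipow I 2 p -> exists e : 'I_m -> 'I_m -> {mpoly A[n]}, p = \sum_a \sum_b e a b * (r a * r b).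
  pose E p := exists e : 'I_m -> 'I_m -> {mpoly A[n]}, p = \sum_a \sum_b e a b * (r a * r b).
  have E0 : E 0.
    by exists (fun _ _ => 0); rewrite big1 // => a _; rewrite big1 // => b _; rewrite mul0r.
  have ED x y : E x -> E y -> E (x + y).
    move=> [e ->] [e' ->]; exists (fun a b => e a b + e' a b).
    rewrite -big_split; apply: eq_bigr => a _ /=.
    by rewrite -big_split; apply: eq_bigr => b _ /=; rewrite mulrDl.
  have EM x y : E y -> E (x * y).
    move=> [e ->]; exists (fun a b => x * e a b); rewrite mulr_sumr; apply: eq_bigr => a _.
    by rewrite mulr_sumr; apply: eq_bigr => b _; rewrite mulrA.
  move=> h; apply: (h (@Ideal _ E E0 ED EM)) => x [g gI ->].
  have [c Ec] := (pi_k _).1 (gI ord0); have [d Ed] := (pi_k _).1 (gI ord_max).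
  exists (fun a b => c a * d b); rewrite big_ord_recl big_ord1.
  rewrite (_ : lift ord0 ord0 = ord_max) ?Ec ?Ed; last exact: val_inj.
  rewrite mulr_suml; apply: eq_bigr => a _; rewrite mulr_sumr; apply: eq_bigr => b _.
  by rewrite mulrACA.
have I21 : ~ ipow I 2 1.
  move=> h; have : I 1.
    apply: h => x [g gI ->]; rewrite big_ord_recl; apply: idealMr; exact: gI.
  by rewrite /I /= rmorph1 => /eqP; rewrite oner_eq0.
have [C [qc [qs qk qC]]] :=
  quotient_alg ((@mpolyC n A) \o (GRing.in_alg A : {rmorphism k -> A}) : {rmorphism k -> _}) I21.
have [|a aE] := @lr_of k A C (qc \o (@mpolyC n A)); first by move=> c; rewrite -qC.
have [|||s sE] := @lr_factor k _ C B ((@mpolyC n A) \o (GRing.in_alg A)) qc pi qs.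
- move=> p /qk h; apply: (@igen_sub _ _ I _ _ h) => x [g gI ->].
  by rewrite big_ord_recl; apply: idealMr; exact: gI.
- exact: qC.
- by move=> c; rewrite /= piC /= lrA.
have sq : square_zero_quotient s.
  split=> [d|c c']; first by have [p <-] := pi_s d; exists (qc p); rewrite sE.
  have [p <-] := qs c; have [p' <-] := qs c'; rewrite !sE => h h'.
  rewrite -rmorphM; apply/qk; exact: (@ipow_mul _ I 1 1 p p' (ipow1 (h : I p)) (ipow1 (h' : I p'))).
have [b bE] := lr_id B.
have [|l [lfE slE]] := lf C B s a b sq; first by move=> x; rewrite /= aE /= sE piC bE.
have [t tE] := choice (fun j => qs (l (v j))).
have [tau [tauE tauC tauX]] := mmapP (@mpolyC n A) t.
have qtau p : qc (tau p) = l (pi p).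
  apply: (@mpoly_rmorph_eq _ _ _ (qc \o tau) (l \o pi)) => [c|j] /=.
    by rewrite tauC piC; have := lfE c; rewrite /= => ->; rewrite aE.
  by rewrite tauX piX tE.
have pitau p : pi (tau p) = pi p.
  by rewrite -sE qtau; have := slE (pi p); rewrite /= => ->; rewrite bE.
exists tau; split=> //; split=> // i; apply: I2; apply/qk; rewrite qtau.
suff -> : pi (r i) = 0 by rewrite lr0.
apply/pi_k; exists (fun j => (j == i)%:R); rewrite (bigD1 i) //= eqxx mul1r big1 ?addr0 // => j /negPf ->.
by rewrite mul0r.
Qed.

(** If w f(a) were in p0 B, then after inverting w the element a would lie in p0 + I. As tau fixes a
    and squares I, a lies in p0 + I^(2^j) for every j, and Krull's theorem gives a(1 - i) in p0 with
    i in I. The reduction modulo p0 is a domain in which a is nonzero, so 1 - i becomes 0, whereas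
    phi sends 1 - i to 1. *)
Lemma going_down_unit A B (f : {lrmorphism A -> B}) K (phi : {lrmorphism B -> K}) (p0 : ideal A) w a :
  fin_presented f -> sq_lift f -> is_field K -> prime_ideal p0 -> (forall x, p0 x -> phi (f x) = 0) ->
  phi w != 0 -> ~ p0 a -> ~ igen (fun y => exists2 x, p0 x & y = f x) (w * f a).
Proof.
move=> fp lf Kf pP p0f pw pa /igen_fin [N [c [b [Sb Ewa]]]].
have [n [m [r [pi [tau [pis piC pik tauC [pitau tau2]]]]]]] := etale_tau fp lf.
pose P := {mpoly A[n]}; pose S := {poly P}.
have Sb' i : exists x, p0 x /\ b i = f x by have [x ? ?] := Sb i; exists x.
have [b' Eb'] := choice Sb'.
have [e Ee] := pis w; have [c' Ec'] := choice (fun i => pis (c i)).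
have [g Eg] : exists g : 'I_m -> P, e * a%:MP - \sum_i c' i * (b' i)%:MP = \sum_i g i * r i.
  apply/pik; rewrite rmorphB rmorphM Ee piC Ewa rmorph_sum /=; apply/eqP; rewrite subr_eq0; apply/eqP.
  by apply: eq_bigr => i _; rewrite rmorphM Ec' piC; have [_ ->] := Eb' i.
have [d Ed] : exists d : 'I_m -> P, e - tau e = \sum_i d i * r i.
  by apply/pik; rewrite rmorphB pitau subrr.
have [ee Eee] := choice tau2.
(* The variable X stands for 1 / e. The Newton step X(2 - tau(e) X) for the inverse of tau(e) sends
   u = eX - 1 to minus the square of tau(e) X - 1, so u behaves like the other generators. *)
pose t' : S := 'X * (2%:R - (tau e)%:P * 'X).
pose tau' : {rmorphism S -> S} :=
  horner_morph (fun x => mulrC t' (((@polyC P) \o tau : {rmorphism P -> S}) x)).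
have tauP p : tau' p%:P = (tau p)%:P by rewrite /tau' /= horner_morphC.
have tauX : tau' 'X = t' by rewrite /tau' /= horner_morphX.
pose u : S := e%:P * 'X - 1.
have Etu : tau' u = - ((u - (e - tau e)%:P * 'X) * (u - (e - tau e)%:P * 'X)).
  by rewrite /u rmorphB rmorphM tauP tauX rmorph1 /t' polyCB; ring.
pose kap : {rmorphism k -> S} := (@polyC P) \o (@mpolyC n A) \o (GRing.in_alg A : {rmorphism k -> A}).
pose G (s : S) := [\/ exists x : A, s = x%:MP%:P, exists j, s = ('X_j)%:P | s = 'X].
have GS s : exists2 z, {in z, forall x, G x} & fgen kap z s.
  have cat z z' : {in z, forall x, G x} -> {in z', forall x, G x} -> {in z ++ z', forall x, G x}.
    by move=> h h' x; rewrite mem_cat => /orP [/h|/h'].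
  have mono z z' z2 x : {in z, forall x, G x} -> {in z', forall x, G x} -> fgen kap z x ->
     (z2 = z ++ z' \/ z2 = z' ++ z) -> fgen kap z2 x.
    move=> _ _ h E; apply: fgen_sub h => y yz; apply: fgen_mem.
    by case: E => ->; rewrite mem_cat yz ?orbT.
  have add x y : (exists2 z, {in z, forall x, G x} & fgen kap z x) ->
     (exists2 z, {in z, forall x, G x} & fgen kap z y) -> exists2 z, {in z, forall x, G x} & fgen kap z (x + y).
    move=> [z zG zx] [z' zG' zy]; exists (z ++ z'); first exact: cat.
    by apply: fgenD; [apply: (mono z z') => //; left|apply: (mono z' z) => //; right].
  have mul x y : (exists2 z, {in z, forall x, G x} & fgen kap z x) ->
     (exists2 z, {in z, forall x, G x} & fgen kap z y) -> exists2 z, {in z, forall x, G x} & fgen kap z (x * y).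
    move=> [z zG zx] [z' zG' zy]; exists (z ++ z'); first exact: cat.
    by apply: fgenM; [apply: (mono z z') => //; left|apply: (mono z' z) => //; right].
  have gx x : G x -> exists2 z, {in z, forall x, G x} & fgen kap z x.
    by move=> Gx; exists [:: x]; [move=> y; rewrite inE => /eqP ->|apply: fgen_mem; rewrite inE].
  apply: (@poly_mpoly_ind A n (fun s => exists2 z, {in z, forall x, G x} & fgen kap z s) _ _ _ add mul).
  - by move=> x; apply: gx; constructor 1; exists x.
  - by move=> i; apply: gx; constructor 2; exists i.
  - by apply: gx; constructor 3.
(* All elements occurring in the finitely many relations. A polynomial ring T over k maps onto a
   subring containing them, and Krull's theorem is applied in T because A is arbitrary. *)
pose l : seq S := [:: 'X; t'; u; e%:P; a%:MP%:P] ++ [seq ('X_j)%:P | j : 'I_n] ++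
  [seq (tau 'X_j)%:P | j : 'I_n] ++ [seq (r i)%:P | i : 'I_m] ++ [seq (g i)%:P | i : 'I_m] ++
  [seq (d i)%:P | i : 'I_m] ++ [seq (c' i)%:P | i : 'I_N] ++ [seq (b' i)%:MP%:P | i : 'I_N] ++
  [seq (ee ij.1.1 ij.1.2 ij.2)%:P | ij : 'I_m * 'I_m * 'I_m].
have [z zG zl] := fgen_family l GS.
pose T := {mpoly k[size z]}.
have [Psi [PsiE PsiC PsiX]] := mmapP kap (fun i : 'I_(size z) => nth 0 z i).
have lift s : fgen kap z s -> exists p, Psi p = s by move=> [p <-]; exists p.
have tz s : s \in z -> fgen kap z (tau' s).
  move=> sz; case: (zG _ sz) => [[x Ex]|[j Ej]|EX].
  - by rewrite Ex tauP tauC -Ex; apply: fgen_mem.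
  - by rewrite Ej tauP; apply: zl; rewrite !mem_cat (map_f (fun j => (tau 'X_j)%:P)) ?mem_enum ?orbT.
  - by rewrite EX tauX; apply: zl; rewrite !inE eqxx orbT.
have [th thE] := choice (fun i : 'I_(size z) => lift _ (tz _ (mem_nth 0 (ltn_ord i)))).
have [Th [_ ThC ThX]] := mmapP (@mpolyC (size z) k) th.
have PsiTh p : Psi (Th p) = tau' (Psi p).
  apply: (@mpoly_rmorph_eq _ _ _ (Psi \o Th) (tau' \o Psi)) => [x|i] /=.
    by rewrite ThC PsiC /kap /= tauP tauC.
  by rewrite ThX thE PsiX.
have lf1 s : s \in l -> exists p, Psi p = s by move=> /zl /lift.
have hR (i : 'I_m) : exists p, Psi p = (r i)%:P.
  by apply: lf1; rewrite !mem_cat (map_f (fun i => (r i)%:P)) ?mem_enum ?orbT.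
have [R ER] := choice hR.
have hG' (i : 'I_m) : exists p, Psi p = (g i)%:P.
  by apply: lf1; rewrite !mem_cat (map_f (fun i => (g i)%:P)) ?mem_enum ?orbT.
have [G' EG] := choice hG'.
have hD' (i : 'I_m) : exists p, Psi p = (d i)%:P.
  by apply: lf1; rewrite !mem_cat (map_f (fun i => (d i)%:P)) ?mem_enum ?orbT.
have [D' ED] := choice hD'.
have hC' (i : 'I_N) : exists p, Psi p = (c' i)%:P.
  by apply: lf1; rewrite !mem_cat (map_f (fun i => (c' i)%:P)) ?mem_enum ?orbT.
have [C' EC] := choice hC'.
have hB' (i : 'I_N) : exists p, Psi p = (b' i)%:MP%:P.
  by apply: lf1; rewrite !mem_cat (map_f (fun i => (b' i)%:MP%:P)) ?mem_enum ?orbT.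
have [B' EB] := choice hB'.
have hE' (i : 'I_m * 'I_m * 'I_m) : exists p, Psi p = (ee i.1.1 i.1.2 i.2)%:P.
  by apply: lf1; rewrite !mem_cat (map_f (fun ij : 'I_m * 'I_m * 'I_m => (ee ij.1.1 ij.1.2 ij.2)%:P)) ?mem_enum ?orbT.
have [E' EE] := choice hE'.
have [X' EX] : exists p, Psi p = 'X by apply: lf1; rewrite !inE eqxx.
have [U' EU] : exists p, Psi p = u by apply: lf1; rewrite !inE eqxx ?orbT.
have [al Eal] : exists p, Psi p = a%:MP%:P by apply: lf1; rewrite !inE eqxx ?orbT.
pose J : ideal T := igen (fun p => p = U' \/ exists i, p = R i).
have JU : J U' by apply: igen_mem; left.
have JR i : J (R i) by apply: igen_mem; right; exists i.
(* The part of p0 that is used, together with the relations between the chosen generators. *)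
pose N1 : ideal T := iadd (iker Psi) (igen (fun p => exists i, p = B' i)).
have N1k p : Psi p = 0 -> N1 p by move=> h; apply: (@iaddl _ (iker Psi)).
have N1b i : N1 (B' i) by apply: iaddr; apply: igen_mem; exists i.
have ThN p : N1 p -> N1 (Th p).
  apply: (@iadd_sub _ _ _ (ipre Th N1)) => {}p.
    by move=> h; apply: N1k; rewrite PsiTh (h : Psi p = 0) rmorph0.
  apply: igen_sub => _ [i ->]; change (N1 (Th (B' i))).
  rewrite -(subrK (B' i) (Th (B' i))); apply: idealD => //; apply: N1k.
  by rewrite rmorphB PsiTh EB tauP tauC subrr.
pose W j : ideal T := iadd N1 (ipow J j).
have WM j j' x y : W j x -> W j' y -> W (j + j')%N (x * y).
  move=> [x1 Nx1 Jx2] [y1 Ny1 Jy2]; exists (x1 * y + (x - x1) * y1).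
    by apply: idealD; [exact: idealMr|exact: idealM].
  by rewrite (_ : _ - _ = (x - x1) * (y - y1)); [apply: ipow_mul|ring].
have W2 p : J p -> W 2 (Th p).
  apply: (@igen_sub _ _ (ipre Th (W 2))) => _ [->|[i ->]].
    change (W 2 (Th U')).
    have [v Jv Pv] : exists2 v, J v & Psi v = u - (e - tau e)%:P * 'X.
      exists (U' - (\sum_i D' i * R i) * X').
        by apply: idealB => //; apply: idealMr; apply: ideal_sum => i _; apply: idealM.
      rewrite (rmorphB Psi) (rmorphM Psi) (rmorph_sum Psi) EU EX Ed rmorph_sum.
      by congr (_ - _ * _); apply: eq_bigr => i _; rewrite (rmorphM Psi) ED ER /= polyCM.
    rewrite -(subrK (- (v * v)) (Th U')); apply: idealD.
      apply/iaddl/N1k; rewrite opprK (rmorphD Psi) PsiTh EU Etu (rmorphM Psi) Pv.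
      exact: addNr.
    by apply: idealN; apply: (@iaddr _ N1 (ipow J 2)); apply: (@ipow_mul _ J 1 1); apply: ipow1.
  change (W 2 (Th (R i))); pose v := \sum_a \sum_b E' (i, a, b) * (R a * R b).
  rewrite -(subrK v (Th (R i))); apply: idealD.
    apply/iaddl/N1k; rewrite rmorphB PsiTh ER tauP Eee /v !rmorph_sum /=; apply/eqP; rewrite subr_eq0; apply/eqP.
    apply: eq_bigr => x _; rewrite !rmorph_sum; apply: eq_bigr => y _.
    rewrite !(rmorphM Psi) EE !ER /=. rewrite -!polyCM. reflexivity.
  apply: (@iaddr _ N1 (ipow J 2)); apply: ideal_sum => x _; apply: ideal_sum => y _.
  by apply: idealM; apply: (@ipow_mul _ J 1 1); apply: ipow1.
have Wth j p : W j p -> W (j * 2)%N (Th p).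
  apply: (@iadd_sub _ _ _ (ipre Th (W (j * 2)%N))) => {}p.
    by move=> h; apply/iaddl/ThN.
  apply: (@igen_sub _ _ (ipre Th (W (j * 2)%N))) => _ [h hJ ->].
  change (W (j * 2)%N (Th (\prod_i h i))); rewrite rmorph_prod.
  elim: j h hJ => [|j IHj] h hJ; first by rewrite big_ord0; apply/iaddr/ipow0.
  by rewrite big_ord_recl mulSn; apply: WM; [apply: W2|apply: IHj].
have Wal j : W (2 ^ j)%N al.
  elim: j => [|j IHj].
    (* The start of the induction is a = X e a - u a, where e a is known modulo p0 and I. *)
    pose v := X' * (\sum_i G' i * R i) - U' * al; pose v' := X' * (\sum_i C' i * B' i).
    rewrite -(subrK (v + v') al); apply: idealD; last first.
      rewrite addrC; apply: idealD.
        by apply: iaddl; apply: idealM; apply: ideal_sum => i _; apply: idealM.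
      apply: (@iaddr _ N1 (ipow J 1)); apply: ipow1; apply: idealB; last exact: idealMr.
      by apply: idealM; apply: ideal_sum => i _; apply: idealM.
    have P1 : Psi (\sum_i G' i * R i) = (e * a%:MP - \sum_i c' i * (b' i)%:MP)%:P.
      rewrite Eg (rmorph_sum Psi) rmorph_sum; apply: eq_bigr => i _.
      by rewrite (rmorphM Psi) EG ER /= -!polyCM.
    have P2 : Psi (\sum_i C' i * B' i) = (\sum_i c' i * (b' i)%:MP)%:P.
      rewrite (rmorph_sum Psi) rmorph_sum; apply: eq_bigr => i _.
      by rewrite (rmorphM Psi) EC EB /= -!polyCM.
    apply/iaddl/N1k; rewrite (rmorphB Psi) (rmorphD Psi) (rmorphB Psi) !(rmorphM Psi) P1 P2 EX EU Eal.
    move: (\sum_i _) => y; rewrite /u polyCB polyCM.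
    move: (e%:P) (a%:MP%:P) (y%:P) ('X : S) => e1 a1 y1 x1; ring.
  rewrite -(subrK (Th al) al); apply: idealD; last by rewrite expnSr; apply: Wth.
  by apply/iaddl/N1k; rewrite rmorphB PsiTh Eal tauP tauC subrr.
have [j|i Ji Ni] := @krull _ N1 J al (@noeth_mpoly k (size z)).
  have : W (2 ^ j)%N al by [].
  apply: (@iadd_sub _ N1 (ipow J (2 ^ j)) (iadd N1 (ipow J j))) => y hy; first exact: iaddl.
  by apply: iaddr; apply: ipow_leq hy; apply/ltnW/ltn_expl.
pose Sg : {rmorphism S -> {poly {mpoly (dquot pP)[n]}}} := map_poly (map_mpoly (dpi pP)).
have SgC x : Sg x%:MP%:P = (dpi pP x)%:MP%:P by rewrite /Sg /= map_polyC /= map_mpolyC.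
have SgN p : N1 p -> Sg (Psi p) = 0.
  apply: (@iadd_sub _ (iker Psi) (igen (fun p => exists i, p = B' i)) (ipre Psi (iker Sg))) => {}p.
    by move=> h; change (Sg (Psi p) = 0); rewrite (h : Psi p = 0) rmorph0.
  apply: igen_sub => _ [j ->]; change (Sg (Psi (B' j)) = 0).
  have dj : dpi pP (b' j) = 0 by apply/dpi0; have [] := Eb' j.
  by rewrite EB SgC dj !rmorph0.
have Si : Sg (Psi (1 - i)) = 0.
  have : Sg (Psi al) * Sg (Psi (1 - i)) = 0.
    by rewrite -(rmorphM Sg) -(rmorphM Psi); apply: SgN; rewrite mulrBr mulr1 mulrC.
  move/eqP; rewrite mulf_eq0 => /orP [/eqP|/eqP //].
  by rewrite Eal SgC => /eqP; rewrite polyC_eq0 mpolyC_eq0 => /eqP /dpi0.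
have [||phi0 phi0E] := @rmorphism_factor A (dquot pP) K (dpi pP) (phi \o f : {rmorphism A -> K}).
- exact: dpi_surj.
- by move=> x /dpi0 /p0f.
pose ev1 : {rmorphism S -> K} := horner_morph (fun x => mulrC (phi w)^-1 ((phi \o pi : {rmorphism P -> K}) x)).
have [ev2 [_ ev2C ev2X]] := mmapP phi0 (fun j => phi (pi 'X_j)).
pose ev3 : {rmorphism {poly {mpoly (dquot pP)[n]}} -> K} := horner_morph (fun x => mulrC (phi w)^-1 (ev2 x)).
have ev13 s : ev1 s = ev3 (Sg s).
  have e1 p : ev2 (map_mpoly (dpi pP) p) = phi (pi p).
    apply: (@mpoly_rmorph_eq _ _ _ (ev2 \o map_mpoly (dpi pP)) (phi \o pi)) => [x|j] /=.
      by rewrite map_mpolyC ev2C phi0E piC.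
    by rewrite map_mpolyX ev2X.
  elim/poly_ind: s => [|s x IH]; first by rewrite !rmorph0.
  rewrite (rmorphD ev1) (rmorphM ev1) (rmorphD Sg) (rmorphM Sg) (rmorphD ev3) (rmorphM ev3) IH.
  congr (_ * _ + _); first by rewrite /ev1 /ev3 /Sg /= map_polyX !horner_morphX.
  by rewrite /ev1 /ev3 /Sg /= map_polyC !horner_morphC /= e1.
have ev0 : ev1 (Psi (1 - i)) = 0 by rewrite ev13 Si rmorph0.
have evJ p : J p -> ev1 (Psi p) = 0.
  apply: (@igen_sub _ _ (iker (ev1 \o Psi))) => _ [->|[j ->]] /=.
    by rewrite EU /u rmorphB rmorphM rmorph1 /ev1 /= horner_morphC horner_morphX /= Ee mulrV ?subrr // Kf.
  rewrite ER /ev1 /= horner_morphC /= (_ : pi _ = 0) ?lr0 //.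
  apply/pik; exists (fun j' => (j' == j)%:R); rewrite (bigD1 j) //= eqxx mul1r big1 ?addr0 // => j' /negPf ->.
  by rewrite mul0r.
by move: ev0; rewrite rmorphB rmorph1 rmorphB rmorph1 evJ // subr0 => /eqP; rewrite oner_eq0.
Qed.

(** A prime that contains p0 B and avoids all products w f(a), with phi w nonzero and a outside p0,
    is contained in the kernel of phi and contracts to p0. *)
Lemma going_down A B (f : {lrmorphism A -> B}) K (phi : {lrmorphism B -> K}) (p0 : ideal A) :
  fin_presented f -> sq_lift f -> is_field K -> prime_ideal p0 -> (forall x, p0 x -> phi (f x) = 0) ->
  exists Q : ideal B, [/\ prime_ideal Q, forall b, Q b -> phi b = 0 & forall a, Q (f a) <-> p0 a].
Proof.
move=> fp lf Kf pP p0f.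
pose S y := exists w a, [/\ y = w * f a, phi w != 0 & ~ p0 a].
have [||Q [pQ IQ SQ]] := @prime_avoid B S (igen (fun y => exists2 x, p0 x & y = f x)).
- split; first by exists 1, 1; rewrite mul1r lr1 lr1 oner_neq0; split=> //; case: pP.
  move=> _ _ [w [a [-> pw pa]]] [w' [a' [-> pw' pa']]]; exists (w * w'), (a * a'); split.
  - by rewrite lrM mulrACA.
  - by rewrite lrM; apply: field_mul.
  - by case: pP => _ h /h [].
- by move=> _ [w [a [-> pw pa]]]; apply: (going_down_unit fp lf Kf pP p0f pw pa).
have p01 : ~ p0 1 by case: pP.
exists Q; split=> // [b Qb|a].
  apply: contrapT => /eqP pb; apply: (SQ b) => //; exists b, 1; split=> //; by rewrite lr1 mulr1.
split=> [Qa|pa]; last by apply/IQ/igen_mem; exists a.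
by apply: contrapT => pa; apply: (SQ (f a)) => //; exists 1, a; rewrite mul1r lr1 oner_neq0.
Qed.
End EtaleTau.

Section BaseChange.
Context (k : closedFieldType).
Implicit Types A B C D K L : comUnitAlgType k.

(** W is a complement of K relative to the list l, built one generator at a time; it plays the role
    of a K-linear projection of the finitely many relevant coefficients onto K. *)
Lemma linear_splitting K K1 (i : {lrmorphism K -> K1}) (l : seq K1) : is_field K ->
  exists W : K1 -> Prop, [/\ W 0, forall x y, W x -> W y -> W (x + y), forall a x, W x -> W (i a * x),
    forall a, W (i a) -> a = 0 & forall x, x \in l -> exists a, W (x - i a)].
Proof.
move=> Kf; elim: l => [|h l [W [W0 WD WZ Wi Wl]]].
  exists (fun x => x = 0); split=> // [x y -> ->|a x ->|a ia]; rewrite ?addr0 ?mulr0 //.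
  by apply: contrapT => /eqP a0; have := field_map i Kf a0; rewrite ia eqxx.
have [[a Wa]|nh] := pselect (exists a, W (h - i a)).
  exists W; split=> // x; rewrite inE => /orP [/eqP ->|/Wl //]; by exists a.
exists (fun x => exists c, W (x - i c * h)); split.
- by exists 0; rewrite lr0 mul0r subr0.
- move=> x y [c Wc] [d Wd]; exists (c + d); have := WD _ _ Wc Wd; congr W; rewrite lrD; ring.
- move=> a x [c Wc]; exists (a * c); have := WZ a _ Wc; congr W; rewrite lrM; ring.
- move=> a [c Wc]; case: (eqVneq c 0) => [c0|c0].
    by apply: Wi; move: Wc; rewrite c0 lr0 mul0r subr0.
  case: nh; exists (c^-1 * a); have cu := Kf _ c0.
  have E : i c^-1 * i c = 1 by rewrite -lrM mulVr ?lr1.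
  have EN : i (- c^-1) = - i c^-1 by rewrite -[- _ in LHS]sub0r lrB lr0 sub0r.
  have := WZ (- c^-1) _ Wc; congr W; rewrite EN lrM.
  by transitivity (i c^-1 * i c * h - i c^-1 * i a); [ring|rewrite E mul1r].
- move=> x; rewrite inE => /orP [/eqP ->|/Wl [a Wa]].
    by exists 0, 1; rewrite lr0 lr1 mul1r subr0 subrr.
  by exists a, 0; rewrite lr0 mul0r subr0.
Qed.

(** Projecting the coefficients of h to K along W gives g; the coefficients of the error then lie
    both in K and in W. *)
Lemma ideal_descent K K1 (i : {lrmorphism K -> K1}) n m (r : 'I_m -> {mpoly K[n]}) (p : {mpoly K[n]})
    (h : 'I_m -> {mpoly K1[n]}) : is_field K ->
  map_mpoly i p = \sum_j h j * map_mpoly i (r j) -> exists g : 'I_m -> {mpoly K[n]}, p = \sum_j g j * r j.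
Proof.
move=> Kf Ep; pose l := flatten [seq [seq (h j)@_e | e <- msupp (h j)] | j : 'I_m].
have [W [W0 WD WZ Wi Wl]] := linear_splitting i l Kf.
have Wh je : exists a, W ((h je.1)@_je.2 - i a).
  case: je => j e /=; case: (boolP (e \in msupp (h j))) => eh.
    apply: Wl; apply/flattenP; exists [seq (h j)@_e | e <- msupp (h j)].
      by apply: map_f; rewrite mem_enum.
    exact: map_f.
  by exists 0; rewrite memN_msupp_eq0 // lr0 subrr.
have [a aE] := choice Wh.
pose g j : {mpoly K[n]} := \sum_(e <- msupp (h j)) a (j, e) *: 'X_[e].
have gE j e : W ((h j)@_e - i (g j)@_e).
  rewrite /g raddf_sum /=; case: (boolP (e \in msupp (h j))) => eh.
    rewrite (bigD1_seq e) //= mcoeffZ mcoeffX eqxx mulr1 big1 ?addr0; first exact: (aE (j, e)).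
    by move=> e' ne; rewrite mcoeffZ mcoeffX (negPf ne) mulr0.
  rewrite memN_msupp_eq0 // big_seq big1 ?lr0 ?subrr // => e' e'h.
  rewrite mcoeffZ mcoeffX; case: eqP => [E|]; last by rewrite mulr0.
  by rewrite -E e'h in eh.
exists g; apply/eqP; rewrite -subr_eq0; apply/eqP/mpolyP => e; rewrite mcoeff0; apply: Wi.
have -> : i (p - \sum_j g j * r j)@_e = (\sum_j (h j - map_mpoly i (g j)) * map_mpoly i (r j))@_e.
  rewrite -(mcoeff_map_mpoly i) (rmorphB (map_mpoly i)) /= (rmorph_sum (map_mpoly i)) /= Ep; congr (_ @_ e).
  by rewrite -sumrB; apply: eq_bigr => j _; rewrite (rmorphM (map_mpoly i)) mulrBl.
rewrite raddf_sum; elim/big_ind: _ => // j _ /=; rewrite mcoeffM; elim/big_ind: _ => // -[e1 e2] /= _.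
by rewrite mulrC mcoeff_map_mpoly; apply: WZ; rewrite mcoeffB mcoeff_map_mpoly.
Qed.

(** If a power of e vanished after extension to K1, ideal membership would descend and it would
    vanish in B, which the map b to a field excludes. So some prime of the extended algebra avoids
    e. *)
Lemma base_change K B (f : {lrmorphism K -> B}) K1 (i : {lrmorphism K -> K1}) K2 (b : {lrmorphism B -> K2}) e :
  fin_presented f -> is_field K -> is_field K2 -> b e != 0 ->
  exists L (be : {lrmorphism B -> L}) (j : {lrmorphism K1 -> L}),
    [/\ is_field L, be \o f =1 j \o i & be e != 0].
Proof.
move=> [n [m [v [r [ps pk]]]]] Kf Kf2 be.
have [pi [piE piC piX]] := mmapP (f : {rmorphism K -> B}) v.
have [e' Ee] := ps e; rewrite -piE in Ee.
pose M : {rmorphism {mpoly K[n]} -> {mpoly K1[n]}} := map_mpoly i.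
pose I : ideal {mpoly K1[n]} := fin_ideal (fun y => exists j, y = M (r j)).
have In y : I y -> exists h : 'I_m -> {mpoly K1[n]}, y = \sum_j h j * M (r j).
  move=> [N [c [b' [Sb ->]]]]; have [ix Eix] := choice Sb.
  exists (fun j => \sum_(l < N | ix l == j) c l).
  rewrite (partition_big ix xpredT) //=; apply: eq_bigr => j _.
  by rewrite mulr_suml; apply: eq_bigr => l /eqP <-; rewrite Eix.
have [||P [pP IP SP]] := @prime_avoid _ (fun y => exists l, y = M e' ^+ l) I.
- split; first by exists 0%N.
  by move=> _ _ [l ->] [l' ->]; exists (l + l')%N; rewrite exprD.
- move=> _ [l ->] /In [h Eh]; have [|g Eg] := ideal_descent (p := e' ^+ l) (r := r) (i := i) (h := h) Kf.
    by rewrite -Eh; exact: rmorphXn.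
  have : pi (e' ^+ l) = 0 by rewrite piE; apply/pk; exists g.
  rewrite rmorphXn Ee => /(congr1 b); rewrite lrX lr0 => /eqP; apply/negP; exact: field_exp.
have [Q [qc [qs q0 qC]]] := quotient_alg ((@mpolyC n K1) \o (GRing.in_alg K1 : {rmorphism k -> K1}) : {rmorphism k
  -> _}) (proj1 pP).
have pZ : prime_ideal (iker (idfun : {rmorphism Q -> Q})).
  split=> [/eqP|x y]; first by rewrite oner_eq0.
  have [s <-] := qs x; have [t <-] := qs y; rewrite /= -rmorphM => /q0 /(proj2 pP) [] /q0 ->; by [left|right].
have [L [al [Lf al0]]] := residue_field pZ.
have [|jj jE] := @lr_of k K1 Q (qc \o (@mpolyC n K1)); first by move=> c; rewrite -qC.
have [||||bq bqE] := @lr_factor k _ B Q ((@mpolyC n K) \o (GRing.in_alg K)) pi (qc \o M).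
- by move=> u; have [p <-] := ps u; exists p.
- move=> p; rewrite piE => /pk [c ->].
  have r0 l : qc (M (r l)) = 0.
    by apply/q0/IP; exists 1%N, (fun=> 1), (fun=> M (r l)); split; [move=> _; exists l|rewrite big_ord1 mul1r].
  by rewrite (rmorph_sum (qc \o M)) big1 // => l _; rewrite (rmorphM (qc \o M)) /= r0 mulr0.
- by move=> c; rewrite /= piC /= lrA.
- by move=> c; rewrite /= /M map_mpolyC -qC /=; congr (qc (_ %:MP)); exact: lrA.
have [bL bLE] := lr_comp bq al; have [jL jLE] := lr_comp jj al.
exists L, bL, jL; split=> // [x|].
  by rewrite /= bLE jLE /= -piC bqE /= /M map_mpolyC jE.
rewrite bLE /= -Ee bqE /=; apply/eqP => /al0 /q0 h; apply: (SP _ _ h).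
by exists 1%N; rewrite expr1.
Qed.
End BaseChange.

(** * Connectedness of the zip group *)

Section EPath.
Context (k : closedFieldType) (q : nat) (q0 : (0 < q)%N).
Implicit Types A B C D K L : comUnitAlgType k.

(** The segment 1 + t(x - 1), with its entrywise q-th powers as Levi blocks of the second component
    and the remaining entries of y scaled by t, joins the identity to (x, y) over K[t] localized at
    the determinants. *)
Lemma E_path K (x y : gl K) : is_field K -> in_E q x y ->
  exists A (j : {lrmorphism K -> A}) (f0 f1 : {lrmorphism A -> K}) (x' y' : gl A),
  [/\ forall a b : A, a * b = 0 -> a = 0 \/ b = 0, f0 \o j =1 id, f1 \o j =1 id, in_E q x' y' &
    [/\ glmap f0 x' = gl1 K, glmap f0 y' = gl1 K, glmap f1 x' = x & glmap f1 y' = y]].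
Proof.
move=> Kf /(in_EP q0) [lx uy Exy]; have [B [io [j [ios io0 jE hU]]]] := poly_alg K.
have Bd (a b : B) : a * b = 0 -> a = 0 \/ b = 0.
  have [p <-] := ios a; have [r <-] := ios b; rewrite -rmorphM => /io0 pr.
  case: (eqVneq p 0) => [->|p0]; first by left; rewrite rmorph0.
  case: (eqVneq r 0) => [->|r0]; first by right; rewrite rmorph0.
  have l0 : lead_coef p * lead_coef r != 0 by apply: field_mul; rewrite ?lead_coef_eq0.
  by have := lead_coef_proper_mul l0; rewrite pr lead_coef0 => l1; rewrite -l1 eqxx in l0.
pose t := io 'X.
pose M : 'M[B]_4 := 1%:M + t *: (map_mx j (val x) - 1%:M).
pose N : 'M[B]_4 := \matrix_(a, b) if sblk a b then M a b ^+ q else t * j (val y a b).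
have [id_ idE] := lr_id K.
have [f0 [f0j f0p]] := hU K id_ 0; have [f1 [f1j f1p]] := hU K id_ 1.
have f0t : f0 t = 0 by rewrite f0p map_polyX hornerX.
have f1t : f1 t = 1 by rewrite f1p map_polyX hornerX.
have lM : lowb M.
  move=> a b ha hb; rewrite !mxE lx // lr0.
  have -> : (a == b) = false by apply/negP => /eqP E; move: hb; rewrite -E leqNgt ha.
  by rewrite mulr0n subrr mulr0 addr0.
have dM z (f : {lrmorphism B -> K}) : (forall a, f (j a) = id_ a) -> f t = z ->
   map_mx f M = 1%:M + z *: (val x - 1%:M).
  move=> fj ft; apply/matrixP => a b; rewrite !mxE lrD lrM ft lrB fj idE.
  by case: (a == b); rewrite ?lr1 ?lr0.
have dN z (f : {lrmorphism B -> K}) : (forall a, f (j a) = id_ a) -> f t = z ->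
   forall a b, f (N a b) = if sblk a b then (1%:M + z *: (val x - 1%:M)) a b ^+ q else z * val y a b.
  move=> fj ft a b; rewrite mxE; case: ifP => _; last by rewrite lrM ft fj idE.
  by rewrite lrX; congr (_ ^+ q); have := congr1 (fun m : 'M_4 => m a b) (dM z f fj ft); rewrite mxE.
have M0 : map_mx f0 M = 1%:M by rewrite (dM 0) // scale0r addr0.
have M1 : map_mx f1 M = val x by rewrite (dM 1) // scale1r addrC subrK.
have N0 : map_mx f0 N = 1%:M.
  apply/matrixP => a b; rewrite [LHS]mxE (dN 0) // scale0r addr0 mul0r mxE.
  case: (eqVneq a b) => [->|_]; first by rewrite /sblk eqxx expr1n.
  by rewrite expr0n eqn0Ngt q0 if_same.
have N1 : map_mx f1 N = val y.
  apply/matrixP => a b; rewrite [LHS]mxE (dN 1) // scale1r addrC subrK mul1r.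
  by case: ifP => // ab; rewrite Exy.
pose d := \det M * \det N.
have d0 : f0 d = 1.
  have Ed (Q : 'M[B]_4) : f0 (\det Q) = \det (map_mx f0 Q) by rewrite det_map_mx.
  by rewrite lrM !Ed M0 N0 det1 mulr1.
have d1 : f1 d \is a GRing.unit.
  have Ed (Q : 'M[B]_4) : f1 (\det Q) = \det (map_mx f1 Q) by rewrite det_map_mx.
  by rewrite lrM !Ed M1 N1; apply: unitrM_imp; rewrite -unitmxE; apply: valP.
have dn n : d ^+ n != 0.
  by apply/eqP => /(congr1 f0); rewrite lrX d0 expr1n lr0 => /eqP; rewrite oner_eq0.
have [A [g [lg gU]]] := localization dn; have [gd gB g0] := lg.
have [|h0 h0E] := gU _ f0; first by rewrite d0 unitr1.
have [h1 h1E] := gU _ f1 d1.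
have [jA jAE] := lr_comp j g.
have uM : map_mx g M \in unitmx.
  by rewrite unitmxE det_map_mx; move: gd; rewrite lrM unitrM => /andP [].
have uN : map_mx g N \in unitmx.
  by rewrite unitmxE det_map_mx; move: gd; rewrite lrM unitrM => /andP [].
exists A, jA, h0, h1, (gl_mk uM), (gl_mk uN).
have mapE (h : {lrmorphism A -> K}) (f : {lrmorphism B -> K}) (Q : 'M[B]_4) :
    h \o g =1 f -> map_mx h (map_mx g Q) = map_mx f Q.
  by move=> E; apply/matrixP => a b; rewrite !mxE; apply: E.
split.
- move=> a b ab; have [a' [n En]] := gB a; have [b' [m Em]] := gB b.
  have : g (a' * b') = 0 by rewrite lrM -En -Em mulrACA ab mul0r.
  have un l : g d ^+ l \is a GRing.unit by apply: unitrX.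
  case/g0 => l /Bd [/Bd [a0|b0]|/eqP]; last by rewrite (negPf (dn l)).
    by left; apply: (mulIr (un n)); rewrite En a0 lr0 mul0r.
  by right; apply: (mulIr (un m)); rewrite Em b0 lr0 mul0r.
- by move=> a; rewrite /= jAE; have := h0E (j a); rewrite /= => ->; rewrite f0j idE.
- by move=> a; rewrite /= jAE; have := h1E (j a); rewrite /= => ->; rewrite f1j idE.
- apply/(in_EP q0); split=> /=.
  + exact: lowb_map.
  + move=> a b ha hb; rewrite !mxE.
    have -> : sblk a b = false by rewrite /sblk hb ltnNge ha.
    by rewrite uy // lr0 mulr0 lr0.
  + by move=> a b ab; rewrite !mxE ab lrX.
by split; apply: val_inj; rewrite /= ?(mapE _ _ _ h0E) ?(mapE _ _ _ h1E).
Qed.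
End EPath.

(** * Descent of clopen sets of k-points to the connected components *)

Section Component.
Context (k : fieldType) (S : kfunctor k).
Implicit Types A B C D K L : comUnitAlgType k.

Lemma open_of (T : forall K, S K -> Prop) :
  (forall A (a : S A) K (f : {lrmorphism A -> K}), is_field K -> T K (fmap f a) ->
    exists2 x, f x != 0 & forall L (g : {lrmorphism A -> L}), is_field L -> g x != 0 -> T L (fmap g a)) ->
  open_sub (fun A a => forall K (f : {lrmorphism A -> K}), is_field K -> T K (fmap f a)).
Proof.
move=> hT A a; exists (fun x => forall L (g : {lrmorphism A -> L}), is_field L -> g x != 0 -> T L (fmap g a)).
move=> B f; split=> [h|[n [b [x [Ix E1]]]] K g Kf].
  have : igen (fun y => exists2 x, (forall L (g : {lrmorphism A -> L}), is_field L -> g x != 0 -> T L (fmap g a)) &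
    y = f x) 1.
    apply: prime_unit => P pP SP; have [L [g [Lf g0]]] := residue_field pP.
    have [gf gfE] := lr_comp f g.
    have := h L g Lf; rewrite -(fmap_comp _ gfE) => /hT -/(_ Lf) [x gx hx].
    move/eqP: gx; apply; rewrite gfE /=; apply/g0/SP/igen_mem; by exists x.
  case/igen_fin => n [b [y [Sy ->]]]; have [x hx] : exists x : 'I_n -> A, forall i,
    (forall L (g : {lrmorphism A -> L}), is_field L -> g (x i) != 0 -> T L (fmap g a)) /\ y i = f (x i).
    have Sy' i : exists x, (forall L (g : {lrmorphism A -> L}), is_field L -> g x != 0 -> T L (fmap g a)) /\ y i = f x.
      by have [x ? ?] := Sy i; exists x.
    by have [x hx] := choice Sy'; exists x.
  exists n, b, x; split=> [i|]; first by have [] := hx i.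
  by apply: eq_bigr => i _; have [_ ->] := hx i.
have [gf gfE] := lr_comp f g; rewrite -(fmap_comp _ gfE).
have [i gi] : exists i, gf (x i) != 0.
  apply: contrapT => no; have : g 1 = 0.
    rewrite -E1 lr_sum big1 // => i _; rewrite lrM; case: (eqVneq (gf (x i)) 0) => [|ne].
      by rewrite gfE /= => ->; rewrite mulr0.
    by case: no; exists i.
  by rewrite lr1 => /eqP; rewrite oner_eq0.
exact: (Ix i).
Qed.

Lemma open_field (U : subfunctor S) K (a : S K) L (f : {lrmorphism K -> L}) :
  open_sub U -> is_field K -> is_field L -> U K a <-> U L (fmap f a).
Proof.
move=> oU Kf Lf; have [I HI] := oU K a; have [i iE] := lr_id K.
have -> : U K a <-> U K (fmap i a) by rewrite (fmap_id a iE).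
split=> /HI [n [b [x [Ix E1]]]]; apply/HI.
  exists n, (fun j => f (b j)), x; split=> //.
  by rewrite -(lr1 f) -E1 lr_sum; apply: eq_bigr => j _; rewrite lrM iE.
have [j fj] : exists j, x j != 0.
  apply: contrapT => no; have : (1 : L) = 0.
    rewrite -E1 big1 // => j _; case: (eqVneq (x j) 0) => [->|ne]; first by rewrite lr0 mulr0.
    by case: no; exists j.
  by move/eqP; rewrite oner_eq0.
exists 1%N, (fun=> (x j)^-1), (fun=> x j); split=> //.
by rewrite big_ord1 iE mulVr // Kf.
Qed.

(** The component is the union of the connected sets through a0. The set D of points that no open
    set distinguishes from a0 shows that there is one. *)
Lemma component_exists K0 (a0 : S K0) : is_field K0 ->
  exists2 C : subfunctor S, connected_component C & C K0 a0.
Proof.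
move=> Kf0; pose C : subfunctor S := fun K a =>
  exists C' : subfunctor S, [/\ connected_set C', C' K0 a0 & C' K a].
pose D : subfunctor S := fun K a => forall U, open_sub U -> U K a <-> U K0 a0.
have cD : connected_set D.
  split.
  - move=> K L f a Kf Lf; split=> h U oU; have := open_field a f oU Kf Lf; have := h U oU; tauto.
  - by exists K0, a0; split=> // U _.
  move=> U V oU oV cov [K [a [Kf Da Ua]]] [L [b [Lf Db Vb]]].
  exists K0, a0; split=> //; split; [exact/(Da U oU)|exact/(Db V oV)].
have Ca0 : C K0 a0 by exists D; split=> // U _.
exists C => //; split; last first.
  by move=> C' cC' sub K a Kf C'a; exists C'; split=> //; apply: sub.
split.
- move=> K L f a Kf Lf; split=> -[C' [cC' C'0 C'a]]; exists C'; split=> //;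
    by have [sC' _ _] := cC'; apply/(sC' K L f a Kf Lf).
- by exists K0, a0.
move=> U V oU oV cov [K [a [Kf [C1 [cC1 C10 C1a]] Ua]]] [L [b [Lf [C2 [cC2 C20 C2b]] Vb]]].
have sub (C' : subfunctor S) : connected_set C' -> C' K0 a0 ->
    forall K (x : S K), is_field K -> C' K x -> U K x \/ V K x.
  by move=> cC' C'0 K' x K'f C'x; apply: cov => //; exists C'.
have up (C' : subfunctor S) : connected_set C' -> C' K0 a0 -> Defs.meets C' (fun A x => U A x /\ V A x) ->
    Defs.meets C (fun A x => U A x /\ V A x).
  by move=> cC' C'0 [K' [x [K'f C'x UVx]]]; exists K', x; split=> //; exists C'.
case: (cov K0 a0 Kf0 Ca0) => h0.
  apply: (up C2) => //; have [_ _ hC2] := cC2; apply: hC2 => //; first exact: sub.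
    by exists K0, a0.
  by exists L, b.
apply: (up C1) => //; have [_ _ hC1] := cC1; apply: hC1 => //; first exact: sub.
  by exists K, a.
by exists K0, a0.
Qed.
End Component.

Lemma fmap_sq (k : fieldType) (X : kfunctor k) (A B B' C : comUnitAlgType k) (f : {lrmorphism A -> B})
    (g : {lrmorphism B -> C}) (f' : {lrmorphism A -> B'}) (g' : {lrmorphism B' -> C}) (x : X A) :
  g \o f =1 g' \o f' -> fmap g (fmap f x) = fmap g' (fmap f' x).
Proof.
move=> E; have [h hE] := lr_comp f g; rewrite -(fmap_comp x hE); apply: fmap_comp => z.
by rewrite hE E.
Qed.

Section Descent.
Context (k : closedFieldType) (q : nat) (q0 : (0 < q)%N) (X : zip_space k q) (S : kfunctor k) (pr : kmap X S).
Implicit Types (A B C D R K L : comUnitAlgType k) (O : pts X -> Prop).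
Context (cov : forall K (s : X K), is_field K -> exists c : chart X, cU c K s).
Context (prI : forall A (x y : gl A) (s : X A), in_E q x y -> pr A (zact x y s) = pr A s).
Context (prT : forall A (s s' : X A), pr A s = pr A s' -> exists x y : gl A, in_E q x y /\ zact x y s = s').
Context (prL : forall A (a : S A), exists B (f : {lrmorphism A -> B}) (s : X B),
    etale_cover f /\ pr B s = fmap f a).

Section Partition.
Context (O O' : pts X -> Prop) (oO : opn O) (oO' : opn O') (OO : forall y, O y \/ O' y)
  (dO : forall y, O y -> O' y -> False).

(** An element of E is joined to the identity over a domain, so moving along the orbit cannot leave
    one part of a clopen partition. *)
Lemma E_stable K (s : X K) (x y : gl K) : is_field K -> in_E q x y -> fld O s -> fld O (zact x y s).
Proof.
move=> Kf Exy Os; have [A [j [f0 [f1 [x' [y' [Ad f0j f1j E' [fx0 fy0 fx1 fy1]]]]]]]] := E_path q0 Kf Exy.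
have [i iE] := lr_id K; pose s' := zact x' y' (fmap j s).
have E0 : fmap f0 s' = s.
  rewrite /s' zact_nat // fx0 fy0 zact1 -(@fmap_comp _ X _ _ _ j f0 i) ?fmap_id // => z.
  by have := f0j z; rewrite /= => ->; rewrite iE.
have E1 : fmap f1 s' = zact x y s.
  rewrite /s' zact_nat // fx1 fy1 -(@fmap_comp _ X _ _ _ j f1 i) ?fmap_id // => z.
  by have := f1j z; rewrite /= => ->; rewrite iE.
rewrite -E1; apply: (fld_path cov f1 Ad Kf Kf oO oO' OO dO (f := f0)).
by rewrite E0.
Qed.

Lemma fiber_stable K (s s' : X K) : is_field K -> pr K s = pr K s' -> fld O s -> fld O s'.
Proof. by move=> Kf /prT [x [y [Exy <-]]]; apply: E_stable. Qed.

Lemma fld_excl K (s : X K) : is_field K -> fld O s -> fld O' s -> False.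
Proof. by move=> Kf h h'; have [y] := fld_disj Kf h h'; apply: dO. Qed.
End Partition.

Definition base O K (a : S K) := exists L (i : {lrmorphism K -> L}) (s : X L),
  [/\ is_field L, pr L s = fmap i a & fld O s].

(** Fibres of the torsor are orbits, so membership in O can be read on the local section s0 instead
    of on the given lift. *)
Lemma cover_base O O' A (a : S A) B (f : {lrmorphism A -> B}) (s0 : X B) K (phi : {lrmorphism A -> K}) :
  opn O -> opn O' -> (forall y, O y \/ O' y) -> (forall y, O y -> O' y -> False) ->
  etale_cover f -> pr B s0 = fmap f a -> is_field K -> base O (fmap phi a) ->
  exists L (b : {lrmorphism B -> L}) (i : {lrmorphism K -> L}),
    [/\ is_field L, b \o f =1 i \o phi & fld O (fmap b s0)].
Proof.
move=> oO oO' OO dO [_ _ ecov] Es0 Kf [K1 [i1 [s1 [Kf1 Es1 Os1]]]].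
have [ip ipE] := lr_comp phi i1; have [L [i [b [Lf bE]]]] := ecov K1 ip Kf1.
have [ii iiE] := lr_comp i1 i; exists L, b, ii; split=> // [z|].
  by have := bE z; rewrite /= => ->; rewrite iiE /= ipE.
apply: (fiber_stable oO oO' OO dO (s := fmap i s1) Lf); last exact: fld_map.
rewrite !appE Es0 Es1 -(@fmap_comp _ _ _ _ _ phi i1 ip) //; apply: fmap_sq => z.
by have := bE z; rewrite /= => ->.
Qed.

Section Partition2.
Context (O O' : pts X -> Prop) (oO : opn O) (oO' : opn O') (OO : forall y, O y \/ O' y)
  (dO : forall y, O y -> O' y -> False).

Lemma base_spread A (a : S A) B (f : {lrmorphism A -> B}) (s0 : X B) K (phi : {lrmorphism A -> K}) :
  etale_cover f -> pr B s0 = fmap f a -> is_field K -> base O (fmap phi a) ->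
  exists L (b : {lrmorphism B -> L}) (i : {lrmorphism K -> L}) e,
    [/\ is_field L, b \o f =1 i \o phi, b e != 0 &
      forall L' (g : {lrmorphism B -> L'}), is_field L' -> g e != 0 -> fld O (fmap g s0)].
Proof.
move=> ec Es0 Kf ba; have [L [b [i [Lf bE Ob]]]] := cover_base oO oO' OO dO ec Es0 Kf ba.
by have [e be he] := fld_open Lf Ob; exists L, b, i, e.
Qed.

Lemma base_up K (a : S K) L (phi : {lrmorphism K -> L}) : is_field K -> is_field L ->
  base O a -> base O (fmap phi a).
Proof.
move=> Kf Lf ba; have [B [f [s0 [ec Es0]]]] := prL a; have [i iE] := lr_id K.
have [|L0 [b [i0 [e [L0f bE be he]]]]] := @base_spread K a B f s0 K i ec Es0 Kf.
  by rewrite (fmap_id a iE).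
have [fp _ _] := ec; have [L' [be' [j [L'f bjE be'e]]]] := base_change phi fp Kf L0f be.
exists L', j, (fmap be' s0); split=> //; last exact: he.
by rewrite appE Es0; apply: fmap_sq.
Qed.

(** After a common extension of the fields, the two lifts of a lie in the same orbit, which is
    contained in one part. *)
Lemma base_excl' K (a : S K) K1 (i1 : {lrmorphism K -> K1}) (s1 : X K1) : is_field K -> is_field K1 ->
  base O a -> pr K1 s1 = fmap i1 a -> fld O' s1 -> False.
Proof.
move=> Kf Kf1 ba Es1 Os1; have [B [f [s0 [ec Es0]]]] := prL a; have [i iE] := lr_id K.
have [|L0 [b [i0 [e [L0f bE be he]]]]] := @base_spread K a B f s0 K i ec Es0 Kf.
  by rewrite (fmap_id a iE).
have [fp _ _] := ec; have [L' [be' [j [L'f bjE be'e]]]] := base_change i1 fp Kf L0f be.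
have h1 := he _ be' L'f be'e; have h2 := fld_map j Kf1 Os1.
apply: (fun h => fld_excl dO L'f (s := fmap j s1) h h2).
apply: (fiber_stable oO oO' OO dO (s := fmap be' s0) L'f) h1.
by rewrite !appE Es0 Es1; apply: fmap_sq.
Qed.

(** Openness of etale maps, by going down. If every function vanishing off the image of O vanishes
    at phi, some prime Q of B in the part O' contracts to a prime p0 contained in the kernel of phi.
    Going down from b gives another prime over p0, in the part O, so the point p0 would come from
    both parts. *)
Lemma base_open A (a : S A) K (phi : {lrmorphism A -> K}) : is_field K -> base O (fmap phi a) ->
  exists2 x, phi x != 0 & forall L (g : {lrmorphism A -> L}), is_field L -> g x != 0 -> base O (fmap g a).
Proof.
move=> Kf ba; have [B [f [s0 [ec Es0]]]] := prL a; have [fp ef ecov] := ec.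
have sq : sq_lift f.
  by move=> C D s u v hs hE; have [l [h1 h2 _]] := ef C D s u v hs hE; exists l.
have [L [b [i [e [Lf bE be he]]]]] := base_spread ec Es0 Kf ba.
pose V x := forall L (g : {lrmorphism A -> L}), is_field L -> ~ base O (fmap g a) -> g x = 0.
have [[x Vx px]|no] := pselect (exists2 x, V x & phi x != 0).
  exists x => // L' g L'f gx; apply: contrapT => nb; by move/eqP: gx; apply; apply: Vx.
have Vphi x : V x -> phi x = 0 by move=> Vx; apply: contrapT => /eqP px; apply: no; exists x.
pose J y := forall L (g : {lrmorphism B -> L}), is_field L -> fld O' (fmap g s0) -> g y = 0.
have J0 : J 0 by move=> L' g _ _; rewrite lr0.
have JD y z : J y -> J z -> J (y + z).
  by move=> hy hz L' g L'f h; rewrite lrD hy // hz // addr0.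
have JM y z : J z -> J (y * z) by move=> hz L' g L'f h; rewrite lrM hz // mulr0.
pose JI := @Ideal _ J J0 JD JM.
have JV x : J (f x) -> V x.
  move=> Jx L' g L'f nb; have [K' [i' [b' [K'f bE']]]] := ecov L' g L'f.
  apply: contrapT => /eqP gx; have /eqP := field_map i' L'f gx; apply.
  have := bE' x; rewrite /= => <-; apply: (Jx K' b' K'f).
  case: (fld_cover cov (fmap b' s0) oO oO' OO K'f) => // h; case: nb.
  exists K', i', (fmap b' s0); split=> //; rewrite appE Es0; exact: fmap_sq.
have [||Q [pQ JQ SQ]] := @prime_avoid _ (fun y => exists2 x, phi x != 0 & y = f x) JI.
- split; first by exists 1; rewrite lr1 // oner_neq0.
  by move=> _ _ [x px ->] [x' px' ->]; exists (x * x'); rewrite lrM //; apply: field_mul.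
- by move=> _ [x px ->] /JV /Vphi /eqP; rewrite (negPf px).
have [M [g [Mf gQ]]] := residue_field pQ; have [gf gfE] := lr_comp f g.
have gO' : fld O' (fmap g s0).
  case: (fld_cover cov (fmap g s0) oO oO' OO Mf) => // h.
  have [e' ge' he'] := fld_open Mf h; case/eqP: ge'; apply/gQ/JQ => L' g' L'f hO'.
  apply: contrapT => /eqP g'e; exact: (fld_excl dO L'f (he' _ g' L'f g'e) hO').
pose p0 := ipre (f : {rmorphism A -> B}) Q.
have pp0 : prime_ideal p0.
  split; first by rewrite /p0 /= rmorph1; case: pQ.
  by move=> x y; rewrite /p0 /= rmorphM; case: pQ => _; apply.
have [|Q' [pQ' Q'b Q'p]] := going_down (phi := b) fp sq Lf pp0.
  move=> x Qx; have := bE x; rewrite /= => ->; suff -> : phi x = 0 by rewrite lr0.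
  by apply: contrapT => /eqP px; apply: (SQ (f x) _ Qx); exists x.
have [M' [g' [M'f g'Q]]] := residue_field pQ'.
have g'e : g' e != 0 by apply: contraNneq be => /g'Q /Q'b ->.
have [N [h [Nf hN hfr]]] := residue_frac pp0.
have [gf' gf'E] := lr_comp f g'.
have [|u uE] := @residue_embed _ A N h M gf Nf Mf hfr.
  by move=> x; rewrite hN gfE /= gQ.
have [|u' u'E] := @residue_embed _ A N h M' gf' Nf M'f hfr.
  by move=> x; rewrite hN gf'E /= g'Q Q'p.
exfalso; apply: (@base_excl' N (fmap h a) M u (fmap g s0) Nf Mf _ _ gO').
  exists M', u', (fmap g' s0); split=> //; last exact: he.
  by rewrite appE Es0; apply: fmap_sq => x; have := u'E x; rewrite gf'E /= => ->.
by rewrite appE Es0; apply: fmap_sq => x; have := uE x; rewrite gfE /= => ->.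
Qed.
End Partition2.

Context (hsurj : forall C : subfunctor S, connected_component C ->
  forall K (g : gl K), is_field K ->
  exists K' (f : {lrmorphism K -> K'}) (s : X K'),
    [/\ is_field K', C K' (pr K' s) & zmap X K' s = glmap f g]).

Lemma entry_at_subproof (g0 : gl (k^o : comUnitAlgType k)) (a b : 'I_4) A B (f : {lrmorphism A -> B}) (s : X A) :
  val (zmap X B (fmap f s)) a b - (val g0 a b : k)%:A = f (val (zmap X A s) a b - (val g0 a b : k)%:A).
Proof. by rewrite appE /= mxE lrB lrA. Qed.
Definition entry_at g0 a b : fn X := @KMap k X (affine_line k) _ (@entry_at_subproof g0 a b).

(** Both parts have open images in S. The component of S below a point of O' contains, by
    surjectivity, the image of a point over g0, which is in O; connectedness then yields a point in
    both images. *)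
Lemma clopen_all O O' (g0 : gl (k^o : comUnitAlgType k)) : opn O -> opn O' ->
  (forall y, O y \/ O' y) -> (forall y, O y -> O' y -> False) ->
  (forall y : pts X, zmap X _ y = g0 -> O y) -> forall y, O y.
Proof.
move=> oO oO' OO dO h0 y; case: (OO y) => // O'y; exfalso.
have OO2 z : O' z \/ O z by case: (OO z); [right|left].
have dO2 z : O' z -> O z -> False by move=> h h'; apply: dO h' h.
have kf := @is_field_k k.
have [C cC Cy] := component_exists (pr _ y) kf.
have [K' [f [s' [K'f Cs Es]]]] := hsurj cC g0 kf.
have [i iE] := lr_id (k^o : comUnitAlgType k).
have Os' : fld O s'.
  case: (fld_cover cov s' oO oO' OO K'f) => // -[c [phi [e [Ep pe he]]]].
  (* The entries of g0 are constants of k, so lying over g0 is a closed condition that survives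
     specialization to a k-point. *)
  have [|x [Zx xe _]] := @special _ X (fun E => exists a b, E = entry_at g0 a b) c K' phi e K'f _ pe.
    move=> _ [a [b ->]]; rewrite /ev /= Ep Es /= mxE.
    have Ef : f (val g0 a b) = (val g0 a b : k)%:A.
      by rewrite -(lrA f); congr (f _); rewrite -[LHS]mulr1.
    by rewrite Ef subrr.
  case: (dO (at_ x)); last exact: he.
  apply: h0; apply: val_inj; apply/matrixP => a b.
  have := Zx _ (ex_intro _ a (ex_intro _ b erefl)); rewrite /ev /= => /eqP.
  by rewrite subr_eq0 => /eqP ->; apply: mulr1.
pose U : subfunctor S := fun A a => forall K (f : {lrmorphism A -> K}), is_field K -> base O (fmap f a).
pose V : subfunctor S := fun A a => forall K (f : {lrmorphism A -> K}), is_field K -> base O' (fmap f a).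
have oU : open_sub U by apply: open_of => A a K g Kf; apply: (base_open oO oO' OO dO Kf).
have oV : open_sub V by apply: open_of => A a K g Kf; apply: (base_open oO' oO OO2 dO2 Kf).
have bU K (s : X K) : is_field K -> fld O s -> U K (pr K s).
  move=> Kf Os L g Lf; apply: (base_up oO oO' OO dO) => //; have [j jE] := lr_id K.
  by exists K, j, s; split=> //; rewrite (fmap_id _ jE).
have bV K (s : X K) : is_field K -> fld O' s -> V K (pr K s).
  move=> Kf Os L g Lf; apply: (base_up oO' oO OO2 dO2) => //; have [j jE] := lr_id K.
  by exists K, j, s; split=> //; rewrite (fmap_id _ jE).
have [[sC _ hC] _] := cC.
have [|||K [a [Kf Ca [Ua Va]]]] := hC U V oU oV.
- move=> K a Kf Ca; have [B [g [s [[_ _ ecov] Eg]]]] := prL a; have [j jE] := lr_id K.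
  have [L [l [b [Lf bE]]]] := ecov K j Kf.
  have Eb : pr L (fmap b s) = fmap l a.
    rewrite appE Eg -[in RHS](fmap_id a jE); exact: fmap_sq.
  case: (fld_cover cov (fmap b s) oO oO' OO Lf) => h; [left|right];
    by apply/(open_field _ l) => //; rewrite -Eb; auto.
- by exists K', (pr K' s'); split=> //; apply: bU.
- by exists (k^o : comUnitAlgType k), (pr _ y); split=> //; apply: bV => //; apply: fld_k.
have [j jE] := lr_id K.
have := Ua K j Kf; rewrite (fmap_id a jE) => ba.
have := Va K j Kf; rewrite (fmap_id a jE) => -[L [l [s [Lf Es2 Os2]]]].
exact: (base_excl' oO oO' OO dO Kf Lf ba Es2 Os2).
Qed.
End Descent.

(** * Existence of charts *)

Section BasicOpen.
Context (k : fieldType).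
Implicit Types A B C D K L R : comUnitAlgType k.

Lemma prime_residue A (P : A -> Prop) : ~ igen P 1 ->
  exists K (f : {lrmorphism A -> K}), is_field K /\ forall x, P x -> f x = 0.
Proof.
move=> h; apply: contrapT => no; apply/h/prime_unit => I pI PI; apply: no.
by have [K [f [Kf f0]]] := residue_field pI; exists K, f; split=> // x Px; apply/f0/PI/igen_mem.
Qed.

Lemma unit_of_fields A (a : A) :
  (forall K (f : {lrmorphism A -> K}), is_field K -> f a != 0) -> a \is a GRing.unit.
Proof.
move=> h; apply: contrapT => na; have [|K [f [Kf f0]]] := @prime_residue A (fun x => x = a).
  case/igen_fin => n [c [b [ba E]]]; apply/na/unitrPr; exists (\sum_i c i).
  by rewrite mulrC mulr_suml E; apply: eq_bigr => i _; rewrite ba.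
by have := h K f Kf; rewrite f0 // eqxx.
Qed.

Lemma open_localize (X : kfunctor k) (U : subfunctor X) A (x : X A) K (f : {lrmorphism A -> K}) :
  open_sub U -> is_field K -> U K (fmap f x) -> exists2 a, f a != 0 &
    forall C (g : {lrmorphism A -> C}), g a \is a GRing.unit -> U C (fmap g x).
Proof.
move=> oU Kf; have [I HI] := oU A x => /HI [n [b [a [Ia Sba]]]].
have [i fai] : exists i, f (a i) != 0.
  apply: contrapT => h; have : (1 : K) = 0.
    rewrite -Sba big1 // => i _; case: (eqVneq (f (a i)) 0) => [->|ne]; rewrite ?mulr0 //.
    by case: h; exists i.
  by apply/eqP/oner_neq0.
exists (a i) => // C g ga; apply/HI; exists 1%N, (fun=> (g (a i))^-1), (fun=> a i).
by split=> //; rewrite big_ord1 mulVr.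
Qed.

Lemma open_of_fields (X : kfunctor k) (U : subfunctor X) A (x : X A) : open_sub U ->
  (forall K (f : {lrmorphism A -> K}), is_field K -> U K (fmap f x)) -> U A x.
Proof.
move=> oU h; have [I HI] := oU A x; have [i iE] := lr_id A.
rewrite -(fmap_id x iE); apply/HI.
have : igen I 1.
  apply: contrapT => /prime_residue [K [f [Kf f0]]].
  have /HI [n [b [a [Ia E]]]] := h K f Kf; have /eqP := E.
  by rewrite big1 ?(eq_sym 0) ?oner_eq0 // => j _; rewrite f0 // mulr0.
case/igen_fin => n [c [b [Ib E]]]; exists n, c, b; split=> //.
by rewrite E; apply: eq_bigr => j _; rewrite iE.
Qed.

(** The ideal attached to an A-point is generated by the t whose inversion moves the point into the
    locus where b is invertible. That there are enough of them is checked at residue fields, where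
    the point first enters U and then b becomes invertible. *)
Lemma basic_open (X : kfunctor k) (U : subfunctor X) R (u : X R) R' (b : R) (l : {lrmorphism R -> R'}) :
  affine_open U u -> is_localization b l ->
  (forall C (g : {lrmorphism R -> C}), g b \is a GRing.unit -> exists h : {lrmorphism R' -> C}, h \o l =1 g) ->
  affine_open (fun A x => exists f : {lrmorphism R' -> A}, fmap f (fmap l u) = x) (fmap l u).
Proof.
move=> [oU inj UE] [ub lB l0] lU; split; last by [].
  move=> A x; pose U' A (x : X A) := exists f : {lrmorphism R' -> A}, fmap f (fmap l u) = x.
  have U'map B C (g : {lrmorphism B -> C}) (y : X B) : U' B y -> U' C (fmap g y).
    by move=> [h <-]; have [gh ghE] := lr_comp h g; exists gh; apply: fmap_comp.
  have U'U B (y : X B) : U' B y -> U B y.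
    by move=> [h <-]; have [hl hlE] := lr_comp l h; apply/UE; exists hl; apply: fmap_comp.
  exists (fun t => forall C (g : {lrmorphism A -> C}), g t \is a GRing.unit -> U' C (fmap g x)) => B f.
  split=> [h|[n [c [t [It E]]]]].
    have : igen (fun y => exists2 t, (forall C (g : {lrmorphism A -> C}), g t \is a GRing.unit ->
        U' C (fmap g x)) & y = f t) 1.
      apply: contrapT => /prime_residue [K [g [Kf g0]]]; have [gf gfE] := lr_comp f g.
      have := U'map _ _ g _ h; rewrite -(fmap_comp x gfE) => U'K.
      have [a ga ha] := open_localize oU Kf (U'U _ _ U'K).
      have am m : a ^+ m != 0.
        apply/eqP => E; have := unitrX m (Kf _ ga).
        by rewrite -lrX E lr0 unitr0.
      have [B1 [m [lm mU]]] := localization am; have [um mB _] := lm.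
      have [w Ew] := (UE _ _).1 (ha _ m um); have [s [n En]] := mB (w b).
      have key C (h1 : {lrmorphism A -> C}) : h1 a \is a GRing.unit ->
         exists2 w' : {lrmorphism R -> C}, fmap w' u = fmap h1 x & w' b * h1 a ^+ n = h1 s.
        move=> uh; have [m' m'E] := mU _ h1 uh; have [w' w'E] := lr_comp w m'.
        exists w'; first by rewrite (fmap_comp u w'E) Ew -(@fmap_comp _ X _ _ _ m m' h1).
        have m'E' z : m' (m z) = h1 z by apply: m'E.
        by rewrite w'E /= -!m'E' -lrX -lrM En.
      have /eqP : gf (a * s) = 0.
        rewrite gfE /=; apply: g0; exists (a * s) => // C h1; rewrite lrM unitrM => /andP [ua us].
        have [w' Ew' E1] := key C h1 ua; have [|h' h'E] := lU _ w'.
          by move: us; rewrite -E1 unitrM => /andP [].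
        by exists h'; rewrite -Ew' -(@fmap_comp _ X _ _ _ l h' w').
      apply/negP; rewrite lrM; apply/eqP => E.
      have [w' Ew' E1] := key K gf (Kf _ ga); have [h' Eh'] := U'K.
      have [hl hlE] := lr_comp l h'.
      have hw : hl =1 w' by apply: inj; rewrite Ew' -Eh'; apply: fmap_comp.
      have us : gf s \is a GRing.unit.
        rewrite -E1 unitrM -hw hlE /= lr_unit //= unitrX //; exact: Kf.
      by have := unitrM_imp (Kf _ ga) us; rewrite E unitr0.
    case/igen_fin => n [c [y [Sy ->]]].
    have Sy' i : exists t, (forall C (g : {lrmorphism A -> C}), g t \is a GRing.unit ->
        U' C (fmap g x)) /\ y i = f t by have [t ? ?] := Sy i; exists t.
    have [t ht] := choice Sy'; exists n, c, t; split=> [i|]; first by have [] := ht i.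
    by apply: eq_bigr => i _; have [_ ->] := ht i.
  have fld K (g : {lrmorphism B -> K}) : is_field K -> U' K (fmap g (fmap f x)).
    move=> Kf; have [gf gfE] := lr_comp f g; rewrite -(fmap_comp x gfE).
    have [i gi] : exists i, gf (t i) != 0.
      apply: contrapT => no; have : g 1 = 0.
        rewrite -E lr_sum big1 // => i _; rewrite lrM; case: (eqVneq (gf (t i)) 0) => [|ne].
          by rewrite gfE /= => ->; rewrite mulr0.
        by case: no; exists i.
      by rewrite lr1 => /eqP; rewrite oner_eq0.
    exact: (It i K gf (Kf _ gi)).
  have /UE [w Ew] : U B (fmap f x) by apply: open_of_fields => // K g Kf; apply/U'U/fld.
  have [|h hE] := lU _ w; last by exists h; rewrite -Ew -(@fmap_comp _ X _ _ _ l h w).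
  apply: unit_of_fields => K g Kf; have [h Eh] := fld K g Kf.
  have [hl hlE] := lr_comp l h; have [gw gwE] := lr_comp w g.
  have E1 : hl =1 gw.
    by apply: inj; rewrite (fmap_comp u gwE) Ew -Eh; apply: fmap_comp.
  have : gw b \is a GRing.unit by rewrite -E1 hlE /= lr_unit.
  by rewrite gwE /=; apply: contraTneq => ->; rewrite unitr0.
move=> A f g; have [fl flE] := lr_comp l f; have [gl glE] := lr_comp l g => E b'.
have fg : fl =1 gl by apply: inj; rewrite (fmap_comp u flE) (fmap_comp u glE).
have [r [n En]] := lB b'; have un : g (l b) ^+ n \is a GRing.unit by apply/unitrX/lr_unit.
have fgl z : f (l z) = g (l z) by have := fg z; rewrite flE glE.
have Ef : f b' * f (l b) ^+ n = f (l r) by rewrite -lrX -lrM En.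
have Eg : g b' * g (l b) ^+ n = g (l r) by rewrite -lrX -lrM En.
by apply: (mulIr un); rewrite Eg -fgl Ef fgl.
Qed.
End BasicOpen.

Section Universal.
Context (k : fieldType).
Implicit Types A B C D K L R : comUnitAlgType k.
Definition kgen A (z : seq A) := fgen (GRing.in_alg A : {rmorphism k -> A}) z.

(** The coordinate ring of GL_4, with the entries and the inverse of the determinant as explicit
    generators. *)
Lemma gl_universal : exists (R : comUnitAlgType k) (g0 : gl R),
  (forall A (g : gl A), exists h : {lrmorphism R -> A}, glmap h g0 = g) /\
  forall c, kgen ((\det (val g0))^-1 :: [seq val g0 ij.1 ij.2 | ij : 'I_4 * 'I_4]) c.
Proof.
have [B [io [j [ios io0 jE hU]]]] := mpoly_alg (k^o : comUnitAlgType k) (4 * 4).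
pose M : 'M[B]_4 := \matrix_(a, b) io 'X_(mxvec_index a b).
have ev C (g : 'M[C]_4) : exists h : {lrmorphism B -> C}, map_mx h M = g.
  have [i iE] := in_algP (k := k) C.
  pose m (l : 'I_(4 * 4)) := (mxvec g) ord0 l.
  have [h [_ hE]] := hU C i m; exists h; apply/matrixP => a b; rewrite !mxE hE.
  have [f [fE _ fX]] := mmapP (i : {rmorphism k^o -> C}) m.
  by rewrite -fE fX /m mxvecE.
have [h1 E1] := ev (k^o : comUnitAlgType k) 1%:M.
have dn n : \det M ^+ n != 0.
  apply/eqP => /(congr1 h1); rewrite lrX lr0.
  have -> : h1 (\det M) = \det (map_mx h1 M) by rewrite det_map_mx.
  by rewrite E1 det1 expr1n => /eqP; rewrite oner_eq0.
have [R [l [[ul lB l0] lU]]] := localization dn.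
have uM : map_mx l M \in unitmx by rewrite unitmxE det_map_mx.
exists R, (gl_mk uM); split=> [A g|c].
  have [h hE] := ev A (val g); have [|h' h'E] := lU _ h.
    have -> : h (\det M) = \det (map_mx h M) by rewrite det_map_mx.
    by rewrite hE -unitmxE; apply: valP.
  exists h'; apply: val_inj; apply/matrixP => a b; rewrite /= !mxE.
  by have := h'E (io 'X_(mxvec_index a b)); rewrite /= => ->; rewrite -hE !mxE.
have [b [n En]] := lB c; have [p Ep] := ios b.
set z := _ :: _.
have zb p' : kgen z (l (io p')).
  have [f [fE fC fX]] := mmapP (GRing.in_alg R : {rmorphism k -> R}) (fun ix => l (io 'X_ix)).
  have -> : l (io p') = f p'.
    apply: (@mpoly_rmorph_eq _ _ _ (l \o io) f) => [a|i] /=; last by rewrite fX.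
    rewrite fC -jE; transitivity (l (j (a : k)%:A)).
      by congr (l (j _)); apply/esym/mulr1.
    by rewrite (lrA j) (lrA l).
  rewrite fE; elim/mpolyind: p' => [|a m p' _ _ IH]; first by rewrite -fE rmorph0 -(rmorph0 (GRing.in_alg R));
    apply: fgenC.
  rewrite -fE rmorphD fE; apply: fgenD; last by rewrite fE.
  rewrite -mul_mpolyC -fE rmorphM fC; apply: fgenM; first exact: fgenC.
  rewrite (mpolyXE_id _ m) rmorph_prod; elim/big_ind: _ => [||i _].
  - by rewrite -(rmorph1 (GRing.in_alg R)); apply: fgenC.
  - exact: fgenM.
  rewrite rmorphXn fX; elim: (m i) => [|e IHe].
    by rewrite expr0 -(rmorph1 (GRing.in_alg R)); apply: fgenC.
  rewrite exprS; apply: fgenM => //; apply: fgen_mem; rewrite inE; apply/orP; right.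
  clear IHe; case/mxvec_indexP: i => a' b'; apply/mapP; exists (a', b'); first by rewrite mem_enum.
  by rewrite /= !mxE.
have Ed : \det (map_mx l M) = l (\det M) by rewrite det_map_mx.
have -> : c = l (io p) * (\det (map_mx l M))^-1 ^+ n.
  rewrite Ed Ep -En exprVn mulrK // unitrX //.
apply: fgenM; first exact: zb.
elim: n {En} => [|n IHn].
  by rewrite expr0 -(rmorph1 (GRing.in_alg R)); apply: fgenC.
by rewrite exprS; apply: fgenM => //; apply: fgen_mem; rewrite inE eqxx.
Qed.
End Universal.

Section ChartsExist.
Context (k : closedFieldType) (X : kfunctor k) (m : kmap X (GL4 k)).
Implicit Types A B C D K L R : comUnitAlgType k.

Lemma kgen_map A B (f : {lrmorphism A -> B}) z z' a : kgen z a -> (forall x, x \in z -> kgen z' (f x)) ->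
  kgen z' (f a).
Proof.
move=> [p <-] h; have [F [FE FC FX]] := mmapP (GRing.in_alg A : {rmorphism k -> A}) (fun i : 'I_(size z) => nth 0 z i).
have [G [GE GC GX]] := mmapP (GRing.in_alg B : {rmorphism k -> B}) (fun i : 'I_(size z) => nth 0 [seq f x | x <- z]
  (i : 'I_(size z))).
have -> : f (mmap (GRing.in_alg A) (fun i : 'I_(size z) => nth 0 z i) p) = G p.
  rewrite -FE; apply: (@mpoly_rmorph_eq _ _ _ (f \o F) G) => [c|i] /=.
    by rewrite FC GC; exact: lrA.
  by rewrite FX GX (nth_map 0).
apply: (fgen_sub (z := [seq f x | x <- z])) => [y /mapP [x xz ->]|]; first exact: h.
have sz : size [seq f x | x <- z] = size z by rewrite size_map.
have [H [HE HC HX]] := mmapP (GRing.in_alg B : {rmorphism k -> B}) (fun i : 'I_(size [seq f x | x <- z]) => nth 0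
  [seq f x | x <- z] i).
have [W [WE WC WX]] := mmapP (@mpolyC (size [seq f x | x <- z]) k) (fun i : 'I_(size z) => 'X_(cast_ord (esym sz)
  i) : {mpoly k[size [seq f x | x <- z]]}).
exists (W p); rewrite -HE; move: p; apply: (@mpoly_rmorph_eq _ _ _ (H \o W) G) => [c|i] /=.
  by rewrite WC HC GC.
by rewrite WX HX GX.
Qed.

(** The affine open set V of GL_4 comes without generators. Shrinking to the locus where a function
    a on GL_4 is invertible, with image b in B, makes the chart generated by the coordinates of
    GL_4, by 1 / b and by the generators of B over V. *)
Lemma charts_cover : locally_fin_presented m -> forall K (s : X K), is_field K -> exists c : chart X, cU c K s.
Proof.
move=> lfp K s Kf; have [V [A0 [v [U [B [u [aV aU Us [f [fp Ef]]]]]]]]] := lfp K s Kf.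
have [oV injV VE] := aV; have [oU injU UE] := aU.
have [phi Ephi] := (UE K s).1 Us.
have [G [g0 [gU gG]]] := @gl_universal k.
have [gk Egk] := gU K (m K s).
have [phif phifE] := lr_comp f phi.
have Vg : V K (@fmap k (GL4 k) _ _ gk g0).
  by apply/VE; exists phif; rewrite (@fmap_comp _ (GL4 k) _ _ _ _ _ _ _ phifE) -Ef -appE Ephi -Egk.
have [a ga ha] := open_localize oV Kf Vg.
have [h Eh0] := gU B (m B u); pose b := h a.
have Eh : @fmap k (GL4 k) _ _ h g0 = m B u := Eh0.
have [phih phihE] := lr_comp h phi.
have phg : phih =1 gk.
  have e1 : glmap phih g0 = glmap gk g0.
    rewrite -[LHS]/(@fmap k (GL4 k) _ _ phih g0) (@fmap_comp _ (GL4 k) _ _ _ _ _ _ _ phihE) Eh -appE Ephi.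
    by rewrite -Egk.
  move=> c; have [e2 e3] : (forall x, x \in [seq val g0 ij.1 ij.2 | ij : 'I_4 * 'I_4] -> phih x = gk x) /\
      phih (\det (val g0))^-1 = gk (\det (val g0))^-1.
    have e2 i j : phih (val g0 i j) = gk (val g0 i j).
      by have := congr1 (fun w : gl K => val w i j) e1; rewrite /= !mxE.
    split=> [x /mapP [[i j] _ ->]|]; first exact: e2.
    have ud : \det (val g0) \is a GRing.unit by rewrite -unitmxE; apply: valP.
    rewrite !lrV //; congr (_^-1).
    have -> : phih (\det (val g0)) = \det (map_mx phih (val g0)) by rewrite det_map_mx.
    have -> : gk (\det (val g0)) = \det (map_mx gk (val g0)) by rewrite det_map_mx.
    by congr (\det _); apply: (congr1 val e1).
  have [p Ep] := gG c; rewrite -Ep.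
  set z := _ :: _ in p Ep *.
  have [F [FE FC FX]] := mmapP (GRing.in_alg G : {rmorphism k -> G}) (fun i : 'I_(size z) => nth 0 z i).
  rewrite -FE; apply: (@mpoly_rmorph_eq _ _ _ (phih \o F) (gk \o F)) => [d|i] /=.
    by rewrite FC; apply: etrans (lrA _ d) (esym (lrA _ d)).
  rewrite FX; have := mem_nth 0 (ltn_ord i); rewrite {2}/z inE => /orP [/eqP ->|/e2 //]; exact: e3.
have pb : phi b != 0 by rewrite -[phi b]phihE phg.
have bn n : b ^+ n != 0.
  apply/eqP => E; have := unitrX n (Kf _ pb); by rewrite -lrX E lr0 unitr0.
have [R [l [ll lU]]] := localization bn.
have aR := basic_open aU ll lU; have [ub lB _] := ll.
have [h2 h2E] := lr_comp h l.
have [|GA [la [lla laU]]] := @localization k G a.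
  by move=> n; apply/eqP => E; have := unitrX n (Kf _ ga); rewrite -lrX E lr0 unitr0.
have [ua laB _] := lla.
have [rho Erho] := (VE _ _).1 (ha _ la ua).
have [|kp kpE] := laU _ h2; first by rewrite h2E.
have [lf lfE] := lr_comp f l; have [kr krE] := lr_comp rho kp.
have lfk : lf =1 kr.
  apply: injV; rewrite (@fmap_comp _ (GL4 k) _ _ _ _ _ _ _ lfE) (@fmap_comp _ (GL4 k) _ _ _ _ _ _ _ krE) Erho.
  rewrite -(@fmap_comp _ (GL4 k) _ _ _ la kp h2); last by move=> z; have := kpE z; rewrite /= => ->.
  by rewrite (@fmap_comp _ (GL4 k) _ _ _ _ _ _ _ h2E) Eh Ef.
have [n [mm [w [r [ws _]]]]] := fp.
pose zG := (\det (val g0))^-1 :: [seq val g0 ij.1 ij.2 | ij : 'I_4 * 'I_4].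
pose z : seq R := (l b)^-1 :: [seq h2 x | x <- zG] ++ [seq l (w i) | i : 'I_n].
have gens (c : R) : kgen z c.
  have zG' x : kgen z (h2 x).
    apply: (kgen_map (gG x)) => y yz; apply: fgen_mem; rewrite inE mem_cat.
    by rewrite map_f ?orbT.
  have zV e : kgen z ((l b)^-1 ^+ e).
    elim: e => [|e IHe]; first by rewrite expr0 -(rmorph1 (GRing.in_alg R)); apply: fgenC.
    by rewrite exprS; apply: fgenM => //; apply: fgen_mem; rewrite inE eqxx.
  have zA x : kgen z (lf x).
    rewrite lfk krE /=; have [y [e Ee]] := laB (rho x).
    have kpE' t : kp (la t) = h2 t by apply: kpE.
    have lb : h2 a = l b by rewrite h2E.
    have -> : kp (rho x) = h2 y * (l b)^-1 ^+ e.
      by rewrite -kpE' -Ee lrM lrX kpE' lb exprVn mulrK // unitrX.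
    by apply: fgenM; [exact: zG'|exact: zV].
  have zB y : kgen z (l y).
    have [P <-] := ws y; have [F [FE FC FX]] := mmapP (f : {rmorphism A0 -> B}) w.
    rewrite -FE; elim/mpolyind: P => [|x e P _ _ IH].
      by rewrite !rmorph0 -(rmorph0 (GRing.in_alg R)); apply: fgenC.
    rewrite rmorphD lrD; apply: fgenD => //; rewrite -mul_mpolyC rmorphM lrM FC.
    apply: fgenM; first by have := zA x; rewrite lfE.
    rewrite (mpolyXE_id _ e) rmorph_prod; elim/big_ind: _ => [|x1 x2|i _].
    - by rewrite lr1 -(rmorph1 (GRing.in_alg R)); apply: fgenC.
    - by rewrite lrM; apply: fgenM.
    rewrite rmorphXn FX; elim: (e i) => [|e' IHe].
      by rewrite expr0 lr1 -(rmorph1 (GRing.in_alg R)); apply: fgenC.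
    rewrite exprS lrM; apply: fgenM => //; apply: fgen_mem.
    by rewrite inE mem_cat (map_f (fun i => l (w i))) ?orbT // mem_enum.
  have [y [e Ee]] := lB c.
  have -> : c = l y * (l b)^-1 ^+ e by rewrite -Ee exprVn mulrK // unitrX.
  by apply: fgenM; [exact: zB|exact: zV].
have [|h' h'E] := lU K phi; first exact: Kf.
exists (@Chart k X _ R (fmap l u) (size z) (fun i => nth 0 z i) aR gens).
exists h'; rewrite -Ephi -(@fmap_comp _ X _ _ _ l h' phi) // => x; by have := h'E x.
Qed.
End ChartsExist.

(** * Coordinates on a zip space *)

Section Trig.
Context (R : comUnitRingType).
Implicit Types x y : 'M[R]_4.
Definition trig x := forall i j : 'I_4, (i < j)%N -> x i j = 0.
Lemma trigP x : reflect (trig x) (is_trig_mx x).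
Proof. exact: is_trig_mxP. Qed.

Lemma trig_diag_unit x i : trig x -> x \in unitmx -> x i i \is a GRing.unit.
Proof.
move=> /trigP tx; rewrite unitmxE det_trig // => /unitrPr [z Ez].
by apply/unitrPr; exists (\prod_(j | j != i) x j j * z); rewrite mulrA -[RHS]Ez [in RHS](bigD1 i).
Qed.

Lemma trig_inv x : trig x -> x \in unitmx -> trig (invmx x) /\ forall i, invmx x i i = (x i i)^-1.
Proof.
move=> tx ux; have E := mulmxV ux; set y := invmx x in E *.
have key (i j : 'I_4) : (i <= j)%N -> (forall l : 'I_4, (l < i)%N -> y l j = 0) ->
    x i i * y i j = (i == j)%:R.
  move=> ij h; have := congr1 (fun m : 'M_4 => m i j) E; rewrite !mxE => <-.
  rewrite (bigD1 i) //= big1 ?addr0 // => l li; case: (ltngtP l i) => [li'|il|/val_inj E'].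
  - by rewrite h // mulr0.
  - by rewrite tx // mul0r.
  - by rewrite E' eqxx in li.
have ty : trig y.
  move=> i j; move: {2}(i : nat) (leqnn i) => n; elim: n i => [|n IHn] i il ij.
    apply: (mulrI (trig_diag_unit i tx ux)); rewrite key ?(ltnW ij) ?mulr0 //.
      by rewrite -val_eqE /= ltn_eqF.
    by move=> l; move: il; rewrite leqn0 => /eqP ->.
  apply: (mulrI (trig_diag_unit i tx ux)); rewrite key ?(ltnW ij) ?mulr0 //.
    by rewrite -val_eqE /= ltn_eqF.
  by move=> l li; apply: IHn; [rewrite -ltnS (leq_trans li)|apply: ltn_trans ij].
split=> // i; have ui := trig_diag_unit i tx ux.
apply: (mulrI ui); rewrite key // ?eqxx ?mulrV // => l li; exact: ty.
Qed.
End Trig.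

Definition zt (i : 'I_4) : 'I_4 := if (i < 2)%N then inord (i + 2) else inord (i - 2).
Lemma ztE i : zt i = (if (i < 2)%N then i + 2 else i - 2)%N :> nat.
Proof. by rewrite /zt; have := ltn_ord i; case: ifP => h li; rewrite /= inordK; lia. Qed.
Lemma ztK : involutive zt.
Proof.
by move=> i; apply: val_inj; have := ltn_ord i; rewrite /= !ztE; case: (ltnP i 2) => h li;
  case: ifP; lia.
Qed.
Lemma zeltwE i : zeltw i = zt i.
Proof.
have E (a b : nat) (c : 'I_4) : (a < 4)%N -> (b < 4)%N ->
    tperm (inord a) (inord b) c = if c == a :> nat then inord b else if c == b :> nat then inord a else c.
  move=> ha hb; rewrite permE /= -!val_eqE /= !inordK //.
apply: val_inj; rewrite /= ztE /zeltw /w0I !permM permE /= /refl !inordK // !E //.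
by case: i => -[|[|[|[|//]]]] hi //=; rewrite !(inordK, fun_if) //=; case: eqP.
Qed.

Section Coord.
Context (k : closedFieldType) (q : nat) (q0 : (0 < q)%N) (X : zip_space k q).
Implicit Types (A B C D K : comUnitAlgType k).

(* N = zmap(s) z and Y = N^-1; the permutation zt : i |-> i +- 2 is the one of z. *)
Definition Nm A (s : X A) : 'M[A]_4 := \matrix_(i, j) val (zmap X A s) i (zt j).
Definition Ym A (s : X A) : 'M[A]_4 := \matrix_(i, j) invmx (val (zmap X A s)) (zt i) j.

Lemma Nm_nat A B (f : {lrmorphism A -> B}) s i j : Nm (fmap f s) i j = f (Nm s i j).
Proof. by rewrite !mxE appE /= mxE. Qed.
Lemma map_invmx_lr A B (f : {lrmorphism A -> B}) (g : gl A) : invmx (map_mx f (val g)) = map_mx f (invmx (val g)).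
Proof.
have U : map_mx f (val g) \in unitmx := valP (glmap f g).
apply: (can_inj (mulKmx U)); rewrite mulmxV // -map_mxM mulmxV ?(valP g) //.
by rewrite map_mx1.
Qed.
Lemma Ym_nat A B (f : {lrmorphism A -> B}) s i j : Ym (fmap f s) i j = f (Ym s i j).
Proof. by rewrite !mxE appE /= map_invmx_lr mxE. Qed.

Definition xe i j : fn X := @KMap k X (affine_line k) (fun A s => Nm s i j) (fun A B f s => Nm_nat f s i j).
Definition ye i j : fn X := @KMap k X (affine_line k) (fun A s => Ym s i j) (fun A B f s => Ym_nat f s i j).

Lemma NY A (s : X A) : Nm s *m Ym s = 1%:M.
Proof.
apply/matrixP => i j; rewrite mxE.
have := congr1 (fun m : 'M_4 => m i j) (mulmxV (valP (zmap X A s))); rewrite mxE => <-.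
rewrite [RHS](reindex_inj (can_inj ztK)) /=; apply: eq_bigr => l _.
by rewrite !mxE.
Qed.
Lemma YN A (s : X A) : Ym s *m Nm s = 1%:M.
Proof. by apply: mulmx1C; apply: NY. Qed.
Lemma Nm_unit A (s : X A) : Nm s \in unitmx.
Proof. by have [] := mulmx1_unit (NY s). Qed.
Lemma Ym_inv A (s : X A) : Ym s = invmx (Nm s).
Proof. by apply: (can_inj (mulKmx (Nm_unit s))); rewrite NY mulmxV // Nm_unit. Qed.

Definition bmx A (y : gl A) : 'M[A]_4 := \matrix_(i, j) invmx (val y) (zt i) (zt j).
Definition bmxV A (y : gl A) : 'M[A]_4 := \matrix_(i, j) val y (zt i) (zt j).

Lemma Nm_act A (x y : gl A) (s : X A) : in_E q x y -> Nm (zact x y s) = val x *m Nm s *m bmx y.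
Proof.
move=> Exy; apply/matrixP => i j; rewrite mxE zmap_equiv //= [in RHS]mxE [LHS]mxE.
rewrite [LHS](reindex_inj (can_inj ztK)) /=; apply: eq_bigr => l _.
rewrite [in RHS]mxE [bmx y l j]mxE; congr (_ * _); rewrite !mxE; apply: eq_bigr => l' _.
by rewrite !mxE.
Qed.
Lemma Ym_act A (x y : gl A) (s : X A) : in_E q x y -> Ym (zact x y s) = bmxV y *m Ym s *m invmx (val x).
Proof.
move=> Exy; have U := Nm_unit (zact x y s).
apply: (can_inj (mulKmx U)); rewrite NY Nm_act //.
have bb : bmx y *m bmxV y = 1%:M.
  apply/matrixP => i j; rewrite mxE.
  have := congr1 (fun m : 'M_4 => m (zt i) (zt j)) (mulVmx (valP y)); rewrite !mxE.
  rewrite (inj_eq (can_inj ztK)) => <-.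
  rewrite [RHS](reindex_inj (can_inj ztK)) /=; apply: eq_bigr => l _; by rewrite !mxE.
rewrite !mulmxA -(mulmxA _ (bmx y)) bb mulmx1 -(mulmxA _ (Nm s)) NY mulmx1 mulmxV //; exact: valP.
Qed.

(** The permutation z exchanges the two blocks and keeps the order inside each. It turns the upper
    block triangular y into a lower one, whose diagonal blocks are q-th powers of lower triangular
    blocks of x. *)
Lemma bmx_trig A (x y : gl A) : in_E' q x y ->
  [/\ trig (bmx y), trig (bmxV y), forall i, bmx y i i = (val x (zt i) (zt i) ^+ q)^-1
    & forall i, bmxV y i i = val x (zt i) (zt i) ^+ q].
Proof.
move=> [/(in_EP q0) [lx uy Exy] /trigP tx].
have tV : trig (bmxV y).
  move=> i j ij; rewrite mxE; case: (boolP (sblk (zt i) (zt j))) => h.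
    rewrite Exy // tx ?expr0n ?eqn0Ngt ?q0 //.
    by move: h; rewrite /sblk !ztE; have := ltn_ord i; have := ltn_ord j; case: (ltnP i 2); case: (ltnP j 2); lia.
  by apply: uy; move: h; rewrite /sblk !ztE; have := ltn_ord i; have := ltn_ord j; case: (ltnP i 2); case: (ltnP j
    2); lia.
have bb : bmxV y *m bmx y = 1%:M.
  apply/matrixP => i j; rewrite mxE.
  have := congr1 (fun m : 'M_4 => m (zt i) (zt j)) (mulmxV (valP y)); rewrite !mxE.
  rewrite (inj_eq (can_inj ztK)) => <-.
  rewrite [RHS](reindex_inj (can_inj ztK)) /=; apply: eq_bigr => l _; by rewrite !mxE.
have [uV _] := mulmx1_unit bb.
have Eb : bmx y = invmx (bmxV y) by apply: (can_inj (mulKmx uV)); rewrite bb mulmxV.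
have [tb db] := trig_inv tV uV.
have dV i : bmxV y i i = val x (zt i) (zt i) ^+ q by rewrite mxE Exy // /sblk.
by rewrite Eb; split=> // i; rewrite db dV.
Qed.

(** Multiplication by lower triangular matrices on both sides feeds an entry only from positions to
    its north-east. *)
Lemma corner (R : comUnitRingType) (a m b : 'M[R]_4) (i j : 'I_4) : trig a -> trig b ->
  (forall l l' : 'I_4, (l <= i)%N -> (j <= l')%N -> (l, l') != (i, j) -> m l l' = 0) ->
  (a *m m *m b) i j = a i i * m i j * b j j.
Proof.
move=> ta tb h; have am (l' : 'I_4) : (j <= l')%N -> (a *m m) i l' = a i i * m i l'.
  move=> jl; rewrite mxE (bigD1 i) //= big1 ?addr0 // => l li.
  case: (ltngtP l i) => [li'|il|/val_inj E]; last by rewrite E eqxx in li.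
    by rewrite h ?mulr0 ?(ltnW li') //; apply/eqP => -[E]; rewrite E eqxx in li.
  by rewrite ta // mul0r.
rewrite mxE (bigD1 j) //= am // big1 ?addr0 // => l lj.
case: (ltngtP l j) => [lj'|jl|/val_inj E]; last by rewrite E eqxx in lj.
  by rewrite tb // mulr0.
by rewrite am ?(ltnW jl) // h ?mulr0 ?mul0r ?(ltnW jl) //; apply/eqP => -[E]; rewrite E eqxx in lj.
Qed.

Lemma corner0 (R : comUnitRingType) (a m b : 'M[R]_4) (i j : 'I_4) : trig a -> trig b ->
  (forall l l' : 'I_4, (l <= i)%N -> (j <= l')%N -> m l l' = 0) ->
  (a *m m *m b) i j = 0.
Proof.
by move=> ta tb h; rewrite corner // ?h ?mulr0 ?mul0r // => l l' li jl _; apply: h.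
Qed.

Lemma mpoly_dense D n (p : {mpoly D[n]}) (Y : {lrmorphism D -> k^o} -> Prop) :
  (forall d, (forall y, Y y -> y d = 0) -> d = 0) ->
  (forall y, Y y -> forall v : 'I_n -> k, mmap y v p = 0) -> p = 0.
Proof.
move=> hD hp; apply/mpolyP => m; rewrite mcoeff0; apply: hD => y Yy.
have E : map_mpoly y p = 0.
  apply: contrapT => /eqP ne.
  pose Z := @Ideal {mpoly k[n]} (fun x => x = 0) erefl
    (fun x y hx hy => eq_ind_r (fun t => t + y = 0) (eq_ind_r (fun t => 0 + t = 0) (addr0 0) hy) hx)
    (fun a x hx => eq_ind_r (fun t => a * t = 0) (mulr0 a) hx).
  have pZ : prime_ideal Z.
    split=> [/eqP|a b /eqP]; first by rewrite /= oner_eq0.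
    by rewrite mulf_eq0 => /orP [] /eqP; [left|right].
  have [|f [fC _ fp]] := jacobson_mpoly pZ (b := map_mpoly y p); first exact/eqP.
  move: fp; rewrite (point_of fC) => /eqP; apply.
  rewrite -(hp y Yy (fun i => f 'X_i)).
  have [g1 [g1E g1C g1X]] := mmapP (y : {rmorphism D -> k^o}) (fun i => f 'X_i).
  rewrite -g1E; apply: (@mpoly_rmorph_eq D k n (meval (fun i => f 'X_i) \o map_mpoly y) g1) => [c|i] /=.
    by rewrite map_mpolyC mevalC g1C.
  by rewrite map_mpolyX mevalXU g1X.
by have := congr1 (mcoeff m) E; rewrite mcoeff_map_mpoly mcoeff0.
Qed.

Context (cov : forall K (s : X K), is_field K -> exists c : chart X, cU c K s).
Context (Z : fn X -> Prop) (sZ : smooth_set Z).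
Context (stZ : forall A (x y : gl A) (s : X A), in_E' q x y -> zeros Z s -> zeros Z (zact x y s)).

Lemma character_nat A B (f : {lrmorphism A -> B}) lam (x : gl A) : trig (val x) ->
  f (character lam x) = character lam (glmap f x).
Proof.
move=> tx; rewrite /character (rmorph_prod f); apply: eq_bigr => i _ /=; rewrite mxE.
have ui := trig_diag_unit i tx (valP x).
by case: (lam i) => n; rewrite ?NegzE -?exprnP -?exprnN /= ?lrX // lrV ?unitrX // lrX.
Qed.

(** E' is an open part of an affine space. Over the universal zero of Z in a chart, its universal
    element lives in a localized polynomial ring, where an identity valid at all k-points is
    valid. *)
Lemma E'_dense (h : forall A, X A -> A) lam : natural_on Z h ->
  (forall (x y : gl (k^o : comUnitAlgType k)) (s : pts X), in_E' q x y -> zeros Z s ->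
     h _ (zact x y s) = character lam x * h _ s) ->
  forall A (x y : gl A) (s : X A), in_E' q x y -> zeros Z s ->
     h A (zact x y s) = character lam x * h A s.
Proof.
move=> hn hk A x y s Exy Zs; apply/eqP; rewrite -subr_eq0; apply/eqP.
have [Exy0 /trigP tx] := Exy.
suff : ann (h A (zact x y s) - character lam x * h A s) 1 by rewrite /ann /= mul1r.
apply: prime_unit => P pP SP; have [K [f [Kf f0]]] := residue_field pP.
have [c cs] := cov (fmap f s) Kf.
have [ax [fa am hax]] := local_chart Kf cs.
have [n hn'] : exists n, ax ^+ n * (h A (zact x y s) - character lam x * h A s) = 0; last first.
  by move/negP: fa; apply; apply/eqP/f0/(prime_exp (n := n) pP)/SP.
apply: nilp_ann => B g lg; have [ua _ _] := lg; have [w Ew] := hax _ g ua.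
have Zw : zeros Z (fmap w (cu c)) by rewrite Ew; apply: zeros_map.
have [/(eqs_map Zw)|nz] := pselect (eqs c Z 1).
  by rewrite lr1 => /eqP; rewrite oner_eq0.
have [D [d [ds d0 Zd dU]]] := universal_zero nz.
have [w' w'E] := dU _ _ Zw.
(* Sixteen variables for each of x and y; the entries determined by the equations of E' are
   overwritten in [x0] and [y0]. *)
have [M [io [j [ios io0 jE hU]]]] := mpoly_alg D (4 * 4 + 4 * 4).
pose u a b := io 'X_(lshift (4 * 4) (mxvec_index a b)).
pose v a b := io 'X_(rshift (4 * 4) (mxvec_index a b)).
pose x0 : 'M[M]_4 := \matrix_(a, b) if (a < b)%N then 0 else u a b.
pose y0 : 'M[M]_4 := \matrix_(a, b) if sblk a b then x0 a b ^+ q else if (a < 2)%N then v a b else 0.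
have spec C (e : {lrmorphism D -> C}) (x1 y1 : gl C) : in_E' q x1 y1 ->
    exists e' : {lrmorphism M -> C}, [/\ forall r, e' (j r) = e r, map_mx e' x0 = val x1 & map_mx e' y0 = val y1].
  move=> [/(in_EP q0) [lx1 uy1 E1] /trigP tx1].
  pose vv (i : 'I_(4 * 4 + 4 * 4)) := match split i with inl i => mxvec (val x1) ord0 i | inr i => mxvec (val y1)
    ord0 i end.
  have [e' [e'j e'E]] := hU C e vv.
  have [F [FE FC FX]] := mmapP (e : {rmorphism D -> C}) vv.
  have eu a b : e' (u a b) = val x1 a b.
    by rewrite /u e'E -FE FX /vv (unsplitK (inl _)) mxvecE.
  have ev b1 b2 : e' (v b1 b2) = val y1 b1 b2.
    by rewrite /v e'E -FE FX /vv (unsplitK (inr _)) mxvecE.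
  have ex a b : e' (x0 a b) = val x1 a b.
    by rewrite mxE; case: ifP => ab; [rewrite lr0 tx1|rewrite eu].
  exists e'; split=> //; apply/matrixP => a b; rewrite mxE ?ex // mxE.
  case: ifP => [ab|/negbT ab]; first by rewrite lrX ex E1.
  case: ifP => [a2|/negbT a2]; first by rewrite ev.
  rewrite lr0 uy1 //; first by rewrite leqNgt.
  by move: ab; rewrite /sblk (negPf a2); case: (ltnP b 2).
have E1 C : in_E' q (gl1 C) (gl1 C).
  split; last by apply/trigP => a b ab; rewrite mxE -val_eqE /= ltn_eqF.
  apply/(in_EP q0); split=> [a b ha hb|a b ha hb|a b ab]; rewrite /= !mxE.
  - by case: eqP => // E; move: hb; rewrite -E leqNgt ha.
  - by case: eqP => // E; move: hb; rewrite -E ltnNge ha.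
  - by case: eqP => _; rewrite ?expr1n // expr0n eqn0Ngt q0.
pose dd := \det x0 * \det y0.
have [idD idDE] := lr_id D; have [e1 [_ e1x e1y]] := spec D idD _ _ (E1 D).
have mdet C (e : {lrmorphism M -> C}) (m : 'M[M]_4) : e (\det m) = \det (map_mx e m) by rewrite det_map_mx.
have ddn m : dd ^+ m != 0.
  apply/eqP => /(congr1 e1); rewrite lrX lrM !mdet e1x e1y det1 mulr1 expr1n lr0 => /eqP.
  by rewrite oner_eq0.
have [T [l [ll lU]]] := localization ddn; have [ul lB _] := ll.
have ux : map_mx l x0 \in unitmx.
  by rewrite unitmxE -mdet; move: ul; rewrite lrM unitrM => /andP [].
have uy : map_mx l y0 \in unitmx.
  by rewrite unitmxE -mdet; move: ul; rewrite lrM unitrM => /andP [].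
pose xT : gl T := gl_mk ux; pose yT : gl T := gl_mk uy.
have ET : in_E' q xT yT.
  split; last by apply/trigP => a b ab; rewrite /= !mxE ab lr0.
  apply/(in_EP q0); split=> [a b ha hb|a b ha hb|a b ab]; rewrite /= !mxE.
  - by rewrite (leq_trans ha hb) lr0.
  - by rewrite /sblk hb ltnNge ha /= lr0.
  - by rewrite ab lrX.
have [jl jlE] := lr_comp j l; have [djl djlE] := lr_comp d jl.
pose sT := fmap djl (cu c).
have ZT : zeros Z sT.
  by rewrite /sT (fmap_comp _ djlE); apply: zeros_map.
pose del := h T (zact xT yT sT) - character lam xT * h T sT.
have fact C (e : {lrmorphism D -> C}) (x1 y1 : gl C) : in_E' q x1 y1 ->
    exists2 e' : {lrmorphism T -> C}, e' del = h C (zact x1 y1 (fmap e (fmap d (cu c)))) - character lam x1 * h C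
      (fmap e (fmap d (cu c)))
      & True.
  move=> E11; have [e' [e'j e'x e'y]] := spec C e x1 y1 E11.
  have [|e2 e2E] := lU _ e'.
    rewrite lrM !mdet e'x e'y; apply: unitrM_imp; rewrite -unitmxE; exact: valP.
  exists e2 => //; have e2l z : e2 (l z) = e' z by apply: e2E.
  have gx : glmap e2 xT = x1.
    by apply: val_inj; rewrite /= -e'x; apply/matrixP => a b; rewrite !mxE.
  have gy : glmap e2 yT = y1.
    by apply: val_inj; rewrite /= -e'y; apply/matrixP => a b; rewrite !mxE.
  have es : fmap e2 sT = fmap e (fmap d (cu c)).
    rewrite /sT (fmap_comp _ djlE); have [h1 h1E] := lr_comp jl e2.
    rewrite -(fmap_comp _ h1E); apply: lr_eq => r.
    by rewrite h1E /= jlE /= e2l e'j.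
  rewrite /del lrB lrM -!hn //; last exact: stZ.
  by rewrite zact_nat; [rewrite gx gy es character_nat ?gx //; case: ET => _ /trigP|case: ET].
have del0 : del = 0.
  have [b [m Em]] := lB del; have [p Ep] := ios b; have [pd Epd] := ios dd.
  have pz : p * pd = 0.
    apply: (@mpoly_dense D _ _ (fun e => zeros Z (fmap e (fmap d (cu c))))).
      move=> r hr; have [r' Er] := ds r; rewrite -Er; apply/d0/(chart_dens sZ) => y' Zy'.
      have [e eE] := dU _ _ Zy'; rewrite -eE; rewrite Er; apply: hr.
      by have <- : at_ y' = fmap e (fmap d (cu c)) by apply: fmap_comp => z; rewrite /= eE.
    move=> e Ze vv; have [e' [e'j e'E]] := hU _ e vv.
    rewrite -e'E (rmorphM io) Epd lrM; case: (eqVneq (e' dd) 0) => [->|ne]; first by rewrite mulr0.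
    have [|e2 e2E] := lU _ e'; first by rewrite unit_k.
    have e2l z : e2 (l z) = e' z by apply: e2E.
    suff d0' : e2 del = 0.
      by rewrite -e2l Ep -Em lrM d0' !mul0r.
    have es : fmap e2 sT = fmap e (fmap d (cu c)).
      rewrite /sT (fmap_comp _ djlE); have [h1 h1E] := lr_comp jl e2.
      rewrite -(fmap_comp _ h1E); apply: lr_eq => r.
      by rewrite h1E /= jlE /= e2l e'j.
    rewrite /del lrB lrM -!hn //; last exact: stZ.
    have [ET0 /trigP tT] := ET.
    rewrite zact_nat // es character_nat // hk ?subrr //.
    split; first exact: in_E_map.
    by apply/trigP => a1 b1 ab; rewrite /= mxE tT // lr0.
  have : l (io (p * pd)) = 0 by rewrite pz rmorph0 lr0.
  rewrite (rmorphM io) Epd lrM Ep -Em -mulrA -exprSr => E.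
  by apply: (mulIr (unitrX m.+1 ul)); rewrite E mul0r.
have ExyB : in_E' q (glmap g x) (glmap g y).
  split; first exact: in_E_map.
  by apply/trigP => a1 b1 ab; rewrite /= mxE tx // lr0.
have [e2 e2E _] := fact B w' _ _ ExyB.
have Es : fmap w' (fmap d (cu c)) = fmap g s.
  by rewrite -Ew; apply/esym/fmap_comp => z; rewrite /= w'E.
rewrite lrB lrM -!hn //; last exact: stZ.
by rewrite zact_nat // character_nat // -Es -e2E del0 lr0.
Qed.
End Coord.

(** * Inverses in the zip group *)

Section Frobenius.
Context (k : closedFieldType) (q : nat) (hk : is_Fqbar q k).
Implicit Types (A B C D K : comUnitAlgType k).

Lemma q_gt0 : (0 < q)%N.
Proof. by case: hk => -[p [m [/pcharf_prime /prime_gt0 p0 _ ->]]] _; rewrite expn_gt0 p0. Qed.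

Lemma q_pnat A : [pchar A].-nat q.
Proof.
case: hk => -[p [m [hp _ ->]]] _; have pA : p \in [pchar A] by rewrite pchar_lalg.
by rewrite pnatX pnatE ?pA //; apply: pcharf_prime hp.
Qed.

Lemma frobD A (a b : A) : (a + b) ^+ q = a ^+ q + b ^+ q.
Proof. exact/exprDn_pchar/q_pnat. Qed.
Lemma frob0 A : (0 : A) ^+ q = 0. Proof. by rewrite expr0n eqn0Ngt q_gt0. Qed.
Lemma frob_sum A (I : finType) (P : pred I) (F : I -> A) :
  (\sum_(i | P i) F i) ^+ q = \sum_(i | P i) F i ^+ q.
Proof.
elim/big_rec2: _ => [|i u v _ <-]; first exact: frob0.
exact: frobD.
Qed.

Let blk A (m : 'M[A]_4) : 'M[A]_4 := \matrix_(i, j) if sblk i j then m i j else 0.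
Lemma blk_mul A (a b : 'M[A]_4) : (lowb a /\ lowb b) \/ (uppb a /\ uppb b) -> blk (a *m b) = blk a *m blk b.
Proof.
move=> h; apply/matrixP => i j; rewrite mxE [RHS]mxE.
transitivity (\sum_(l | sblk i l) (if sblk i j then a i l * b l j else 0)); last first.
  rewrite big_mkcond; apply: eq_bigr => l _; rewrite !mxE /sblk.
  by case: (i < 2)%N; case: (l < 2)%N; case: (j < 2)%N; rewrite /= ?mulr0 ?mul0r.
case: ifP => ij; last by rewrite big1.
case: h => -[ha hb]; first exact: lowb_diag.
have := lowb_diag (x := b^T) (y := a^T) (i := j) (j := i); rewrite -trmx_mul [_^T _ _]mxE => -> //.
- apply: eq_big => [l|l _]; last by rewrite !mxE mulrC.
  by move: ij; rewrite /sblk => /eqP ->; rewrite eq_sym.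
- exact/uppb_tr.
- exact/uppb_tr.
- by move: ij; rewrite /sblk eq_sym.
Qed.
Let fr A (m : 'M[A]_4) : 'M[A]_4 := map_mx (fun a => a ^+ q) m.
Lemma fr_mul A (a b : 'M[A]_4) : fr (a *m b) = fr a *m fr b.
Proof.
by apply/matrixP => i j; rewrite !mxE frob_sum; apply: eq_bigr => l _; rewrite !mxE exprMn.
Qed.
Lemma blk1 A : blk (1%:M : 'M[A]_4) = 1%:M.
Proof.
apply/matrixP => i j; rewrite !mxE; case: ifP => // ij; case: eqP => // E.
by rewrite E /sblk eqxx in ij.
Qed.
Lemma fr1 A : fr (1%:M : 'M[A]_4) = 1%:M.
Proof. by apply/matrixP => i j; rewrite !mxE; case: eqP; rewrite ?expr1n ?frob0. Qed.
Lemma EP A (x y : gl A) : in_E q x y <-> [/\ lowb (val x), uppb (val y) & blk (val y) = fr (blk (val x))].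
Proof.
split=> [/(in_EP q_gt0) [lx uy E]|[lx uy E]].
  split=> //; apply/matrixP => i j; rewrite !mxE; case: ifP => ij; first by rewrite E.
  by rewrite frob0.
apply/(in_EP q_gt0); split=> // i j ij.
by have := congr1 (fun m : 'M_4 => m i j) E; rewrite !mxE ij.
Qed.

(** Extracting the diagonal blocks is multiplicative on each of the two parabolics, and so is the
    entrywise q-th power because q is a power of the characteristic. *)
Lemma in_E_inv A (x y : gl A) : in_E q x y -> in_E q (glV x) (glV y).
Proof.
move=> /EP [lx uy E]; have lV := lowb_inv (valP x) lx; have uV := uppb_inv (valP y) uy.
apply/EP; split=> //=.
have E1 : blk (val y) *m blk (invmx (val y)) = 1%:M.
  by rewrite -blk_mul; [rewrite mulmxV ?blk1 //; apply: valP|right].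
have E2 : blk (val y) *m fr (blk (invmx (val x))) = 1%:M.
  rewrite E -fr_mul -blk_mul; last by left.
  by rewrite mulmxV ?blk1 ?fr1 //; apply: valP.
have [u _] := mulmx1_unit E1.
by apply: (can_inj (mulKmx u)); rewrite E1 E2.
Qed.
Lemma in_E'_inv A (x y : gl A) : in_E' q x y -> in_E' q (glV x) (glV y).
Proof.
move=> [Exy /trigP tx]; split; first exact: in_E_inv.
by apply/trigP; have [] := trig_inv tx (valP x).
Qed.
Lemma zactK (X : zip_space k q) A (x y : gl A) (s : X A) : in_E q x y ->
  zact (glV x) (glV y) (zact x y s) = s.
Proof.
move=> E; rewrite -zactM //; last exact: in_E_inv.
rewrite (_ : glM _ _ = gl1 A); last by apply: val_inj; rewrite /= mulVmx // (valP x).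
rewrite (_ : glM (glV y) y = gl1 A); last by apply: val_inj; rewrite /= mulVmx // (valP y).
exact: zact1.
Qed.
Lemma zactKV (X : zip_space k q) A (x y : gl A) (s : X A) : in_E q x y ->
  zact x y (zact (glV x) (glV y) s) = s.
Proof.
move=> E; rewrite -zactM //; last exact: in_E_inv.
rewrite (_ : glM _ _ = gl1 A); last by apply: val_inj; rewrite /= mulmxV // (valP x).
rewrite (_ : glM y (glV y) = gl1 A); last by apply: val_inj; rewrite /= mulmxV // (valP y).
exact: zact1.
Qed.
End Frobenius.

(** * Translation of germs by k-points of the zip group *)

Section Translate.
Context (k : closedFieldType) (q : nat) (hk : is_Fqbar q k) (X : zip_space k q).
Implicit Types (A B C D K : comUnitAlgType k) (Z : fn X -> Prop).
Local Notation ko := (k^o : comUnitAlgType k).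

Lemma structure_map A : {f : {lrmorphism k^o -> A} | forall c, f c = c%:A}.
Proof. exact/cid/in_algP. Qed.
Definition stm A : {lrmorphism k^o -> A} := sval (structure_map A).
Lemma stmE A c : stm A c = c%:A. Proof. exact: (svalP (structure_map A)). Qed.
Opaque stm.

Lemma glmap_stm A B (f : {lrmorphism A -> B}) (x : gl ko) : glmap f (glmap (stm A) x) = glmap (stm B) x.
Proof. by apply: val_inj; apply/matrixP => i j; rewrite /= !mxE !stmE lrA. Qed.
Lemma glmap_stm1 (x : gl ko) : glmap (stm ko) x = x.
Proof. by apply: val_inj; apply/matrixP => i j; rewrite /= !mxE stmE; apply: mulr1. Qed.

Definition trans (x y : gl ko) A (s : X A) : X A := zact (glmap (stm A) x) (glmap (stm A) y) s.

Section Fixed.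
Context (x y : gl ko) (Exy : in_E q x y).
Lemma trans_nat A B (f : {lrmorphism A -> B}) s : fmap f (trans x y s) = trans x y (fmap f s).
Proof. by rewrite /trans zact_nat ?glmap_stm //; apply: in_E_map => //; apply: q_gt0 hk. Qed.
Lemma trans_k (s : pts X) : trans x y s = zact x y s.
Proof. by rewrite /trans !glmap_stm1. Qed.
End Fixed.

Lemma transK (x y : gl ko) A (s : X A) : in_E q x y -> trans (glV x) (glV y) (trans x y s) = s.
Proof.
move=> Exy; have E : in_E q (glmap (stm A) x) (glmap (stm A) y) by apply: in_E_map => //; apply: q_gt0 hk.
rewrite -[RHS](zactK hk s E) /trans; congr zact; apply: val_inj => /=; exact/esym/map_invmx_lr.
Qed.
Lemma transKV (x y : gl ko) A (s : X A) : in_E q x y -> trans x y (trans (glV x) (glV y) s) = s.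
Proof.
move=> Exy; have E : in_E q (glmap (stm A) x) (glmap (stm A) y) by apply: in_E_map => //; apply: q_gt0 hk.
rewrite -[RHS](zactKV hk s E) /trans; congr zact; congr zact; apply: val_inj => /=; exact/esym/map_invmx_lr.
Qed.

(** A chart is moved by translating its universal point; its coordinate ring does not change. *)
Lemma near_trans (x y : gl ko) (s : pts X) Q : in_E q x y -> near s Q ->
  near (zact x y s) (fun t => Q (zact (glV x) (glV y) t)).
Proof.
move=> Exy [c [z [e [Ez ze he]]]]; have EV := in_E_inv hk Exy; have [oU inj UE] := c_open c.
have aff : affine_open (fun A (t : X A) => cU c A (trans (glV x) (glV y) t)) (trans x y (cu c)).
  split=> [A t|A f g|A t].
  - have [I HI] := oU A (trans (glV x) (glV y) t); exists I => B f.
    by rewrite -trans_nat //; apply: HI.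
  - by rewrite !trans_nat // => /(congr1 (trans (glV x) (glV y) (A := A))); rewrite !transK //; apply: inj.
  - split=> [/UE [f Ef]|[f <-]]; first by exists f; rewrite trans_nat // Ef transKV.
    by apply/UE; exists f; rewrite trans_nat // transK.
pose c' := @Chart k X _ (cR c) (trans x y (cu c)) (cn c) (@cv _ _ c) aff (@c_gen _ _ c).
have atE (y' : kpoint c) : @at_ _ _ c' y' = zact x y (at_ y').
  by rewrite /at_ /= trans_nat // trans_k.
exists c', z, e; split=> //; first by rewrite (atE z) Ez.
by move=> y' ye; rewrite (atE y') zactK //; apply: he.
Qed.

Lemma reg_trans (x y : gl ko) Z (s : pts X) phi : in_E q x y ->
  (forall t : pts X, zeros Z t -> zeros Z (zact (glV x) (glV y) t)) -> reg Z s phi ->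
  reg Z (zact x y s) (fun t => phi (zact (glV x) (glV y) t)).
Proof.
move=> Exy hZ [c [z [e [r [Ez ze he]]]]]; have EV := in_E_inv hk Exy; have [oU inj UE] := c_open c.
have aff : affine_open (fun A (t : X A) => cU c A (trans (glV x) (glV y) t)) (trans x y (cu c)).
  split=> [A t|A f g|A t].
  - have [I HI] := oU A (trans (glV x) (glV y) t); exists I => B f.
    by rewrite -trans_nat //; apply: HI.
  - by rewrite !trans_nat // => /(congr1 (trans (glV x) (glV y) (A := A))); rewrite !transK //; apply: inj.
  - split=> [/UE [f Ef]|[f <-]]; first by exists f; rewrite trans_nat // Ef transKV.
    by apply/UE; exists f; rewrite trans_nat // transK.
pose c' := @Chart k X _ (cR c) (trans x y (cu c)) (cn c) (@cv _ _ c) aff (@c_gen _ _ c).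
have atE (y' : kpoint c) : @at_ _ _ c' y' = zact x y (at_ y').
  by rewrite /at_ /= trans_nat // trans_k.
exists c', z, e, r; split=> //; first by rewrite (atE z) Ez.
by move=> y' ye; rewrite (atE y') zactK // => /hZ; rewrite zactK //; apply: he.
Qed.
End Translate.

(** * Local constancy of the vanishing of germs *)

Section Irreducible.
Context (k : closedFieldType) (X : kfunctor k).
Implicit Types (c : chart X) (Z : fn X -> Prop).

(** Functions whose germ vanishes at x form an ideal of a Noetherian ring, so a single denominator
    e0 serves for all of them. *)
Lemma irreducible_nbhd c Z (x : kpoint c) : smooth_set Z -> zeros Z (at_ x) ->
  exists2 e0, x e0 != 0 & forall r, (exists2 e, x e != 0 & eqs c Z (e * r)) -> eqs c Z (e0 * r).
Proof.
move=> sZ Zx; pose P := {mpoly k[cn c]}.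
pose good (I : ideal P) := (forall p, I p -> exists2 e, x e != 0 & eqs c Z (e * gam c p)) /\
  exists2 e0, x e0 != 0 & forall p, I p -> eqs c Z (e0 * gam c p).
have [|I [[IK [e0 xe0 he0]] mI]] := @noeth_mpoly k (cn c) good.
  exists (iprinc 0); split=> [_ [a ->]|].
    by exists 1; rewrite ?lr1 ?oner_neq0 // mulr0 rmorph0 mulr0; apply: ideal0.
  exists 1; first by rewrite lr1 oner_neq0.
  by move=> _ [a ->]; rewrite mulr0 rmorph0 mulr0; apply: ideal0.
exists e0 => // r [e xe he]; have [p Ep] := gam_surj r.
suff : I p by move/he0; rewrite Ep.
have sub z : iadd I (iprinc p) z -> eqs c Z (e0 * e * gam c z).
  apply: (@iadd_sub _ I (iprinc p) (ipre (gam c) (icolon (eqs c Z) (e0 * e)))) => {}z.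
    move=> Iz; change (eqs c Z (e0 * e * gam c z)); rewrite mulrAC mulrC; apply: idealM; exact: he0.
  move=> [a ->]; change (eqs c Z (e0 * e * gam c (a * p))).
  by rewrite rmorphM Ep mulrCA -!mulrA; do 2 apply: idealM.
have xee : x (e0 * e) != 0 by rewrite lrM mulf_neq0.
apply: (mI (iadd I (iprinc p))); last by apply/iaddr/iprinc_mem.
- split; first by move=> z /sub h; exists (e0 * e).
  by exists (e0 * e).
- exact: iaddl.
Qed.

Lemma zg_near Z q phi : smooth_set Z -> zeros Z q -> reg Z q phi ->
  near q (fun q' => zeros Z q' -> zg Z q' phi <-> zg Z q phi).
Proof.
move=> sZ Zq rp; have [c [x Eq]] := near_chart (reg_near rp); rewrite -Eq in rp Zq *.
have [e [r [xe he]]] := reg_in rp; have [e0 xe0 he0] := irreducible_nbhd sZ Zq.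
apply: (@nearI _ _ c x (e * e0)); first by rewrite lrM mulf_neq0.
move=> y; rewrite lrM mulf_eq0 => /norP [ye ye0] Zy.
rewrite (zg_in ye he) (zg_in xe he); split.
  move=> /(chart_nullst sZ Zy) [u yu Ju]; apply: eqs_germ.
  case: (chart_dom (r1 := u) (r2 := r) sZ Zq) => //.
    by exists 1; rewrite ?lr1 ?oner_neq0 // mul1r.
  move/he0/(eqs_map Zy)/eqP; by rewrite lrM mulf_eq0 (negPf ye0) (negPf yu).
move=> /(chart_nullst sZ Zq) /he0 J0; apply: eqs_germ; by exists e0.
Qed.

Lemma zg_point_near Z q phi Q : near q Q -> ~ zg Z q phi -> exists s, [/\ Q s, zeros Z s & phi s != 0].
Proof.
move=> nQ nz; apply: contrapT => no; apply: nz; apply: near_sub nQ => s Qs Zs.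
by apply: contrapT => /eqP ps; apply: no; exists s.
Qed.
Lemma zg_reg_near Z q phi : reg Z q phi -> near q (reg Z^~ phi).
Proof.
move=> [c [x [e [r [<- xe he]]]]]; apply: (@nearI _ _ c x e) => // y ye; by exists c, y, e, r.
Qed.
End Irreducible.

(** * Dividing sections by smooth equations *)

Section Lifting.
Context (k : closedFieldType) (q : nat) (X : zip_space k q).
Implicit Types (A B C D K : comUnitAlgType k) (Z : fn X -> Prop).

Lemma dual_numbers : exists C (p : {lrmorphism C -> k^o}) (e : C),
  [/\ square_zero_quotient p, p e = 0 & e != 0].
Proof.
pose i : {rmorphism k -> {poly k}} := @polyC k.
pose I : ideal {poly k} := iprinc ('X^2).
have I1 : ~ I 1.
  by case=> p /polyP /(_ 0%N); rewrite coefMXn coef1 /= => /eqP; rewrite oner_eq0.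
have [C [f [fs f0 fC]]] := quotient_alg i I1.
have [p pE] : exists p : {lrmorphism C -> k^o}, forall t, p (f t) = t.[0].
  have [|||p pE] := @lr_factor k _ C k^o i f (horner_eval (0 : k)) fs.
  - by move=> t /f0 [a ->]; rewrite /= /horner_eval hornerM hornerXn expr0n mulr0.
  - exact: fC.
  - by move=> c; rewrite /= /horner_eval /i hornerC; apply/esym/mulr1.
  by exists p.
exists C, p, (f 'X); split; last 2 first.
- by rewrite pE hornerX.
- apply/eqP => /f0 [a /polyP /(_ 1%N)]; rewrite coefX coefMXn /= => /eqP; by rewrite oner_eq0.
split=> [d|c c']; first by exists (f d%:P); rewrite pE hornerC.
have [t <-] := fs c; have [t' <-] := fs c'; rewrite !pE => ht ht'.
rewrite -rmorphM; apply/f0.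
have dv (u : {poly k}) : u.[0] = 0 -> exists v, u = v * 'X.
  by move=> /eqP; rewrite -/(root u 0) => /factor_theorem [v ->]; exists v; rewrite subr0.
have [v ->] := dv t ht; have [v' ->] := dv t' ht'.
by exists (v * v'); rewrite expr2 mulrACA.
Qed.

Context (hlift : forall C D (s : {lrmorphism C -> D}) (x : X D) (g : gl C),
  square_zero_quotient s -> zmap X D x = glmap s g -> exists2 x', zmap X C x' = g & fmap s x' = x).

Lemma unit_lift C D (s : {lrmorphism C -> D}) (M : 'M[C]_4) : square_zero_quotient s ->
  map_mx s M \in unitmx -> M \in unitmx.
Proof.
move=> sq; rewrite !unitmxE det_map_mx; exact: square_zero_unit.
Qed.

(** As the map to GL_4 is smooth, the entries of N can be lifted independently of each other; loci
    of vanishing entries are therefore smooth. *)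
Lemma lift_x C D (s : {lrmorphism C -> D}) (x : X D) (M : 'M[C]_4) : square_zero_quotient s ->
  (forall a b, s (M a b) = Nm x a b) -> exists2 x' : X C, fmap s x' = x & Nm x' = M.
Proof.
move=> sq E; pose G : 'M[C]_4 := \matrix_(i, j) M i (zt j).
have EG : map_mx s G = val (zmap X D x).
  by apply/matrixP => a b; rewrite !mxE E mxE ztK.
have uG : G \in unitmx by apply: (unit_lift sq); rewrite EG; apply: valP.
have [|x' Ex' Es] := hlift (x := x) (g := gl_mk uG) sq; first by apply: val_inj; rewrite /= EG.
by exists x' => //; apply/matrixP => a b; rewrite mxE Ex' /= mxE ztK.
Qed.

Lemma lift_y C D (s : {lrmorphism C -> D}) (x : X D) (M : 'M[C]_4) : square_zero_quotient s ->
  (forall a b, s (M a b) = Ym x a b) -> exists2 x' : X C, fmap s x' = x & Ym x' = M.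
Proof.
move=> sq E; pose G : 'M[C]_4 := \matrix_(i, j) M (zt i) j.
have EG : map_mx s G = invmx (val (zmap X D x)).
  by apply/matrixP => a b; rewrite !mxE E mxE ztK.
have uG : G \in unitmx by apply: (unit_lift sq); rewrite EG unitmx_inv; apply: valP.
have uV : invmx G \in unitmx by rewrite unitmx_inv.
have [|x' Ex' Es] := hlift (x := x) (g := gl_mk uV) sq.
  apply: val_inj; rewrite /= -(map_invmx_lr s (gl_mk uG)) /= EG invmxK //.
by exists x' => //; apply/matrixP => a b; rewrite mxE Ex' /= invmxK mxE ztK.
Qed.

Definition xset (P : 'I_4 -> 'I_4 -> bool) : fn X -> Prop := fun E => exists a b, P a b /\ E = xe X a b.
Definition yset (P : 'I_4 -> 'I_4 -> bool) : fn X -> Prop := fun E => exists a b, P a b /\ E = ye X a b.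

Lemma zeros_x P A (s : X A) : zeros (xset P) s <-> forall a b, P a b -> Nm s a b = 0.
Proof.
split=> [h a b ab|h _ [a [b [ab ->]]]]; last exact: (h a b).
by apply: (h (xe X a b)); exists a, b.
Qed.
Lemma zeros_y P A (s : X A) : zeros (yset P) s <-> forall a b, P a b -> Ym s a b = 0.
Proof.
split=> [h a b ab|h _ [a [b [ab ->]]]]; last exact: (h a b).
by apply: (h (ye X a b)); exists a, b.
Qed.

Lemma smooth_eq Z Z' : (forall A (s : X A), zeros Z s <-> zeros Z' s) -> smooth_set Z -> smooth_set Z'.
Proof. by move=> E sZ C D s x sq /E Zx; have [x' /E] := sZ C D s x sq Zx; exists x'. Qed.

Lemma smooth_x P : smooth_set (xset P).
Proof.
move=> C D s x sq /zeros_x Zx; have [ss _] := sq.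
have [l lE] := choice (fun ab : 'I_4 * 'I_4 => ss (Nm x ab.1 ab.2)).
have [|x' Es EN] := @lift_x C D s x (\matrix_(a, b) if P a b then 0 else l (a, b)) sq.
  by move=> a b; rewrite mxE; case: ifP => ab; [rewrite lr0 Zx|rewrite lE].
by exists x' => //; apply/zeros_x => a b ab; rewrite EN mxE ab.
Qed.
Lemma smooth_y P : smooth_set (yset P).
Proof.
move=> C D s x sq /zeros_y Zx; have [ss _] := sq.
have [l lE] := choice (fun ab : 'I_4 * 'I_4 => ss (Ym x ab.1 ab.2)).
have [|x' Es EN] := @lift_y C D s x (\matrix_(a, b) if P a b then 0 else l (a, b)) sq.
  by move=> a b; rewrite mxE; case: ifP => ab; [rewrite lr0 Zx|rewrite lE].
by exists x' => //; apply/zeros_y => a b ab; rewrite EN mxE ab.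
Qed.

(** A zero germ vanishes on every point over the dual numbers above p, so one tangent vector on
    which h is nonzero is enough. *)
Lemma not_zg Z h (p : pts X) : smooth_set Z -> zeros Z p ->
  (forall C (f : {lrmorphism C -> k^o}) (e : C), square_zero_quotient f -> f e = 0 -> e != 0 -> ev h p = 0 ->
    exists s : X C, [/\ fmap f s = p, zeros Z s & ev h s != 0]) -> ~ zg Z p (@ev _ _ h k^o).
Proof.
move=> sZ Zp H zh; have hp : ev h p = 0 by apply: (near_at zh).
have [C [f [e [sq fe e0]]]] := dual_numbers.
have [s [Es Zs hs]] := H C f e sq fe e0 hp.
move/eqP: hs; apply; apply: (zg_point sZ zh Zs Es) => a fa.
by apply: (square_zero_unit sq); rewrite unit_k.
Qed.

Lemma not_zg_x P (a b : 'I_4) p : ~~ P a b -> zeros (xset P) p -> ~ zg (xset P) p (@ev _ _ (xe X a b) k^o).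
Proof.
move=> nP Zp; apply: (@not_zg _ (xe X a b) p (@smooth_x P) Zp) => C f e sq fe e0 hp.
have /zeros_x Zx := Zp.
have [|x' Es EN] := @lift_x C k^o f p (\matrix_(i, j) if (i == a) && (j == b) then e else (Nm p i j : k)%:A) sq.
  move=> i j; rewrite mxE; case: ifP => [/andP [/eqP -> /eqP ->]|_]; first by rewrite fe; apply/esym/hp.
  by rewrite lrA; apply: mulr1.
exists x'; split=> //.
  apply/zeros_x => i j ij; rewrite EN mxE; case: ifP => [/andP [/eqP E /eqP E']|_].
    by rewrite -E -E' ij in nP.
  by rewrite Zx // scale0r.
by rewrite /ev /= EN mxE !eqxx.
Qed.
Lemma not_zg_y P (a b : 'I_4) p : ~~ P a b -> zeros (yset P) p -> ~ zg (yset P) p (@ev _ _ (ye X a b) k^o).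
Proof.
move=> nP Zp; apply: (@not_zg _ (ye X a b) p (@smooth_y P) Zp) => C f e sq fe e0 hp.
have /zeros_y Zx := Zp.
have [|x' Es EN] := @lift_y C k^o f p (\matrix_(i, j) if (i == a) && (j == b) then e else (Ym p i j : k)%:A) sq.
  move=> i j; rewrite mxE; case: ifP => [/andP [/eqP -> /eqP ->]|_]; first by rewrite fe; apply/esym/hp.
  by rewrite lrA; apply: mulr1.
exists x'; split=> //.
  apply/zeros_y => i j ij; rewrite EN mxE; case: ifP => [/andP [/eqP E /eqP E']|_].
    by rewrite -E -E' ij in nP.
  by rewrite Zx // scale0r.
by rewrite /ev /= EN mxE !eqxx.
Qed.
End Lifting.

(** * Sections on closed strata and their quotients *)

Section Nodes.
Context (k : closedFieldType) (q : nat) (hk : is_Fqbar q k) (X : zip_space k q).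
Implicit Types (A B C D K : comUnitAlgType k) (Z : fn X -> Prop) (lam chi : weight).
Local Notation ko := (k^o : comUnitAlgType k).

Definition F1 (s : pts X) := trig (Nm s).
(** The closure of the stratum of the simple reflection with index i, counted from 0. For i > 2 no
    position is exempt and the condition is [F1]. *)
Definition onC (i : nat) (s : pts X) := forall a b : 'I_4, (a < b)%N ->
  ~~ ((a == i :> nat) && (b == i.+1 :> nat)) -> Nm s a b = 0.

(* A section phi of weight lam on the closed stratum Z, obtained by divisions that are possible only on W;
   W meets every one-dimensional stratum in a clopen set, outside which phi may be extended by 0. *)
Record node Z lam (W : pts X -> Prop) (phi : pts X -> k) : Prop := Node {
  n_open : forall s, W s -> zeros Z s -> near s (fun t => zeros Z t -> W t);
  n_F1 : forall s, F1 s -> W s;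
  n_st : forall (x y : gl ko) s, in_E' q x y -> zeros Z s -> W s -> W (zact x y s);
  n_reg : forall s, W s -> zeros Z s -> reg Z s phi;
  n_eq : forall (x y : gl ko) s, in_E' q x y -> W s -> zeros Z s ->
    phi (zact x y s) = character lam x * phi s;
  n_clo : forall i s, onC i s -> zeros Z s -> ~ W s -> near s (fun t => onC i t -> zeros Z t -> ~ W t) }.

Lemma node_sub Z Z' lam W phi : (forall s : pts X, zeros Z' s -> zeros Z s) ->
  node Z lam W phi -> node Z' lam W phi.
Proof.
move=> ZZ [n1 n2 n3 n4 n5 n6]; split=> //.
- by move=> s Ws /ZZ Zs; apply: near_sub (n1 s Ws Zs) => t h /ZZ.
- by move=> x y s E /ZZ Zs; apply: n3.
- by move=> s Ws /ZZ Zs; apply: reg_sub (n4 s Ws Zs).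
- by move=> x y s E Ws /ZZ; apply: n5.
- by move=> i s Cs /ZZ Zs nW; apply: near_sub (n6 i s Cs Zs nW) => t h Ct /ZZ; apply: h.
Qed.

Lemma reg_add Z (p : pts X) phi psi : reg Z p phi -> reg Z p psi -> reg Z p (fun s => phi s - psi s).
Proof.
move=> h; have [c [x Eq]] := near_chart (reg_near h); rewrite -Eq in h * => h'.
have [e [r [xe he]]] := reg_in h; have [e' [r' [xe' he']]] := reg_in h'.
exists c, x, (e * e'), (r * e' - r' * e); rewrite lrM mulf_neq0 //; split=> // y.
rewrite lrM mulf_eq0 => /norP [ye ye'] Zy.
by rewrite lrB !lrM -he // -he' //; move: (phi _) (psi _) (y e) (y e') => /= *; ring.
Qed.

Lemma charB lam chi (x : gl ko) : trig (val x) ->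
  character (fun i => lam i - chi i) x = character lam x / character chi x.
Proof.
move=> tx; rewrite /character -prodf_div; apply: eq_bigr => i _.
have ui := trig_diag_unit i tx (valP x); rewrite unit_k in ui.
by rewrite expfzDr // -invr_expz.
Qed.
Lemma char_neq0 lam (x : gl ko) : trig (val x) -> character lam x != 0.
Proof.
move=> tx; apply/prodf_neq0 => i _.
have ui := trig_diag_unit i tx (valP x); rewrite unit_k in ui.
exact: expfz_neq0.
Qed.

Section Division.
Context Z (h : fn X) chi (sZ : smooth_set Z) (sZh : smooth_set (addeq Z h))
  (stZ : forall (x y : gl ko) (s : pts X), in_E' q x y -> zeros Z s -> zeros Z (zact x y s))
  (hE : forall (x y : gl ko) (s : pts X), in_E' q x y -> zeros Z s -> ev h (zact x y s) = character chi x * ev h s)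
  (FZ : forall s : pts X, F1 s -> zeros Z s /\ ev h s = 0)
  (hN : forall s : pts X, zeros Z s -> ~ zg Z s (@ev _ _ h k^o))
  (hC : forall i, (forall s, onC i s -> zeros Z s -> ev h s = 0) \/
     (forall s, onC i s -> zeros Z s -> ev h s = 0 -> F1 s)).

Let quo (phi psi : pts X -> k) (s : pts X) :=
  reg Z s psi /\ near s (fun t => zeros Z t -> phi t = ev h t * psi t).

Lemma quo_uniq phi psi psi' s : zeros Z s -> quo phi psi s -> quo phi psi' s -> psi s = psi' s.
Proof.
move=> Zs [r1 n1] [r2 n2].
have ns : near s (fun=> True) := reg_near r1.
have [|||h0|/near_at h0] := @zg_dom _ _ Z s (@ev _ _ h k^o) (fun t => psi t - psi' t) sZ Zs.
- exact: reg_ev.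
- exact: reg_add.
- apply: near_sub (near_and n1 n2) => t [h1 h2] Zt.
  by rewrite mulrBr -h1 // -h2 // subrr.
- by case: (hN Zs h0).
by apply/eqP; rewrite -subr_eq0; apply/eqP/h0.
Qed.

Lemma quo_near phi psi s : quo phi psi s -> near s (fun t => quo phi psi t).
Proof. by move=> [r1 n1]; apply: near_and (zg_reg_near r1) (near_near n1). Qed.

(** W' consists of the points of W where a local quotient exists; it is open, stable under E' and
    contains [F1]. On the curve i its complement is open as well: either h vanishes on the curve,
    and having a nonzero germ along h = 0 is a locally constant condition, or h vanishes only on
    [F1], inside W'. *)
Lemma divide1 lam W phi : node Z lam W phi -> (forall p, F1 p -> zg (addeq Z h) p phi) ->
  exists W' phi', node Z (fun i => lam i - chi i) W' phi' /\
    forall p, F1 p -> near p (fun s => zeros Z s -> phi s = ev h s * phi' s).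
Proof.
move=> [n1 n2 n3 n4 n5 n6] hz.
pose W' s := W s /\ (zeros Z s -> exists psi, quo phi psi s).
(* Local quotients have equal values at s, since local rings of Z are domains and h is not a zero
   germ; the choice is thus harmless. *)
pose phi' s := xget (0 : k) (fun v => exists2 psi, quo phi psi s & v = psi s).
have phi'E psi s : zeros Z s -> quo phi psi s -> phi' s = psi s.
  move=> Zs qs; rewrite /phi'; case: xgetP => [v _ [psi' q' ->]|/(_ (psi s)) []].
    exact: (quo_uniq Zs q' qs).
  by exists psi.
have phi'N psi s : quo phi psi s -> near s (fun t => zeros Z t -> psi t = phi' t).
  by move/quo_near; apply: near_sub => t qt Zt; rewrite (phi'E psi).
have FW p : F1 p -> W' p.
  move=> Fp; split=> [|Zp]; first exact: n2.
  have [Zp' hp] := FZ Fp.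
  have [|psi r1 n7] := zg_div sZh _ (n4 p (n2 p Fp) Zp) (hz p Fp); last by exists psi.
  exact/zeros_add.
have trq (x y : gl ko) s psi : in_E' q x y -> W s -> zeros Z s -> quo phi psi s ->
   quo phi (fun t => character lam x / character chi x * psi (zact (glV x) (glV y) t)) (zact x y s).
  move=> E Ws Zs [r1 m1]; have [Exy /trigP tx] := E; have EV := in_E'_inv hk E.
  have ZV (t : pts X) : zeros Z t -> zeros Z (zact (glV x) (glV y) t) by apply: stZ.
  have r2 := reg_trans hk Exy ZV r1; split.
    by apply: (reg_mul _ r2); apply: reg_cst (reg_near r2).
  have m2 := near_trans hk Exy (near_and m1 (n1 s Ws Zs)).
  apply: near_sub m2 => t [m3 Wt] Zt; have := m3 (ZV _ Zt).
  set t' := zact (glV x) (glV y) t; have Zt' : zeros Z t' := ZV _ Zt.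
  have Et : t = zact x y t' by rewrite zactKV.
  move=> E1; have Eh : ev h t = character chi x * ev h t' by rewrite {1}Et hE.
  have Ep : phi t = character lam x * phi t' by rewrite {1}Et n5 //; apply: Wt.
  rewrite Ep Eh E1; have c0 := char_neq0 chi tx.
  have aux (u v w z : k) : z != 0 -> w * (u * v) = z * u * (w / z * v) by move=> z0; field.
  exact: aux.
exists W', phi'; split; last first.
  move=> p Fp; have [_ /(_ (FZ Fp).1) [psi qp]] := FW p Fp.
  apply: near_sub (near_and (phi'N _ _ qp) qp.2) => t [e1 e2] Zt.
  by rewrite -e1 // e2.
split=> //.
- move=> s [Ws /[swap] Zs /(_ Zs) [psi qs]].
  apply: near_sub (near_and (n1 s Ws Zs) (quo_near qs)) => t [h1 h2] Zt.
  by split; [apply: h1|exists psi].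
- move=> x y s E Zs [Ws /(_ Zs) [psi qs]]; split; first exact: n3.
  by move=> _; eexists; apply: trq E Ws Zs qs.
- move=> s [Ws /[swap] Zs /(_ Zs) [psi qs]].
  by apply: reg_eq (phi'N _ _ qs) qs.1.
- move=> x y s E [Ws /[swap] Zs /(_ Zs) [psi qs]].
  have [Exy /trigP tx] := E.
  rewrite (phi'E _ _ (stZ E Zs) (trq x y s psi E Ws Zs qs)) zactK //.
  by rewrite (phi'E _ _ Zs qs) charB.
- move=> i s Cs Zs nW'; have [Ws|nW] := pselect (W s); last first.
    by apply: near_sub (n6 i s Cs Zs nW) => t ht Ct Zt [Wt _]; apply: ht.
  (* Where h is invertible phi / h is a quotient, so a point of W outside W' lies on h = 0. *)
  have hs : ev h s = 0.
    apply: contrapT => /eqP hs; apply: nW'; split=> // _.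
    have rh : reg Z s (@ev _ _ h k^o) by apply: reg_ev; apply: reg_near (n4 s Ws Zs).
    exists (fun t => phi t * (ev h t)^-1); split.
      by apply: reg_mul (n4 s Ws Zs) _; apply: reg_inv.
    apply: near_sub (reg_neq0 rh Zs hs) => t ht Zt; by rewrite mulrCA divff ?mulr1 // ht.
  have Zhs : zeros (addeq Z h) s by apply/zeros_add.
  have rs : reg (addeq Z h) s phi by apply: reg_sub (n4 s Ws Zs) => t /zeros_add [].
  have nzg : ~ zg (addeq Z h) s phi.
    by move=> zs; apply: nW'; split=> // _; have [psi r1 m1] := zg_div sZh Zhs (n4 s Ws Zs) zs; exists psi.
  case: (hC i) => [h0|hF]; last by case: nzg; apply: hz; apply: (hF s).
  apply: near_sub (zg_near sZh Zhs rs) => t ht Ct Zt [Wt /(_ Zt) [psi [_ qt]]].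
  apply: nzg; apply/(ht _); first by apply/zeros_add; split=> //; apply: h0.
  by apply: near_sub qt => t' e /zeros_add [Zt' h']; rewrite e // h' mul0r.
Qed.

(** Division stops as soon as the quotient is nonzero along h = 0 near some point of [F1]. If it
    never stopped, phi would be divisible by all powers of h and be a zero germ by Krull's
    theorem. *)
Lemma divide lam W phi : node Z lam W phi -> (exists2 p, F1 p & ~ zg Z p phi) ->
  exists (m : nat) W' phi', [/\ node Z (fun i => lam i - m%:Z * chi i) W' phi',
    exists2 p, F1 p & ~ zg (addeq Z h) p phi'
    & forall p, F1 p -> near p (fun s => zeros Z s -> phi s = ev h s ^+ m * phi' s)].
Proof.
move=> nd [p0 F0 nz]; apply: contrapT => no.
have all (m : nat) : exists W' phi', node Z (fun i => lam i - m%:Z * chi i) W' phi' /\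
    forall p, F1 p -> near p (fun s => zeros Z s -> phi s = ev h s ^+ m * phi' s).
  elim: m => [|m [W' [phi' [nd' hp]]]].
    exists W, phi; split.
      by rewrite (_ : (fun i => _) = lam) //; apply/funext => i; rewrite mul0r subr0.
    move=> p Fp; have [Zp _] := FZ Fp; have [_ n2 _ n4 _ _] := nd.
    by apply: near_sub (reg_near (n4 p (n2 p Fp) Zp)) => t _ _; rewrite mul1r.
  have [|W2 [phi2 [nd2 hp2]]] := divide1 nd'.
    move=> p Fp; apply: contrapT => np; apply: no; exists m, W', phi'; split=> //.
    by exists p.
  exists W2, phi2; split.
    rewrite (_ : (fun i => _) = (fun i => lam i - m%:Z * chi i - chi i)) //; apply/funext => i.
    by rewrite -addrA -opprD intS mulrDl mul1r [chi i + _]addrC.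
  move=> p Fp; apply: near_sub (near_and (hp p Fp) (hp2 p Fp)) => t [e1 e2] Zt.
  by rewrite e1 // e2 // mulrA -exprSr.
have [Z0 h0] := FZ F0; apply: nz.
have [_ n2 _ n4 _ _] := nd.
apply: (zg_krull sZ Z0 h0 (n4 p0 (n2 p0 F0) Z0)) => m.
have [W' [phi' [[_ n2' _ n4' _ _] hp]]] := all m; exists phi'; last exact: hp.
by apply: n4' => //; apply: n2'.
Qed.
End Division.
End Nodes.

(** * Strata of length one *)

Import Num.Theory.

Section Strata.
Context (k : closedFieldType) (q : nat) (hk : is_Fqbar q k) (X : zip_space k q).
Implicit Types (A B C D K : comUnitAlgType k) (Z : fn X -> Prop) (lam chi : weight).
Local Notation ko := (k^o : comUnitAlgType k).

Lemma Nm_mul A (s : X A) : Nm s = val (zmap X A s) *m perm_mx zeltw.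
Proof.
rewrite -[zeltw]invgK -col_permE; apply/matrixP => i j; rewrite !mxE; congr (fun_of_matrix _ _ _).
by apply: (@perm_inj _ zeltw); rewrite permKV zeltwE ztK.
Qed.

Lemma stratum_Nm A (s : X A) w : flag_stratum w s <-> exists b b' : gl A,
  [/\ in_B b, in_B b' & Nm s = val b *m perm_mx w *m val b'].
Proof.
have up : (perm_mx zeltw : 'M[A]_4) \in unitmx by apply: unitmx_perm.
split=> -[b [b' [hb hb' E]]]; exists b, b'; split=> //.
  by rewrite Nm_mul E /= mulmxKV.
apply: val_inj => /=; rewrite -E Nm_mul mulmxK //.
Qed.

Definition offC (i : nat) (a b : 'I_4) := (a < b)%N && ~~ ((a == i :> nat) && (b == i.+1 :> nat)).
Definition CE i : fn X -> Prop := @xset k q X (offC i).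

Lemma zeros_C i (s : pts X) : zeros (CE i) s <-> onC i s.
Proof.
rewrite zeros_x; split=> h a b; first by move=> ab nab; apply: h; rewrite /offC ab.
by move=> /andP [ab nab]; apply: h.
Qed.

Lemma closed_zeros Z : closed_sub (fun A s => zeros Z s).
Proof.
move=> A x; exists (fun a => exists2 E, Z E & a = ev E x) => B f; split=> [h _ [E ZE ->]|h E ZE].
  by rewrite -evE h.
by rewrite evE h //; exists E.
Qed.

Lemma xset_stable (P : 'I_4 -> 'I_4 -> bool) A (x y : gl A) (s : X A) :
  (forall a b a' b' : 'I_4, P a b -> (a' <= a)%N -> (b <= b')%N -> P a' b') ->
  in_E' q x y -> zeros (@xset k q X P) s -> zeros (@xset k q X P) (zact x y s).
Proof.
move=> hP Exy; rewrite !zeros_x => h a b ab; have [E /trigP tx] := Exy.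
have [tb _ _ _] := bmx_trig (q_gt0 hk) Exy.
by rewrite Nm_act // corner0 // => l l' la bl; apply/h/(hP a b).
Qed.
Lemma yset_stable (P : 'I_4 -> 'I_4 -> bool) A (x y : gl A) (s : X A) :
  (forall a b a' b' : 'I_4, P a b -> (a' <= a)%N -> (b <= b')%N -> P a' b') ->
  in_E' q x y -> zeros (@yset k q X P) s -> zeros (@yset k q X P) (zact x y s).
Proof.
move=> hP Exy; rewrite !zeros_y => h a b ab; have [E /trigP tx] := Exy.
have [_ tb _ _] := bmx_trig (q_gt0 hk) Exy; have [tV _] := trig_inv tx (valP x).
by rewrite Ym_act // corner0 // => l l' la bl; apply/h/(hP a b).
Qed.

Lemma CE_stable i A (x y : gl A) (s : X A) : in_E' q x y -> zeros (CE i) s -> zeros (CE i) (zact x y s).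
Proof.
move=> Exy; rewrite !zeros_x => h a b /andP [ab nab]; have [E /trigP tx] := Exy.
have [tb _ _ _] := bmx_trig (q_gt0 hk) Exy.
rewrite Nm_act // corner0 // => l l' la bl; apply: h; rewrite /offC (leq_ltn_trans la) ?(leq_trans ab) //=.
move: nab; rewrite !negb_and; lia.
Qed.

Lemma perm_refl (R : nzRingType) (i : 'I_3) (a b : 'I_4) : (perm_mx (refl i) : 'M[R]_4) a b =
  (if a == i :> nat then (b == i.+1 :> nat)%:R else if a == i.+1 :> nat then (b == i :> nat)%:R else (a == b)%:R).
Proof.
have hi := ltn_ord i.
have e1 (c : 'I_4) : (c == inord i) = (c == i :> nat) by rewrite -val_eqE /= inordK //; lia.
have e2 (c : 'I_4) : (c == inord i.+1) = (c == i.+1 :> nat) by rewrite -val_eqE /= inordK //; lia.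
rewrite !mxE /refl permE /= e1 e2; case: ifP => _; first by rewrite eq_sym e2.
by case: ifP => _; first by rewrite eq_sym e1.
Qed.

Lemma stratum_C (i : 'I_3) A (s : X A) : flag_stratum (refl i) s -> zeros (CE i) s.
Proof.
case/stratum_Nm => b [b' [/trigP tb /trigP tb' E]]; apply/zeros_x => a c /andP [ac nac].
rewrite E corner0 // => l l' la cl; rewrite perm_refl.
move: nac; rewrite negb_and -val_eqE /=.
by do 2 (case: eqP => ?); rewrite ?mulr0n //; do ?case: eqP => ? //; lia.
Qed.

Lemma closure_C (i : 'I_3) A (s : X A) : flag_closure (flag_stratum (refl i)) s -> zeros (CE i) s.
Proof.
apply; first exact: closed_zeros.
  by move=> B x y t Exy; apply: CE_stable.
by move=> B t; apply: stratum_C.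
Qed.

(** An explicit Bruhat decomposition: subtracting z times column b from column a clears the entry
    (a, a), and exchanging the two columns then gives a lower triangular matrix. *)
Lemma offC_decomp (i : 'I_3) (M : 'M[ko]_4) (a b : 'I_4) : a = i :> nat -> b = i.+1 :> nat -> M \in unitmx ->
  (forall c d : 'I_4, offC i c d -> M c d = 0) -> M a b != 0 ->
  exists u u' : gl ko, [/\ in_B u, in_B u' & M = val u *m perm_mx (refl i) *m val u'].
Proof.
move=> ai bi uM Cs x0; set x := M a b in x0; pose z := M a a / x.
have ab : a != b by rewrite -val_eqE /= ai bi; lia.
pose L : 'M[ko]_4 := 1%:M + z *: delta_mx b a; pose L' : 'M[ko]_4 := 1%:M - z *: delta_mx b a.
have LL : L' *m L = 1%:M.
  rewrite /L /L' mulmxDr mulmx1 mulmxBl mul1mx -scalemxAr -scalemxAl mul_delta_mx_0 ?scaler0 ?subr0 ?subrK //.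
have uL : L \in unitmx by have [] := mulmx1_unit LL.
have up : (perm_mx (refl i) : 'M[ko]_4) \in unitmx by apply: unitmx_perm.
have ub : M *m L' *m perm_mx (refl i) \in unitmx.
  rewrite !unitmx_mul uM up andbT /=; have [] := mulmx1_unit LL; by move=> ->.
exists (gl_mk ub), (gl_mk uL); split; last first.
- rewrite /= -(mulmxA (M *m L')) -perm_mxM.
  have -> : (refl i * refl i)%g = 1%g by rewrite /refl tperm2.
  by rewrite perm_mx1 mulmx1 -mulmxA LL mulmx1.
- apply/trigP => c d cd; rewrite !mxE.
  have -> : (c == d) = false by apply/negbTE; rewrite -val_eqE /=; lia.
  have -> : (c == b) && (d == a) = false.
    by apply/negP => /andP [/eqP Ec /eqP Ed]; move: cd; rewrite Ec Ed ai bi; lia.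
  by rewrite mulr0 addr0.
have EL c d : (M *m L') c d = M c d - (d == a)%:R * z * M c b.
  rewrite /L' mulmxBr mulmx1 !mxE; congr (_ - _); rewrite (bigD1 b) //= big1 ?addr0.
    by rewrite !mxE eqxx /= mulrC; case: eqP; rewrite ?mul1r ?mulr1 // mulr0 !mul0r.
  by move=> l /negPf lb; rewrite !mxE lb /= !mulr0.
apply/trigP => c d cd; change ((M *m L' *m perm_mx (refl i)) c d = 0).
rewrite -[refl i]invgK -col_permE mxE.
have -> : (refl i)^-1%g = refl i by rewrite /refl tpermV.
have Ea : inord i = a by apply: val_inj; rewrite /= inordK ?ai // -ai ltn_ord.
have Eb : inord i.+1 = b by apply: val_inj; rewrite /= inordK ?bi // -bi ltn_ord.
rewrite /refl Ea Eb permE /= EL.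
have hN (u v : 'I_4) : (u < v)%N -> ~~ ((u == a) && (v == b)) -> M u v = 0.
  by move=> uv nuv; apply: Cs; rewrite /offC uv -bi -ai; move: nuv; rewrite -!val_eqE.
case: (eqVneq d a) => [Ed|da].
  rewrite eq_sym (negPf ab) mul0r mul0r subr0; apply: hN; first by rewrite Ed in cd; lia.
  by apply/negP => /andP [/eqP Ec _]; rewrite Ec Ed ltnn in cd.
case: (eqVneq d b) => [Ed|db].
  rewrite eqxx mul1r; case: (eqVneq c a) => [->|ca]; first by rewrite /z divfK ?subrr.
  have ca' : (c < a)%N by move: ca cd; rewrite Ed -val_eqE /=; lia.
  by rewrite !hN ?mulr0 ?subr0 //; rewrite ?(negPf ca) //; lia.
by rewrite (negPf da) !mul0r subr0 hN // (negPf db) andbF.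
Qed.

Lemma C_stratum (i : 'I_3) (s : pts X) (a b : 'I_4) : a = i :> nat -> b = i.+1 :> nat ->
  zeros (CE i) s -> Nm s a b != 0 -> flag_stratum (refl i) s.
Proof.
move=> ai bi /zeros_x Cs x0; apply/stratum_Nm.
exact: offC_decomp ai bi (Nm_unit s) Cs x0.
Qed.

(** The union of the strata of 1 and of a simple reflection is stable under inversion, so the curves
    can be described by N or by N^-1. *)
Lemma offC_inv (i : 'I_3) (M M' : 'M[ko]_4) (a b : 'I_4) : a = i :> nat -> b = i.+1 :> nat -> M *m M' = 1%:M ->
  (forall c d : 'I_4, offC i c d -> M c d = 0) ->
  (forall c d : 'I_4, offC i c d -> M' c d = 0) /\ (M' a b = 0 -> M a b = 0).
Proof.
move=> ai bi E Cs; have [uM _] := mulmx1_unit E.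
have EM : M' = invmx M by apply: (can_inj (mulKmx uM)); rewrite E mulmxV.
case: (eqVneq (M a b) 0) => [x0|x0].
  have tM : trig M.
    move=> c d cd; case: (boolP (offC i c d)) => [/Cs //|]; rewrite /offC cd /= negbK => /andP [/eqP Ec /eqP Ed].
    by rewrite -x0; congr (M _ _); apply: val_inj; rewrite /= ?ai ?bi.
  have [tV _] := trig_inv tM uM; rewrite EM; split=> // c d /andP [cd _]; exact: tV.
have [u [u' [/trigP tu /trigP tu' Eu]]] := offC_decomp ai bi uM Cs x0.
have [tV dV] := trig_inv tu (valP u); have [tV' dV'] := trig_inv tu' (valP u').
have EV : M' = invmx (val u') *m perm_mx (refl i) *m invmx (val u).
  apply: (can_inj (mulKmx uM)); rewrite E Eu.
  have uu := valP u; have uu' := valP u'.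
  rewrite !mulmxA -(mulmxA _ (val u') (invmx _)) mulmxV // mulmx1 -(mulmxA (val u)) -perm_mxM.
  by rewrite (_ : refl i * refl i = 1)%g ?perm_mx1 ?mulmx1 ?mulmxV // /refl tperm2.
split=> [c d /andP [cd ncd]|].
  rewrite EV corner0 // => l l' lc dl; rewrite perm_refl.
  move: ncd; rewrite negb_and -val_eqE /=.
  by do 2 (case: eqP => ?); rewrite ?mulr0n //; do ?case: eqP => ? //; lia.
rewrite EV corner //; last first.
  move=> l l' la bl ne; rewrite perm_refl.
  have {}ne : ~~ ((l == i :> nat) && (l' == i.+1 :> nat)).
    by apply: contra ne => /andP [/eqP E1 /eqP E2]; apply/eqP; congr (_, _); apply: val_inj; rewrite /= ?ai ?bi.
  rewrite ai in la; rewrite bi in bl; rewrite -val_eqE /=.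
  by do 2 (case: eqP => ?); rewrite ?mulr0n //; do ?case: eqP => ? //; lia.
rewrite perm_refl ai bi !eqxx mulr1 dV dV' => /eqP; rewrite mulf_eq0 !invr_eq0.
by rewrite -[_ == 0]negbK -unit_k -[X in _ || X]negbK -unit_k !trig_diag_unit //; apply: valP.
Qed.

(** On both strata of the curve these diagonal entries are products of diagonal entries of
    invertible triangular matrices. They supply the units used to adjust weights. *)
Lemma C_diag (i : 'I_3) (s : pts X) (j : 'I_4) : zeros (CE i) s -> j != i :> nat -> j != i.+1 :> nat -> Nm s j j != 0.
Proof.
move=> Cs ji ji1; have ia : (i < 4)%N by have := ltn_ord i; lia.
have ib : (i.+1 < 4)%N by have := ltn_ord i; lia.
pose a := Ordinal ia; pose b := Ordinal ib.
case: (eqVneq (Nm s a b) 0) => [x0|x0].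
  have ts : trig (Nm s).
    move=> c d cd; case: (boolP ((c == i :> nat) && (d == i.+1 :> nat))) => [/andP [/eqP Ec /eqP Ed]|n].
      by rewrite -x0; congr (Nm s _ _); apply: val_inj.
    by apply: (zeros_C i s).1 => //.
  by have := trig_diag_unit j ts (Nm_unit s); rewrite unit_k.
have [u [u' [/trigP tu /trigP tu' ->]]] := (stratum_Nm s _).1 (@C_stratum i s a b erefl erefl Cs x0).
have d1 := trig_diag_unit j tu (valP u); have d2 := trig_diag_unit j tu' (valP u').
rewrite corner //; last first.
  move=> l l' lj jl ne; rewrite perm_refl -val_eqE /=.
  have {}ne : ~~ ((l == j :> nat) && (l' == j :> nat)).
    by apply: contra ne => /andP [/eqP E1 /eqP E2]; apply/eqP; congr (_, _); apply: val_inj.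
  by do 2 (case: eqP => ?); rewrite ?mulr0n //; do ?case: eqP => ? //; lia.
rewrite perm_refl (negPf ji) (negPf ji1) eqxx mulr1.
by rewrite unit_k in d1; rewrite unit_k in d2; rewrite mulf_neq0.
Qed.

(** The character e_a - q e_b, which is the weight of the entry of N in row a and column [zt b]. *)
Definition wt (a b : 'I_4) : weight := fun c => (c == a)%:Z - q%:Z * (c == b)%:Z.
Lemma char_wt (x : gl ko) a b : trig (val x) -> character (wt a b) x = val x a a * (val x b b ^+ q)^-1.
Proof.
move=> tx; have u c : val x c c != 0 by rewrite -unit_k; apply: trig_diag_unit tx (valP x).
rewrite (@charB _ (fun c => (c == a)%:Z) (fun c => q%:Z * (c == b)%:Z)) //; congr (_ / _).
  rewrite /character (bigD1 a) //= eqxx expr1z big1 ?mulr1 // => c /negPf ->; exact: expr0z.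
rewrite /character (bigD1 b) //= eqxx mulr1 -exprnP big1 ?mulr1 // => c /negPf ->; by rewrite mulr0 expr0z.
Qed.
Lemma charZ (x : gl ko) lam (n : int) : trig (val x) -> character (fun c => n * lam c) x = character lam x ^ n.
Proof.
move=> tx; have u c : val x c c != 0 by rewrite -unit_k; apply: trig_diag_unit tx (valP x).
rewrite /character (big_morph (fun t : k => t ^ n) (fun a b => expfzMl a b n) (exp1rz _ n)); apply: eq_bigr => c _;
  by rewrite mulrC exprz_exp.
Qed.
Lemma charD (x : gl ko) lam chi : trig (val x) ->
  character (fun c => lam c + chi c) x = character lam x * character chi x.
Proof.
move=> tx; have u c : val x c c != 0 by rewrite -unit_k; apply: trig_diag_unit tx (valP x).
by rewrite /character -big_split; apply: eq_bigr => c _ /=; rewrite expfzDr.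
Qed.

Lemma x_equiv (a b : 'I_4) (x y : gl ko) (s : pts X) : in_E' q x y ->
  (forall l l' : 'I_4, (l <= a)%N -> (b <= l')%N -> (l, l') != (a, b) -> Nm s l l' = 0) ->
  Nm (zact x y s) a b = character (wt a (zt b)) x * Nm s a b.
Proof.
move=> Exy h; have [E /trigP tx] := Exy; have [tb _ db _] := bmx_trig (q_gt0 hk) Exy.
by rewrite Nm_act // corner // db char_wt // mulrAC.
Qed.
Lemma y_equiv (a b : 'I_4) (x y : gl ko) (s : pts X) : in_E' q x y ->
  (forall l l' : 'I_4, (l <= a)%N -> (b <= l')%N -> (l, l') != (a, b) -> Ym s l l' = 0) ->
  Ym (zact x y s) a b = character (fun c => - wt b (zt a) c) x * Ym s a b.
Proof.
move=> Exy h; have [E /trigP tx] := Exy; have [_ tb _ db] := bmx_trig (q_gt0 hk) Exy.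
have [tV dV] := trig_inv tx (valP x).
rewrite Ym_act // corner // db dV.
rewrite (_ : (fun c => _) = (fun c => 0 - wt b (zt a) c)); last by apply/funext => c; rewrite sub0r.
rewrite (@charB _ (fun=> 0) (wt b (zt a))) // char_wt // invf_div.
rewrite (_ : character _ x = 1); last by rewrite /character big1.
by rewrite mul1r mulrAC.
Qed.
End Strata.

Import Order.TTheory.

(** * Pseudo-completeness on the one-dimensional strata *)

Section Curves.
Context (k : closedFieldType) (q : nat) (hk : is_Fqbar q k) (X : zip_space k q).
Implicit Types (A B C D K : comUnitAlgType k) (Z : fn X -> Prop) (lam chi : weight).
Local Notation ko := (k^o : comUnitAlgType k).
Context (cov : forall K (s : X K), is_field K -> exists c : chart X, cU c K s).
Context (hlift : forall C D (s : {lrmorphism C -> D}) (x : X D) (g : gl C),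
  square_zero_quotient s -> zmap X D x = glmap s g -> exists2 x', zmap X C x' = g & fmap s x' = x).
Context (hpc : forall i : 'I_3, pseudo_complete (flag_closure (@flag_stratum k q X (refl i)))).

Lemma near_k (p : pts X) : near p (fun=> True).
Proof.
have [c /chart_point [f Ef]] := cov p (@is_field_k k).
by exists c, f, 1; split=> //; rewrite (lr1 f) oner_neq0.
Qed.

Lemma near_open_sub (U : subfunctor X) (p : pts X) : open_sub U -> U _ p -> near p (fun t => U _ t).
Proof.
move=> oU Up; have [c [x Ex]] := near_chart (near_k p); rewrite -Ex in Up *.
have [a xa ha] := open_localize oU (@is_field_k k) Up.
by apply: (nearI xa) => y ya; apply: ha; rewrite unit_k.
Qed.

Lemma reg_expz Z (p : pts X) phi (n : int) : reg Z p phi -> zeros Z p -> phi p != 0 -> reg Z p (fun s => phi s ^ n).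
Proof.
move=> rp Zp np; case: n => n; first exact: reg_exp.
by rewrite NegzE; apply: reg_inv (reg_exp _ rp) _ Zp => _; rewrite expf_neq0.
Qed.

Definition dete : fn X.
Proof.
refine (@KMap k X (affine_line k) (fun A s => \det (Nm s)) _) => A B f s.
have -> : Nm (fmap f s) = map_mx f (Nm s) by apply/matrixP => i j; rewrite Nm_nat [RHS]mxE.
by rewrite det_map_mx.
Defined.

Section OneCurve.
Context (i : 'I_3) (a b j l : 'I_4) (ai : a = i :> nat) (bi : b = i.+1 :> nat)
  (ja : j != a) (jb : j != b) (la : l != a) (lb : l != b).

(** A function vanishing on the open stratum is killed by x_ab at all k-points of the closed locus.
    Local rings there are domains and x_ab is not a zero germ, so the function vanishes. *)
Lemma closure_dense (p : pts X) : zeros (@CE k q X i) p -> flag_closure (flag_stratum (refl i)) p.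
Proof.
move=> Cp V cV stV hV; have [c [x Ex]] := near_chart (near_k p); rewrite -Ex in Cp *.
have [I HI] := cV _ (cu c); apply/HI => r Ir.
have sC : smooth_set (@CE k q X i) by apply: smooth_x.
have [|[e xe he]|[e xe he]] := chart_dom (r1 := r) (r2 := ev (xe X a b) (cu c)) sC Cp.
- exists 1; first by rewrite lr1 oner_neq0.
  rewrite mul1r; apply: (chart_dens sC) => y Cy; rewrite lrM -evE.
  case: (eqVneq (ev (xe X a b) (at_ y)) 0) => [E|ne]; first by rewrite -[X in _ * X]/(ev _ (at_ y)) E mulr0.
  have Vy : V _ (at_ y) by apply/hV/(C_stratum ai bi Cy ne).
  by move/HI: Vy => /(_ r Ir) ->; rewrite mul0r.
- by have := eqs_map Cp he; rewrite lrM => /eqP; rewrite mulf_eq0 (negPf xe) => /eqP.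
exfalso; apply: (@not_zg_x _ _ _ hlift (offC i) a b (at_ x)) => //.
  by rewrite /offC ai bi !eqxx andbF.
apply: (nearI xe) => y ye Cy; have := eqs_map Cy he.
by rewrite lrM -evE => /eqP; rewrite mulf_eq0 (negPf ye) => /eqP.
Qed.

Lemma h_equiv (x y : gl ko) (s : pts X) : in_E' q x y -> zeros (@CE k q X i) s ->
  Nm (zact x y s) a b = character (wt q a (zt b)) x * Nm s a b.
Proof.
move=> Exy /zeros_C Cs; apply: x_equiv => // c d ca bd ne; apply: Cs; first by rewrite ai bi in ca bd; lia.
by apply: contra ne => /andP [/eqP E1 /eqP E2]; apply/eqP; congr (_, _); apply: val_inj; rewrite /= ?ai ?bi.
Qed.
Lemma diag_equiv (c : 'I_4) (x y : gl ko) (s : pts X) : c != a -> c != b -> in_E' q x y -> zeros (@CE k q X i) s ->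
  Nm (zact x y s) c c = character (wt q c (zt c)) x * Nm s c c.
Proof.
move=> ca cb Exy /zeros_C Cs; apply: x_equiv => // d e dc ce ne; apply: Cs.
  rewrite ltn_neqAle (leq_trans dc) // andbT; apply: contra ne => /eqP E.
  have Ec : d = c :> nat by apply/eqP; rewrite eqn_leq dc E.
  by apply/eqP; congr (_, _); apply: val_inj => //=; rewrite -E.
apply/negP => /andP [/eqP E1 /eqP E2]; move: ca cb; rewrite -!val_eqE /= ai bi; lia.
Qed.
Lemma det_equiv (x y : gl ko) (s : pts X) : in_E' q x y ->
  \det (Nm (zact x y s)) = character (fun=> 1 - q%:Z) x * \det (Nm s).
Proof.
move=> Exy; have [E /trigP tx] := Exy; have [tb _ db _] := bmx_trig (q_gt0 hk) Exy.
rewrite Nm_act // !det_mulmx (det_trig (introT (trigP _) tx)) (det_trig (introT (trigP _) tb)).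
rewrite (@charB _ (fun=> 1) (fun=> q%:Z)) // mulrAC; congr (_ * _); rewrite /character.
congr (_ * _); rewrite -prodfV [RHS](reindex_inj (can_inj ztK)) /=.
by apply: eq_bigr => c _; rewrite db.
Qed.

(** The product of phi^N, x_ab^c0 and powers of the units det N, x_jj and x_ll has weight 0, hence
    is constant near p. It is 0 at p because c0 > 0 and x_ab vanishes there. So phi x_ab is a zero
    germ at p, although neither factor is one. *)
Lemma curve Z lam W phi p (N c0 : nat) (cd c1 c2 : int) :
  (forall s : pts X, zeros Z s <-> onC i s) -> node Z lam W phi -> F1 p -> ~ zg Z p phi ->
  (0 < N)%N -> (0 < c0)%N ->
  (forall c : 'I_4, N%:Z * lam c + (c0%:Z * wt q a (zt b) c + (cd * (1 - q%:Z) +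
     (c1 * wt q j (zt j) c + c2 * wt q l (zt l) c))) = 0) -> False.
Proof.
move=> ZC nd Fp nz N0 c00 wt0.
have sC : smooth_set (@CE k q X i) by apply: smooth_x.
have ZC' (s : pts X) : zeros (@CE k q X i) s <-> zeros Z s by rewrite ZC zeros_C.
have [n1 n2 n3 n4 n5 n6] := node_sub (fun s => (ZC' s).1) nd.
have zgC psi : zg Z p psi <-> zg (@CE k q X i) p psi.
  by split; apply: near_sub => t h /ZC'.
pose G (s : pts X) : k := ev (xe X a b) s ^+ c0 * (ev dete s ^ cd * (ev (xe X j j) s ^ c1 * ev (xe X l l) s ^ c2)).
(* W is clopen on the curve, so extension by 0 gives a function that is regular everywhere. *)
pose eta (s : pts X) : k := if `[< W s >] then phi s ^+ N * G s else 0.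
have etaE s : W s -> eta s = phi s ^+ N * G s by move=> Ws; rewrite /eta asboolT.
have etaN s : ~ W s -> eta s = 0 by move=> Ws; rewrite /eta asboolF.
have ji : j != i :> nat by rewrite -ai.
have ji1 : j != i.+1 :> nat by rewrite -bi.
have li : l != i :> nat by rewrite -ai.
have li1 : l != i.+1 :> nat by rewrite -bi.
have dn (s : pts X) : ev dete s != 0.
  by rewrite -unit_k; have := Nm_unit s; rewrite unitmxE.
have G_reg s : zeros (@CE k q X i) s -> reg (@CE k q X i) s G.
  move=> Cs; have ns := near_k s; rewrite /G.
  have r1 (E : fn X) n : ev E s != 0 -> reg (@CE k q X i) s (fun t : pts X => ev E t ^ n).
    by move=> ne; apply: reg_expz => //; apply: reg_ev.
  exact: (reg_mul (reg_exp c0 (reg_ev _ _ ns)) (reg_mul (r1 dete cd (dn s)) (reg_mul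
    (r1 (xe X j j) c1 (C_diag Cs ji ji1)) (r1 (xe X l l) c2 (C_diag Cs li li1))))).
have eta_reg s : zeros (@CE k q X i) s -> reg (@CE k q X i) s eta.
  move=> Cs; have [Ws|nW] := pselect (W s).
    apply: (@reg_eq _ _ _ s (fun t => phi t ^+ N * G t)).
      by apply: near_sub (n1 s Ws Cs) => t Wt Ct; rewrite etaE //; apply: Wt.
    by apply: reg_mul; [apply/reg_exp/n4|apply: G_reg].
  apply: (@reg_eq _ _ _ s (fun=> 0)); last exact: reg_cst (near_k s).
  apply: near_sub (n6 i s ((zeros_C i s).1 Cs) Cs nW) => t ht Ct.
  by rewrite etaN //; apply: ht => //; apply/zeros_C.
have stW (x y : gl ko) s : in_E' q x y -> zeros (@CE k q X i) s -> W (zact x y s) <-> W s.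
  move=> Exy Cs; split=> [h|]; last exact: n3.
  rewrite -(zactK hk s (proj1 Exy)); apply: n3 => //; first exact: in_E'_inv.
  exact: CE_stable.
have eta_inv (x y : gl ko) s : in_E' q x y -> zeros (@CE k q X i) s -> eta (zact x y s) = character (fun=> 0) x * eta s.
  move=> Exy Cs; have [E /trigP tx] := Exy.
  have ch0 : character (fun=> 0) x = 1 by rewrite /character big1.
  have [Ws|nW] := pselect (W s); last by rewrite !etaN ?mulr0 // stW.
  rewrite !etaE ?stW // n5 // /G /ev /= h_equiv // det_equiv // !diag_equiv //.
  rewrite !exprMn !expfzMl !exprnP -!charZ //.
  rewrite -(_ : (fun c => N%:Z * lam c + (c0%:Z * wt q a (zt b) c + (cd * (1 - q%:Z) +
     (c1 * wt q j (zt j) c + c2 * wt q l (zt l) c)))) = (fun=> 0)); last exact/funext.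
  rewrite (@charD _ x (fun c => N%:Z * lam c)) // (@charD _ x (fun c => c0%:Z * wt q a (zt b) c)) //.
  rewrite (@charD _ x (fun c => cd * (1 - q%:Z))) // (@charD _ x (fun c => c1 * wt q j (zt j) c)) //.
  move: (character _ x) (character _ x) (character _ x) (character _ x) (character _ x) => u1 u2 u3 u4 u5.
  move: (_ ^ _) (_ ^ _) (_ ^ _) (_ ^ _) (_ ^ _) => v1 v2 v3 v4 v5.
  by ring.
have [H [Hn HE]] := regular_fn sC cov eta_reg.
have Hk (x y : gl ko) (s : pts X) : in_E' q x y -> zeros (@CE k q X i) s ->
    H _ (zact x y s) = character (fun=> 0) x * H _ s.
  by move=> E0 Cs0; rewrite !HE ?eta_inv //; apply: CE_stable.
have Hinv A (x y : gl A) (s : X A) : in_E' q x y -> zeros (@CE k q X i) s -> H A (zact x y s) = H A s.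
  move=> Exy Cs; have := @E'_dense k q (q_gt0 hk) X cov (@CE k q X i) sC (@CE_stable k q hk X i) H (fun=> 0) Hn Hk
    A x y s Exy Cs.
  have ch1 : character (fun=> 0) x = 1 by rewrite /character big1.
  by move=> ->; rewrite ch1 mul1r.
have trig_C (s : pts X) : F1 s -> zeros (@CE k q X i) s by move=> Fs; apply/zeros_C => c d ltcd _; apply: Fs.
have Cp := trig_C p Fp; have clp := closure_dense Cp.
have [||U [c [oU stU Up hU]]] := hpc (h := fun A s _ => H A s) _ _ (@is_field_k k) clp.
- move=> A B f s zs _; apply: Hn; exact: closure_C zs.
- by move=> A x y s zs _ Exy; apply: Hinv => //; apply: closure_C zs.
have hp : ev (xe X a b) p = 0 by apply: Fp; rewrite ai bi.
have ec : c = 0.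
  have := hU _ p clp Up; rewrite HE // etaE; last exact: n2.
  rewrite /G hp expr0n eqn0Ngt c00 mul0r mulr0 => E; rewrite -[c]mulr1; exact/esym/E.
have zp : zg (@CE k q X i) p (fun s => phi s * ev (xe X a b) s).
  apply: near_sub (near_and (n1 p (n2 p Fp) Cp) (near_open_sub oU Up)) => t [Wt Ut] Ct.
  have clt := closure_dense Ct.
  have := hU _ t clt Ut; rewrite HE // etaE; last exact: Wt.
  rewrite ec scale0r => /eqP; rewrite mulf_eq0 => /orP [|].
    by rewrite expf_eq0 N0 => /eqP ->; rewrite mul0r.
  rewrite /G mulf_eq0 => /orP [|]; first by rewrite expf_eq0 c00 => /eqP ->; rewrite mulr0.
  rewrite !mulf_eq0 !expfz_eq0 (negPf (dn t)) !andbF /=.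
  by rewrite (negPf (C_diag Ct ji ji1)) (negPf (C_diag Ct li li1)) !andbF.
have [|||] := zg_dom sC Cp _ _ zp.
- exact: n4 (n2 p Fp) Cp.
- exact: reg_ev (near_k p).
- by move/zgC.
apply: (@not_zg_x _ _ _ hlift (offC i) a b p) => //.
by rewrite /offC ai bi !eqxx andbF.
Qed.
End OneCurve.
End Curves.

(** * Vanishing near the closed stratum *)

Definition o0 : 'I_4 := @Ordinal 4 0 isT.
Definition o1 : 'I_4 := @Ordinal 4 1 isT.
Definition o2 : 'I_4 := @Ordinal 4 2 isT.
Definition o3 : 'I_4 := @Ordinal 4 3 isT.
Lemma zt0 : zt o0 = o2. Proof. by apply: val_inj; rewrite /= ztE. Qed.
Lemma zt1 : zt o1 = o3. Proof. by apply: val_inj; rewrite /= ztE. Qed.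
Lemma zt2 : zt o2 = o0. Proof. by apply: val_inj; rewrite /= ztE. Qed.
Lemma zt3 : zt o3 = o1. Proof. by apply: val_inj; rewrite /= ztE. Qed.
Lemma ord4P (P : 'I_4 -> Prop) : P o0 -> P o1 -> P o2 -> P o3 -> forall i, P i.
Proof.
move=> h0 h1 h2 h3 [[|[|[|[|//]]]] hi].
- by rewrite (_ : Ordinal hi = o0) //; apply: val_inj.
- by rewrite (_ : Ordinal hi = o1) //; apply: val_inj.
- by rewrite (_ : Ordinal hi = o2) //; apply: val_inj.
- by rewrite (_ : Ordinal hi = o3) //; apply: val_inj.
Qed.
Lemma sum4 (V : nmodType) (F : 'I_4 -> V) : \sum_i F i = F o0 + (F o1 + (F o2 + F o3)).
Proof.
rewrite !big_ord_recl big_ord0 addr0.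
by congr (F _ + (F _ + (F _ + F _))); apply: val_inj.
Qed.

Definition inl (l : seq (nat * nat)) (a b : 'I_4) : bool := (val a, val b) \in l.
(** Tests on lists of positions, decided by computation. Stability of l under moves to the
    north-east makes the locus stable under E', and [NEat] makes the entry at p transform by a
    character on that locus. *)
Definition NE (l : seq (nat * nat)) := all (fun p => all (fun p' => (p'.1 <= p.1)%N && (p.2 <= p'.2)%N ==> (p' \in l))
  [seq (u, v) | u <- iota 0 4, v <- iota 0 4]) l.
Definition NEat (l : seq (nat * nat)) (p : nat * nat) :=
  all (fun p' => (p'.1 <= p.1)%N && (p.2 <= p'.2)%N ==> (p' == p) || (p' \in l))
  [seq (u, v) | u <- iota 0 4, v <- iota 0 4].
Definition upper (l : seq (nat * nat)) := all (fun p => p.1 < p.2)%N l.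
Lemma grid (a b : 'I_4) : (val a, val b) \in [seq (u, v) | u <- iota 0 4, v <- iota 0 4].
Proof. by apply: allpairs_f; rewrite mem_iota /=; apply: ltn_ord. Qed.
Lemma NE_inl l (a b a' b' : 'I_4) : NE l -> inl l a b -> (a' <= a)%N -> (b <= b')%N -> inl l a' b'.
Proof.
move=> /allP h ab ha hb; have := allP (h _ ab) _ (grid a' b').
by rewrite /= ha hb.
Qed.

Section Tree.
Context (k : closedFieldType) (q : nat) (hk : is_Fqbar q k) (X : zip_space k q).
Implicit Types (A B C D K : comUnitAlgType k) (Z : fn X -> Prop) (lam chi : weight).
Local Notation ko := (k^o : comUnitAlgType k).
Context (hlift : forall C D (s : {lrmorphism C -> D}) (x : X D) (g : gl C),
  square_zero_quotient s -> zmap X D x = glmap s g -> exists2 x', zmap X C x' = g & fmap s x' = x).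

(* Equations h of a stratum inside Z by which sections on Z may be divided. *)
Record sec Z (h : fn X) chi : Prop := Sec {
  s_Z : smooth_set Z; s_Zh : smooth_set (addeq Z h);
  s_st : forall (x y : gl ko) (s : pts X), in_E' q x y -> zeros Z s -> zeros Z (zact x y s);
  s_E : forall (x y : gl ko) (s : pts X), in_E' q x y -> zeros Z s -> ev h (zact x y s) = character chi x * ev h s;
  s_F : forall s : pts X, F1 s -> zeros Z s /\ ev h s = 0;
  s_N : forall s : pts X, zeros Z s -> ~ zg Z s (@ev _ _ h k^o);
  s_C : forall i, (forall s, onC i s -> zeros Z s -> ev h s = 0) \/
     (forall s, onC i s -> zeros Z s -> ev h s = 0 -> F1 s) }.

Lemma one_section Z h chi lam W phi : sec Z h chi -> node Z lam W phi -> (exists2 p, F1 p & ~ zg Z p phi) ->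
  exists (m : nat) W' phi', node Z (fun i => lam i - m%:Z * chi i) W' phi' /\
    exists2 p, F1 p & ~ zg (addeq Z h) p phi'.
Proof.
move=> [h1 h2 h3 h4 h5 h6 h7] nd ex.
have [m [W' [phi' [nd' ex' _]]]] := divide hk h1 h2 h3 h4 h5 h6 h7 nd ex.
by exists m, W', phi'.
Qed.

(** Dividing by h2 cannot create vanishing along h1: if phi1 = h2^m phi2 and phi2 vanished on h1 =
    0, so would phi1. One section thus serves both branches of the tree. *)
Lemma two_sections Z h1 chi1 h2 chi2 lam W phi : sec Z h1 chi1 -> sec Z h2 chi2 -> node Z lam W phi ->
  (exists2 p, F1 p & ~ zg Z p phi) ->
  exists (m1 m2 : nat) W' phi', [/\ node Z (fun i => lam i - m1%:Z * chi1 i - m2%:Z * chi2 i) W' phi',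
    exists2 p, F1 p & ~ zg (addeq Z h1) p phi' & exists2 p, F1 p & ~ zg (addeq Z h2) p phi'].
Proof.
move=> s1 s2 nd ex; have [m1 [W1 [phi1 [nd1 [p1 F1p nz1]]]]] := one_section s1 nd ex.
have [g1 g2 g3 g4 g5 g6 g7] := s2.
have [|m2 [W2 [phi2 [nd2 ex2 hp]]]] := divide hk g1 g2 g3 g4 g5 g6 g7 nd1.
  exists p1 => // z; apply: nz1; apply: near_sub z => t h /zeros_add [Zt _]; exact: h.
exists m1, m2, W2, phi2; split=> //; exists p1 => // z; apply: nz1.
by apply: near_sub (near_and z (hp p1 F1p)) => t [e1 e2] Zt; rewrite e2 ?e1 ?mulr0 //; have [] := (zeros_add _ _
  _).1 Zt.
Qed.

Lemma nz_eq Z Z' phi : (forall s : pts X, zeros Z s <-> zeros Z' s) ->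
  (exists2 p, F1 p & ~ zg Z p phi) -> exists2 p, F1 p & ~ zg Z' p phi.
Proof. by move=> E [p Fp nz]; exists p => // z; apply: nz; apply: near_sub z => t h /E. Qed.

Local Notation xs l := (@xset k q X (inl l)).
Local Notation ys l := (@yset k q X (inl l)).

Lemma addeq_x l (a b : 'I_4) A (s : X A) : zeros (addeq (xs l) (xe X a b)) s <-> zeros (xs ((val a, val b) :: l)) s.
Proof.
rewrite zeros_add !zeros_x; split=> [[h hab] c d|h].
  by rewrite /inl inE => /orP [/eqP [/val_inj -> /val_inj ->]|/h].
by split=> [c d cd|]; apply: h; rewrite /inl inE ?eqxx // -/(inl l c d) cd orbT.
Qed.
Lemma addeq_y l (a b : 'I_4) A (s : X A) : zeros (addeq (ys l) (ye X a b)) s <-> zeros (ys ((val a, val b) :: l)) s.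
Proof.
rewrite zeros_add !zeros_y; split=> [[h hab] c d|h].
  by rewrite /inl inE => /orP [/eqP [/val_inj -> /val_inj ->]|/h].
by split=> [c d cd|]; apply: h; rewrite /inl inE ?eqxx // -/(inl l c d) cd orbT.
Qed.

Lemma F1_Y (s : pts X) : F1 s -> trig (Ym s).
Proof. by move=> Fs; rewrite Ym_inv; have [] := trig_inv Fs (Nm_unit s). Qed.

Lemma onC_F1 i (s : pts X) (a b : 'I_4) : onC i s -> a = i :> nat -> b = i.+1 :> nat -> Nm s a b = 0 -> F1 s.
Proof.
move=> Cs ai bi h c d cd; case: (boolP ((c == i :> nat) && (d == i.+1 :> nat))) => [/andP [/eqP Ec /eqP Ed]|n].
  by rewrite -h; congr (fun_of_matrix _ _ _); apply: val_inj; rewrite /= ?ai ?bi.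
exact: Cs.
Qed.

Lemma onC_Y i (s : pts X) (c d : 'I_4) : onC i s -> (c < d)%N -> ~~ ((c == i :> nat) && (d == i.+1 :> nat)) -> Ym s
  c d = 0.
Proof.
move=> Cs cd ncd; case: (ltnP i 3) => i3.
  have i4 : (i < 4)%N by lia. have i14 : (i.+1 < 4)%N by lia.
  have [h _] := @offC_inv k (Ordinal i3) (Nm s) (Ym s) (Ordinal i4) (Ordinal i14) erefl erefl (NY s)
    (fun a b ab => (zeros_x _ _).1 ((zeros_C i s).2 Cs) a b ab).
  by apply: h; rewrite /offC cd.
apply: F1_Y => // a b ab; apply: Cs => //.
by apply/negP => /andP [/eqP E _]; have := ltn_ord b; lia.
Qed.
Lemma onC_Y0 i (s : pts X) (a b : 'I_4) : onC i s -> a = i :> nat -> b = i.+1 :> nat -> Ym s a b = 0 -> F1 s.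
Proof.
move=> Cs ai bi; have i3 : (i < 3)%N by have := ltn_ord b; lia.
have [_ h] := @offC_inv k (Ordinal i3) (Nm s) (Ym s) a b ai bi (NY s)
  (fun a b ab => (zeros_x _ _).1 ((zeros_C i s).2 Cs) a b ab).
by move/h; apply: onC_F1 Cs ai bi.
Qed.
Lemma onC_of_Y (i : 'I_3) (s : pts X) : (forall c d : 'I_4, offC i c d -> Ym s c d = 0) -> onC i s.
Proof.
move=> h; have i4 : (i < 4)%N by have := ltn_ord i; lia.
have i14 : (i.+1 < 4)%N by have := ltn_ord i; lia.
have [h' _] := @offC_inv k i (Ym s) (Nm s) (Ordinal i4) (Ordinal i14) erefl erefl (YN s) h.
by apply/zeros_C/zeros_x.
Qed.

Lemma curve_cases i (a b : 'I_4) (g : pts X -> k) :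
  (forall s, onC i s -> ~~ ((a == i :> nat) && (b == i.+1 :> nat)) -> g s = 0) ->
  (forall s, onC i s -> a = i :> nat -> b = i.+1 :> nat -> g s = 0 -> F1 s) ->
  (forall s, onC i s -> g s = 0) \/ (forall s, onC i s -> g s = 0 -> F1 s).
Proof.
move=> h0 h1; case: (boolP ((a == i :> nat) && (b == i.+1 :> nat))) => [/andP [/eqP ai /eqP bi]|n].
  by right=> s Cs; apply: h1.
by left=> s Cs; apply: h0.
Qed.

Lemma sec_x l (a b : 'I_4) : NE l -> upper l -> (a < b)%N -> ~~ inl l a b -> NEat l (val a, val b) ->
  sec (xs l) (xe X a b) (wt q a (zt b)).
Proof.
move=> hl ul ab nl ha; have Fz (s : pts X) : F1 s -> zeros (xs l) s.
  by move=> Fs; apply/zeros_x => c d cd; apply: Fs; apply: (allP ul _ cd).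
have nz (s : pts X) (c d : 'I_4) : zeros (xs l) s -> (c <= a)%N -> (b <= d)%N -> (c, d) != (a, b) -> Nm s c d = 0.
  move=> /zeros_x h ca bd ne; apply: h; have := allP ha _ (grid c d); rewrite /= ca bd /= => /orP [/eqP [E1 E2]|//].
  by case/eqP: ne; congr (_, _); apply: val_inj.
split.
- exact: smooth_x.
- by apply: (smooth_eq (Z := xs ((val a, val b) :: l))); [move=> A s; rewrite addeq_x|apply: smooth_x].
- move=> x y s Exy; apply: (xset_stable hk) => // c d c' d' h1 h2 h3; exact: NE_inl h1 h2 h3.
- by move=> x y s Exy Zs; apply: (x_equiv hk) => // c d; apply: nz.
- by move=> s Fs; split; [exact: Fz|exact: Fs].
- by move=> s Zs; apply: (not_zg_x hlift).
- move=> i; case: (@curve_cases i a b (@ev _ _ (xe X a b) k^o)) => [s Cs n|s Cs ai bi h|h|h].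
  + exact: Cs.
  + exact: onC_F1 Cs ai bi h.
  + by left=> s Cs _; apply: h.
  + by right=> s Cs _; apply: h.
Qed.

Lemma sec_y l (a b : 'I_4) : NE l -> upper l -> (a < b)%N -> ~~ inl l a b -> NEat l (val a, val b) ->
  sec (ys l) (ye X a b) (fun c => - wt q b (zt a) c).
Proof.
move=> hl ul ab nl ha; have Fz (s : pts X) : F1 s -> zeros (ys l) s.
  by move=> Fs; apply/zeros_y => c d cd; apply: F1_Y => //; apply: (allP ul _ cd).
have nz (s : pts X) (c d : 'I_4) : zeros (ys l) s -> (c <= a)%N -> (b <= d)%N -> (c, d) != (a, b) -> Ym s c d = 0.
  move=> /zeros_y h ca bd ne; apply: h; have := allP ha _ (grid c d); rewrite /= ca bd /= => /orP [/eqP [E1 E2]|//].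
  by case/eqP: ne; congr (_, _); apply: val_inj.
split.
- exact: smooth_y.
- by apply: (smooth_eq (Z := ys ((val a, val b) :: l))); [move=> A s; rewrite addeq_y|apply: smooth_y].
- move=> x y s Exy; apply: (yset_stable hk) => // c d c' d' h1 h2 h3; exact: NE_inl h1 h2 h3.
- by move=> x y s Exy Zs; apply: (y_equiv hk) => // c d; apply: nz.
- by move=> s Fs; split; [exact: Fz|exact: F1_Y].
- by move=> s Zs; apply: (not_zg_y hlift).
- move=> i; case: (@curve_cases i a b (@ev _ _ (ye X a b) k^o)) => [s Cs n|s Cs ai bi h|h|h].
  + exact: onC_Y Cs ab n.
  + exact: onC_Y0 Cs ai bi h.
  + by left=> s Cs _; apply: h.
  + by right=> s Cs _; apply: h.
Qed.

End Tree.

(** * The stratum cut out by a minor *)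

Lemma minor_mul (R : comUnitRingType) (L N M : 'M[R]_4) : trig L -> trig M -> N o0 o3 = 0 -> N o1 o3 = 0 ->
  (L *m N *m M) o0 o1 * (L *m N *m M) o1 o2 - (L *m N *m M) o0 o2 * (L *m N *m M) o1 o1 =
  L o0 o0 * L o1 o1 * (M o1 o1 * M o2 o2) * (N o0 o1 * N o1 o2 - N o0 o2 * N o1 o1).
Proof.
move=> tL tM h03 h13; rewrite ![(L *m N *m M) _ _]mxE !sum4 ![(L *m N) _ _]mxE !sum4 h03 h13.
rewrite !(tL o0 o1 isT) !(tL o0 o2 isT) !(tL o0 o3 isT) !(tL o1 o2 isT) !(tL o1 o3 isT) !(tM o0 o1 isT) !(tM o0 o2
  isT) !(tM o1 o2 isT); ring.
Qed.

Section Tree.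
Context (k : closedFieldType) (q : nat) (hk : is_Fqbar q k) (X : zip_space k q).
Implicit Types (A B C D K : comUnitAlgType k) (Z : fn X -> Prop) (lam chi : weight).
Local Notation ko := (k^o : comUnitAlgType k).
Context (hlift : forall C D (s : {lrmorphism C -> D}) (x : X D) (g : gl C),
  square_zero_quotient s -> zmap X D x = glmap s g -> exists2 x', zmap X C x' = g & fmap s x' = x).

Local Notation xs P := (@xset k q X P).
Local Notation ys P := (@yset k q X P).
Lemma minor_nat A B (f : {lrmorphism A -> B}) (s : X A) :
  Nm (fmap f s) o0 o1 * Nm (fmap f s) o1 o2 - Nm (fmap f s) o0 o2 * Nm (fmap f s) o1 o1 =
  f (Nm s o0 o1 * Nm s o1 o2 - Nm s o0 o2 * Nm s o1 o1).
Proof. by rewrite !Nm_nat lrB !lrM. Qed.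
Definition minor : fn X := @KMap k X (affine_line k) _ minor_nat.

Section Minor.
Context A (s : X A) (h03 : Nm s o0 o3 = 0) (h13 : Nm s o1 o3 = 0).
Local Notation x i j := (Nm s i j).
Local Notation y i j := (Ym s i j).
Let NYe i j : x i o0 * y o0 j + (x i o1 * y o1 j + (x i o2 * y o2 j + x i o3 * y o3 j)) = (i == j)%:R.
Proof.
have E : (Nm s *m Ym s) i j = (1%:M : 'M_4) i j by rewrite NY.
by rewrite mxE sum4 in E; rewrite E mxE.
Qed.
(** As x_03 = x_13 = 0, the first two rows have rank 2 in columns 0, 1, 2, so the entries in columns
    1, 2 cannot all vanish. The coefficients built from N^-1 make this explicit over any ring; they
    show that the minor has a nonzero differential. *)
Lemma unimodular : 1 = x o0 o1 * (y o1 o0 - y o1 o0 * (x o1 o1 * y o1 o1 + x o1 o2 * y o2 o1)) +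
  x o0 o2 * (y o2 o0 - y o2 o0 * (x o1 o1 * y o1 o1 + x o1 o2 * y o2 o1)) +
  x o1 o1 * (y o1 o1 - y o1 o0 * (x o0 o0 * y o0 o1)) + x o1 o2 * (y o2 o1 - y o2 o0 * (x o0 o0 * y o0 o1)).
Proof.
have e00 := NYe o0 o0; have e11 := NYe o1 o1; have e10 := NYe o1 o0; have e01 := NYe o0 o1.
rewrite h03 h13 !mul0r !addr0 /= in e00 e11 e10 e01.
set P := x o0 o1 * y o1 o0 + x o0 o2 * y o2 o0 in e00.
set Q := x o1 o1 * y o1 o1 + x o1 o2 * y o2 o1 in e11 *.
set r := x o1 o1 * y o1 o0 + x o1 o2 * y o2 o0 in e10.
have E1 : x o0 o0 * y o0 o0 = 1 - P by rewrite -[1]/(1%:R : A) -e00 addrK.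
have E2 : x o1 o0 * y o0 o1 = 1 - Q by rewrite -[1]/(1%:R : A) -e11 addrK.
have E3 : r = - (x o1 o0 * y o0 o0) by apply/eqP; rewrite -addr_eq0 addrC e10.
transitivity (P + Q - P * Q - r * (x o0 o0 * y o0 o1)); last by rewrite /P /Q /r; ring.
have E4 : (1 - P) * (1 - Q) = - (r * (x o0 o0 * y o0 o1)) by rewrite -E1 -E2 E3; ring.
by rewrite -E4; ring.
Qed.

Context (hm : x o0 o1 * x o1 o2 - x o0 o2 * x o1 o1 = 0).
(** Rows 0 and 1 of N N^-1 = 1 are combined to eliminate one entry of N^-1; the vanishing minor
    removes another. *)
Lemma minor_relations : let al := x o1 o2 * x o0 o0 - x o0 o2 * x o1 o0 in
  let be := x o1 o1 * x o0 o0 - x o0 o1 * x o1 o0 in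
  (forall j, al * y o0 j = x o1 o2 * (o0 == j)%:R - x o0 o2 * (o1 == j)%:R) /\
  (forall j, be * y o0 j = x o1 o1 * (o0 == j)%:R - x o0 o1 * (o1 == j)%:R).
Proof.
split=> j; rewrite -!NYe h03 h13 !mul0r !addr0.
  transitivity (x o1 o2 * (x o0 o0 * y o0 j) - x o0 o2 * (x o1 o0 * y o0 j) +
    (x o0 o1 * x o1 o2 - x o0 o2 * x o1 o1) * y o1 j); [by rewrite hm; ring|ring].
transitivity (x o1 o1 * (x o0 o0 * y o0 j) - x o0 o1 * (x o1 o0 * y o0 j) -
    (x o0 o1 * x o1 o2 - x o0 o2 * x o1 o1) * y o2 j); [by rewrite hm; ring|ring].
Qed.
(** Up to sign the four entries of the minor are multiples of the coefficients [al] and [be] of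
    [minor_relations], both of which kill y_0j; as these entries generate the unit ideal, y_0j is
    zero. *)
Lemma minor_y (j : 'I_4) : (1 < j)%N -> y o0 j = 0.
Proof.
move=> j1; have [ha hb] := minor_relations.
have j0 : (o0 == j) = false by apply/negbTE/eqP => E; rewrite -E in j1.
have j1' : (o1 == j) = false by apply/negbTE/eqP => E; rewrite -E in j1.
have a0 := ha j; have b0 := hb j; rewrite j0 j1' !mulr0 subrr in a0 b0.
have a1 := ha o1; have b1 := hb o1; have a2 := ha o0; have b2 := hb o0.
rewrite /= !mulr0 !mulr1 ?sub0r ?subr0 in a1 b1 a2 b2.
rewrite -[LHS]mul1r unimodular !mulrDl.
have z01 : x o0 o1 * y o0 j = 0 by rewrite -[x o0 o1]opprK -b1 mulNr mulrAC b0 mul0r oppr0.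
have z02 : x o0 o2 * y o0 j = 0 by rewrite -[x o0 o2]opprK -a1 mulNr mulrAC a0 mul0r oppr0.
have z11 : x o1 o1 * y o0 j = 0 by rewrite -b2 mulrAC b0 mul0r.
have z12 : x o1 o2 * y o0 j = 0 by rewrite -a2 mulrAC a0 mul0r.
by rewrite !(mulrAC _ _ (y o0 j)) z01 z02 z11 z12 !mul0r !addr0.
Qed.
Lemma minor_y01 : y o0 o1 = 0 -> x o0 o1 = 0 /\ x o0 o2 = 0.
Proof.
move=> h; have [/(_ o1) a1 /(_ o1) b1] := minor_relations; rewrite h /= !mulr0 !mulr1 !sub0r in a1 b1.
by split; apply/eqP; rewrite -oppr_eq0 -?a1 -?b1.
Qed.
End Minor.

(** Arbitrary lifts of the entries miss the value c by some e with e^2 = 0. Correcting the four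
    entries by e times the lifted coefficients of [unimodular], suitably permuted and signed,
    changes the minor by exactly -e. *)
Lemma lift_minor C D (f : {lrmorphism C -> D}) (x : X D) (P : 'I_4 -> 'I_4 -> bool) (c : C) : square_zero_quotient f ->
  P o0 o3 -> P o1 o3 -> ~~ P o0 o1 -> ~~ P o0 o2 -> ~~ P o1 o1 -> ~~ P o1 o2 ->
  zeros (xs P) x -> f c = ev minor x -> exists x' : X C, [/\ fmap f x' = x, zeros (xs P) x' & ev minor x' = c].
Proof.
move=> sq P03 P13 n01 n02 n11 n12 /zeros_x Zx fc; have [ss nil] := sq.
have [l lE] := choice (fun ab : 'I_4 * 'I_4 => ss (Nm x ab.1 ab.2)).
have U := unimodular (Zx _ _ P03) (Zx _ _ P13).
set u1 := (_ - _) in U; set u2 := (X in _ * _ + _ * X + _) in U; set u3 := (X in _ + _ * X + _) in U; set u4 := (X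
  in _ + _ * X) in U.
have [v1 V1] := ss u1; have [v2 V2] := ss u2; have [v3 V3] := ss u3; have [v4 V4] := ss u4.
move: u1 u2 u3 u4 U V1 V2 V3 V4 => u1 u2 u3 u4 U V1 V2 V3 V4.
pose e := l (o0, o1) * l (o1, o2) - l (o0, o2) * l (o1, o1) - c.
have fe : f e = 0 by rewrite /e !lrB !lrM !lE /= fc subrr.
have ee : e * e = 0 by apply: nil.
have ej : e * (l (o0, o1) * v1 + l (o0, o2) * v2 + l (o1, o1) * v3 + l (o1, o2) * v4) = e.
  apply/eqP; rewrite -subr_eq0 -{2}[e]mulr1 -mulrBr; apply/eqP; apply: nil => //.
  by rewrite lrB lr1 !lrD !lrM !lE V1 V2 V3 V4 /= -U subrr.
pose M : 'M[C]_4 := \matrix_(i, j) if P i j then 0 else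
  if (i == o0) && (j == o1) then l (o0, o1) - e * v4 else if (i == o0) && (j == o2) then l (o0, o2) + e * v3
  else if (i == o1) && (j == o1) then l (o1, o1) + e * v2 else if (i == o1) && (j == o2) then l (o1, o2) - e * v1
    else l (i, j).
have [|x' Es EN] := @lift_x k q X hlift C D f x M sq.
  move=> i j; rewrite mxE; case: ifP => [ij|_]; first by rewrite lr0 Zx.
  by do 4 (case: ifP => [/andP [/eqP -> /eqP ->]|_]; first by rewrite ?lrB ?lrD lrM fe mul0r ?subr0 ?addr0 lE);
    rewrite lE.
exists x'; split=> //; first by apply/zeros_x => i j ij; rewrite EN mxE ij.
rewrite /ev /= EN !mxE (negPf n01) (negPf n02) (negPf n11) (negPf n12) !eqxx /=.
transitivity (e + c - e * (l (o0, o1) * v1 + l (o0, o2) * v2 + l (o1, o1) * v3 + l (o1, o2) * v4) + (e * e) * (v1 *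
  v4 - v2 * v3)).
  by rewrite /e; ring.
by rewrite ej ee mul0r addr0 addrAC subrr add0r.
Qed.

Lemma smooth_minor (P : 'I_4 -> 'I_4 -> bool) : P o0 o3 -> P o1 o3 -> ~~ P o0 o1 -> ~~ P o0 o2 -> ~~ P o1 o1 -> ~~
  P o1 o2 ->
  smooth_set (addeq (xs P) minor).
Proof.
move=> h1 h2 h3 h4 h5 h6 C D f x sq /zeros_add [Zx mx].
have [|x' [E Z' m']] := @lift_minor C D f x P 0 sq h1 h2 h3 h4 h5 h6 Zx; first by rewrite lr0.
by exists x' => //; apply/zeros_add.
Qed.

Definition l4 : seq (nat * nat) := [:: (0, 3); (1, 3)]%N.
Local Notation Z5 := (addeq (xs (inl l4)) minor).

Lemma Z5P A (s : X A) : zeros Z5 s -> [/\ Nm s o0 o3 = 0, Nm s o1 o3 = 0 & Nm s o0 o1 * Nm s o1 o2 - Nm s o0 o2 *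
  Nm s o1 o1 = 0].
Proof. by move=> /zeros_add [/zeros_x h m]; split=> //; apply: h. Qed.

Lemma minor_equiv (x y : gl ko) (s : pts X) : in_E' q x y -> zeros (xs (inl l4)) s ->
  ev minor (zact x y s) = character (fun c => wt q o0 o3 c + wt q o1 o0 c) x * ev minor s.
Proof.
move=> Exy /zeros_x h; have [E /trigP tx] := Exy; have [tb _ db _] := bmx_trig (q_gt0 hk) Exy.
rewrite charD // !char_wt // /ev /= Nm_act //.
have h03 : Nm s o0 o3 = 0 by apply: h. have h13 : Nm s o1 o3 = 0 by apply: h.
rewrite minor_mul // !db zt1 zt2; ring.
Qed.

Lemma onC_minor i (s : pts X) : onC i s -> ev minor s = 0.
Proof.
move=> Cs; rewrite /ev /= (Cs o0 o2) ?mul0r ?subr0 //; last by case: i {Cs} => [|[]].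
case: (eqVneq i 0%N) => [E|n]; last by rewrite (Cs o0 o1) ?mul0r //= eq_sym (negPf n).
by rewrite (Cs o1 o2) ?mulr0 // E.
Qed.

Lemma l4P (i j : 'I_4) : inl l4 i j -> (i < j)%N. Proof. by rewrite /inl !inE => /orP [] /eqP [-> ->]. Qed.

Lemma sec_minor : sec (xs (inl l4)) minor (fun c => wt q o0 o3 c + wt q o1 o0 c).
Proof.
split.
- exact: smooth_x.
- exact: smooth_minor.
- move=> x y s Exy; apply: (xset_stable hk) => // c d c' d' h1 h2 h3; exact: NE_inl h1 h2 h3.
- exact: minor_equiv.
- move=> s Fs; split; first by apply/zeros_x => a b /l4P; apply: Fs.
  by rewrite /ev /= !(Fs o0) // !mul0r subr0.
- move=> s Zs; refine (@not_zg k q X _ minor s (@smooth_x k q X hlift _) Zs _) => C f e sq fe e0 m0.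
  have [|x' [E Z' m']] := @lift_minor C ko f s (inl l4) e sq isT isT isT isT isT isT Zs; first by rewrite fe m0.
  by exists x'; rewrite m'.
- by move=> i; left=> s Cs _; apply: onC_minor Cs.
Qed.

Lemma Z5_stable (x y : gl ko) (s : pts X) : in_E' q x y -> zeros Z5 s -> zeros Z5 (zact x y s).
Proof.
move=> Exy /zeros_add [Zs ms]; have [_ _ st E _ _ _] := sec_minor.
by apply/zeros_add; split; [exact: st|rewrite E // ms mulr0].
Qed.
Lemma F1_Z5 (s : pts X) : F1 s -> zeros Z5 s.
Proof. by move=> Fs; apply/zeros_add; have [_ _ _ _ h _ _] := sec_minor; apply: h. Qed.

Lemma row0_Y A (s : X A) : (forall j : 'I_4, (0 < j)%N -> Nm s o0 j = 0) -> forall j : 'I_4, (0 < j)%N -> Ym s o0 j = 0.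
Proof.
move=> h j j0; have E i : (Nm s *m Ym s) o0 i = (1%:M : 'M_4) o0 i by rewrite NY.
have EE i : Nm s o0 o0 * Ym s o0 i = (o0 == i)%:R.
  by have := E i; rewrite mxE sum4 !(h o1 isT) !(h o2 isT) !(h o3 isT) !mul0r !addr0 => ->; rewrite mxE.
have := EE j; have -> : (o0 == j) = false by apply/negbTE/eqP => Ej; rewrite -Ej in j0.
by move=> Ej; rewrite -[LHS]mul1r -[1](EE o0) mulrAC Ej mul0r.
Qed.
Lemma row0_N A (s : X A) : (forall j : 'I_4, (0 < j)%N -> Ym s o0 j = 0) -> forall j : 'I_4, (0 < j)%N -> Nm s o0 j = 0.
Proof.
move=> h j j0; have E i : (Ym s *m Nm s) o0 i = (1%:M : 'M_4) o0 i by rewrite YN.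
have EE i : Ym s o0 o0 * Nm s o0 i = (o0 == i)%:R.
  by have := E i; rewrite mxE sum4 !(h o1 isT) !(h o2 isT) !(h o3 isT) !mul0r !addr0 => ->; rewrite mxE.
have := EE j; have -> : (o0 == j) = false by apply/negbTE/eqP => Ej; rewrite -Ej in j0.
by move=> Ej; rewrite -[LHS]mul1r -[1](EE o0) mulrAC Ej mul0r.
Qed.
Lemma col3_Y A (s : X A) : (forall j : 'I_4, (j < 3)%N -> Nm s j o3 = 0) -> forall j : 'I_4, (j < 3)%N -> Ym s j o3 = 0.
Proof.
move=> h j j0; have E i : (Ym s *m Nm s) i o3 = (1%:M : 'M_4) i o3 by rewrite YN.
have EE i : Ym s i o3 * Nm s o3 o3 = (i == o3)%:R.
  by have := E i; rewrite mxE sum4 !(h o0 isT) !(h o1 isT) !(h o2 isT) !mulr0 !add0r => ->; rewrite mxE.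
have := EE j; have -> : (j == o3) = false by apply/negbTE/eqP => Ej; rewrite Ej in j0.
by move=> Ej; rewrite -[LHS]mulr1 -[1](EE o3) mulrCA Ej mulr0.
Qed.
Lemma col3_N A (s : X A) : (forall j : 'I_4, (j < 3)%N -> Ym s j o3 = 0) -> forall j : 'I_4, (j < 3)%N -> Nm s j o3 = 0.
Proof.
move=> h j j0; have E i : (Nm s *m Ym s) i o3 = (1%:M : 'M_4) i o3 by rewrite NY.
have EE i : Nm s i o3 * Ym s o3 o3 = (i == o3)%:R.
  by have := E i; rewrite mxE sum4 !(h o0 isT) !(h o1 isT) !(h o2 isT) !mulr0 !add0r => ->; rewrite mxE.
have := EE j; have -> : (j == o3) = false by apply/negbTE/eqP => Ej; rewrite Ej in j0.
by move=> Ej; rewrite -[LHS]mulr1 -[1](EE o3) mulrCA Ej mulr0.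
Qed.

Definition l6 : seq (nat * nat) := [:: (0, 1); (0, 2); (0, 3); (1, 3)]%N.
(** On the stratum of the minor, y_01 = 0 forces x_01 = x_02 = 0, which leads back to a locus of
    vanishing entries of N. *)
Lemma Z6E A (s : X A) : zeros (addeq Z5 (ye X o0 o1)) s <-> zeros (xs (inl l6)) s.
Proof.
split=> [/zeros_add [/Z5P [h03 h13 hm] y01]|/zeros_x h].
  have [h1 h2] := minor_y01 h03 h13 hm y01.
  by apply/zeros_x => a b; elim/ord4P: a; elim/ord4P: b.
have r0 (j : 'I_4) : (0 < j)%N -> Nm s o0 j = 0 by elim/ord4P: j => // _; apply: h.
apply/zeros_add; split; last exact: (row0_Y r0).
apply/zeros_add; split; first by apply/zeros_x => a b ab; apply: h; rewrite /inl /l6 2!inE -/(inl l4 a b) ab !orbT.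
by rewrite /ev /= !r0 // !mul0r subr0.
Qed.

Definition l7 : seq (nat * nat) := [:: (0, 2); (0, 3); (1, 3); (2, 3)]%N.
(** Once the last column is cleared, the minor is up to a unit the cofactor giving y_02, so this
    branch continues with entries of N^-1. *)
Lemma Z7E A (s : X A) : zeros (addeq Z5 (xe X o2 o3)) s <-> zeros (ys (inl l7)) s.
Proof.
split=> [/zeros_add [/Z5P [h03 h13 hm] x23]|/zeros_y h].
  have c3 (j : 'I_4) : (j < 3)%N -> Ym s j o3 = 0.
    by apply: col3_Y => {}j; elim/ord4P: j.
  apply/zeros_y => a b; elim/ord4P: a; elim/ord4P: b => // _; by [apply: c3|apply: (minor_y h03 h13 hm)].
have c3 (j : 'I_4) : (j < 3)%N -> Nm s j o3 = 0.
  by apply: col3_N => {}j; elim/ord4P: j => // _; apply: h.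
apply/zeros_add; split; last exact: c3.
apply/zeros_add; split; first by apply/zeros_x => a b; elim/ord4P: a; elim/ord4P: b => // _; apply: c3.
have E i : Ym s o0 o0 * Nm s o0 i + Ym s o0 o1 * Nm s o1 i = (o0 == i)%:R.
  have : (Ym s *m Nm s) o0 i = (1%:M : 'M_4) o0 i by rewrite YN.
  by rewrite mxE sum4 (h o0 o2 isT) (h o0 o3 isT) !mul0r !addr0 => ->; rewrite mxE.
have E1 := E o1; have E2 := E o2; rewrite /= in E1 E2.
rewrite /ev /=; move: (Nm s o0 o1) (Nm s o1 o2) (Nm s o0 o2) (Nm s o1 o1) E1 E2 (E o0).
move: (Ym s o0 o0) (Ym s o0 o1) (Nm s o0 o0) (Nm s o1 o0) => y0 y1 x00 x10 x01 x12 x02 x11 E1 E2 E0.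
have E1' : y0 * x01 = - (y1 * x11) by apply/eqP; rewrite -addr_eq0 E1.
have E2' : y0 * x02 = - (y1 * x12) by apply/eqP; rewrite -addr_eq0 E2.
rewrite -[LHS]mulr1 -[1]E0.
transitivity (x00 * ((y0 * x01) * x12 - (y0 * x02) * x11) + x10 * (x01 * (y1 * x12) - x02 * (y1 * x11))); first by ring.
have -> : (y0 * x01) * x12 - (y0 * x02) * x11 = 0 by rewrite E1' E2'; ring.
have F1' : y1 * x11 = - (y0 * x01) by rewrite E1' opprK.
have F2' : y1 * x12 = - (y0 * x02) by rewrite E2' opprK.
rewrite F1' F2'; ring.
Qed.

Lemma Z5_Y (s : pts X) : zeros Z5 s -> forall j : 'I_4, (1 < j)%N -> Ym s o0 j = 0.
Proof. by move=> /Z5P [h03 h13 hm] j; apply: (minor_y h03 h13 hm). Qed.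

Lemma sec_Y01 : sec Z5 (ye X o0 o1) (fun c => - wt q o1 o2 c).
Proof.
split.
- exact: smooth_minor.
- by apply: (smooth_eq (Z := xs (inl l6))); [move=> A s; rewrite Z6E|apply: smooth_x].
- exact: Z5_stable.
- move=> x y s Exy Zs; rewrite -[o2]zt0; apply: (y_equiv hk) => // c d.
  elim/ord4P: c => //; elim/ord4P: d => // _ _ _; exact: (Z5_Y Zs).
- by move=> s Fs; split; [exact: F1_Z5|exact: F1_Y].
- move=> s Zs; refine (@not_zg k q X _ (ye X o0 o1) s _ Zs _) => [|C f e sq fe e0 y0]; first exact: smooth_minor.
  have [h03 h13 hm] := Z5P Zs; have [n01 n02] := minor_y01 h03 h13 hm y0.
  have Zx := (zeros_x _ _).1 ((zeros_add _ _ _).1 Zs).1.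
  (* Adding e times row 1 in columns 1 and 2 to row 0 keeps the minor zero. If y_01 stayed zero, the
     two new entries would vanish and [unimodular] would give e = 0. *)
  pose M : 'M[C]_4 := \matrix_(i, j) if (i == o0) && ((j == o1) || (j == o2)) then e * (Nm s o1 j : k)%:A else (Nm
    s i j : k)%:A.
  have [|x' Es EN] := @lift_x k q X hlift C ko f s M sq.
    move=> i j; rewrite mxE; case: ifP => [/andP [/eqP -> /orP [] /eqP ->]|_]; last by rewrite lrA; apply: mulr1.
      by rewrite lrM fe mul0r n01.
    by rewrite lrM fe mul0r n02.
  have e01 : Nm x' o0 o1 = e * (Nm s o1 o1 : k)%:A by rewrite EN mxE.
  have e02 : Nm x' o0 o2 = e * (Nm s o1 o2 : k)%:A by rewrite EN mxE.
  have e11 : Nm x' o1 o1 = (Nm s o1 o1 : k)%:A by rewrite EN mxE.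
  have e12 : Nm x' o1 o2 = (Nm s o1 o2 : k)%:A by rewrite EN mxE.
  have m' : Nm x' o0 o1 * Nm x' o1 o2 - Nm x' o0 o2 * Nm x' o1 o1 = 0 by rewrite e01 e02 e11 e12 mulrAC subrr.
  have Z' : zeros Z5 x'.
    apply/zeros_add; split; last exact: m'.
    apply/zeros_x => a b ab; rewrite EN mxE; case: ifP => [/andP [/eqP E]|_]; last by rewrite Zx // scale0r.
    by move: ab; rewrite E /inl !inE; elim/ord4P: b.
  exists x'; split=> //; apply/eqP => y0'; case/eqP: e0.
  have [h03' h13' hm'] := Z5P Z'; have [n01' n02'] := minor_y01 h03' h13' hm' y0'.
  have := unimodular h03' h13'; rewrite n01' n02' !mul0r !add0r e11 e12 => U.
  by rewrite -[LHS]mulr1 U mulrDr !mulrA -e01 -e02 n01' n02' !mul0r addr0.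
- move=> i; case: (@curve_cases k q X i o0 o1 (@ev _ _ (ye X o0 o1) k^o)) => [s Cs n|s Cs ai bi h|h|h].
  + exact: (onC_Y Cs) n.
  + exact: onC_Y0 Cs ai bi h.
  + by left=> s Cs _; apply: h.
  + by right=> s Cs _; apply: h.
Qed.

Lemma sec_X23 : sec Z5 (xe X o2 o3) (wt q o2 o1).
Proof.
have E7 A (s : X A) : zeros (addeq (xs (inl ((2, 3) :: l4)%N)) minor) s <-> zeros (addeq Z5 (xe X o2 o3)) s.
  by rewrite !zeros_add -(addeq_x l4 o2 o3) zeros_add; tauto.
split.
- exact: smooth_minor.
- by apply: (smooth_eq E7); apply: smooth_minor.
- exact: Z5_stable.
- move=> x y s Exy Zs; rewrite -[o1]zt3; apply: (x_equiv hk) => // c d; have [h03 h13 _] := Z5P Zs.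
  by elim/ord4P: c => //; elim/ord4P: d.
- by move=> s Fs; split; [exact: F1_Z5|exact: Fs].
- move=> s Zs; refine (@not_zg k q X _ (xe X o2 o3) s _ Zs _) => [|C f e sq fe e0 y0]; first exact: smooth_minor.
  have [h03 h13 hm] := Z5P Zs; have Zx := (zeros_x _ _).1 ((zeros_add _ _ _).1 Zs).1.
  have [|x' Es EN] := @lift_x k q X hlift C ko f s (\matrix_(i, j) if (i == o2) && (j == o3) then e else (Nm s i j
    : k)%:A) sq.
    move=> i j; rewrite mxE; case: ifP => [/andP [/eqP -> /eqP ->]|_]; first by rewrite fe; apply/esym/y0.
    by rewrite lrA; apply: mulr1.
  exists x'; split=> //; last by rewrite /ev /= EN mxE.
  apply/zeros_add; split; last first.
    have e01 : Nm x' o0 o1 = (Nm s o0 o1 : k)%:A by rewrite EN mxE.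
    have e02 : Nm x' o0 o2 = (Nm s o0 o2 : k)%:A by rewrite EN mxE.
    have e11 : Nm x' o1 o1 = (Nm s o1 o1 : k)%:A by rewrite EN mxE.
    have e12 : Nm x' o1 o2 = (Nm s o1 o2 : k)%:A by rewrite EN mxE.
    change (Nm x' o0 o1 * Nm x' o1 o2 - Nm x' o0 o2 * Nm x' o1 o1 = 0); rewrite e01 e02 e11 e12.
    by rewrite -!in_algE -!rmorphM -rmorphB; rewrite hm rmorph0.
  apply/zeros_x => a b ab; rewrite EN mxE; case: ifP => [/andP [/eqP E _]|_]; last by rewrite Zx // scale0r.
  by move: ab; rewrite E /inl !inE.
- move=> i; case: (@curve_cases k q X i o2 o3 (@ev _ _ (xe X o2 o3) k^o)) => [s Cs n|s Cs ai bi h|h|h].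
  + exact: Cs.
  + exact: onC_F1 Cs ai bi h.
  + by left=> s Cs _; apply: h.
  + by right=> s Cs _; apply: h.
Qed.
End Tree.

(** The linear form that vanishes on the weights of det N, x_22 and x_33, the units on the first
    curve, and equals 1 + q^2 on the weight of x_01. [ell2] and [ell3] are its analogues for x_12
    and x_23. *)
Definition ell1 (q : nat) (lam : weight) : int := lam o0 - lam o1 + q%:Z * lam o2 - q%:Z * lam o3.
Definition ell2 (q : nat) (lam : weight) : int := - (q%:Z * lam o0) + lam o1 - lam o2 + q%:Z * lam o3.
Definition ell3 (q : nat) (lam : weight) : int := q%:Z * lam o0 - q%:Z * lam o1 + lam o2 - lam o3.

(* The sum of the six hypotheses with multipliers that are positive polynomials in r = q - 2 is (q^4 - 1) times minus
   the conclusion, up to nonnegative multiples of the multiplicities m02, ..., j12. *)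
Lemma tree_arith (q : nat) (lam : weight) (m02 m13 m01 n13 n12 n23 mm n01 m23 k12 k23 j01 j12 : nat) : (1 < q)%N ->
  0 <= ell3 q (fun c => lam c - m02%:Z * wt q o0 o0 c - m13%:Z * wt q o1 o1 c - m01%:Z * wt q o0 o3 c - n13%:Z * (-
    wt q o3 o3 c) - n12%:Z * (- wt q o2 o3 c) - n23%:Z * (- wt q o3 o0 c)) ->
  0 <= ell2 q (fun c => lam c - m02%:Z * wt q o0 o0 c - m13%:Z * wt q o1 o1 c - m01%:Z * wt q o0 o3 c - n13%:Z * (-
    wt q o3 o3 c) - n12%:Z * (- wt q o2 o3 c) - n23%:Z * (- wt q o3 o0 c)) ->
  0 <= ell3 q (fun c => lam c - m02%:Z * wt q o0 o0 c - m13%:Z * wt q o1 o1 c - mm%:Z * (wt q o0 o3 c + wt q o1 o0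
    c) - n01%:Z * (- wt q o1 o2 c) - m23%:Z * wt q o2 o1 c - k12%:Z * wt q o1 o0 c - k23%:Z * wt q o2 o1 c) ->
  0 <= ell2 q (fun c => lam c - m02%:Z * wt q o0 o0 c - m13%:Z * wt q o1 o1 c - mm%:Z * (wt q o0 o3 c + wt q o1 o0
    c) - n01%:Z * (- wt q o1 o2 c) - m23%:Z * wt q o2 o1 c - k12%:Z * wt q o1 o0 c - k23%:Z * wt q o2 o1 c) ->
  0 <= ell2 q (fun c => lam c - m02%:Z * wt q o0 o0 c - m13%:Z * wt q o1 o1 c - mm%:Z * (wt q o0 o3 c + wt q o1 o0
    c) - n01%:Z * (- wt q o1 o2 c) - m23%:Z * wt q o2 o1 c - j01%:Z * (- wt q o1 o2 c) - j12%:Z * (- wt q o2 o3 c)) ->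
  0 <= ell1 q (fun c => lam c - m02%:Z * wt q o0 o0 c - m13%:Z * wt q o1 o1 c - mm%:Z * (wt q o0 o3 c + wt q o1 o0
    c) - n01%:Z * (- wt q o1 o2 c) - m23%:Z * wt q o2 o1 c - j01%:Z * (- wt q o1 o2 c) - j12%:Z * (- wt q o2 o3 c)) ->
  (q%:Z ^+ 3 + 2 * q%:Z ^+ 2 + 1) * (lam o0 - lam o3) + (q%:Z + 1) ^+ 2 * (lam o0 - lam o2) <= 0.
Proof.
move=> q1 h1 h2 h3 h4 h5 h6; pose r : int := (q - 2)%N%:Z; have r0 : 0 <= r by [].
have Eq : q%:Z = r + 2 by rewrite /r; lia.
have pos (a b c' d e f g h i : nat) : 0 <= a%:Z + b%:Z * r + c'%:Z * r ^+ 2 + d%:Z * r ^+ 3 + e%:Z * r ^+ 4 + f%:Z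
  * r ^+ 5 + g%:Z * r ^+ 6 + h%:Z * r ^+ 7 + i%:Z * r ^+ 8.
  by do ! (apply: addr_ge0 || apply: mulr_ge0 || apply: exprn_ge0).
have {}h1 := mulr_ge0 (pos 45 66 38 10 1 0 0 0 0) h1.
have {}h2 := mulr_ge0 (pos 30 34 14 2 0 0 0 0 0) h2.
have {}h3 := mulr_ge0 (pos 40 102 99 47 11 1 0 0 0) h3.
have {}h4 := mulr_ge0 (pos 48 124 120 55 12 1 0 0 0) h4.
have {}h5 := mulr_ge0 (pos 312 674 625 319 94 15 1 0 0) h5.
have {}h6 := mulr_ge0 (pos 220 411 317 125 25 2 0 0 0) h6.
(* Only these eight multiplicities survive, with nonnegative coefficients; those of [m13], [m01],
   [mm], [m23] and [k12] cancel in the combination. *)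
have p_m02 := mulr_ge0 (pos 390 1612 2813 2726 1617 604 139 18 1) (isT : 0 <= m02%:Z).
have p_n13 := mulr_ge0 (pos 15 47 56 32 9 1 0 0 0) (isT : 0 <= n13%:Z).
have p_n12 := mulr_ge0 (pos 15 47 56 32 9 1 0 0 0) (isT : 0 <= n12%:Z).
have p_n23 := mulr_ge0 (pos 45 156 215 152 59 12 1 0 0) (isT : 0 <= n23%:Z).
have p_n01 := mulr_ge0 (pos 180 669 1016 823 388 107 16 1 0) (isT : 0 <= n01%:Z).
have p_k23 := mulr_ge0 (pos 56 250 459 448 251 81 14 1 0) (isT : 0 <= k23%:Z).
have p_j01 := mulr_ge0 (pos 164 601 900 722 341 96 15 1 0) (isT : 0 <= j01%:Z).
have p_j12 := mulr_ge0 (pos 240 1052 1956 2023 1279 508 124 17 1) (isT : 0 <= j12%:Z).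
rewrite leNgt; apply/negP => O.
have Q4 : 0 < (r + 2) ^+ 4 - 1.
  have -> : (r + 2) ^+ 4 - 1 = 15 + (0%:Z + 32%:Z * r + 24%:Z * r ^+ 2 + 8%:Z * r ^+ 3 + 1%:Z * r ^+ 4 + 0%:Z * r
    ^+ 5 + 0%:Z * r ^+ 6 + 0%:Z * r ^+ 7 + 0%:Z * r ^+ 8) by ring.
  by apply: ltr_wpDr => //; apply: pos.
have {}O := mulr_gt0 Q4 O.
suff T : (((r + 2) ^+ 4 - 1) * ((q%:Z ^+ 3 + 2 * q%:Z ^+ 2 + 1) * (lam o0 - lam o3) + (q%:Z + 1) ^+ 2 * (lam o0 -
  lam o2))) + ((45%:Z + 66%:Z * r + 38%:Z * r ^+ 2 + 10%:Z * r ^+ 3 + 1%:Z * r ^+ 4 + 0%:Z * r ^+ 5 + 0%:Z * r ^+ 6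
  + 0%:Z * r ^+ 7 + 0%:Z * r ^+ 8) * ell3 q (fun c => lam c - m02%:Z * wt q o0 o0 c - m13%:Z * wt q o1 o1 c -
  m01%:Z * wt q o0 o3 c - n13%:Z * (- wt q o3 o3 c) - n12%:Z * (- wt q o2 o3 c) - n23%:Z * (- wt q o3 o0 c))
  + (30%:Z + 34%:Z * r + 14%:Z * r ^+ 2 + 2%:Z * r ^+ 3 + 0%:Z * r ^+ 4 + 0%:Z * r ^+ 5 + 0%:Z * r ^+ 6 + 0%:Z * r
    ^+ 7 + 0%:Z * r ^+ 8) * ell2 q (fun c => lam c - m02%:Z * wt q o0 o0 c - m13%:Z * wt q o1 o1 c - m01%:Z * wt q
    o0 o3 c - n13%:Z * (- wt q o3 o3 c) - n12%:Z * (- wt q o2 o3 c) - n23%:Z * (- wt q o3 o0 c))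
  + (40%:Z + 102%:Z * r + 99%:Z * r ^+ 2 + 47%:Z * r ^+ 3 + 11%:Z * r ^+ 4 + 1%:Z * r ^+ 5 + 0%:Z * r ^+ 6 + 0%:Z *
    r ^+ 7 + 0%:Z * r ^+ 8) * ell3 q (fun c => lam c - m02%:Z * wt q o0 o0 c - m13%:Z * wt q o1 o1 c - mm%:Z * (wt
    q o0 o3 c + wt q o1 o0 c) - n01%:Z * (- wt q o1 o2 c) - m23%:Z * wt q o2 o1 c - k12%:Z * wt q o1 o0 c - k23%:Z
    * wt q o2 o1 c)
  + (48%:Z + 124%:Z * r + 120%:Z * r ^+ 2 + 55%:Z * r ^+ 3 + 12%:Z * r ^+ 4 + 1%:Z * r ^+ 5 + 0%:Z * r ^+ 6 + 0%:Z
    * r ^+ 7 + 0%:Z * r ^+ 8) * ell2 q (fun c => lam c - m02%:Z * wt q o0 o0 c - m13%:Z * wt q o1 o1 c - mm%:Z *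
    (wt q o0 o3 c + wt q o1 o0 c) - n01%:Z * (- wt q o1 o2 c) - m23%:Z * wt q o2 o1 c - k12%:Z * wt q o1 o0 c -
    k23%:Z * wt q o2 o1 c)
  + (312%:Z + 674%:Z * r + 625%:Z * r ^+ 2 + 319%:Z * r ^+ 3 + 94%:Z * r ^+ 4 + 15%:Z * r ^+ 5 + 1%:Z * r ^+ 6 +
    0%:Z * r ^+ 7 + 0%:Z * r ^+ 8) * ell2 q (fun c => lam c - m02%:Z * wt q o0 o0 c - m13%:Z * wt q o1 o1 c - mm%:Z
    * (wt q o0 o3 c + wt q o1 o0 c) - n01%:Z * (- wt q o1 o2 c) - m23%:Z * wt q o2 o1 c - j01%:Z * (- wt q o1 o2 c)
    - j12%:Z * (- wt q o2 o3 c))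
  + (220%:Z + 411%:Z * r + 317%:Z * r ^+ 2 + 125%:Z * r ^+ 3 + 25%:Z * r ^+ 4 + 2%:Z * r ^+ 5 + 0%:Z * r ^+ 6 +
    0%:Z * r ^+ 7 + 0%:Z * r ^+ 8) * ell1 q (fun c => lam c - m02%:Z * wt q o0 o0 c - m13%:Z * wt q o1 o1 c - mm%:Z
    * (wt q o0 o3 c + wt q o1 o0 c) - n01%:Z * (- wt q o1 o2 c) - m23%:Z * wt q o2 o1 c - j01%:Z * (- wt q o1 o2 c)
    - j12%:Z * (- wt q o2 o3 c))
  + (390%:Z + 1612%:Z * r + 2813%:Z * r ^+ 2 + 2726%:Z * r ^+ 3 + 1617%:Z * r ^+ 4 + 604%:Z * r ^+ 5 + 139%:Z * r
    ^+ 6 + 18%:Z * r ^+ 7 + 1%:Z * r ^+ 8) * m02%:Z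
  + (15%:Z + 47%:Z * r + 56%:Z * r ^+ 2 + 32%:Z * r ^+ 3 + 9%:Z * r ^+ 4 + 1%:Z * r ^+ 5 + 0%:Z * r ^+ 6 + 0%:Z * r
    ^+ 7 + 0%:Z * r ^+ 8) * n13%:Z
  + (15%:Z + 47%:Z * r + 56%:Z * r ^+ 2 + 32%:Z * r ^+ 3 + 9%:Z * r ^+ 4 + 1%:Z * r ^+ 5 + 0%:Z * r ^+ 6 + 0%:Z * r
    ^+ 7 + 0%:Z * r ^+ 8) * n12%:Z
  + (45%:Z + 156%:Z * r + 215%:Z * r ^+ 2 + 152%:Z * r ^+ 3 + 59%:Z * r ^+ 4 + 12%:Z * r ^+ 5 + 1%:Z * r ^+ 6 +
    0%:Z * r ^+ 7 + 0%:Z * r ^+ 8) * n23%:Z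
  + (180%:Z + 669%:Z * r + 1016%:Z * r ^+ 2 + 823%:Z * r ^+ 3 + 388%:Z * r ^+ 4 + 107%:Z * r ^+ 5 + 16%:Z * r ^+ 6
    + 1%:Z * r ^+ 7 + 0%:Z * r ^+ 8) * n01%:Z
  + (56%:Z + 250%:Z * r + 459%:Z * r ^+ 2 + 448%:Z * r ^+ 3 + 251%:Z * r ^+ 4 + 81%:Z * r ^+ 5 + 14%:Z * r ^+ 6 +
    1%:Z * r ^+ 7 + 0%:Z * r ^+ 8) * k23%:Z
  + (164%:Z + 601%:Z * r + 900%:Z * r ^+ 2 + 722%:Z * r ^+ 3 + 341%:Z * r ^+ 4 + 96%:Z * r ^+ 5 + 15%:Z * r ^+ 6 +
    1%:Z * r ^+ 7 + 0%:Z * r ^+ 8) * j01%:Z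
  + (240%:Z + 1052%:Z * r + 1956%:Z * r ^+ 2 + 2023%:Z * r ^+ 3 + 1279%:Z * r ^+ 4 + 508%:Z * r ^+ 5 + 124%:Z * r
    ^+ 6 + 17%:Z * r ^+ 7 + 1%:Z * r ^+ 8) * j12%:Z) = 0.
  have : 0 < 0 :> int; last by [].
  rewrite -[X in _ < X]T; apply: (lt_le_trans O); rewrite lerDl.
  by rewrite !addr_ge0.
rewrite /ell1 /ell2 /ell3 /wt /= Eq; ring.
Qed.

(** * Descent through the tree to its six leaves *)

Section Tree.
Context (k : closedFieldType) (q : nat) (hk : is_Fqbar q k) (X : zip_space k q).
Implicit Types (A B C D K : comUnitAlgType k) (Z : fn X -> Prop) (lam chi : weight).
Local Notation ko := (k^o : comUnitAlgType k).
Context (cov : forall K (s : X K), is_field K -> exists c : chart X, cU c K s).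
Context (hlift : forall C D (s : {lrmorphism C -> D}) (x : X D) (g : gl C),
  square_zero_quotient s -> zmap X D x = glmap s g -> exists2 x', zmap X C x' = g & fmap s x' = x).

Local Notation xs P := (@xset k q X P).
Local Notation ys P := (@yset k q X P).

Context (hpc : forall i : 'I_3, pseudo_complete (flag_closure (@flag_stratum k q X (refl i)))).
Local Notation Z5 := (addeq (xs (inl l4)) (@minor k q X)).
Local Notation live Z phi := (exists2 p : pts X, F1 p & ~ zg Z p phi).

Lemma q_gt1 : (1 < q)%N.
Proof. by have [[p [m [/andP [/prime_gt1 p1 _] m0 ->]]] _] := hk; rewrite -(exp1n m) ltn_exp2r. Qed.

(* If e < 0, a power of phi times powers of x_ab, det N, x_jj and x_ll would be a nonconstant function of weight 0
   on the curve i. *)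
Lemma leaf (i : 'I_3) (a b j l : 'I_4) Z lam W phi (e cd c1 c2 : int) : a = i :> nat -> b = i.+1 :> nat ->
  j != a -> j != b -> l != a -> l != b ->
  (forall s : pts X, zeros Z s <-> onC i s) -> node Z lam W phi -> live Z phi ->
  (forall c : 'I_4, (q%:Z ^+ 4 - 1) * lam c + (- (q%:Z ^+ 2 - 1) * e * wt q a (zt b) c + (cd * (1 - q%:Z) +
     (c1 * wt q j (zt j) c + c2 * wt q l (zt l) c))) = 0) -> 0 <= e.
Proof.
move=> ai bi ja jb la lb ZC nd [p Fp nz] E; rewrite leNgt; apply/negP => e0.
have q1 := q_gt1.
have Q1 : 1 < q%:Z by rewrite ltz_nat.
have Q2 : 0 < q%:Z ^+ 2 - 1 by rewrite subr_gt0 exprn_egt1.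
have Q4 : 0 < q%:Z ^+ 4 - 1 by rewrite subr_gt0 exprn_egt1.
have C0 : 0 < - (q%:Z ^+ 2 - 1) * e by rewrite mulNr oppr_gt0 pmulr_rlt0.
have [N EN] : exists N : nat, N%:Z = q%:Z ^+ 4 - 1.
  by exists (absz (q%:Z ^+ 4 - 1)); rewrite abszE ger0_norm ?ltW.
have [c0 Ec0] : exists c0 : nat, c0%:Z = - (q%:Z ^+ 2 - 1) * e.
  by exists (absz (- (q%:Z ^+ 2 - 1) * e)); rewrite abszE ger0_norm ?ltW.
have := @curve k q hk X cov hlift hpc i a b j l ai bi ja jb la lb Z lam W phi p N c0 cd c1 c2 ZC nd Fp nz.
apply=> [||c]; last by rewrite EN Ec0.
  by rewrite -ltz_nat EN.
by rewrite -ltz_nat Ec0.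
Qed.

Lemma leaf1 Z lam W phi : (forall s : pts X, zeros Z s <-> onC 0 s) -> node Z lam W phi -> live Z phi -> 0 <= ell1
  q lam.
Proof.
(* [w] is the part of (1 + q^2) lam carried by the units. The exponents of det N, x_22 and x_33
   solve the linear system that cancels (q^2 - 1) w; the factor q^2 - 1 is what makes them
   integers. *)
move=> ZC nd lv; pose e := ell1 q lam; pose w c := (1 + q%:Z ^+ 2) * lam c - e * wt q o0 o3 c.
pose d := - (q%:Z - 1) * (w o0 + q%:Z * w o2).
apply: (@leaf (@Ordinal 3 0 isT) o0 o1 o2 o3 Z lam W phi e (w o0 + q%:Z * w o2) (- (q%:Z ^+ 2 - 1) * w o2 - d) (-
  (q%:Z ^+ 2 - 1) * w o3 - d)) => // c.
rewrite zt1 zt2 zt3 /d /w /e /ell1 /wt; elim/ord4P: c => /=; ring.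
Qed.
Lemma leaf2 Z lam W phi : (forall s : pts X, zeros Z s <-> onC 1 s) -> node Z lam W phi -> live Z phi -> 0 <= ell2
  q lam.
Proof.
move=> ZC nd lv; pose e := ell2 q lam; pose w c := (1 + q%:Z ^+ 2) * lam c - e * wt q o1 o0 c.
pose d := - (q%:Z - 1) * (w o2 + q%:Z * w o0).
apply: (@leaf (@Ordinal 3 1 isT) o1 o2 o0 o3 Z lam W phi e (w o2 + q%:Z * w o0) (- (q%:Z ^+ 2 - 1) * w o0 - d) (-
  (q%:Z ^+ 2 - 1) * w o3 - d)) => // c.
rewrite zt2 zt0 zt3 /d /w /e /ell2 /wt; elim/ord4P: c => /=; ring.
Qed.
Lemma leaf3 Z lam W phi : (forall s : pts X, zeros Z s <-> onC 2 s) -> node Z lam W phi -> live Z phi -> 0 <= ell3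
  q lam.
Proof.
move=> ZC nd lv; pose e := ell3 q lam; pose w c := (1 + q%:Z ^+ 2) * lam c - e * wt q o2 o1 c.
pose d := - (q%:Z - 1) * (w o2 + q%:Z * w o0).
apply: (@leaf (@Ordinal 3 2 isT) o2 o3 o0 o1 Z lam W phi e (w o2 + q%:Z * w o0) (- (q%:Z ^+ 2 - 1) * w o0 - d) (-
  (q%:Z ^+ 2 - 1) * w o1 - d)) => // c.
rewrite zt3 zt0 zt1 /d /w /e /ell3 /wt; elim/ord4P: c => /=; ring.
Qed.

Lemma node_eq Z Z' lam W phi : (forall s : pts X, zeros Z s <-> zeros Z' s) -> node Z lam W phi -> node Z' lam W phi.
Proof. by move=> E; apply: node_sub => s /E. Qed.
Lemma node_add Z h lam W phi : node Z lam W phi -> node (addeq Z h) lam W phi.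
Proof. by apply: node_sub => s /zeros_add []. Qed.

Lemma onC_x i l (s : pts X) : (forall a b : 'I_4, inl l a b = (a < b)%N && ~~ ((a == i :> nat) && (b == i.+1 :>
  nat))) ->
  zeros (xs (inl l)) s <-> onC i s.
Proof.
move=> h; rewrite zeros_x; split=> H a b => [ab n|]; first by apply: H; rewrite h ab.
by rewrite h => /andP [ab n]; apply: H.
Qed.
Lemma onC_y (i : 'I_3) l (s : pts X) : (forall a b : 'I_4, inl l a b = (a < b)%N && ~~ ((a == i :> nat) && (b ==
  i.+1 :> nat))) ->
  zeros (ys (inl l)) s <-> onC i s.
Proof.
move=> h; rewrite zeros_y; split=> H.
  by apply: onC_of_Y => a b ab; apply: H; rewrite h; move: ab; rewrite /offC.
by move=> a b; rewrite h => /andP [ab n]; apply: onC_Y H _ _.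
Qed.

(** The branch x_02 = 0 continues through x_01 and y_13 and splits at y_12 and y_23. The branch x_13
    = 0 continues through the minor, splits at y_01 and x_23, and each of these splits once more.
    Each leaf contributes one inequality on lam with the multiplicities collected on the way. *)
Lemma tree lam W phi : node (xs (inl [:: (0, 3)%N])) lam W phi -> live (xs (inl [:: (0, 3)%N])) phi ->
  (q%:Z ^+ 3 + 2 * q%:Z ^+ 2 + 1) * (lam o0 - lam o3) + (q%:Z + 1) ^+ 2 * (lam o0 - lam o2) <= 0.
Proof.
move=> nd lv; have S0 a b := @sec_x k q hk X hlift [:: (0, 3)%N] a b.
have [m02 [m13 [W1 [p1 [nd1 lv1 lv4]]]]] := two_sections hk (S0 o0 o2 isT isT isT isT isT) (S0 o1 o3 isT isT isT
  isT isT) nd lv.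
rewrite zt2 zt3 in nd1.
have {}lv1 := nz_eq (fun s => addeq_x [:: (0, 3)%N] o0 o2 s) lv1.
have n1 := node_eq (fun s => addeq_x [:: (0, 3)%N] o0 o2 s) (node_add (xe X o0 o2) nd1).
have {}lv4 := nz_eq (fun s => addeq_x [:: (0, 3)%N] o1 o3 s) lv4.
have n4 := node_eq (fun s => addeq_x [:: (0, 3)%N] o1 o3 s) (node_add (xe X o1 o3) nd1).
have [m01 [W2 [p2 [n2 lv2]]]] := one_section hk (@sec_x k q hk X hlift [:: (0, 2); (0, 3)]%N o0 o1 isT isT isT isT
  isT) n1 lv1.
rewrite zt1 in n2.
(* Row 0 is supported on the diagonal for N exactly when it is for N^-1; this is where the branch
   changes from entries of N to entries of N^-1. *)
have E2 (s : pts X) : zeros (addeq (xs (inl [:: (0, 2); (0, 3)]%N)) (xe X o0 o1)) s <-> zeros (ys (inl [:: (0, 1);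
  (0, 2); (0, 3)]%N)) s.
  rewrite (addeq_x [:: (0, 2); (0, 3)]%N o0 o1) zeros_x zeros_y; split=> h a b ab.
    suff r0 (j : 'I_4) : (0 < j)%N -> Ym s o0 j = 0 by move: ab; elim/ord4P: a => //; elim/ord4P: b => // _; apply: r0.
    by apply: row0_Y => {}j j0; apply: h; move: j0; elim/ord4P: j.
  suff r0 (j : 'I_4) : (0 < j)%N -> Nm s o0 j = 0 by move: ab; elim/ord4P: a => //; elim/ord4P: b => // _; apply: r0.
  by apply: row0_N => {}j j0; apply: h; move: j0; elim/ord4P: j.
have {}lv2 := nz_eq E2 lv2; have {}n2 := node_eq E2 (node_add (xe X o0 o1) n2).
have [n13 [W3 [p3 [n3 lv3]]]] := one_section hk (@sec_y k q hk X hlift [:: (0, 1); (0, 2); (0, 3)]%N o1 o3 isT isT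
  isT isT isT) n2 lv2.
rewrite zt1 in n3.
have E3 s := addeq_y [:: (0, 1); (0, 2); (0, 3)]%N o1 o3 (s : pts X).
have {}lv3 := nz_eq E3 lv3; have {}n3 := node_eq E3 (node_add (ye X o1 o3) n3).
have S3 a b := @sec_y k q hk X hlift [:: (1, 3); (0, 1); (0, 2); (0, 3)]%N a b.
have [n12 [n23 [W8 [p8 [nd8 lv8 lv9]]]]] := two_sections hk (S3 o1 o2 isT isT isT isT isT) (S3 o2 o3 isT isT isT
  isT isT) n3 lv3.
rewrite zt1 zt2 in nd8.
have h1 := leaf3 (fun s => iff_trans (addeq_y _ o1 o2 s) (onC_y (i := @Ordinal 3 2 isT) _ _)) (node_add _ nd8) lv8.
have h2 := leaf2 (fun s => iff_trans (addeq_y _ o2 o3 s) (onC_y (i := @Ordinal 3 1 isT) _ _)) (node_add _ nd8) lv9.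
have E4 (s : pts X) : zeros (xs (inl [:: (1, 3); (0, 3)]%N)) s <-> zeros (xs (inl l4)) s.
  by rewrite !zeros_x; split=> h a b ab; apply: h; move: ab; rewrite /inl !inE orbC.
have {}lv4 := nz_eq E4 lv4; have {}n4 := node_eq E4 n4.
have [mm [W5 [p5 [n5 lv5]]]] := one_section hk (sec_minor hk hlift) n4 lv4.
have {}n5 := node_add (@minor k q X) n5.
have [n01 [m23 [W6 [p6 [n6 lv6 lv7]]]]] := two_sections hk (sec_Y01 hk hlift) (sec_X23 hk hlift) n5 lv5.
have {}lv6 := nz_eq (fun s => Z6E s) lv6; have {}lv7 := nz_eq (fun s => Z7E s) lv7.
have n7 := node_eq (fun s => Z7E s) (node_add (xe X o2 o3) n6).
have {}n6 := node_eq (fun s => Z6E s) (node_add (ye X o0 o1) n6).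
have S6 a b := @sec_x k q hk X hlift l6 a b.
have [k12 [k23 [W9 [p9 [n9 lv10 lv11]]]]] := two_sections hk (S6 o1 o2 isT isT isT isT isT) (S6 o2 o3 isT isT isT
  isT isT) n6 lv6.
rewrite zt2 zt3 in n9.
have h3 := leaf3 (fun s => iff_trans (addeq_x _ o1 o2 s) (onC_x (i := 2) _ _)) (node_add _ n9) lv10.
have h4 := leaf2 (fun s => iff_trans (addeq_x _ o2 o3 s) (onC_x (i := 1) _ _)) (node_add _ n9) lv11.
have S7 a b := @sec_y k q hk X hlift l7 a b.
have [j01 [j12 [Wa [pa [na lv12 lv13]]]]] := two_sections hk (S7 o0 o1 isT isT isT isT isT) (S7 o1 o2 isT isT isT
  isT isT) n7 lv7.
rewrite zt0 zt1 in na.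
have h5 := leaf2 (fun s => iff_trans (addeq_y _ o0 o1 s) (onC_y (i := @Ordinal 3 1 isT) _ _)) (node_add _ na) lv12.
have h6 := leaf1 (fun s => iff_trans (addeq_y _ o1 o2 s) (onC_y (i := @Ordinal 3 0 isT) _ _)) (node_add _ na) lv13.
apply: (@tree_arith q lam m02 m13 m01 n13 n12 n23 mm n01 m23 k12 k23 j01 j12 q_gt1); [apply: h1|apply: h2|apply:
  h3|apply: h4|apply: h5|apply: h6];
by move=> a b; elim/ord4P: a; elim/ord4P: b.
Qed.
End Tree.

(** * Spreading along projective lines *)

Section Resultant.
Context (R : comNzRingType).
Lemma sum_coef (p : {poly R}) n : (size p <= n)%N -> p = \sum_(j < n) (p`_j)%:P * 'X^j.
Proof.
move=> sp; under eq_bigr => j _ do rewrite mul_polyC.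
rewrite -(poly_def n (fun j => p`_j)); apply/polyP => i; rewrite coef_poly.
by case: ltnP => // ni; rewrite nth_default // (leq_trans sp).
Qed.

(* The ideal (G, T) of R[u] contains the determinant of the multiplication by G on R[u]/T. *)
Lemma eliminant (T G : {poly R}) n : size T = n.+2 -> exists r U V, r%:P = U * G + V * T /\
  forall (K : fieldType) (f : {rmorphism R -> K}), map_poly f T = f (lead_coef T) *: 'X^(n.+1) ->
    f (lead_coef T) != 0 -> (map_poly f G).[0] != 0 -> f r != 0.
Proof.
move=> sT; have T0 : T != 0 by rewrite -size_poly_eq0 sT.
pose N (i : 'I_n.+1) := Pdiv.Ring.rscalp (G * 'X^i) T.
pose A (i : 'I_n.+1) := Pdiv.Ring.rdivp (G * 'X^i) T.
pose M : 'M[R]_n.+1 := \matrix_(i, j) (Pdiv.Ring.rmodp (G * 'X^i) T)`_j.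
pose l := lead_coef T.
have E i : (l ^+ N i)%:P * (G * 'X^i) = A i * T + \sum_j (M i j)%:P * 'X^j.
  rewrite mul_polyC Pdiv.ComRing.rdivp_eq; congr (_ + _).
  rewrite [LHS](@sum_coef _ n.+1); first by apply: eq_bigr => j _; rewrite mxE.
  by rewrite -ltnS -sT Pdiv.Ring.ltn_rmodp.
pose a i := (\adj M) ord0 i.
exists (\det M), (\sum_i (a i)%:P * ((l ^+ N i)%:P * 'X^i)), (- \sum_i (a i)%:P * A i); split.
  rewrite mulNr mulr_suml [X in _ - X]mulr_suml -sumrB.
  transitivity (\sum_i \sum_j (a i)%:P * ((M i j)%:P * 'X^j)).
    rewrite exchange_big /=.
    transitivity (\sum_j ((\adj M *m M) ord0 j)%:P * 'X^j); last first.
      apply: eq_bigr => j _; rewrite mxE rmorph_sum mulr_suml /=; apply: eq_bigr => i _.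
      by rewrite rmorphM /= mulrA.
    rewrite mul_adj_mx (bigD1 ord0) //= big1 ?addr0; first by rewrite mxE eqxx mulr1n expr0 mulr1.
    by move=> j j0; rewrite mxE eq_sym (negPf j0) mulr0n mul0r.
  apply: eq_bigr => i _; rewrite -mulr_sumr -!mulrA -mulrBr; congr (_ * _).
  by rewrite [_ * G]mulrC E addrAC subrr add0r.
(* Here T becomes a unit times X^(n+1), so reduction modulo T truncates and the matrix is
   triangular, with diagonal entries G(0) times a unit. *)
move=> K f Tf l0 G0; rewrite -det_map_mx -det_tr.
have Mf i j : f (M i j) = f l ^+ N i * ((map_poly f G) * 'X^i)`_j.
  have := congr1 (fun p : {poly K} => p`_j) (congr1 (map_poly f) (E i)).
  rewrite !(rmorphM, rmorphD) /= map_polyC /= map_polyXn Tf rmorphXn coefCM => ->.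
  rewrite coefD -[X in X * _]/(map_poly f (A i)) -scalerAr coefZ coefMXn ltnS -ltnS ltn_ord mulr0 add0r.
  rewrite rmorph_sum coef_sum (bigD1 j) //= big1 ?addr0.
    by rewrite rmorphM /= map_polyC /= map_polyXn coefCM coefXn eqxx mulr1.
  by move=> l' lj; rewrite rmorphM /= map_polyC /= map_polyXn coefCM coefXn eq_sym val_eqE (negPf lj) mulr0.
rewrite det_trig; last first.
  by apply/is_trig_mxP => i j ij; rewrite 2!mxE Mf coefMXn ij mulr0.
by apply/prodf_neq0 => i _; rewrite 2!mxE Mf coefMXn ltnn subnn -horner_coef0 mulf_neq0 // expf_neq0.
Qed.
End Resultant.

Section Fibers.
Context (k : closedFieldType) (q : nat) (hk : is_Fqbar q k) (X : zip_space k q).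
Implicit Types (A B C D K : comUnitAlgType k) (Z : fn X -> Prop) (lam chi : weight).
Local Notation ko := (k^o : comUnitAlgType k).
Local Notation xs P := (@xset k q X P).
Context (cov : forall K (s : X K), is_field K -> exists c : chart X, cU c K s).
Context (hlift : forall C D (s : {lrmorphism C -> D}) (x : X D) (g : gl C),
  square_zero_quotient s -> zmap X D x = glmap s g -> exists2 x', zmap X C x' = g & fmap s x' = x).

Lemma poly_ext (p p' : {poly k}) : (forall a, p.[a] = p'.[a]) -> p = p'.
Proof.
move=> h; apply/eqP; rewrite -subr_eq0; apply/negP => /negP /closed_nonrootP [a].
by rewrite /root hornerD hornerN h subrr eqxx.
Qed.

Definition uni A (a : A) : 'M[A]_4 := \matrix_(i, j) ((i == j)%:R + a *+ ((i == o0) && (j == o1))).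
Lemma uniM A (a b : A) : uni a *m uni b = uni (a + b).
Proof.
apply/matrixP => i j; rewrite mxE sum4 !mxE; elim/ord4P: i; elim/ord4P: j; rewrite /= ?mulr0n ?mulr1n ?mulr1; ring.
Qed.
Lemma uni0 A : uni (0 : A) = 1%:M.
Proof. by apply/matrixP => i j; rewrite !mxE mul0rn addr0. Qed.
Lemma uni_unit A (a : A) : uni a \in unitmx.
Proof. by have [] := @mulmx1_unit _ _ (uni a) (uni (- a)) _ => //; rewrite uniM subrr uni0. Qed.
Lemma uni_inv A (a : A) : invmx (uni a) = uni (- a).
Proof. by apply: (can_inj (mulKmx (uni_unit a))); rewrite mulmxV ?uni_unit // uniM subrr uni0. Qed.
Definition ug A (a : A) : gl A := gl_mk (uni_unit a).
Lemma ug_map A B (f : {lrmorphism A -> B}) a : glmap f (ug a) = ug (f a).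
Proof.
apply: val_inj; apply/matrixP => i j; rewrite /= !mxE lrD; congr (_ + _); last by case: (_ && _); rewrite ?mulr0n
  ?mulr1n ?lr0.
by case: (i == j); rewrite ?lr0 ?lr1.
Qed.
Lemma ug_E A (a : A) : in_E q (ug a) (ug (a ^+ q)).
Proof.
apply/(in_EP (q_gt0 hk)); split=> [i j|i j|i j] /=; rewrite !mxE; elim/ord4P: i => //; elim/ord4P: j => //= _;
 rewrite ?mulr0n ?mulr1n ?addr0 ?add0r ?expr1n ?(frob0 hk) //.
Qed.
(** For nonzero a the pair acting here is in E but not in E', so the values of F along this line are
    not tied to the value at s by equivariance. *)
Definition mv A (s : X A) (a : A) : X A := zact (ug a) (ug (a ^+ q)) s.
Lemma mv_nat A B (f : {lrmorphism A -> B}) (s : X A) a : fmap f (mv s a) = mv (fmap f s) (f a).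
Proof. by rewrite /mv zact_nat ?ug_map ?lrX //; apply: ug_E. Qed.
Lemma mv0 A (s : X A) : mv s 0 = s.
Proof.
by rewrite /mv (frob0 hk) (_ : ug 0 = gl1 A) ?zact1 //; apply: val_inj; rewrite /= uni0.
Qed.

(** The row operation contributes a factor u and the column operation a factor -u^q; hence the four
    terms, and degree q + 1 when x_12 is nonzero. *)
Definition theta A (s : X A) : {poly A} := (Nm s o0 o3)%:P + (Nm s o1 o3)%:P * 'X -
  (Nm s o0 o2)%:P * 'X^q - (Nm s o1 o2)%:P * 'X^(q.+1).
Lemma thetaE A (s : X A) a : Nm (mv s a) o0 o3 = (theta s).[a].
Proof.
rewrite /mv Nm_act; last exact: ug_E.
have bE : bmx (ug (a ^+ q)) = \matrix_(i, j) uni (- a ^+ q) (zt i) (zt j).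
  by apply/matrixP => i j; rewrite !mxE /= uni_inv mxE.
have aE : val (ug a) = uni a by [].
rewrite bE aE [LHS]mxE sum4 ![(uni a *m _) _ _]mxE !sum4 ![(\matrix_(i, j) uni _ _ _) _ _]mxE zt0 zt1 zt2 zt3 ![uni
  _ _ _]mxE.
rewrite /= /theta !(hornerD, hornerN, hornerM, hornerC, hornerX, hornerXn) /= !mulr0n !mulr1n exprS; ring.
Qed.
Lemma theta_k (s : pts X) (a : k) : ev (xe X o0 o3) (mv s (a : ko)) = (theta s : {poly k}).[a].
Proof. exact: thetaE. Qed.
Lemma theta_map A B (f : {lrmorphism A -> B}) (s : X A) : map_poly f (theta s) = theta (fmap f s).
Proof.
by rewrite /theta !Nm_nat !(rmorphB, rmorphD, rmorphM) /= !map_polyC /= map_polyX !map_polyXn.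
Qed.

(** F is evaluated at the universal point of the chart moved by the generic parameter of the
    line. *)
Lemma fiber_poly (F : fn X) (c : chart X) : exists P : {poly cR c}, forall (y : kpoint c) (a : k), (map_poly y
  P).[a] = ev F (mv (at_ y) (a : ko)).
Proof.
have [B [io [j [ios io0 ioC ioH]]]] := poly_alg (cR c).
have [P EP] := ios (ev F (mv (fmap j (cu c)) (io 'X))).
exists P => y a; have [h [hj hio]] := ioH _ y (a : ko).
rewrite -hio EP -evE mv_nat; congr (ev F (mv _ _)); last by rewrite hio map_polyX hornerX.
by rewrite /at_ -(@fmap_comp _ X _ _ _ j h y) // => r; rewrite /= hj.
Qed.

Lemma theta_at (c : chart X) (y : kpoint c) : map_poly y (theta (cu c)) = theta (at_ y).
Proof. exact: theta_map. Qed.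

Definition E0 := @xset k q X (fun _ _ => false).
Lemma zE0 A (s : X A) : zeros E0 s. Proof. by apply/zeros_x. Qed.
Lemma smooth0 : smooth_set E0. Proof. exact: smooth_x. Qed.

Definition germ0 (c : chart X) (x : kpoint c) (r : cR c) :=
  exists2 u, x u != 0 & forall y : kpoint c, y u != 0 -> y r = 0.

Lemma germ0_ev (c : chart X) (x : kpoint c) (E : fn X) : germ0 x (ev E (cu c)) <-> zg E0 (at_ x) (@ev _ _ E k^o).
Proof.
split=> [[u xu hu]|/near_in [u xu hu]].
  by apply: (nearI xu) => y yu _; rewrite /at_ evE; apply: hu.
by exists u => // y yu; rewrite -evE; apply: (hu y yu); apply: zE0.
Qed.

Lemma germ_nbhd (c : chart X) (x : kpoint c) : exists2 e0, x e0 != 0 & forall y : kpoint c, y e0 != 0 ->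
  (forall r, germ0 y r -> germ0 x r) /\ forall r, germ0 x r -> y r = 0.
Proof.
have [e0 xe0 he0] := irreducible_nbhd smooth0 (zE0 (at_ x)); exists e0 => // y ye0.
have null (z : kpoint c) r : germ0 z r -> exists2 e, z e != 0 & eqs c E0 (e * r).
  by move=> [u zu hu]; apply: (chart_nullst smooth0 (zE0 _)); exists u => // w wu _; apply: hu.
split=> r; last first.
  move=> /null /he0 /(eqs_map (zE0 (fmap y (cu c)))) /eqP; by rewrite lrM mulf_eq0 (negPf ye0) => /eqP.
move=> /null [u yu Ju]; case: (chart_dom (r1 := u) (r2 := r) smooth0 (zE0 (at_ x))) => [||h].
- by exists 1; rewrite ?lr1 ?oner_neq0 // mul1r.
- move/he0/(eqs_map (zE0 (fmap y (cu c))))/eqP; by rewrite lrM mulf_eq0 (negPf ye0) (negPf yu).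
- by have [e xe H] := eqs_germ h; exists e => // z ze; apply: H ze (zE0 _).
Qed.

Lemma germ0M (c : chart X) (x : kpoint c) a b : germ0 x (a * b) -> germ0 x a \/ germ0 x b.
Proof.
move=> [u xu hu]; have ne h : (exists2 e, x e != 0 & eqs c E0 (e * h)) -> germ0 x h.
  by move=> /eqs_germ [e xe H]; exists e => // z ze; apply: H ze (zE0 _).
case: (chart_dom (r1 := a) (r2 := b) smooth0 (zE0 (at_ x))) => [|h|h]; [|by left; apply: ne|by right; apply: ne].
by apply: (chart_nullst smooth0 (zE0 _)); exists u => // w wu _; apply: hu.
Qed.

Lemma regs_in (c : chart X) (x : kpoint c) n (Q : nat -> pts X -> k) : (forall i, (i < n)%N -> reg E0 (at_ x) (Q i)) ->
  exists e (r : nat -> cR c), x e != 0 /\ forall y : kpoint c, y e != 0 -> forall i, (i < n)%N -> Q i (at_ y) * y e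
    = y (r i).
Proof.
elim: n => [|n IHn] h; first by exists 1, (fun=> 0); rewrite lr1 oner_neq0.
have [e [r [xe he]]] := IHn (fun i hi => h i (ltnW hi)).
have [e' [r' [xe' he']]] := reg_in (h n (ltnSn n)).
exists (e * e'), (fun i => if i == n then e * r' else r i * e'); split; first by rewrite lrM mulf_neq0.
move=> y; rewrite lrM mulf_eq0 => /norP [ye ye'] i; rewrite ltnS leq_eqVlt; case: eqP => [-> _|_ /= hi].
  by rewrite !lrM -(he' y ye' (zE0 _)) mulrCA.
by rewrite !lrM -(he y ye i hi) mulrA.
Qed.

Section Divisible.
Context (F : fn X).
Local Notation x03 := (xe X o0 o3).

(* x_03 divides F on the line {mv s a}, over the fraction field of the local ring at s. *)
Definition fdiv (s : pts X) := exists n (c : pts X -> k) (Q : nat -> pts X -> k),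
  [/\ reg E0 s c, forall i, (i < n)%N -> reg E0 s (Q i), ~ zg E0 s c
    & near s (fun t => forall a : k, c t * ev F (mv t (a : ko)) = (\sum_(i < n) Q i t * a ^+ i) * ev x03 (mv t (a :
      ko)))].

Lemma fdiv_in (c : chart X) (x : kpoint c) : fdiv (at_ x) -> exists e r (Q : {poly cR c}), [/\ x e != 0, ~ germ0 x r
  & forall y : kpoint c, y e != 0 -> forall a : k, y r * ev F (mv (at_ y) (a : ko)) = (map_poly y Q).[a] * ev x03
    (mv (at_ y) (a : ko))].
Proof.
move=> [n [phi [Q [rp rQ np /near_in [u xu hu]]]]].
have [|e [r [xe he]]] := @regs_in c x n.+1 (fun i => if i == n then phi else Q i).
  by move=> i; case: eqP => // ne; rewrite ltnS leq_eqVlt; case: eqP => // _; apply: rQ.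
have hn (y : kpoint c) (ye : y e != 0) : phi (at_ y) * y e = y (r n) by have := he y ye n (ltnSn n); rewrite eqxx.
have hi (y : kpoint c) (ye : y e != 0) i : (i < n)%N -> Q i (at_ y) * y e = y (r i).
  by move=> lt; have := he y ye i (ltnW lt); rewrite ltn_eqF.
exists (u * e), (r n), (\poly_(i < n) r i); split; first by rewrite lrM mulf_neq0.
  by move=> g; apply: np; apply/(zg_in xe (r := r n)) => [y ye _|]; [exact: hn|have [v xv hv] := g; exists v => //
    y yv _; apply: hv].
move=> y; rewrite lrM mulf_eq0 => /norP [yu ye] a; rewrite -(hn y ye) mulrAC hu // mulrAC; congr (_ * _).
rewrite poly_def rmorph_sum horner_sum mulr_suml; apply: eq_bigr => i _.
by rewrite -mul_polyC rmorphM /= map_polyC /= map_polyXn hornerM hornerC hornerXn -(hi y ye i (ltn_ord i)) mulrAC.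
Qed.

Lemma fdiv_of (c : chart X) (x : kpoint c) e r (Q : {poly cR c}) : x e != 0 -> ~ germ0 x r ->
  (forall y : kpoint c, y e != 0 -> forall a : k, y r * ev F (mv (at_ y) (a : ko)) = (map_poly y Q).[a] * ev x03
    (mv (at_ y) (a : ko))) ->
  fdiv (at_ x).
Proof.
move=> xe nr h; have mk r' : exists phi : pts X -> k, forall y : kpoint c, phi (at_ y) = y r'.
  have [phi hp] := @reg_make _ _ c 1 r'; exists phi => y; have := hp y; by rewrite lr1 mulr1; apply; rewrite oner_neq0.
have x1 : x 1 != 0 by rewrite lr1 oner_neq0.
have mkr phi r' : (forall y : kpoint c, phi (at_ y) = y r') -> reg E0 (at_ x) phi.
  by move=> hp; exists c, x, 1, r'; split=> // y _ _; rewrite lr1 mulr1.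
have [phi hp] := mk r; have [psi hq] := choice (fun i => mk Q`_i).
exists (size Q), phi, psi; split; first exact: mkr hp.
- by move=> i _; apply: mkr (hq i).
- by move=> /near_in [u xu hu]; apply: nr; exists u => // y yu; rewrite -hp; apply: hu (zE0 _).
apply: (nearI xe) => y ye a; rewrite hp h //; congr (_ * _).
rewrite [in LHS](@sum_coef _ Q _ (leqnn _)) rmorph_sum horner_sum; apply: eq_bigr => i _.
by rewrite rmorphM /= map_polyC /= map_polyXn hornerM hornerC hornerXn hq.
Qed.

Lemma opn_fdiv : opn fdiv.
Proof.
move=> s Ts; have [c [x Es]] := near_chart (near_k cov s); rewrite -Es in Ts *.
have [e [r [Q [xe nr h]]]] := fdiv_in Ts; have [e0 xe0 h0] := germ_nbhd x.
apply: (@nearI _ _ c x (e * e0)); first by rewrite lrM mulf_neq0.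
move=> y; rewrite lrM mulf_eq0 => /norP [ye ye0]; apply: (fdiv_of ye _ h).
by move=> g; apply: nr; apply: (h0 y ye0).1.
Qed.

(** The relation r F = Q x_03 is the vanishing of the coefficients of one polynomial over the chart.
    On a neighbourhood where germs vanish at all points simultaneously, a relation at y is also one
    at x. *)
Lemma opn_nfdiv : opn (fun s => ~ fdiv s).
Proof.
move=> s nT; have [c [x Es]] := near_chart (near_k cov s); rewrite -Es in nT *.
have [e0 xe0 h0] := germ_nbhd x; have [P hP] := fiber_poly F c.
apply: (nearI xe0) => y ye0 Ty; apply: nT; have [e [r [Q [ye nr h]]]] := fdiv_in Ty.
have [h1 h2] := h0 y ye0.
pose D := r%:P * P - Q * theta (cu c).
have Dv (z : kpoint c) : map_poly z D = (z r)%:P * map_poly z P - map_poly z Q * theta (at_ z).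
  by rewrite /D rmorphB !rmorphM /= map_polyC /= theta_at.
have gD i : germ0 x D`_i.
  apply: h1; exists e => // z ze; rewrite -coef_map /=.
  rewrite (_ : map_poly z D = 0) ?coef0 //; apply: poly_ext => a.
  by rewrite Dv hornerD hornerN !hornerM hornerC horner0 hP h // theta_k subrr.
have [e1 xe1 g1] := germ_nbhd x; apply: (fdiv_of xe1 (r := r) (Q := Q)).
  move=> g; apply: nr; exists e0 => // z ze0; exact: (h0 z ze0).2.
move=> z ze1 a; rewrite -hP theta_k.
have D0 : map_poly z D = 0 by apply/polyP => i; rewrite coef_map coef0; apply: (g1 z ze1).2.
have := congr1 (fun p : {poly k} => p.[a]) D0; rewrite Dv hornerD hornerN !hornerM hornerC horner0 => /eqP.
by rewrite subr_eq0 => /eqP.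
Qed.

Lemma size_theta A (s : X A) : Nm s o1 o2 != 0 -> size (theta s) = q.+2 /\ lead_coef (theta s) = - Nm s o1 o2.
Proof.
move=> n0; pose w := (Nm s o0 o3)%:P + (Nm s o1 o3)%:P * 'X - (Nm s o0 o2)%:P * 'X^q.
have q1 := q_gt1 hk.
have sw : (size w < q.+2)%N.
  rewrite ltnS; apply: leq_trans (size_polyD _ _) _; rewrite geq_max; apply/andP; split.
    apply: leq_trans (size_polyD _ _) _; rewrite geq_max; apply/andP; split.
      by apply: leq_trans (size_polyC_leq1 _) _; lia.
    by rewrite mul_polyC; apply: leq_trans (size_scale_leq _ _) _; rewrite size_polyX; lia.
  by rewrite size_polyN mul_polyC; apply: leq_trans (size_scale_leq _ _) _; rewrite size_polyXn; lia.
have l : lead_coef (- ((Nm s o1 o2)%:P * 'X^(q.+1))) = - Nm s o1 o2.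
  by rewrite lead_coefN lead_coef_Mmonic ?monicXn // lead_coefC.
have sz : size (- ((Nm s o1 o2)%:P * 'X^(q.+1))) = q.+2.
  by rewrite size_polyN size_Mmonic ?monicXn ?polyC_eq0 // size_polyXn size_polyC n0 add1n.
rewrite /theta -/w; split; first by rewrite addrC size_polyDl sz.
by rewrite addrC lead_coefDl ?sz.
Qed.

(** At s0 the only root of Theta is u = 0, and near u = 0 the vanishing of F gives G F = H x_03 with
    G(0) nonzero. The eliminant r = U G + V Theta is nonzero at s0 and turns this into r F = (U H +
    V F) x_03 on the whole line. *)
Lemma fdiv_local (s0 : pts X) : Nm s0 o0 o3 = 0 -> Nm s0 o1 o3 = 0 -> Nm s0 o0 o2 = 0 -> Nm s0 o1 o2 != 0 ->
  zg (xs (inl [:: (0, 3)%N])) s0 (@ev _ _ F k^o) -> fdiv s0.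
Proof.
move=> h03 h13 h02 h12 zF; have [c [x Es]] := near_chart (near_k cov s0).
rewrite -Es in h03 h13 h02 h12 zF *.
have E03 A (s : X A) : zeros (xs (inl [:: (0, 3)%N])) s <-> zeros (addeq E0 x03) s.
  rewrite zeros_add zeros_x; split=> [h|[_ h] a b]; first by split; [exact: zE0|exact: h].
  by elim/ord4P: a; elim/ord4P: b.
have [|||psi rpsi hpsi] := @zg_div _ X E0 x03 (at_ x) (@ev _ _ F k^o) (smooth_eq E03 (@smooth_x k q X hlift _)).
- by apply/zeros_add; split; [exact: zE0|].
- exact: reg_ev (near_k cov _).
- by apply: near_sub zF => s h /E03.
have [e1 [r1 [xe1 he1]]] := reg_in rpsi; have [e2 xe2 he2] := near_in hpsi.
have hF (y : kpoint c) : y (e1 * e2) != 0 -> ev F (at_ y) * y e1 = ev x03 (at_ y) * y r1.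
  rewrite lrM mulf_eq0 => /norP [ye1 ye2]; rewrite (he2 y ye2 (zE0 _)) -mulrA; congr (_ * _).
  exact: (he1 y ye1 (zE0 _)).
have xe : x (e1 * e2) != 0 by rewrite lrM mulf_neq0.
have [B [io [j [ios io0 ioC ioH]]]] := poly_alg (cR c).
pose s' := mv (fmap j (cu c)) (io 'X).
have ev_s' (g : {lrmorphism B -> ko}) (y : kpoint c) (a : k) : (forall r, g (j r) = y r) -> g (io 'X) = a -> fmap g
  s' = mv (at_ y) (a : ko).
  move=> gj gX; rewrite mv_nat gX; congr (mv _ _).
  by rewrite /at_ -(@fmap_comp _ X _ _ _ j g y) // => r; rewrite /= gj.
have ioX (y : kpoint c) a (g : {lrmorphism B -> ko}) : (forall p, g (io p) = (map_poly y p).[a]) -> g (io 'X) = a.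
  by move=> ->; rewrite map_polyX hornerX.
have [g0 [g0j g0i]] := ioH _ x (0 : ko).
have E0s : fmap g0 s' = at_ x by rewrite (ev_s' g0 x 0 g0j (ioX _ _ _ g0i)) mv0.
have [|b [g0b bn univ]] := @local_chart k X c B s' _ g0 (@is_field_k k).
  by rewrite E0s; apply/chart_point; exists x.
have [C [fb [[ub surj _] ext]]] := localization bn.
have [h Eh] := univ C fb ub.
have [b1 [n1 Eb1]] := surj (h (e1 * e2)); have [b3 [n3 Eb3]] := surj (h e1); have [b2 [n2 Eb2]] := surj (h r1).
have lifts (g : {lrmorphism B -> ko}) : g b != 0 -> exists y' : kpoint c, [/\ at_ y' = fmap g s', y' (e1 * e2) * g
  b ^+ n1 = g b1,
    y' e1 * g b ^+ n3 = g b3 & y' r1 * g b ^+ n2 = g b2].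
  move=> gb; have [|g' Eg] := ext ko g; first by rewrite unit_k.
  have [y' Ey] := lr_comp h g'; have Ey' r : y' r = g' (h r) by exact: Ey.
  have gf r : g' (fb r) = g r by exact: Eg.
  exists y'; split; [|by rewrite Ey' -!gf -lrX -lrM Eb1|by rewrite Ey' -!gf -lrX -lrM Eb3|by rewrite Ey' -!gf -lrX
    -lrM Eb2].
  rewrite /at_ (@fmap_comp _ X _ _ _ h g' y' _ Ey) Eh.
  by rewrite -(@fmap_comp _ X _ _ _ fb g' g) // => r; rewrite /= gf.
have [pb Epb] := ios b; have [p1 Ep1] := ios b1; have [p2 Ep2] := ios b2; have [p3 Ep3] := ios b3.
(* The factors [pb] and [p1] make both sides vanish where the moved point leaves the chart or the
   domain of the quotient; the others clear denominators. *)
pose G := pb * p1 * p3 * pb ^+ n2; pose H := pb * p1 * p2 * pb ^+ n3.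
have GH (y : kpoint c) (a : k) : (map_poly y G).[a] * ev F (mv (at_ y) (a : ko)) = (map_poly y H).[a] * ev x03 (mv
  (at_ y) (a : ko)).
  have [g [gj gi]] := ioH _ y (a : ko).
  rewrite -!gi /G /H !(rmorphM io) !(rmorphXn io) Epb Ep1 Ep2 Ep3 !lrM !lrX.
  case: (eqVneq (g b) 0) => [->|gb]; first by rewrite !mul0r.
  case: (eqVneq (g b1) 0) => [->|gb1]; first by rewrite mulr0 !mul0r.
  have [y' [Ey y1 y3 y2]] := lifts g gb; rewrite -(ev_s' g y a gj (ioX _ _ _ gi)) -Ey.
  have /hF HF : y' (e1 * e2) != 0 by apply: contra_neq gb1 => E; rewrite -y1 E mul0r.
  rewrite -y3 -y2 -!mulrA; congr (_ * (_ * _)).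
  move: HF; move: (ev F _) (ev x03 _) (y' e1) (y' r1) (g b ^+ n3) (g b ^+ n2) => u v u' v' w w' HF.
  transitivity (u * u' * (w * w')); [ring|rewrite HF; ring].
have G0 : (map_poly x G).[0] != 0.
  have [y' [Ey y1 y3 y2]] := lifts g0 g0b; have Ey' := at_inj (etrans Ey E0s).
  rewrite -g0i /G !(rmorphM io) !(rmorphXn io) Epb Ep1 Ep3 !lrM !lrX -y1 -y3 !Ey'.
  by rewrite !mulf_neq0 ?expf_neq0.
have n12 : Nm (cu c) o1 o2 != 0.
  by apply: contra_neq h12 => E; rewrite /at_ Nm_nat E lr0.
have [sT lT] := size_theta n12; have [r [U [V [ErUV hr]]]] := eliminant G sT.
have [P hP] := fiber_poly F c.
have xr : x r != 0.
  have xl : x (lead_coef (theta (cu c))) = - Nm (at_ x) o1 o2 by rewrite lT (raddfN x) /at_ Nm_nat.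
  apply: (hr k x) => //; last by change (x (lead_coef (theta (cu c))) != 0); rewrite xl oppr_eq0.
  change (map_poly x (theta (cu c)) = x (lead_coef (theta (cu c))) *: 'X^(q.+1)); rewrite xl theta_at.
  by rewrite /theta h03 h13 h02 !polyC0 !mul0r addr0 subr0 sub0r -mul_polyC polyCN mulNr.
apply: (@fdiv_of c x 1 r (U * H + V * P)); first by rewrite lr1 oner_neq0.
  by move=> [u xu hu]; case/eqP: xr; apply: hu.
have gen (A0 : comNzRingType) (r0 u g v t f0 h0 : A0) : r0 = u * g + v * t -> g * f0 = h0 * t -> r0 * f0 = (u * h0
  + v * f0) * t.
  by move=> -> E'; transitivity (u * (g * f0) + v * (t * f0)); [ring|rewrite E'; ring].
have mapL (u g v t : {poly cR c}) (y : kpoint c) : map_poly y (u * g + v * t) = map_poly y u * map_poly y g +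
  map_poly y v * map_poly y t.
  by rewrite rmorphD !rmorphM.
move=> y _ a; rewrite (_ : (map_poly y (U * H + V * P)).[a] = (map_poly y U).[a] * (map_poly y H).[a] + (map_poly y
  V).[a] * ev F (mv (at_ y) (a : ko))).
  apply: (gen k _ _ _ _ _ _ _ _ (GH y a)); have := congr1 (fun p => (map_poly y p).[a]) ErUV.
  by rewrite map_polyC hornerC mapL hornerD !hornerM theta_at -theta_k.
by rewrite mapL hornerD !hornerM hP.
Qed.

(** At a lower triangular point all coefficients of Theta vanish, so the local argument is made at
    nearby points of x_02 = x_03 = x_13 = 0 with x_12 nonzero. Openness of the failure of
    divisibility brings the result back to p. *)
Lemma fdiv_F1 (p : pts X) : F1 p -> zg (xs (inl [:: (0, 3)%N])) p (@ev _ _ F k^o) -> fdiv p.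
Proof.
move=> Fp zp; apply: contrapT => nT.
have nQ := near_and (near_near zp) (opn_nfdiv nT).
have Zp : zeros (xs (inl [:: (0, 2); (0, 3); (1, 3)]%N)) p.
  by apply/zeros_x => a b; elim/ord4P: a => //; elim/ord4P: b => // _; apply: Fp.
have [s [[zs nTs] /zeros_x Zs h12]] := zg_point_near nQ (@not_zg_x k q X hlift (inl [:: (0, 2); (0, 3); (1, 3)]%N)
  o1 o2 p isT Zp).
by apply: nTs; apply: fdiv_local => //; apply: Zs.
Qed.

(** Pseudo-division of Phi by Theta leaves a remainder of degree at most q. Up to the factor r,
    Theta divides it where x_12 is nonzero and Theta has degree q + 1, so the remainder is zero as a
    germ. At u = 0 on x_03 = 0 this gives x_12^N F = 0, and x_12 is not a zero germ there. *)
Lemma fdiv_zg (p : pts X) : zeros (xs (inl [:: (0, 3)%N])) p -> fdiv p -> zg (xs (inl [:: (0, 3)%N])) p (@ev _ _ F k^o).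
Proof.
move=> Zp; have [c [x Es]] := near_chart (near_k cov p); rewrite -Es in Zp * => Tx.
have [e [r [Q [xe' nr h]]]] := fdiv_in Tx; have [P hP] := fiber_poly F c.
have n12 : ~ germ0 x (Nm (cu c) o1 o2).
  by move=> /(germ0_ev x (xe X o1 o2)); apply: not_zg_x => //; apply: zE0.
have N0 : Nm (cu c) o1 o2 != 0.
  apply/eqP => E; apply: n12; rewrite E; exists 1; first by rewrite lr1 oner_neq0.
  by move=> y _; rewrite lr0.
have [sT lT] := size_theta N0; pose N := Pdiv.Ring.rscalp P (theta (cu c)).
pose D := Pdiv.Ring.rdivp P (theta (cu c)); pose w := Pdiv.Ring.rmodp P (theta (cu c)).
pose l := lead_coef (theta (cu c)).
have Ew : (l ^+ N)%:P * P = D * theta (cu c) + w by rewrite mul_polyC Pdiv.ComRing.rdivp_eq.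
have sw : (size w < q.+2)%N by rewrite -sT Pdiv.Ring.ltn_rmodp -size_poly_eq0 sT.
have Ey (y : kpoint c) : (y l ^+ N)%:P * map_poly y P = map_poly y D * theta (at_ y) + map_poly y w.
  by have := congr1 (map_poly y) Ew; rewrite rmorphM rmorphD rmorphM /= map_polyC /= lrX theta_at.
have gw : germ0 x w`_0.
  have [//|/germ0M [//|g]] : germ0 x (Nm (cu c) o1 o2) \/ germ0 x (r * w`_0); last exact: g.
  apply: germ0M; exists e => // y ye; rewrite !lrM.
  case: (eqVneq (y (Nm (cu c) o1 o2)) 0) => [->|ny]; first by rewrite mul0r.
  have [sy _] := @size_theta ko (at_ y) (eq_ind_r (fun z => z != 0) ny (Nm_nat _ _ _ _)).
  have E : (y r)%:P * map_poly y w = ((y l ^+ N)%:P * map_poly y Q - (y r)%:P * map_poly y D) * theta (at_ y).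
    have Eh : (y r)%:P * map_poly y P = map_poly y Q * theta (at_ y).
      by apply: poly_ext => a; rewrite !hornerM hornerC hP h // theta_k.
    rewrite mulrBl -!mulrA -Eh (_ : map_poly y w = (y l ^+ N)%:P * map_poly y P - map_poly y D * theta (at_ y));
      last by rewrite Ey addrAC subrr add0r.
    by rewrite mulrBr; congr (_ - _); rewrite mulrCA.
  have E0' : (y r)%:P * map_poly y w = 0.
    rewrite E; apply/eqP; apply: contraT => nz; have := nz; rewrite mulf_eq0 negb_or => /andP [na nb].
    have : (size ((y r)%:P * map_poly y w)%R < q.+2)%N.
      rewrite mul_polyC; apply: leq_ltn_trans (size_scale_leq _ _) _; exact: leq_ltn_trans (size_poly _ _) sw.
    rewrite E size_mul // sy; have : (0 < size ((y l ^+ N)%:P * map_poly y Q - (y r)%:P * map_poly y D)%R)%N by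
      rewrite size_poly_gt0.
    by case: (size _) => // m _; rewrite addSn /= -addn2; lia.
  have := congr1 (fun z : {poly k} => z`_0) E0'; rewrite coefCM coef_map coef0 /= => ->; by rewrite mulr0.
have [u xu hu] := gw.
have sZ : smooth_set (xs (inl [:: (0, 3)%N])) by apply: smooth_x.
case: (@zg_dom _ X (xs (inl [:: (0, 3)%N])) (at_ x) (fun s => ev (xe X o1 o2) s ^+ N) (@ev _ _ F k^o) sZ Zp).
- exact: reg_exp (reg_ev _ _ (near_k cov _)).
- exact: reg_ev (near_k cov _).
- apply: (nearI xu) => y yu /zeros_x Zy; have h03 : Nm (at_ y) o0 o3 = 0 by apply: Zy.
  have := congr1 (fun z : {poly k} => z.[0]) (Ey y).
  rewrite hornerD !hornerM hornerC hP -theta_k !mv0 (_ : ev (xe X o0 o3) (at_ y) = 0) // mulr0 add0r horner_coef0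
    coef_map /= hu //.
  have yl : y l = - Nm (at_ y) o1 o2 by rewrite /l lT (raddfN y) /at_ Nm_nat.
  rewrite yl exprNn -mulrA => /eqP; rewrite mulf_eq0 signr_eq0 /= => /eqP; exact.
- move=> z; exfalso; apply: (@not_zg_x k q X hlift (inl [:: (0, 3)%N]) o1 o2 (at_ x) isT Zp).
  by apply: near_sub z => s h' Zs; have /eqP := h' Zs; rewrite expf_eq0 => /andP [_ /eqP].
- by [].
Qed.
End Divisible.
End Fibers.

(** * Vanishing on the whole divisor x_03 = 0 *)

Section Vanishing.
Context (k : closedFieldType) (q : nat) (hk : is_Fqbar q k) (X : zip_space k q) (S : kfunctor k) (pr : kmap X S).
Implicit Types (A B C D K : comUnitAlgType k).
Local Notation ko := (k^o : comUnitAlgType k).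
Context (cov : forall K (s : X K), is_field K -> exists c : chart X, cU c K s).
Context (hlift : forall C D (s : {lrmorphism C -> D}) (x : X D) (g : gl C),
  square_zero_quotient s -> zmap X D x = glmap s g -> exists2 x', zmap X C x' = g & fmap s x' = x).
Context (hpc : forall i : 'I_3, pseudo_complete (flag_closure (@flag_stratum k q X (refl i)))).
Context (prT : forall A (s s' : X A), pr A s = pr A s' -> exists x y : gl A, in_E q x y /\ zact x y s = s').
Context (prL : forall A (a : S A), exists B (f : {lrmorphism A -> B}) (s : X B),
    etale_cover f /\ pr B s = fmap f a).
Context (hsurj : forall C : subfunctor S, connected_component C ->
  forall K (g : gl K), is_field K ->
  exists K' (f : {lrmorphism K -> K'}) (s : X K'),
    [/\ is_field K', C K' (pr K' s) & zmap X K' s = glmap f g]).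

Theorem vanishing (F : fn X) (lam : weight) :
  (forall (x y : gl ko) (s : pts X), in_E' q x y -> ev F (zact x y s) = character lam x * ev F s) ->
  0 < (q%:Z ^+ 3 + 2 * q%:Z ^+ 2 + 1) * (lam o0 - lam o3) + (q%:Z + 1) ^+ 2 * (lam o0 - lam o2) ->
  forall p : pts X, ev (xe X o0 o3) p = 0 -> near p (fun t => ev (xe X o0 o3) t = 0 -> ev F t = 0).
Proof.
move=> HF om p hp.
have E03 A (s : X A) : zeros (@xset k q X (inl [:: (0, 3)%N])) s <-> ev (xe X o0 o3) s = 0.
  rewrite zeros_x; split=> [h|h a b]; first exact: h.
  by elim/ord4P: a; elim/ord4P: b.
suff z : zg (@xset k q X (inl [:: (0, 3)%N])) p (@ev _ _ F k^o) by apply: near_sub z => t h /E03.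
apply: fdiv_zg => //; first exact/E03.
(* Over the inverse of z the matrix N is the identity, so the points above g0 satisfy [F1]. *)
pose g0 := glV (gl_perm ko zeltw).
have oF : opn (fdiv F) by apply: opn_fdiv.
have oN : opn (fun s => ~ fdiv F s) by apply: opn_nfdiv.
have := @clopen_all k q (q_gt0 hk) X S pr cov prT prL hsurj (fdiv F) (fun s => ~ fdiv F s) g0 oF oN
  (fun y => EM _) (fun y h h' => h' h); apply.
move=> y Ey; have F1y : F1 y.
  have N1 : Nm y = 1%:M by rewrite Nm_mul Ey /= mulVmx // unitmx_perm.
  by move=> a b ab; rewrite N1 mxE; case: eqP ab => [->|//]; rewrite ltnn.
apply: fdiv_F1 => //; apply: contrapT => nz.
have nd : node (@xset k q X (inl [:: (0, 3)%N])) lam (fun=> True) (@ev _ _ F k^o).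
  split=> //.
  - by move=> s _ _; apply: near_sub (near_k cov s).
  - by move=> s _ _; apply: reg_ev; apply: near_k.
  - by move=> x z s Exz _ _; apply: HF.
have := tree hk cov hlift hpc nd (ex_intro2 _ _ y F1y nz).
by rewrite leNgt om.
Qed.
End Vanishing.

(** * The dual zip space *)

Section Dual.
Context (k : closedFieldType) (q : nat) (hk : is_Fqbar q k).
Implicit Types (A B C D K : comUnitAlgType k).
Local Notation ko := (k^o : comUnitAlgType k).
Local Notation ro := (@rev_ord 4).

(** Transposition along the antidiagonal, J m^T J. *)
Definition flip (R : comUnitRingType) (m : 'M[R]_4) : 'M[R]_4 := \matrix_(i, j) m (ro j) (ro i).
Lemma flipM (R : comUnitRingType) (m m' : 'M[R]_4) : flip (m *m m') = flip m' *m flip m.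
Proof.
apply/matrixP => i j; rewrite !mxE (reindex_inj rev_ord_inj) /=; apply: eq_bigr => l _.
by rewrite !mxE mulrC.
Qed.
Lemma flip1 (R : comUnitRingType) : flip (1%:M : 'M[R]_4) = 1%:M.
Proof. by apply/matrixP => i j; rewrite !mxE (inj_eq rev_ord_inj) eq_sym. Qed.
Lemma flipK (R : comUnitRingType) (m : 'M[R]_4) : flip (flip m) = m.
Proof. by apply/matrixP => i j; rewrite !mxE !rev_ordK. Qed.
Lemma flip_inv (R : comUnitRingType) (m : 'M[R]_4) : m \in unitmx -> flip (invmx m) *m flip m = 1%:M.
Proof. by move=> u; rewrite -flipM mulmxV // flip1. Qed.
Lemma flip_unit (R : comUnitRingType) (m : 'M[R]_4) : m \in unitmx -> flip (invmx m) \in unitmx.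
Proof. by move=> u; have [] := mulmx1_unit (flip_inv u). Qed.
Lemma invmx_flip (R : comUnitRingType) (m : 'M[R]_4) : m \in unitmx -> invmx (flip (invmx m)) = flip m.
Proof.
by move=> u; apply: (can_inj (mulKmx (flip_unit u))); rewrite mulmxV ?flip_unit // flip_inv.
Qed.

(** The involution g -> J g^-T J; the inverse makes it a group morphism, and it preserves B, both
    parabolics and E. *)
Definition dl A (g : gl A) : gl A := gl_mk (flip_unit (valP g)).
Lemma dlK A (g : gl A) : dl (dl g) = g.
Proof. by apply: val_inj; rewrite /= invmx_flip ?flipK //; apply: valP. Qed.
Lemma dlM A (g h : gl A) : dl (glM g h) = glM (dl g) (dl h).
Proof.
apply: val_inj => /=; rewrite -flipM; congr flip.
have u := valP (glM g h); apply: (can_inj (mulKmx u)); rewrite mulmxV //= !mulmxA.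
by rewrite -[_ *m val h *m _]mulmxA mulmxV ?(valP h) // mulmx1 mulmxV ?(valP g).
Qed.
Lemma dlV A (g : gl A) : dl (glV g) = glV (dl g).
Proof. by apply: val_inj; rewrite /= invmxK invmx_flip //; apply: valP. Qed.
Lemma dl1 A : dl (gl1 A) = gl1 A.
Proof. by apply: val_inj; rewrite /= invmx1 flip1. Qed.
Lemma dl_map A B (f : {lrmorphism A -> B}) (g : gl A) : dl (glmap f g) = glmap f (dl g).
Proof. by apply: val_inj; apply/matrixP => i j; rewrite /= map_invmx_lr !mxE. Qed.

Lemma dl_B A (b : gl A) : in_B b -> in_B (dl b).
Proof.
move=> /trigP tb; have [tV _] := trig_inv tb (valP b); apply/trigP => i j ij; rewrite mxE.
by apply: tV => /=; have := ltn_ord i; have := ltn_ord j; lia.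
Qed.
Lemma dl_E A (x y : gl A) : in_E q x y -> in_E q (dl x) (dl y).
Proof.
have q0 := q_gt0 hk; move=> /(in_E_inv hk) /(in_EP q0) [lx uy E]; apply/(in_EP q0); split=> [i j hi hj|i j hi hj|i
  j ij].
- by rewrite mxE; apply: lx => /=; have := ltn_ord i; have := ltn_ord j; lia.
- by rewrite mxE; apply: uy => /=; have := ltn_ord i; have := ltn_ord j; lia.
- rewrite !mxE; apply: E; move: ij; rewrite /sblk /= => /eqP ij; apply/eqP.
  have := ltn_ord i; have := ltn_ord j; move: ij; case: (ltnP i 2); case: (ltnP j 2) => //; lia.
Qed.
Lemma dl_E' A (x y : gl A) : in_E' q x y -> in_E' q (dl x) (dl y).
Proof. by move=> [E b]; split; [apply: dl_E|apply: dl_B]. Qed.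

Lemma dl_character lam (x : gl ko) : in_B x -> character lam (dl x) = character (fun i => - lam (ro i)) x.
Proof.
move=> /trigP tx; have [_ dV] := trig_inv tx (valP x).
rewrite /character (reindex_inj rev_ord_inj) /=; apply: eq_bigr => i _.
by rewrite mxE rev_ordK dV -exprz_inv.
Qed.

Context (X : zip_space k q).
Lemma dmap_nat A B (f : {lrmorphism A -> B}) (s : X A) : dl (zmap X B (fmap f s)) = fmap f (dl (zmap X A s) : GL4 k A).
Proof. by rewrite appE dl_map. Qed.
(** The functor is unchanged; the action and the map to GL_4 are twisted by the involution. This
    permutes the three curves, so the condition of pseudo-completeness is inherited. *)
Definition dual_space : zip_space k q.
Proof.
refine (@ZipSpace k q X (fun A x y s => zact (dl x) (dl y) s) (@KMap k X (GL4 k) _ dmap_nat) _ _ _ _).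
- by move=> A s; rewrite !dl1 zact1.
- by move=> A x y x' y' s E E'; rewrite !dlM zactM //; apply: dl_E.
- by move=> A B f x y s E; rewrite zact_nat ?dl_map //; apply: dl_E.
- by move=> A x y s E; rewrite /= zmap_equiv ?dlM ?dlV ?dlK //; apply: dl_E.
Defined.

Lemma dl_perm A (i : 'I_3) : dl (gl_perm A (refl i)) = gl_perm A (refl (rev_ord i)).
Proof.
apply: val_inj => /=.
have V : invmx (perm_mx (refl i)) = perm_mx (refl i) :> 'M[A]_4.
  have u : (perm_mx (refl i) : 'M[A]_4) \in unitmx by apply: unitmx_perm.
  by apply: (can_inj (mulKmx u)); rewrite mulmxV // -perm_mxM tperm2 perm_mx1.
rewrite V; apply/matrixP => a b; rewrite [LHS]mxE !perm_refl; case: i {V} => [[|[|[|//]]]] hi;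
elim/ord4P: a; elim/ord4P: b; by [].
Qed.
Lemma dl_z A : dl (gl_perm A zeltw) = gl_perm A zeltw.
Proof.
apply: val_inj => /=.
have V : invmx (perm_mx zeltw) = perm_mx zeltw :> 'M[A]_4.
  have u : (perm_mx zeltw : 'M[A]_4) \in unitmx by apply: unitmx_perm.
  apply: (can_inj (mulKmx u)); rewrite mulmxV // -perm_mxM (_ : (zeltw * zeltw)%g = 1%g) ?perm_mx1 //.
  by apply/permP => a; rewrite permM perm1 !zeltwE ztK.
rewrite V; apply/matrixP => a b; rewrite !mxE !zeltwE.
congr (_%:R : A); rewrite -!val_eqE /= !ztE; elim/ord4P: a; elim/ord4P: b; by [].
Qed.

Lemma dual_stratum (i : 'I_3) A (s : X A) : @flag_stratum k q dual_space (refl i) A s <-> @flag_stratum k q X (refl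
  (rev_ord i)) A s.
Proof.
split=> -[b [b' [hb hb' E]]]; exists (dl b), (dl b'); split; try exact: dl_B.
  by rewrite -(dlK (zmap X A s)) [dl (zmap X A s)]E !dlM dl_perm dlV dl_z.
by rewrite [LHS]/= E !dlM dl_perm dlV dl_z rev_ordK.
Qed.
Lemma dual_stable (Z : subfunctor X) : @flag_stable k q dual_space Z <-> @flag_stable k q X Z.
Proof.
split=> h A x y s Exy Zs; last by apply: h => //; apply: dl_E'.
by have := h A (dl x) (dl y) s (dl_E' Exy) Zs; rewrite /= !dlK.
Qed.
Lemma dual_closure (i : 'I_3) : @flag_closure k q dual_space (@flag_stratum k q dual_space (refl i)) =
  @flag_closure k q X (@flag_stratum k q X (refl (rev_ord i))).
Proof.
apply: functional_extensionality_dep => A; apply/funext => s; apply/propext; split=> h Z cZ sZ hZ.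
  by apply: h => //; [apply/dual_stable|move=> B t /dual_stratum; apply: hZ].
by apply: h => //; [apply/dual_stable|move=> B t /dual_stratum; apply: hZ].
Qed.
Lemma dual_complete (hpc : forall i : 'I_3, pseudo_complete (flag_closure (@flag_stratum k q X (refl i)))) (i : 'I_3) :
  pseudo_complete (flag_closure (@flag_stratum k q dual_space (refl i))).
Proof.
rewrite dual_closure => h hn hE K s Kf Zs.
have [|U [c [oU sU Us hU]]] := hpc (rev_ord i) h hn _ K s Kf Zs.
  move=> A x y t zt zt' Exy; have Et : zact x y t = @zact k q dual_space A (dl x) (dl y) t by rewrite /= !dlK.
  by move: zt'; rewrite Et => zt'; apply: hE => //; apply: dl_E'.
by exists U, c; split=> //; apply/dual_stable.
Qed.
End Dual.

(** * Division by a partial Hasse invariant *)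

Section Quotient.
Context (k : closedFieldType) (q : nat) (hk : is_Fqbar q k) (X : zip_space k q).
Implicit Types (A B C D K : comUnitAlgType k).
Local Notation ko := (k^o : comUnitAlgType k).
Local Notation E0 := (@E0 k q X).
Context (cov : forall K (s : X K), is_field K -> exists c : chart X, cU c K s).
Context (hlift : forall C D (s : {lrmorphism C -> D}) (x : X D) (g : gl C),
  square_zero_quotient s -> zmap X D x = glmap s g -> exists2 x', zmap X C x' = g & fmap s x' = x).
Context (h : kmap (GL4 k) (affine_line k)) (F E : fn X) (lam lamH : weight).

Lemma pull_nat A B (f : {lrmorphism A -> B}) (s : X A) : (h B (zmap X B (fmap f s)) : B) = f (h A (zmap X A s)).
Proof. by rewrite appE appE. Qed.
Definition pull : fn X := @KMap k X (affine_line k) _ pull_nat.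

Context (sE : smooth_set (addeq E0 E)) (nE : forall p : pts X, ~ zg E0 p (@ev _ _ E ko))
  (van : forall p : pts X, ev E p = 0 -> near p (fun t => ev E t = 0 -> ev F t = 0))
  (hE : forall A (s : X A), ev pull s = 0 -> ev E s = 0).

Lemma pull_germ (p : pts X) : ~ zg E0 p (@ev _ _ pull ko).
Proof. by move=> z; apply: (nE (p := p)); apply: near_sub z => t ht Zt; apply: (@hE ko t); apply: ht. Qed.

(** The inclusion of zero schemes is tested on the point with values in the coordinate ring modulo
    the pullback of h: E vanishes there, hence is a multiple of that pullback. *)
Lemma pull_divides (c : chart X) (x : kpoint c) : ev pull (at_ x) = 0 -> exists a : cR c, ev E (cu c) = a * ev pull
  (cu c).
Proof.
move=> h0; have n1 : ~ iprinc (ev pull (cu c)) 1.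
  by move=> [a Ea]; have := congr1 x Ea; rewrite lr1 lrM -evE [ev _ _]h0 mulr0 => /eqP; rewrite oner_eq0.
have [B [f [fs f0 fi]]] := @quotient_alg k (cR c) (GRing.in_alg (cR c) : {rmorphism k -> cR c}) _ n1.
have [|g gE] := @lr_of k (cR c) B f; first by move=> a; rewrite -fi.
have : ev E (fmap g (cu c)) = 0 by apply: hE; rewrite evE gE f0; exists 1; rewrite mul1r.
by rewrite evE gE f0 => -[a ->]; exists a.
Qed.

(** F is a local multiple of E because it vanishes on the smooth divisor E = 0, and E is a local
    multiple of the pullback of h. *)
Lemma local_quotient (p : pts X) : exists2 psi, reg E0 p psi & near p (fun t => ev F t = ev pull t * psi t).
Proof.
have nk := near_k cov p; case: (eqVneq (ev pull p) 0) => [h0|h0]; last first.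
  have rp : reg E0 p (@ev _ _ pull ko) by apply: reg_ev.
  exists (fun t => ev F t * (ev pull t)^-1); first by apply: reg_mul; [apply: reg_ev|apply: reg_inv (zE0 _)].
  apply: near_sub (reg_neq0 rp (zE0 _) h0) => t /(_ (zE0 _)) ht; by rewrite mulrCA divff ?mulr1.
have [c [x Es]] := near_chart nk; rewrite -Es in h0 nk *; have [a Ea] := pull_divides h0.
have Eat (y : kpoint c) : ev E (at_ y) = y a * ev pull (at_ y) by rewrite !evE Ea lrM.
have E0p : ev E (at_ x) = 0 by rewrite Eat h0 mulr0.
have Zp : zeros (addeq E0 E) (at_ x) by apply/zeros_add; split; [exact: zE0|].
have zF : zg (addeq E0 E) (at_ x) (@ev _ _ F ko) by apply: near_sub (van E0p) => t ht /zeros_add [_ /ht].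
have [psi rpsi hpsi] := zg_div sE Zp (reg_ev _ _ nk) zF.
have [phi hp] := @reg_make _ _ c 1 a.
have hp' (y : kpoint c) : phi (at_ y) = y a by have := hp y; rewrite lr1 mulr1; apply; rewrite oner_neq0.
exists (fun t => phi t * psi t).
  apply: reg_mul => //; exists c, x, 1, a; split=> //; first by rewrite lr1 oner_neq0.
  by move=> y _ _; rewrite lr1 mulr1.
have [u xu hu] := near_in hpsi; apply: (nearI xu) => y yu.
by rewrite (hu y yu (zE0 _)) Eat hp' mulrA [y a * _]mulrC.
Qed.

(** The pullback of h is nowhere a zero germ, so local quotients are unique and glue; the product
    formula is then a matter of k-points. *)
Lemma global_quotient : exists g : fn X, forall A (s : X A), ev F s = ev g s * ev pull s.
Proof.
have [psi hpsi] := choice (fun p => let: ex_intro2 f r n := local_quotient p in ex_intro (fun f => reg E0 p f /\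
  near p (fun t => ev F t = ev pull t * f t)) f (conj r n)).
have Zt (t : pts X) : zeros E0 t by apply: zE0.
have sm := @smooth0 k q X hlift.
have eta_reg (p : pts X) : zeros E0 p -> reg E0 p (fun s => psi s s).
  move=> _; have [rp np] := hpsi p; apply: reg_eq (rp).
  apply: near_sub (near_and (zg_reg_near rp) (near_near np)) => t [rt nt] _; have [rt' nt'] := hpsi t.
  have z : zg E0 t (fun s => ev pull s * (psi p s - psi t s)).
    by apply: near_sub (near_and nt nt') => s [e1 e2] _; rewrite mulrBr -e1 -e2 subrr.
  case: (zg_dom sm (Zt t) (reg_ev _ _ (near_k cov t)) (reg_add rt rt') z) => [/pull_germ //|z'].
  by have /eqP := near_at z' (Zt t); rewrite subr_eq0 => /eqP.
have [g0 [gn gv]] := regular_fn sm cov eta_reg.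
have gn' A B (f : {lrmorphism A -> B}) (s : X A) : (g0 B (fmap f s) : B) = f (g0 A s) by apply: gn; apply: zE0.
exists (@KMap k X (affine_line k) g0 gn') => A s; apply/eqP; rewrite -subr_eq0; apply/eqP.
apply: (@dens _ X E0 sm cov (fun A s => ev F s - g0 A s * ev pull s)); last exact: zE0.
  by move=> A1 B f t _; rewrite !evE lrB lrM gn'.
move=> t _; rewrite (gv t (Zt t)); have [_ nt] := hpsi t; by rewrite (near_at nt) mulrC subrr.
Qed.

Context (HF : flag_section lam F) (Hh : flag_section (X := zip_group_space k q) lamH h).

(** Comparing the equivariance of F and of h gives that of g after cancelling the pullback of h as a
    germ; density extends it from k-points to all test algebras. *)
Lemma quotient_section : exists g : kmap X (affine_line k), flag_section (fun i => lam i - lamH i) g /\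
  forall A (s : X A), F A s = (g A s : A) * h A (zmap X A s).
Proof.
have [g Eg] := global_quotient; exists g; split; last exact: Eg.
have sm := @smooth0 k q X hlift.
have D := @E'_dense k q (q_gt0 hk) X cov E0 sm (fun A x y s _ _ => zE0 _) (fun A s => ev g s) (fun i => lam i - lamH i)
  (fun A B f s _ => evE _ _ _).
move=> A x0 y0 s0 Exy'; apply: D => //; last exact: zE0.
move=> x y s Exy _ {x0 y0 s0 Exy'}; have [Exy0 /trigP tx] := Exy.
have hq (t : pts X) : ev pull (zact x y t) = character lamH x * ev pull t.
  by have := @Hh ko x y (zmap X _ t) Exy; rewrite /ev /= zmap_equiv.
have gTn A1 B (f : {lrmorphism A1 -> B}) (t : X A1) : (ev g (trans x y (fmap f t)) : B) = f (ev g (trans x y t)).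
  by rewrite -(trans_nat hk Exy0) evE.
pose gT : fn X := @KMap k X (affine_line k) (fun A1 t => ev g (trans x y t)) gTn.
have z : zg E0 s (fun t => ev pull t * (ev gT t - character (fun i => lam i - lamH i) x * ev g t)).
  apply: near_sub (near_k cov s) => t _ _.
  have e1 := HF t Exy; rewrite -![F _ _]/(ev F _) !Eg hq in e1.
  have cH := char_neq0 lamH tx; apply: (mulfI cH); rewrite mulr0 mulrBr mulrBr /ev /= trans_k -/(ev g _).
  rewrite (charB lam lamH tx); apply/eqP; rewrite subr_eq0; apply/eqP.
  have aux (u v w p gz : k) : u != 0 -> gz * (u * p) = v * (w * p) -> u * (p * gz) = u * (p * (v / u * w)).
    move=> u0 e; transitivity (gz * (u * p)); first by ring.
    by rewrite e; field.
  exact: (aux _ _ _ _ _ cH e1).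
have rg : reg E0 s (fun t => ev gT t - character (fun i => lam i - lamH i) x * ev g t).
  apply: reg_add; first by apply: reg_ev; apply: near_k.
  by apply: reg_mul; [apply: reg_cst|apply: reg_ev]; apply: near_k.
case: (zg_dom sm (zE0 s) (reg_ev _ _ (near_k cov s)) rg z) => [/pull_germ //|z'].
by have /eqP := near_at z' (zE0 s); rewrite subr_eq0 /ev /= trans_k => /eqP.
Qed.
End Quotient.

(** * The divisors of the two partial Hasse invariants *)

Section Strata.
Context (k : closedFieldType) (q : nat) (hk : is_Fqbar q k).
Implicit Types (A B C D K : comUnitAlgType k).
Local Notation G := (zip_group_space k q).
Local Notation Gd := (dual_space hk G).

Lemma perm_entry (A : comUnitAlgType k) (b b' : 'M[A]_4) (m : 'M[A]_4) : trig b -> trig b' -> m o0 o3 = 0 -> (b *m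
  m *m b') o0 o3 = 0.
Proof.
move=> tb tb' m0; rewrite corner ?m0 ?mulr0 ?mul0r // => l l'.
by elim/ord4P: l => //; elim/ord4P: l' => // _ _; rewrite eqxx.
Qed.

Lemma w0E (a : 'I_4) : w0 a = rev_ord a. Proof. by rewrite permE. Qed.
Lemma reflE (i : 'I_3) (a : 'I_4) : (refl i a : nat) = if (a == i :> nat) then i.+1 else if (a == i.+1 :> nat) then
  (i : nat) else a.
Proof.
have i4 : (i < 4)%N by have := ltn_ord i; lia. have i14 : (i.+1 < 4)%N by have := ltn_ord i; lia.
rewrite /refl; case: tpermP => [->|->|/eqP n1 /eqP n2]; rewrite ?inordK // ?eqxx //.
  by rewrite (gtn_eqF (ltnSn _)).
by rewrite -!val_eqE /= !inordK // in n1 n2; rewrite (negPf n1) (negPf n2).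
Qed.

(** The permutation sends 0 to 3 and then to 2, so its matrix has a zero in the corner (0, 3), which
    lower triangular factors preserve. *)
Lemma closure3 A (g : G A) : flag_closure (@flag_stratum k q G (w0 * refl (inord 2))%g) g -> Nm (X := G) g o0 o3 = 0.
Proof.
pose Z := @xset k q G (inl [:: (0, 3)%N]).
move=> /(_ (fun A s => zeros Z s) (closed_zeros _)) h.
have /zeros_x : zeros Z g; last by apply.
apply: h => [B x y s Exy|B t /stratum_Nm [b [b' [/trigP tb /trigP tb' E]]]].
  by apply: (xset_stable hk) => // a b a' b'; apply: NE_inl.
apply/zeros_x => a c; elim/ord4P: a; elim/ord4P: c => // _; rewrite E; apply: perm_entry => //.
by rewrite !mxE permM -val_eqE /= reflE w0E /= inordK.
Qed.

(** For alpha_1 the zero in the corner (0, 3) appears after applying the involution, which replaces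
    the permutation by its inverse, reflected. *)
Lemma closure1 A (g : G A) : flag_closure (@flag_stratum k q G (w0 * refl (inord 0))%g) g -> Nm (X := Gd) g o0 o3 = 0.
Proof.
pose Z := @xset k q Gd (inl [:: (0, 3)%N]).
move=> /(_ (fun A s => zeros Z s) (closed_zeros _)) h.
have /zeros_x : zeros Z g; last by apply.
apply: h => [|B t [b [b' [hb hb' E]]]].
  apply/(dual_stable hk) => B x y s Exy; apply: (xset_stable hk) => // a b a' b'; exact: NE_inl.
apply/zeros_x => a c; elim/ord4P: a; elim/ord4P: c => // _; rewrite Nm_mul.
have -> : zmap Gd B t = dl (t : gl B) by [].
rewrite [t]E !dlM dlV dl_z /= mulmxKV ?unitmx_perm //.
apply: perm_entry; [exact/trigP/dl_B|exact/trigP/dl_B|].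
have V : invmx (perm_mx (w0 * refl (inord 0))%g) = perm_mx (w0 * refl (inord 0))^-1%g :> 'M[B]_4.
  have u : (perm_mx (w0 * refl (inord 0))%g : 'M[B]_4) \in unitmx by apply: unitmx_perm.
  by apply: (can_inj (mulKmx u)); rewrite mulmxV // -perm_mxM mulgV perm_mx1.
rewrite V !mxE; case: eqP => [|//] /(congr1 (w0 * refl (inord 0))%g); rewrite permKV => /(congr1 val).
by rewrite permM /= reflE w0E /= inordK.
Qed.
End Strata.

(** * Sections over S as functions on the torsor *)

Section Sections.
Context (k : closedFieldType) (q : nat) (hk : is_Fqbar q k) (S : kfunctor k) (zeta : to_gzip q S) (lam : weight) (f
  : VI_section zeta lam).
Implicit Types (A B C D K : comUnitAlgType k).
Local Notation ko := (k^o : comUnitAlgType k).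
Local Notation X := (gtor zeta).

Lemma P1 A : in_P (gl1 A).
Proof. by apply/in_PP => i j hi hj; rewrite mxE; case: eqP => // E; rewrite E ltnNge hj in hi. Qed.
Lemma gl1_map A B (g : {lrmorphism A -> B}) : glmap g (gl1 A) = gl1 B.
Proof. by apply: val_inj; rewrite /= map_mx1. Qed.
Lemma flag_nat A B (g : {lrmorphism A -> B}) (s : X A) : (f B (fmap g s) (gl1 B) : B) = g (f A s (gl1 A)).
Proof. by rewrite -(gl1_map g) VI_nat //; apply: P1. Qed.
Definition flag_fn : fn X := @KMap k X (affine_line k) _ flag_nat.

Lemma glVK A (x : gl A) : glV (glV x) = x. Proof. by apply: val_inj; rewrite /= invmxK. Qed.
Lemma flag_fn_section : flag_section lam flag_fn.
Proof.
move=> A x y s [Exy bx] /=; rewrite VI_equiv //; last exact: P1.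
have -> : glM (glV x) (gl1 A) = glM (gl1 A) (glV x) by apply: val_inj; rewrite /= mul1mx mulmx1.
rewrite VI_ind ?glVK //; first exact: P1.
by move/trigP: bx => bx; apply/trigP; have [] := trig_inv bx (valP x).
Qed.

(** The copy of GL_2 in the second Levi block. *)
Definition elem A (a b c d : A) : 'M[A]_4 := \matrix_(i, j)
  if (i == o2) && (j == o2) then a else if (i == o2) && (j == o3) then b else
  if (i == o3) && (j == o2) then c else if (i == o3) && (j == o3) then d else (i == j)%:R.
Lemma elemM A (a b c d a' b' c' d' : A) : elem a b c d *m elem a' b' c' d' = elem (a * a' + b * c') (a * b' + b *
  d') (c * a' + d * c') (c * b' + d * d').
Proof. by apply/matrixP => i j; rewrite mxE sum4 !mxE; elim/ord4P: i; elim/ord4P: j; rewrite /= ?mulr0 ?mul0r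
  ?mulr1 ?addr0 ?add0r. Qed.
Lemma elem1 A : elem 1 0 0 1 = 1%:M :> 'M[A]_4.
Proof. by apply/matrixP => i j; rewrite !mxE; elim/ord4P: i; elim/ord4P: j. Qed.
Lemma elem_unit A (a b c d : A) : a * d - b * c = 1 -> elem a b c d \in unitmx.
Proof.
move=> E; have [] := @mulmx1_unit _ _ (elem a b c d) (elem d (- b) (- c) a) _ => //.
rewrite elemM -[RHS]elem1; congr elem; rewrite -?E; ring.
Qed.
Definition eg A (a b c d : A) (E : a * d - b * c = 1) : gl A := gl_mk (elem_unit E).
Lemma eg_P A (a b c d : A) (E : a * d - b * c = 1) : in_P (eg E).
Proof. by apply/in_PP => i j; rewrite mxE; elim/ord4P: i => //; elim/ord4P: j. Qed.
Lemma eg_map A B (g : {lrmorphism A -> B}) (a b c d : A) (E : a * d - b * c = 1) (E' : g a * g d - g b * g c = 1) :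
  glmap g (eg E) = eg E'.
Proof.
by apply: val_inj; apply/matrixP => i j; rewrite /= !mxE; elim/ord4P: i; elim/ord4P: j; rewrite /= ?lr0 ?lr1.
Qed.

Lemma section_poly (a b c d : {poly k}) (E : a * d - b * c = 1) (s : pts X) : exists P : {poly k}, forall (w : k)
  (Ew : (a.[w] : ko) * d.[w] - b.[w] * c.[w] = 1), f ko s (eg Ew) = P.[w].
Proof.
have [B [io [j [ios io0 ioC ioH]]]] := poly_alg ko.
have EB : io a * io d - io b * io c = 1 by rewrite -!rmorphM -rmorphB E rmorph1.
have [P EP] := ios (f B (fmap j s) (eg EB)); exists P => w Ew.
have [i iE] := lr_id ko; have [g [gj gi]] := ioH ko i (w : ko).
have gi' p : g (io p) = p.[w].
  by rewrite gi (_ : map_poly i p = p) //; apply/polyP => n; rewrite coef_map /= iE.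
have Eg : g (io a) * g (io d) - g (io b) * g (io c) = 1 by rewrite !gi'.
transitivity (g (f B (fmap j s) (eg EB))); last by rewrite -EP gi'.
rewrite -VI_nat; last exact: eg_P.
rewrite (eg_map EB Eg) -(@fmap_comp _ X _ _ _ j g i s) => [|r /=]; last by rewrite iE gj iE.
rewrite (fmap_id s iE); congr (f ko s _); apply: val_inj; rewrite /= !gi' //.
Qed.

(* Ind_B^P(lam) vanishes when lam is not dominant: the two charts of the big cells of the second block GL_2
   are related by w |-> 1/w, up to the factor w^(a4-a3). *)
Lemma not_dominant (s : pts X) : lam o2 < lam o3 -> f ko s (gl1 ko) = 0.
Proof.
move=> l23; have [m Em] : exists m : nat, lam o3 - lam o2 = m.+1.
  by exists (absz (lam o3 - lam o2)).-1; lia.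
have D1 : 1 * 1 - 'X * 0 = 1 :> {poly k} by ring. have D2 : 0 * 'X - 1 * (- 1) = 1 :> {poly k} by ring.
have [P hP] := section_poly D1 s; have [P' hP'] := section_poly D2 s.
have PP w : w != 0 -> P'.[w^-1] = w ^+ m.+1 * P.[w].
  move=> w0; have e1 : (1 : {poly k}).[w] * (1 : {poly k}).[w] - 'X.[w] * (0 : {poly k}).[w] = 1 :> ko by rewrite
    !hornerE; ring.
  have e2 : (0 : {poly k}).[w^-1] * 'X.[w^-1] - (1 : {poly k}).[w^-1] * (- 1 : {poly k}).[w^-1] = 1 :> ko by
    rewrite !hornerE; ring.
  rewrite -(hP _ e1) -(hP' _ e2).
  have db : (w : ko) * w^-1 - 0 * (- 1) = 1 by rewrite mul0r subr0 divff.
  pose b := eg db.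
  have Eb : eg e2 = glM (eg e1) b.
    apply: val_inj; rewrite /= elemM !hornerE; congr elem; rewrite ?mul1r ?mul0r ?mulr0 ?addr0 ?add0r //.
    - by rewrite mulrN1 subrr.
    - by rewrite divff.
  have bB : in_B b by apply/trigP => i j; rewrite mxE; elim/ord4P: i => //; elim/ord4P: j.
  have tV := trig_inv ((trigP _ bB)) (valP b).
  rewrite Eb VI_ind //; last exact: eg_P.
  congr (_ * _); rewrite /character.
  have -> : \prod_(i < 4) val (glV b) i i ^ lam i = \prod_(i < 4) (val b i i)^-1 ^ lam i.
    by apply: eq_bigr => i _; rewrite /= (tV.2 i).
  rewrite !big_ord_recl big_ord0 /= !mxE /= !invr1 !exp1rz !mul1r mulr1 invrK.
  have -> : lam (lift ord0 (lift ord0 ord0)) = lam o2 by congr lam; apply: val_inj.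
  have -> : lam (lift ord0 (lift ord0 (lift ord0 ord0))) = lam o3 by congr lam; apply: val_inj.
  by rewrite exprz_inv -expfzDr // addrC Em.
have P0 : P = 0.
  apply: contrapT => /eqP nP; pose d := size P'.
  (* The reversal of P', of size at most d. The relation between the charts makes it X^(d - 1 + m +
     1) P, which is too large unless P is zero. *)
  pose Q := \poly_(i < d) P'`_(d.-1 - i).
  have QE w : w != 0 -> Q.[w] = w ^+ d.-1 * P'.[w^-1].
    move=> w0; rewrite horner_poly [in P'.[_]]horner_coef mulr_sumr (reindex_inj rev_ord_inj) /=.
    apply: eq_bigr => i _; rewrite -/d mulrCA exprVn; have := ltn_ord i; rewrite -/d => id.
    have -> : (d.-1 - (d - i.+1) = i)%N by lia.
    congr (_ * _); have -> : d.-1 = (d - i.+1 + i)%N by lia.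
    by rewrite exprD mulfK ?expf_neq0.
  have EQ : 'X * Q = 'X * ('X ^+ (d.-1 + m.+1) * P).
    apply: poly_ext => w; rewrite !hornerM hornerX hornerXn; case: (eqVneq w 0) => [->|w0]; first by rewrite !mul0r.
    by rewrite QE // PP // exprD -!mulrA.
  have {}EQ : Q = 'X ^+ (d.-1 + m.+1) * P by apply: (mulfI (negbT (polyX_eq0 k))) EQ.
  have : (size Q <= d)%N by apply: size_poly.
  rewrite EQ mulrC size_mulXn // => le; have : (0 < size P)%N by rewrite size_poly_gt0.
  by move: le; rewrite /d; lia.
have e : (1 : {poly k}).[0] * (1 : {poly k}).[0] - 'X.[0] * (0 : {poly k}).[0] = 1 :> ko by rewrite !hornerE; ring.
have z : P.[0] = 0 by rewrite P0 horner0.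
apply: (etrans _ z); rewrite -(hP 0 e); congr (f ko s _); apply: val_inj; rewrite /= !hornerE; exact/esym/elem1.
Qed.
End Sections.

(** Clears the positive denominator of epsilon, whose numerator is (q + 1)^2. *)
Lemma epsilon_int (q : nat) (a b : int) : 0 < a%:~R + epsilon q * b%:~R ->
  0 < (q%:Z ^+ 3 + 2 * q%:Z ^+ 2 + 1) * a + (q%:Z + 1) ^+ 2 * b.
Proof.
have D0 : 0 < q%:R ^+ 3 + 2 * q%:R ^+ 2 + 1 :> rat by rewrite ltr_wpDl // addr_ge0 // ?mulr_ge0 // exprn_ge0.
move=> h; have {h} := mulr_gt0 D0 h.
have -> : (q%:R ^+ 3 + 2 * q%:R ^+ 2 + 1) * (a%:~R + epsilon q * b%:~R) =
  (q%:R ^+ 3 + 2 * q%:R ^+ 2 + 1) * a%:~R + (q%:R + 1) ^+ 2 * b%:~R :> rat.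
  by rewrite /epsilon; field; apply: lt0r_neq0.
have -> : (q%:R ^+ 3 + 2 * q%:R ^+ 2 + 1) * a%:~R + (q%:R + 1) ^+ 2 * b%:~R =
  ((q%:Z ^+ 3 + 2 * q%:Z ^+ 2 + 1) * a + (q%:Z + 1) ^+ 2 * b)%:~R :> rat.
  by rewrite !(intrD, intrM, rmorphXn) /= -!pmulrn.
by rewrite ltr0z.
Qed.

(** * Divisibility by the two partial Hasse invariants *)

Theorem theorem4p2p10 (q : nat) (k : closedFieldType) (hk : is_Fqbar q k)
    (S : kfunctor k) (hS : is_scheme S) (zeta : to_gzip q S)
    (hsmooth : smooth_zeta zeta)
    (hsurj : surjective_on_components zeta)
    (hpc : pseudo_complete_curves zeta)
    (lam1 : weight) (Ha1 : kmap (GL4 k) (affine_line k))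
    (hHa1 : partial_Hasse q (inord 0) lam1 Ha1)
    (lam3 : weight) (Ha3 : kmap (GL4 k) (affine_line k))
    (hHa3 : partial_Hasse q (inord 2) lam3 Ha3)
    (a1 a2 a3 a4 : int)
    (f : VI_section zeta (mk_weight a1 a2 a3 a4)) :
  (0 < (a1 - a4)%:~R + epsilon q * (a2 - a4)%:~R -> divisible_by f lam1 Ha1) /\
  (0 < a1 - a3 -> divisible_by f lam3 Ha3).
Proof.
have [lfp fsm] := hsmooth; have cov := charts_cover lfp.
have hlift (C D : comUnitAlgType k) (s : {lrmorphism C -> D}) (x : zeta D) (g : gl C) : square_zero_quotient s ->
    zmap zeta D x = glmap s g -> exists2 x', zmap zeta C x' = g & fmap s x' = x.
  by move=> sq E; have [x' [E1 E2]] := fsm C D s x g sq E; exists x'.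
have HF := @flag_fn_section k q S zeta _ f; set F := flag_fn f in HF.
have q1 := q_gt1 hk; split=> [h1|h3].
(* On the dual space the weight is minus lambda reversed, so the differences of its coordinates 0, 3
   and 0, 2 are a1 - a4 and a2 - a4, those in hypothesis (1). *)
- pose Xd := dual_space hk zeta.
  have hliftd (C D : comUnitAlgType k) (s : {lrmorphism C -> D}) (x : Xd D) (g : gl C) : square_zero_quotient s ->
      zmap Xd D x = glmap s g -> exists2 x', zmap Xd C x' = g & fmap s x' = x.
    move=> sq E; have [|x' E1 E2] := hlift C D s x (dl g) sq; first by rewrite -dl_map -[glmap s g]E dlK.
    by exists x' => //; rewrite /= E1 dlK.
  have van := @vanishing k q hk Xd S (gproj zeta) cov hliftd (dual_complete (hk := hk) hpc) _ _ _ F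
    (fun i => - mk_weight a1 a2 a3 a4 (rev_ord i)) _ _.
  have {}van (p : pts zeta) : ev (xe Xd o0 o3) p = 0 -> near p (fun t => ev (xe Xd o0 o3) t = 0 -> ev F t = 0).
    apply: van.
    + move=> A s s' /gtrans [x [y [Exy E]]]; exists (dl x), (dl y); split; first exact: dl_E.
      by rewrite /= !dlK.
    + exact: glocal.
    + move=> C cC K g Kf; have [K' [i [s [K'f Cs Es]]]] := hsurj C cC K (dl g) Kf.
      by exists K', i, s; split=> //; rewrite /= Es dl_map dlK.
    + move=> x y s Exy; rewrite -dl_character; last exact: Exy.2.
      exact: (HF _ _ _ _ (dl_E' hk Exy)).
    + have := epsilon_int h1; rewrite /mk_weight /=; congr (_ < _); ring.
  have sm (A : comUnitAlgType k) (s : zeta A) : zeros (@xset k q Xd (inl [:: (0, 3)%N])) s <-> zeros (addeq (@E0 k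
    q zeta) (xe Xd o0 o3)) s.
    rewrite zeros_add zeros_x; split=> [h|[_ h] a b]; first by split; [exact: zE0|exact: h].
    by elim/ord4P: a; elim/ord4P: b.
  apply: (@quotient_section k q hk zeta cov hlift Ha1 F (xe Xd o0 o3) _ _ _ _ van _ HF hHa1.1).
  + exact: (smooth_eq sm (@smooth_x k q Xd hliftd _)).
  + move=> p z; apply: (@not_zg_x k q Xd hliftd (fun _ _ => false) o0 o3 p isT); first exact/zeros_x.
    by apply: near_sub z => t ht _; apply: ht; apply: zE0.
  + by move=> A s /hHa1.2 /(closure1 hk).
(* If a3 < a4, then F = 0 and the quotient is 0. *)
- case: (ltP a3 a4) => [l34|l43].
    have F0 (A : comUnitAlgType k) (s : zeta A) : ev F s = 0.
      apply: (@dens _ zeta (@E0 k q zeta) (@smooth0 k q zeta hlift) cov (fun A s => ev F s)); last exact: zE0.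
        by move=> *; apply: evE.
      by move=> t _; apply: not_dominant.
    exists (@KMap k zeta (affine_line k) (fun A _ => 0 : A) (fun A B i s => esym (lr0 i))); split.
      by move=> A x y s _; rewrite /= mulr0.
    by move=> A s; rewrite /= mul0r; apply: F0.
  have van := @vanishing k q hk zeta S (gproj zeta) cov hlift hpc (@gtrans _ _ _ zeta) (@glocal _ _ _ zeta) hsurj F
    (mk_weight a1 a2 a3 a4) (fun x y s => HF _ x y s).
  have {}van (p : pts zeta) : ev (xe zeta o0 o3) p = 0 -> near p (fun t => ev (xe zeta o0 o3) t = 0 -> ev F t = 0).
    apply: van; rewrite /mk_weight /=.
    (* With a1 > a3 >= a4 both terms of the required inequality are positive. *)
    have h14 : 0 < a1 - a4 by lia.
    apply: addr_gt0; apply: mulr_gt0 => //; last by rewrite exprn_gt0 // ltr_wpDl.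
    by rewrite ltr_wpDl // addr_ge0 // ?mulr_ge0 // exprn_ge0.
  have sm (A : comUnitAlgType k) (s : zeta A) : zeros (@xset k q zeta (inl [:: (0, 3)%N])) s <-> zeros (addeq (@E0
    k q zeta) (xe zeta o0 o3)) s.
    rewrite zeros_add zeros_x; split=> [h|[_ h] a b]; first by split; [exact: zE0|exact: h].
    by elim/ord4P: a; elim/ord4P: b.
  apply: (@quotient_section k q hk zeta cov hlift Ha3 F (xe zeta o0 o3) _ _ _ _ van _ HF hHa3.1).
  + exact: (smooth_eq sm (@smooth_x k q zeta hlift _)).
  + by move=> p; apply: not_zg_x => //; apply: zE0.
  + by move=> A s /hHa3.2 /(closure3 hk).
Qed.
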